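(* Let $\Omega$, $H$, $\Sigma_R^\pm$, $\Gamma_D,\Gamma_N,\Gamma_M$, $\nu$, $\mathbb{H}$ and $a$ be as described in the context. Suppose that $H$ is a positive $C^2$ function on $[0,+\infty)$ with $\int_0^\infty H(s)\,ds<\infty$, that for some $T$ one has $H'(t)<0$ and $H''(t)>0$ for all $t\in(T,\infty)$, and that $$\lim_{t\to\infty}\partial_t\big(\log H(t)\big)=-\infty .$$ Then the embedding $H^2(\Omega)\subset L^2(\Omega)$ is compact, and the spectrum of the Kirchhoff plate problem $\Delta^2u=\lambda u$ in $\Omega$ with the Neumann (traction-free) boundary conditions on both sides of the peak (that is, $\Sigma_R^+\cup\Sigma_R^-\subset\Gamma_N$) is discrete.
   Context: Write $x=(x_1,x_2)=(y,z)\in\mathbb{R}^2$. Let $R\ge0$ and let $H:[0,\infty)\to(0,\infty)$ be a function that on $[R,\infty)$ is smooth and monotone decreasing, with $H'(y)\to 0$ as $y\to+\infty$ and $H''$ bounded. For $\rho\ge R$ put $\Pi_\rho=\{(y,z): y>\rho,\ -H(y)<z<H(y)\}$ and $\Sigma_\rho^\pm=\{(y,z): y>\rho,\ z=\pm H(y)\}$. Let $\Omega\subset\mathbb{R}^2$ be a domain with $C^\infty$ boundary $\Gamma=\partial\Omega$ such that $\Omega\cap\{x_1>R\}=\Pi_R$ and $\Omega\setminus\{x_1>R\}$ is bounded. Let $\Gamma_D,\Gamma_N,\Gamma_M\subset\Gamma$ be pairwise disjoint unions of finite families of open curves with $\Gamma=\overline{\Gamma_D}\cup\overline{\Gamma_N}\cup\overline{\Gamma_M}$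 (some of them may be empty), and let $\nu\in[0,1/2)$. With $\partial_n,\partial_s$ the normal and tangential derivatives and $\varkappa$ the signed curvature of $\Gamma$ (positive on convex parts), the boundary conditions are: - on $\Gamma_D$ (Dirichlet, clamped): $u=\partial_nu=0$; - on $\Gamma_N$ (Neumann, traction-free): $\partial_n\Delta u-(1-\nu)(\partial_s\varkappa\partial_su-\partial_s^2\partial_nu)=0$ and $\Delta u-(1-\nu)(\partial_s^2u+\varkappa\partial_nu)=0$; - on $\Gamma_M$ (mixed, hinged): $u=0$ and $\Delta u-(1-\nu)\varkappa\partial_nu=0$. The problem is understood in variational form: $a(u,v)=\lambda(u,v)_{L_2(\Omega)}$ for all $v\in\mathbb{H}$, where $\mathbb{H}$ is the subspace of all $u\in H^2(\Omega)$ with $u=\partial_nu=0$ on $\Gamma_D$ and $u=0$ on $\Gamma_M$ in the sense of traces, and $a$ is the symmetric bilinear form with $$a(u,u)=\int_\Omega\Big(|\partial_{x_1}^2u|^2+|\partial_{x_2}^2u|^2+2(1-\nu)|\partial_{x_1}\partial_{x_2}u|^2+2\nu\,\partial_{x_1}^2u\,\partial_{x_2}^2u\Big)dx .$$ The conditions on $\Gamma_N$ and the second condition on $\Gamma_M$ are the natural boundary conditions of this formulation. The spectrum of the problem is the spectrum of the nonnegative self-adjoint operator $A$ in $L_2(\Omega)$ associated with (the closure of) the form $a$ with form domain $\mathbb{H}$. It is discrete if it consists only of isolated eigenvalues of finite multiplicity (with no finite accumulation point); equivalently, the embedding of the form domain, with norm $(a(u,u)+\|u\|_{L_2(\Omega)}^2)^{1/2}$,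 into $L_2(\Omega)$ is compact. *)

(* Defs.v *)
(* The plane is R * R with the product Lebesgue measure, and
   all function spaces consist of real-valued functions on the plane that are
   only looked at on a set Om (equality means equality a.e. on Om). *)
From HB Require Import structures.
From mathcomp Require Import all_boot all_order all_algebra.
From mathcomp Require Import all_classical all_reals all_analysis.
Set Implicit Arguments.
Unset Strict Implicit.
Unset Printing Implicit Defensive.
Import Order.TTheory GRing.Theory Num.Theory numFieldNormedType.Exports.
Local Open Scope classical_set_scope.
Local Open Scope ring_scope.

Section smoothness.
Context {R : realType}.
Local Notation plane := (R * R)%type.
Implicit Types (f : R -> R) (phi : plane -> R).

Definition smooth1 f : Prop :=
  forall (k : nat) (x : R), derivable (derive1n k f) x 1.

(* Regularity on the closed half-line [a, +oo[, including the end point, means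
   having an extension to R of that regularity; f is arbitrary left of a. *)
Definition smooth_on_ray (a : R) f : Prop :=
  exists2 g : R -> R, smooth1 g & forall t, a <= t -> f t = g t.

Definition C2_on_ray (a : R) f : Prop :=
  exists g : R -> R,
    [/\ forall k x, (k < 2)%N -> derivable (derive1n k g) x 1,
        continuous (derive1n 2 g) &
        forall t, a <= t -> f t = g t].

Definition smooth2 phi : Prop :=
  forall s : seq plane,
    let f := foldr (fun (v : plane) (g : plane -> R) => 'D_v g) phi s in
    continuous f /\ forall x v, derivable f x v.

Definition pderiv (a : nat * nat) phi : plane -> R :=
  iter a.1 (fun g : plane -> R => 'D_((1, 0) : plane) g)
    (iter a.2 (fun g : plane -> R => 'D_((0, 1) : plane) g) phi).

Definition eucl (v : plane) : R := Num.sqrt (v.1 ^+ 2 + v.2 ^+ 2).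

End smoothness.

Section domains.
Context {R : realType}.
Local Notation plane := (R * R)%type.
Implicit Types (Om S : set plane) (p n : plane) (psi : plane -> R).

Definition peak (H : R -> R) (rho : R) : set plane :=
  [set x | rho < x.1 /\ - H x.1 < x.2 < H x.1].

Definition upper_side (H : R -> R) (rho : R) : set plane :=
  [set x | rho < x.1 /\ x.2 = H x.1].

Definition lower_side (H : R -> R) (rho : R) : set plane :=
  [set x | rho < x.1 /\ x.2 = - H x.1].

Definition domain Om : Prop := [/\ open Om, connected Om & Om !=set0].

Definition frontier Om : set plane := closure Om `&` closure (~` Om).

Definition defining_function Om p psi : Prop :=
  [/\ smooth2 psi,
      (pderiv (1, 0)%N psi p, pderiv (0, 1)%N psi p) <> (0, 0) :> plane &
      \forall x \near p, Om x <-> psi x < 0].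

Definition smooth_boundary Om : Prop :=
  forall p, frontier Om p -> exists psi, defining_function Om p psi.

(* n is the outward unit normal at the boundary point p *)
Definition unit_normal Om p n : Prop :=
  exists2 psi, defining_function Om p psi &
    let g : plane := (pderiv (1, 0)%N psi p, pderiv (0, 1)%N psi p) in
    n = (g.1 / eucl g, g.2 / eucl g).

(* Since the frontier is a 1-manifold, its connected relatively open subsets
   are the open arcs and the whole components (e.g. closed curves). *)
Definition open_curve Om S : Prop :=
  connected S /\ exists2 U : set plane, open U & S = frontier Om `&` U.

Definition finite_union_of_curves Om S : Prop :=
  exists (n : nat) (F : 'I_n -> set plane),
    (forall i, open_curve Om (F i)) /\ S = \bigcup_(i in [set: 'I_n]) F i.

Definition regular_arc S (c1 c2 : R -> R) : Prop :=
  [/\ smooth1 c1, smooth1 c2,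
      forall t, t \in `[0, 1] -> S (c1 t, c2 t),
      forall t, t \in `[0, 1] -> (derive1 c1 t, derive1 c2 t) <> (0, 0) :> plane &
      {in `[0, 1] &, injective (fun t => (c1 t, c2 t) : plane)}].

End domains.

Section sobolev.
Context {R : realType}.
Local Notation plane := (R * R)%type.
Local Notation leb1 := (@lebesgue_measure R).
Local Notation leb2 := (leb1 \x leb1)%E.
Implicit Types (Om : set plane) (u v w g phi : plane -> R) (a : nat * nat).

Definition L2 Om u : Prop := u \_ Om \in Lfun leb2 2%:E.

Definition L2norm Om u : \bar R := ('N[leb2]_(2%:E) [EFin \o (u \_ Om)])%E.

Definition L2dot Om u v : R := \int[leb2]_(x in Om) (u x * v x).

Definition loc_integrable Om u : Prop :=
  measurable_fun Om u /\
  forall K : set plane, compact K -> K `<=` Om ->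
    leb2.-integrable K (EFin \o u).

Definition test_function Om phi : Prop :=
  smooth2 phi /\
  exists K : set plane,
    [/\ compact K, K `<=` Om & forall x, ~ K x -> phi x = 0].

Definition weak_derivative Om a u g : Prop :=
  loc_integrable Om g /\
  forall phi, test_function Om phi ->
    \int[leb2]_(x in Om) (u x * pderiv a phi x) =
    (-1) ^+ (a.1 + a.2) * \int[leb2]_(x in Om) (g x * phi x).

(* A chosen representative of the weak derivative (junk if there is none). *)
Definition wD Om a u : plane -> R := xget (cst 0) (weak_derivative Om a u).

Definition sobolev (k : nat) Om u : Prop :=
  L2 Om u /\
  forall a, (a.1 + a.2 <= k)%N ->
    exists2 g, L2 Om g & weak_derivative Om a u g.

Definition H2norm Om u : \bar R :=
  ((\sum_(i < 3) \sum_(j < 3 | (i + j <= 2)%N)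
      L2norm Om (wD Om (i : nat, j : nat) u) ^+ 2) `^ 2^-1)%E.

Definition H2_compactly_embedded Om : Prop :=
  forall u_ : nat -> plane -> R,
    (forall n, sobolev 2 Om (u_ n)) ->
    (exists M : R, forall n, (H2norm Om (u_ n) <= M%:E)%E) ->
    exists (s : nat -> nat) (v : plane -> R),
      [/\ {homo s : m n / (m < n)%N}, L2 Om v &
          L2norm Om (fun x => u_ (s n) x - v x) @[n --> \oo] --> 0%E].

(* g is the boundary trace of w : w is a limit, in H^1 on bounded parts of Om,
   of functions smooth up to the boundary whose boundary values tend to g in
   L^2 with respect to arc length on every compact arc of the boundary. *)
Definition is_trace Om w g : Prop :=
  measurable_fun setT g /\
  exists phi : nat -> plane -> R,
    [/\ forall k, smooth2 (phi k),
        forall (r : R) a, 0 < r -> (a.1 + a.2 <= 1)%N ->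
          L2norm (Om `&` ball (0 : plane) r)
            (fun x => pderiv a (phi k) x - wD Om a w x) @[k --> \oo] --> 0%E &
        forall c1 c2 : R -> R, regular_arc (frontier Om) c1 c2 ->
          (\int[leb1]_(t in `[0%R, 1%R])
             ((phi k (c1 t, c2 t) - g (c1 t, c2 t)) ^+ 2
              * eucl (derive1 c1 t, derive1 c2 t))%:E)%E @[k --> \oo] --> 0%E].

End sobolev.

Section plate.
Context {R : realType}.
Local Notation plane := (R * R)%type.
Local Notation leb1 := (@lebesgue_measure R).
Local Notation leb2 := (leb1 \x leb1)%E.
Variables (Om GD GM : set plane) (nu : R).
Implicit Types (u v f : plane -> R) (lam : R).

Definition plate_space u : Prop :=
  [/\ sobolev 2 Om u,
      exists2 g, is_trace Om u g & forall p, (GD `|` GM) p -> g p = 0 &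
      exists g1 g2,
        [/\ is_trace Om (wD Om (1, 0)%N u) g1,
            is_trace Om (wD Om (0, 1)%N u) g2 &
            forall p n, GD p -> unit_normal Om p n ->
              n.1 * g1 p + n.2 * g2 p = 0]].

Definition plate_form u v : R :=
  \int[leb2]_(x in Om)
    (wD Om (2, 0)%N u x * wD Om (2, 0)%N v x
     + wD Om (0, 2)%N u x * wD Om (0, 2)%N v x
     + 2 * (1 - nu) * (wD Om (1, 1)%N u x * wD Om (1, 1)%N v x)
     + nu * (wD Om (2, 0)%N u x * wD Om (0, 2)%N v x
             + wD Om (0, 2)%N u x * wD Om (2, 0)%N v x)).

(* Convergence defining the closure of the form. *)
Definition form_cvg (u_ : nat -> plane -> R) u : Prop :=
  [/\ forall n, plate_space (u_ n), L2 Om u,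
      L2norm Om (fun x => u_ n x - u x) @[n --> \oo] --> 0%E &
      forall e : R, 0 < e -> exists N : nat, forall m n,
        (N <= m)%N -> (N <= n)%N ->
        let w := fun x => u_ m x - u_ n x in plate_form w w < e].

Definition closed_form_domain u : Prop :=
  exists u_ : nat -> plane -> R, form_cvg u_ u.

(* The form is closable, so that the limit depends on u and v only. *)
Definition closed_form u v : R :=
  xget 0 [set c | exists u_ v_ : nat -> plane -> R,
    [/\ form_cvg u_ u, form_cvg v_ v &
        plate_form (u_ n) (v_ n) @[n --> \oo] --> c]].

(* plate_op u f : u is in the domain of the self-adjoint operator A associated
   with the closed form, and A u = f.  This graph is invariant under changes of
   u and f on null sets. *)
Definition plate_op u f : Prop :=
  [/\ closed_form_domain u, L2 Om f &
      forall v, closed_form_domain v -> closed_form u v = L2dot Om f v].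

(* A - lam is a bijection from its domain onto L^2(Om) with bounded inverse
   (the estimate contains injectivity).  As A is self-adjoint it is enough to
   consider real lam. *)
Definition plate_resolvent_set : set R :=
  [set lam |
    (exists C : R, forall u f, plate_op u (fun x => lam * u x + f x) ->
       (L2norm Om u <= C%:E * L2norm Om f)%E) /\
    (forall f, L2 Om f -> exists u, plate_op u (fun x => lam * u x + f x))].

Definition plate_spectrum : set R := ~` plate_resolvent_set.

Definition plate_eigenfunction lam u : Prop :=
  plate_op u (fun x => lam * u x).

Definition plate_eigenvalue lam : Prop :=
  exists2 u, plate_eigenfunction lam u & L2norm Om u != 0%E.

Definition finite_multiplicity lam : Prop :=
  exists (n : nat) (e : 'I_n -> plane -> R),
    forall u, plate_eigenfunction lam u ->
      exists c : 'I_n -> R,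
        {ae leb2, forall x, Om x -> u x = \sum_(i < n) c i * e i x}.

Definition plate_spectrum_discrete : Prop :=
  (forall lam, plate_spectrum lam ->
     [/\ isolated plate_spectrum lam, plate_eigenvalue lam &
         finite_multiplicity lam]) /\
  limit_point plate_spectrum = set0.

End plate.

(* Main.v *)
Require Import Defs.
From HB Require Import structures.
From mathcomp Require Import all_boot all_order all_algebra.
From mathcomp Require Import all_classical all_reals all_analysis.
From mathcomp Require Import measurable_realfun.
From mathcomp Require Import ring lra.
Set Implicit Arguments.
Unset Strict Implicit.
Unset Printing Implicit Defensive.
Import Order.TTheory GRing.Theory Num.Theory numFieldNormedType.Exports.
Local Open Scope classical_set_scope.
Local Open Scope ring_scope.


(* Only the pure second derivatives of u are used for compactness.  On a
   horizontal segment, u differs from the affine interpolation of two of its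
   mollified averages by at most C l times the integral of |u_11| over a window of
   length about l.  Integrating the square of this over a set whose horizontal
   sections have length at most eta bounds the mass of u there by
   C eta (mass in the window / l + l^3 * energy).  This makes u small, up to
   finitely many moments,
   - on small squares, hence on compact subsets of Om;
   - on a thin layer along a boundary arc that is a graph, the window being moved
     inside Om along an axis;
   - on the far part of the peak: in the slab t <= y < t + l, u is bounded as above
     by its mass on {|z| < H(t)} over a window left of the slab, where the vertical
     version of the bound gains a factor H(t) / H(t - l); this tends to 0 because
     the logarithmic derivative of H tends to -oo, and the bounds for the slabs
     can be summed.
   Hence every sequence bounded in the energy norm has an L^2-Cauchy subsequence,
   whatever the boundary conditions are.

   As nu < 1, the plate form controls all second derivatives, the closed form is
   given by the same integral, and its domain is complete.  Discreteness is then
   the Fredholm alternative for a closed form with compact unit ball: the Riesz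
   theorem, a contradiction argument for the a priori bound, and the
   impossibility of an infinite orthonormal family of eigenvectors with bounded
   eigenvalues. *)

(** * Smooth functions of one variable *)

(** The peak is a cusp at infinity, its traction-free sides impose nothing on [u], and the plate
    form vanishes on affine functions. So [u] is never compared with zero, but with an affine
    function built from its own averages over a window elsewhere in [Om]. The geometry enters only
    through the segments that join a point to its window inside [Om]: in the peak they run to the
    left, where the peak is wider, and at a boundary arc they run away from the arc along an axis.
    Weak derivatives are tested against products of one-variable functions. On almost every line
    this yields a one-dimensional identity, and the interpolation error is estimated by duality,
    directly for Sobolev functions. Exceptional lines depend on the test function, hence the
    recurring restriction to countable families with rational data. On a square, the two pure second
    derivatives annihilate only the span of 1, y, z and yz; this is why four moments per square
    suffice. Smallness up to finitely many functionals is stable under unions, so local statements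
    can be glued over compact sets. *)

Section smooth_calculus.
Context {R : realType}.
Implicit Types f g h : R -> R.

(** Coinduction on smoothness: exhibiting a class of differentiable functions closed under one
    derivation replaces formulas for iterated derivatives. *)
Lemma smooth1_coind (P : (R -> R) -> Prop) :
  (forall f, P f -> (forall x, derivable f x 1) /\ P (derive1 f)) ->
  forall f, P f -> smooth1 f.
Proof.
move=> H f Pf k; suff: P (derive1n k f) by case/H.
by elim: k => //= k IH; case/H: IH.
Qed.

Lemma smooth1_derivable f x : smooth1 f -> derivable f x 1.
Proof. by move=> /(_ 0%N). Qed.

Lemma smooth1_derive f : smooth1 f -> smooth1 (derive1 f).
Proof. by move=> sf k x; rewrite -derive1Sn; exact: sf. Qed.

Lemma smooth1_continuous f : smooth1 f -> continuous f.
Proof.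
move=> sf x; apply: differentiable_continuous.
exact/derivable1_diffP/smooth1_derivable.
Qed.

Lemma smooth1_is_derive f (x : R) : smooth1 f -> is_derive x 1 f (derive1 f x).
Proof. by move=> sf; rewrite derive1E; exact/derivableP/smooth1_derivable. Qed.

(** The Leibniz rule leads from one product to a sum of two, so [smooth1_coind] has to be run on
    sums of products. *)
Inductive sum_of_products : (R -> R) -> Prop :=
| SumOfProductsM f g : smooth1 f -> smooth1 g ->
    sum_of_products (fun x => f x * g x)
| SumOfProductsD f g : sum_of_products f -> sum_of_products g ->
    sum_of_products (fun x => f x + g x).

Lemma smooth1M f g : smooth1 f -> smooth1 g -> smooth1 (fun x => f x * g x).
Proof.
move=> sf sg; apply: (@smooth1_coind sum_of_products); last exact: SumOfProductsM.
move=> h; elim=> [{sf sg}f {}g sf sg|{sf sg}f {}g _ [df f'P] _ [dg g'P]].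
- have D (x : R) : is_derive x 1 (fun x => f x * g x) (f x * derive1 g x + g x * derive1 f x).
    have Df := smooth1_is_derive x sf; have Dg := smooth1_is_derive x sg.
    by have := is_deriveM Df Dg; rewrite /GRing.scale.
  split=> [x|]; first exact: ex_derive.
  rewrite (_ : derive1 _ = fun x => f x * derive1 g x + g x * derive1 f x); last first.
    by apply/funext => x; rewrite derive1E; exact: derive_val.
  exact: (SumOfProductsD (SumOfProductsM sf (smooth1_derive sg))
                         (SumOfProductsM sg (smooth1_derive sf))).
- split=> [x|]; first exact: derivableD.
  rewrite (_ : derive1 _ = fun x => derive1 f x + derive1 g x); first exact: SumOfProductsD.
  by apply/funext => x; rewrite !derive1E deriveD.
Qed.

Lemma smooth1D f g : smooth1 f -> smooth1 g -> smooth1 (fun x => f x + g x).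
Proof.
move=> sf sg; apply: (@smooth1_coind (fun h => exists f g,
  [/\ smooth1 f, smooth1 g & h = fun x => f x + g x])); last by exists f, g.
move=> {sf sg} _ [{}f [{}g [sf sg ->]]]; split=> [x|].
  by apply: derivableD; exact: smooth1_derivable.
exists (derive1 f), (derive1 g); split; try exact: smooth1_derive.
by apply/funext => x; rewrite !derive1E deriveD//; exact: smooth1_derivable.
Qed.

Lemma smooth1_cst c : smooth1 (fun _ : R => c).
Proof.
apply: (@smooth1_coind (fun h => exists c, h = cst c)); last by exists c.
move=> _ [{}c ->]; split=> [x|]; first exact: derivable_cst.
by exists 0; apply/funext => x; rewrite derive1_cst.
Qed.

Lemma smooth1Z c f : smooth1 f -> smooth1 (fun x => c * f x).
Proof. by move=> sf; apply: smooth1M => //; exact: smooth1_cst. Qed.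

Lemma smooth1N f : smooth1 f -> smooth1 (fun x => - f x).
Proof.
move=> /(@smooth1Z (-1)); rewrite (_ : (fun x => -1 * f x) = fun x => - f x)//.
by apply/funext => x; rewrite mulN1r.
Qed.

Lemma smooth1B f g : smooth1 f -> smooth1 g -> smooth1 (fun x => f x - g x).
Proof. by move=> sf /smooth1N; exact: smooth1D. Qed.

Lemma smooth1_affine f a b : smooth1 f -> smooth1 (fun x => f (a * x + b)).
Proof.
(* The constant [c] collects the factors [a] that the chain rule brings out at each derivation. *)
move=> sf; apply: (@smooth1_coind (fun h => exists c f, smooth1 f /\
  h = fun x => c * f (a * x + b))); last first.
  by exists 1, f; split => //; apply/funext => x; rewrite mul1r.
move=> {sf} _ [c [{}f [sf ->]]].
have D (x : R) : is_derive x 1 (fun x => c * f (a * x + b)) (c * (derive1 f (a * x + b) * a)).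
  have Da : is_derive x 1 (fun x => a * x + b) a.
    by apply: is_derive_eq; rewrite addr0 -[RHS]mulr1.
  have Df := smooth1_is_derive (a * x + b) sf.
  have Dfa : is_derive x 1 (f \o (fun x => a * x + b)) (derive1 f (a * x + b) * a).
    exact: is_derive1_comp.
  exact: (is_deriveZ c Dfa).
split=> [x|]; first exact: ex_derive.
exists (c * a), (derive1 f); split; first exact: smooth1_derive.
by apply/funext => x; rewrite derive1E derive_val; ring.
Qed.

(* The polynomial factor makes this family of flat functions stable under
   derivation. *)
Definition flat_exp (c : R) (p : {poly R}) (x : R) : R :=
  if 0 < x then p.[x^-1] * expR (- c * x^-1) else 0.

(** Induction on the polynomial with the exponent halved at each step: one half of the exponential
    pays for the new factor t, since t exp(- c t / 2) is at most 2 / c, and the other half is left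
    to the induction hypothesis. *)
Lemma poly_expR_bounded (c : R) (p : {poly R}) : 0 < c ->
  exists C : R, forall t, 0 <= t -> `|p.[t]| * expR (- c * t) <= C.
Proof.
elim/poly_ind: p c => [|p a IH] c c0.
  by exists 0 => t t0; rewrite horner0 normr0 mul0r.
have c20 : 0 < c / 2 by rewrite divr_gt0.
have [C HC] := IH _ c20.
exists (2 / c * C + `|a|) => t t0.
have C0 : 0 <= C by apply: le_trans (HC 0 (lexx _)); rewrite mulr_ge0// expR_ge0.
rewrite !hornerE; apply: (@le_trans _ _ ((`|p.[t]| * t + `|a|) * expR (- c * t))).
  rewrite ler_wpM2r ?expR_ge0// (le_trans (ler_normD _ _))// normrM.
  by rewrite (ger0_norm t0).
rewrite mulrDl lerD//; last first.
  by rewrite ler_piMr// -expR0 ler_expR mulNr oppr_le0 mulr_ge0// ltW.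
have -> : - c * t = - (c / 2) * t + - (c / 2) * t by field.
rewrite expRD mulrACA [leRHS]mulrC ler_pM ?mulr_ge0 ?expR_ge0//.
- exact: HC.
- rewrite mulNr expRN ler_pdivrMr ?expR_gt0//.
  apply: (@le_trans _ _ (2 / c * (c / 2 * t))); last first.
    rewrite ler_pM2l ?divr_gt0//; apply: le_trans (expR_ge1Dx _).
    by rewrite lerDr.
  by rewrite le_eqVlt; apply/orP; left; apply/eqP; field; rewrite gt_eqF.
Qed.

(** The previous bound for [p * 'X^2] at 1 / x. Flatness of order two is what forces the difference
    quotient at the origin to tend to 0. *)
Lemma flat_exp_le (c : R) (p : {poly R}) : 0 < c ->
  exists C : R, forall x, `|flat_exp c p x| <= C * x ^+ 2.
Proof.
move=> c0; have [C HC] := poly_expR_bounded (p * 'X^2) c0.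
have C0 : 0 <= C by apply: le_trans (HC 0 (lexx _)); rewrite mulr_ge0// expR_ge0.
exists C => x; rewrite /flat_exp; case: ifPn => x0; last first.
  by rewrite normr0 mulr_ge0// sqr_ge0.
have xi0 : 0 <= x^-1 by rewrite invr_ge0 ltW.
have := HC _ xi0; rewrite hornerM hornerXn !normrM (ger0_norm (expR_ge0 _)).
rewrite (ger0_norm xi0) -invfM mulrAC ler_pdivrMr ?expr2//.
by rewrite mulr_gt0.
Qed.

(** For x > 0 the derivative of 1 / x contributes the factor ['X^2], and the exponential contributes
    [c *: p]; at the origin the quadratic bound of [flat_exp_le] gives the derivative 0. *)
Lemma flat_exp_is_derive (c : R) (p : {poly R}) (x : R) : 0 < c ->
  is_derive x 1 (flat_exp c p) (flat_exp c ('X^2 * (c *: p - p^`())) x).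
Proof.
move=> c0; have [x0|x0|->] := ltrgtP x 0.
- rewrite [X in is_derive _ _ _ X](_ : _ = 0); last first.
    by rewrite /flat_exp ltNge ltW.
  have : is_derive x 1 (cst (0 : R)) 0 by exact: is_derive_cst.
  apply: near_eq_is_derive; near=> y.
  by rewrite /flat_exp /cst ltNge ltW//=; near: y; exact: lt_nbhsl.
- have xn0 : x != 0 by rewrite gt_eqF.
  have Di : is_derive x 1 (fun y : R => y^-1) (- x ^- 2).
    have dV : derivable (fun y : R => y^-1) x 1 by apply: derivableV.
    by apply: DeriveDef => //; rewrite deriveV// derive_id [LHS]mulr1.
  have Dp : is_derive x 1 (horner p \o (fun y : R => y^-1))
      (p^`().[x^-1] * - x ^- 2) by exact: is_derive1_comp.
  have De : is_derive x 1 (expR \o (fun y : R => - c * y^-1))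
      (expR (- c * x^-1) * (- c * - x ^- 2)).
    have Dc : is_derive x 1 (fun y : R => - c * y^-1) (- c * - x ^- 2).
      exact: (is_deriveZ (- c) Di).
    exact: is_derive1_comp.
  have := is_deriveM Dp De; rewrite [X in is_derive _ _ _ X](_ : _ =
    flat_exp c ('X^2 * (c *: p - p^`())) x); last first.
    rewrite /flat_exp x0 !hornerE /= /GRing.scale/= exprVn; ring.
  apply: near_eq_is_derive; near=> y.
  by rewrite /flat_exp ifT//; near: y; exact: lt_nbhsr.
- have [C HC] := flat_exp_le p c0.
  rewrite [X in is_derive _ _ _ X](_ : _ = 0); last by rewrite /flat_exp ltxx.
  suff D : h^-1 *: (flat_exp c p (h *: 1 + 0) - flat_exp c p 0)
      @[h --> 0^'] --> (0 : R).
    by split; [apply/cvg_ex; exists 0|exact/cvg_lim].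
  have C0 : 0 <= C.
    by apply: le_trans (normr_ge0 (flat_exp c p 1)) _; have := HC 1; rewrite expr1n mulr1.
  apply/cvgr0Pnorm_le => e e0; near=> h.
  have h0 : h != 0 by near: h; exact: nbhs_dnbhs_neq.
  rewrite {2}/flat_exp ltxx subr0 addr0 [h *: 1]mulr1 normrM normfV.
  rewrite ler_pdivrMl ?normr_gt0// (le_trans (HC h))//.
  rewrite -normr_id -real_normK ?num_real// normr_id expr2 mulrA [leRHS]mulrC.
  rewrite ler_wpM2r//.
  apply: (@le_trans _ _ ((C + 1) * `|h|)); first by rewrite ler_wpM2r// lerDl.
  rewrite -ler_pdivlMl ?ltr_wpDl//; near: h.
  apply: dnbhs0_le; by rewrite mulr_gt0// invr_gt0 ltr_wpDl.
Unshelve. all: by end_near. Qed.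

Lemma smooth1_flat_exp (c : R) (p : {poly R}) : 0 < c -> smooth1 (flat_exp c p).
Proof.
move=> c0; apply: (@smooth1_coind (fun f => exists p, f = flat_exp c p)); last by exists p.
move=> _ [{}p ->]; split=> [x|].
  by have D := flat_exp_is_derive p x c0; exact: ex_derive.
exists ('X^2 * (c *: p - p^`())); apply/funext => x; rewrite derive1E.
by have D := flat_exp_is_derive p x c0; exact: derive_val.
Qed.

(** For small c this approximates the indicator of ]a, b[ from below; with c = b - a it is a weight
    whose mass is comparable to b - a. Both uses occur. *)
Definition smooth_bump (a b c : R) (x : R) : R :=
  flat_exp c 1 (x - a) * flat_exp c 1 (b - x).

Lemma smooth1_bump a b c : 0 < c -> smooth1 (smooth_bump a b c).
Proof.
move=> c0; apply: smooth1M.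
- have := @smooth1_affine _ 1 (- a) (@smooth1_flat_exp c 1 c0).
  by congr smooth1; apply/funext => x; rewrite mul1r.
- have := @smooth1_affine _ (-1) b (@smooth1_flat_exp c 1 c0).
  by congr smooth1; apply/funext => x; rewrite mulN1r addrC.
Qed.

Lemma flat_exp1E c x : flat_exp c 1 x = if 0 < x then expR (- (c / x)) else 0.
Proof. by rewrite /flat_exp hornerC mul1r mulNr. Qed.

Lemma flat_exp1_ge0 c x : 0 <= flat_exp c 1 x.
Proof. by rewrite flat_exp1E; case: ifP => // _; exact: expR_ge0. Qed.

Lemma flat_exp1_le1 c x : 0 < c -> flat_exp c 1 x <= 1.
Proof.
move=> c0; rewrite flat_exp1E; case: ifPn => // x0.
by rewrite -expR0 ler_expR oppr_le0 divr_ge0// ltW.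
Qed.

Lemma smooth_bump_ge0 a b c x : 0 <= smooth_bump a b c x.
Proof. by rewrite mulr_ge0 ?flat_exp1_ge0. Qed.

Lemma smooth_bump_le1 a b c x : 0 < c -> smooth_bump a b c x <= 1.
Proof.
by move=> c0; rewrite -[leRHS]mul1r ler_pM ?flat_exp1_ge0 ?flat_exp1_le1.
Qed.

Lemma smooth_bump_out a b c x : ~~ (a < x < b) -> smooth_bump a b c x = 0.
Proof.
rewrite negb_and -!leNgt /smooth_bump !flat_exp1E !subr_gt0 => /orP[h|h].
- by rewrite ltNge h/= mul0r.
- by rewrite [x < b]ltNge h/= mulr0.
Qed.

Lemma smooth_bump_cvg a b x :
  smooth_bump a b n.+1%:R^-1 x @[n --> \oo] --> (\1_(`]a, b[%classic) x : R).
Proof.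
rewrite indicE; have [xab|xab] := boolP (a < x < b); last first.
  rewrite memNset; last by rewrite /= in_itv/=; exact/negP.
  by under eq_fun do rewrite smooth_bump_out//; exact: cvg_cst.
rewrite mem_set; last by rewrite /= in_itv.
case/andP: xab => ax xb; rewrite /smooth_bump.
have H y : 0 < y -> flat_exp n.+1%:R^-1 1 y @[n --> \oo] --> (1 : R).
  move=> y0; under eq_fun do rewrite flat_exp1E y0.
  suff : expR (- (n.+1%:R^-1 / y)) @[n --> \oo] --> expR (- (0 * y^-1)).
    by rewrite mul0r oppr0 expR0.
  apply: continuous_cvg; first exact: continuous_expR.
  by apply: cvgN; apply: cvgM; [exact: cvg_harmonic|exact: cvg_cst].
by rewrite -[X in _ --> X]mul1r; apply: cvgM; apply: H; rewrite subr_gt0.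
Qed.

End smooth_calculus.

(** * Compactly supported functions of one variable and their primitives *)

Section compact_support.
Context {R : realType}.
Notation mu := (@lebesgue_measure R).
Implicit Types f g k : R -> R.

(** An explicit interval strictly inside ]c, d[ is kept instead of the topological support: it
    leaves room on both sides, where primitives are shown to vanish. *)
Definition csupp (c d : R) f := exists c1 d1,
  [/\ c < c1, c1 < d1, d1 < d & forall x, ~~ (c1 <= x <= d1) -> f x = 0].

Definition test1 (c d : R) f := smooth1 f /\ csupp c d f.

Lemma csupp_out c d f x : csupp c d f -> ~~ (c < x < d) -> f x = 0.
Proof.
move=> [c1 [d1 [cc1 _ d1d +]]] xcd; apply; apply: contra xcd.
by move=> /andP[c1x xd1]; rewrite (lt_le_trans cc1 c1x) (le_lt_trans xd1 d1d).
Qed.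

Lemma csuppD c d f g : csupp c d f -> csupp c d g ->
  csupp c d (fun x => f x + g x).
Proof.
move=> [c1 [d1 [cc1 cd1 d1d f0]]] [c2 [d2 [cc2 cd2 d2d g0]]].
exists (Num.min c1 c2), (Num.max d1 d2); split.
- by rewrite lt_min cc1.
- by rewrite gt_min !lt_max cd1.
- by rewrite gt_max d1d.
- move=> x; rewrite ge_min le_max negb_and !negb_or => /orP[] /andP[h1 h2].
    by rewrite f0 ?g0 ?add0r// negb_and ?h1 ?h2.
  by rewrite f0 ?g0 ?add0r// negb_and ?h1 ?h2 orbT.
Qed.

Lemma csuppM c d f (g : R -> R) : csupp c d f -> csupp c d (fun x => g x * f x).
Proof.
move=> [c1 [d1 [? ? ? f0]]]; exists c1, d1; split => // x /f0 ->.
by rewrite mulr0.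
Qed.

Lemma test1D c d f g : test1 c d f -> test1 c d g -> test1 c d (fun x => f x + g x).
Proof. by move=> [? ?] [? ?]; split; [exact: smooth1D|exact: csuppD]. Qed.

Lemma test1Z c d f a : test1 c d f -> test1 c d (fun x => a * f x).
Proof. by move=> [? ?]; split; [exact: smooth1Z|exact: csuppM]. Qed.

Lemma test1B c d f g : test1 c d f -> test1 c d g -> test1 c d (fun x => f x - g x).
Proof.
move=> tf /(test1Z (-1)) tg; have := test1D tf tg.
by congr test1; apply/funext => x; rewrite mulN1r.
Qed.

Lemma test1_derive c d f : test1 c d f -> test1 c d (derive1 f).
Proof.
move=> [sf [c1 [d1 [cc1 cd1 d1d f0]]]]; split; first exact: smooth1_derive.
exists c1, d1; split => // x xn; rewrite derive1E.
have : is_derive x 1 (cst 0 : R -> R) 0 by exact: is_derive_cst.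
move=> D; have {}D : is_derive x 1 f 0.
  apply: near_eq_is_derive D; move: xn; rewrite negb_and -!ltNge => /orP[xc|dx].
    near=> y; apply/esym/f0; rewrite negb_and -!ltNge; apply/orP; left.
    by near: y; exact: lt_nbhsl.
  near=> y; apply/esym/f0; rewrite negb_and -!ltNge; apply/orP; right.
  by near: y; exact: lt_nbhsr.
exact: derive_val.
Unshelve. all: by end_near. Qed.

Lemma test1_bump c d a b e : c < a -> a < b -> b < d -> 0 < e ->
  test1 c d (smooth_bump a b e).
Proof.
move=> ca ab bd e0; split; first exact: smooth1_bump.
exists a, b; split => // x xab; apply: smooth_bump_out; apply: contra xab.
by move=> /andP[/ltW -> /ltW ->].
Qed.

Lemma test1_continuous c d f : test1 c d f -> continuous f.
Proof. by move=> [/smooth1_continuous]. Qed.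

Lemma continuous_measurable f : continuous f -> measurable_fun [set: R] f.
Proof. exact: continuous_measurable_fun. Qed.

Lemma test1_measurable c d f : test1 c d f -> measurable_fun [set: R] f.
Proof. by move=> /test1_continuous; exact: continuous_measurable. Qed.

Lemma test1_bounded c d f : test1 c d f -> exists2 M : R, 0 <= M & forall x, `|f x| <= M.
Proof.
move=> [sf [c1 [d1 [cc1 cd1 d1d f0]]]].
have [|x xcd fx] := @EVT_max R (fun x => `|f x|) c1 d1 (ltW cd1).
  apply: continuous_subspaceT => x; apply: cvg_norm.
  exact: smooth1_continuous.
exists `|f x| => // y; have [ycd|/f0 ->] := boolP (c1 <= y <= d1).
  by apply: fx; rewrite in_itv.
by rewrite normr0.
Qed.

Lemma out_int_itv c d f : (forall x, ~~ (c <= x <= d) -> f x = 0) ->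
  \int[mu]_x f x = \int[mu]_(x in `[c, d]) f x.
Proof.
move=> f0; rewrite [RHS]Rintegral_mkcond; apply: eq_Rintegral => x _.
rewrite patchE; case: ifPn => //; rewrite notin_setE /= in_itv/= => xcd.
by apply: f0; exact/negP.
Qed.

Lemma out_integrable c d f : (forall x, ~~ (c <= x <= d) -> f x = 0) ->
  continuous f -> mu.-integrable setT (EFin \o f).
Proof.
move=> f0 cf; have I : mu.-integrable `[c, d] (EFin \o f).
  apply: continuous_compact_integrable; first exact: segment_compact.
  exact: continuous_subspaceT.
move/integrable_mkcond: I => /(_ (measurable_itv _)).
congr (_.-integrable _ _); apply/funext => x; rewrite patchE.
case: ifPn => //; rewrite notin_setE /= in_itv/= => xcd.
by rewrite f0//; exact/negP.
Qed.

Lemma csupp_outc c d f x : csupp c d f -> ~~ (c <= x <= d) -> f x = 0.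
Proof.
move=> cf xcd; apply: (csupp_out cf); apply: contra xcd.
by move=> /andP[/ltW -> /ltW ->].
Qed.

Lemma test1_integrable c d f : test1 c d f -> mu.-integrable setT (EFin \o f).
Proof.
move=> tf; apply: (@out_integrable c d); last exact: test1_continuous tf.
by move=> x; apply: csupp_outc; case: tf.
Qed.

Lemma test1_norm_integrable c d f : test1 c d f ->
  mu.-integrable setT (fun x => `|f x|%:E).
Proof. by move=> /test1_integrable /integrable_norm. Qed.

Lemma smooth1_antider F f : (forall x : R, is_derive x 1 F (f x)) -> smooth1 f -> smooth1 F.
Proof.
move=> DF sf k x; case: k => [|k].
  by have := DF x => ?; exact: ex_derive.
rewrite derive1Sn (_ : derive1 F = f); first exact: sf.
by apply/funext => y; rewrite derive1E; have := DF y => ?; exact: derive_val.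
Qed.

Lemma continuous_itv_integrable f (a b : R) : continuous f ->
  mu.-integrable `[a, b] (EFin \o f).
Proof.
move=> cf; apply: continuous_compact_integrable; first exact: segment_compact.
exact: continuous_subspaceT.
Qed.

(** The primitive starting at c vanishes to the left of the support of k; zero mean is exactly what
    makes it vanish again to the right. *)
Lemma test1_antider c d k : test1 c d k -> \int[mu]_x k x = 0 ->
  exists F, [/\ test1 c d F, derive1 F = k & forall x, `|F x| <= \int[mu]_x `|k x|].
Proof.
move=> tk k0; have [sk [c1 [d1 [cc1 cd1 d1d kout]]]] := tk.
have ck := smooth1_continuous sk.
pose F x := \int[mu]_(t in `[c, x]) k t.
have Fl x : x < c1 -> F x = 0.
  move=> xc1; rewrite /F (@eq_Rintegral _ _ _ _ _ (cst 0)); last first.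
    move=> t; rewrite inE/= in_itv/= => /andP[_ tx]; apply: kout.
    by rewrite negb_and -ltNge (le_lt_trans tx xc1).
  by rewrite Rintegral_cst// mul0r.
have Fr x : d1 < x -> F x = 0.
  move=> d1x; rewrite -k0; apply/esym; apply: out_int_itv => t tcx.
  apply: kout; apply: contra tcx => /andP[h1 h2].
  by rewrite (le_trans (ltW cc1) h1) (le_trans h2 (ltW d1x)).
have DF (x : R) : is_derive x 1 F (k x).
  have [xc1|c1x] := ltP x c1.
    rewrite kout; last by rewrite negb_and -ltNge xc1.
    have : is_derive x 1 (cst 0 : R -> R) 0 by exact: is_derive_cst.
    apply: near_eq_is_derive; near=> y; apply/esym/Fl.
    by near: y; exact: lt_nbhsl.
  have [] := @continuous_FTC1_closed R k c x (x + 1).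
  - by rewrite ltrDl.
  - exact: continuous_itv_integrable.
  - exact: lt_le_trans c1x.
  - exact: ck.
  by rewrite derive1E => dF <-; exact: DeriveDef.
exists F; split.
- split; first exact: smooth1_antider DF sk.
  exists c1, d1; split => // x; rewrite negb_and -!ltNge => /orP[/Fl//|/Fr//].
- by apply/funext => x; rewrite derive1E; have := DF x => ?; exact: derive_val.
- move=> x; apply: (@le_trans _ _ (\int[mu]_(t in `[c, x]) `|k t|)).
    by apply: le_normr_Rintegral => //; exact: continuous_itv_integrable.
  rewrite Rintegral_mkcond; apply: le_Rintegral => //.
  + have I : mu.-integrable `[c, x] (fun t => `|k t|%:E).
      by apply: (@continuous_itv_integrable (fun t => `|k t|)) => y; apply: cvg_norm; exact: ck.
    move/integrable_mkcond: I => /(_ (measurable_itv _)).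
    by rewrite restrict_EFin.
  + exact: test1_norm_integrable tk.
  + by move=> t _; rewrite patchE; case: ifP => _; [exact: lexx|exact: normr_ge0].
Unshelve. all: by end_near. Qed.

Lemma smooth1_LR f (a b : R) : smooth1 f -> derivable_oo_LRcontinuous f a b.
Proof.
move=> sf; split=> [x _||]; first exact: smooth1_derivable.
  exact/cvg_at_right_filter/smooth1_continuous.
exact/cvg_at_left_filter/smooth1_continuous.
Qed.

Lemma test1_int_parts c d f g : test1 c d f -> smooth1 g ->
  \int[mu]_x (g x * derive1 f x) = - \int[mu]_x (derive1 g x * f x).
Proof.
move=> tf sg; have [_ cf'] := test1_derive tf; have [sf cf] := tf.
have cd : c < d by case: cf => c1 [d1 [h1 h2 h3 _]]; apply: lt_trans (lt_trans h1 h2) h3.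
rewrite (@out_int_itv c d); last first.
  by move=> x h; rewrite (csupp_outc cf' h) mulr0.
rewrite [in RHS](@out_int_itv c d); last first.
  by move=> x h; rewrite (csupp_outc cf h) mulr0.
rewrite (@Rintegration_by_parts R g f (derive1 g) (derive1 f))//.
- by rewrite !(csupp_out cf) ?mulr0 ?subrr ?sub0r ?ltxx ?andbF.
- by apply: continuous_subspaceT; exact: smooth1_continuous (smooth1_derive sg).
- exact: smooth1_LR.
- by apply: continuous_subspaceT; exact: smooth1_continuous (smooth1_derive sf).
- exact: smooth1_LR.
Qed.

Lemma smooth1_id : smooth1 (fun x : R => x).
Proof.
by apply: (@smooth1_antider _ (fun _ : R => 1)); exact: smooth1_cst.
Qed.

(** Integration by parts against the identity shows that the first moment of k is minus the integral
    of its primitive. So when both moments vanish one can integrate twice without leaving ]c, d[;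
    the second integration costs the factor d - c. *)
Lemma test1_antider2 c d k : test1 c d k -> \int[mu]_x k x = 0 ->
  \int[mu]_x (x * k x) = 0 ->
  exists F, [/\ test1 c d F, derive1 (derive1 F) = k &
    forall x, `|F x| <= (d - c) * \int[mu]_x `|k x|].
Proof.
move=> tk k0 k1; have [G [tG Gk Gle]] := test1_antider tk k0.
have G0 : \int[mu]_x G x = 0.
  have := test1_int_parts tG smooth1_id.
  under eq_Rintegral do rewrite Gk.
  rewrite k1 => /eqP; rewrite eq_sym oppr_eq0 => /eqP <-.
  by apply: eq_Rintegral => x _; rewrite derive1_id mul1r.
have [F [tF FG Fle]] := test1_antider tG G0.
have cd : c < d.
  by case: tk => _ [c1 [d1 [h1 h2 h3 _]]]; apply: lt_trans (lt_trans h1 h2) h3.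
exists F; split => //; first by rewrite FG.
move=> x; apply: le_trans (Fle x) _.
rewrite (@out_int_itv c d); last first.
  by move=> y h; rewrite (csupp_outc tG.2 h) normr0.
apply: (@le_trans _ _ (\int[mu]_(y in `[c, d]) (\int[mu]_z `|k z|))).
  apply: le_Rintegral => //.
  - apply: (@continuous_itv_integrable (fun y => `|G y|)) => y; apply: cvg_norm.
    exact: test1_continuous tG y.
  - by apply: continuous_itv_integrable => y; exact: cvg_cst.
rewrite Rintegral_cst//= lebesgue_measure_itv/= lte_fin cd /= mulrC//.
Qed.

End compact_support.

Section dominated_Rintegral.
Context d (T : measurableType d) (R : realType) (mu : {measure set T -> \bar R}).

Lemma Rintegral_dominated_cvg (D : set T) (f_ : nat -> T -> R) (f g : T -> R) :
  measurable D -> (forall n, measurable_fun D (f_ n)) ->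
  (forall x, D x -> f_ n x @[n --> \oo] --> f x) ->
  mu.-integrable D (EFin \o g) ->
  (forall n x, D x -> `|f_ n x| <= g x) ->
  \int[mu]_(x in D) f_ n x @[n --> \oo] --> \int[mu]_(x in D) f x.
Proof.
move=> mD mf cf ig fg.
have mfl : measurable_fun D f by apply: measurable_fun_cvg cf.
have fle x : D x -> `|f x| <= g x.
  move=> Dx; have h : `|f_ n x| @[n --> \oo] --> `|f x| by apply: cvg_norm; exact: cf.
  rewrite -(cvg_lim (@Rhausdorff R) h); apply: limr_le; first by apply/cvg_ex; exists `|f x|.
  by near=> n; exact: fg.
have If : mu.-integrable D (EFin \o f).
  apply: le_integrable ig => //; first exact/measurable_EFinP.
  by move=> x Dx /=; rewrite lee_fin (le_trans (fle _ Dx))// ler_norm.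
have h : (\int[mu]_(x in D) (f_ n x)%:E)%E @[n --> \oo] -->
    (\int[mu]_(x in D) (f x)%:E)%E.
  apply: (@dominated_cvg _ _ _ mu D mD (fun n => EFin \o f_ n) (EFin \o f)
      (EFin \o g)) => //.
  - by move=> n; exact/measurable_EFinP.
  - move=> x Dx; apply/fine_cvgP; split; first by near=> n.
    exact: cf.
apply/fine_cvg => /=.
rewrite fineK; last exact: integrable_fin_num.
exact: h.
Unshelve. all: by end_near. Qed.

Lemma Rrestrict_integrable (D : set T) (f : T -> R) : measurable D ->
  mu.-integrable D (EFin \o f) -> mu.-integrable setT (EFin \o f \_ D).
Proof. by move=> mD /(integrable_mkcond _ mD).1; rewrite restrict_EFin. Qed.

End dominated_Rintegral.

(** * Smooth bumps as test functions and averaging windows *)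

Section bumps.
Context {R : realType}.
Notation mu := (@lebesgue_measure R).

Lemma smooth_bump_itv_cvg (a b : R) (r : R -> R) : mu.-integrable setT (EFin \o r) ->
  \int[mu]_x (r x * smooth_bump a b n.+1%:R^-1 x) @[n --> \oo] -->
  \int[mu]_(x in `]a, b[) r x.
Proof.
move=> ir; rewrite [X in _ --> X](_ : _ = \int[mu]_x (r x * \1_(`]a, b[%classic) x)).
  have mr : measurable_fun setT r by apply/measurable_EFinP; exact: measurable_int ir.
  apply: (@Rintegral_dominated_cvg _ _ _ mu setT _ _ (fun x => `|r x|)) => //.
  - move=> n; apply: measurable_funM => //; apply: continuous_measurable.
    by apply: smooth1_continuous; apply: smooth1_bump.
  - by move=> x _; apply: cvgMr; exact: smooth_bump_cvg.
  - exact: integrable_norm ir.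
  - move=> n x _; rewrite normrM ler_piMr// ger0_norm ?smooth_bump_ge0//.
    exact: smooth_bump_le1.
rewrite Rintegral_mkcond; apply: eq_Rintegral => x _; rewrite patchE indicE.
by case: ifP; rewrite ?mulr1 ?mulr0.
Qed.

Lemma smooth_bump_mass_cvg (a b : R) : a < b ->
  \int[mu]_x smooth_bump a b n.+1%:R^-1 x @[n --> \oo] --> b - a.
Proof.
move=> ab.
have I : mu.-integrable setT (EFin \o (\1_(`]a, b[%classic) : R -> R)).
  exact: integrable_indic_itv.
have := @smooth_bump_itv_cvg a b _ I.
rewrite [X in _ --> X -> _](_ : _ = b - a); last first.
  rewrite (@eq_Rintegral _ _ _ _ _ (cst 1)); last by move=> x xab; rewrite indicE xab.
  by rewrite Rintegral_cst//= mul1r lebesgue_measure_itv/= lte_fin ab.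
rewrite (_ : (fun n => _) = (fun n => \int[mu]_x smooth_bump a b n.+1%:R^-1 x))//.
apply/funext => n; apply: eq_Rintegral => x _.
rewrite indicE; case: (boolP (x \in _)); rewrite ?mul1r// notin_setE/= in_itv/=.
by move=> xab; rewrite mul0r smooth_bump_out//; exact/negP.
Qed.

(* Testing against countably many bump functions detects an a.e. bound, by
   Lebesgue differentiation along intervals with rational ends. *)
Lemma smooth_bump_ae_bound (c d M : R) (r : R -> R) :
  mu.-integrable setT (EFin \o r) ->
  (forall (a b : rat) n, c < ratr a -> ratr a < ratr b :> R -> ratr b < d ->
    `|\int[mu]_x (r x * smooth_bump (ratr a) (ratr b) n.+1%:R^-1 x)| <=
      M * \int[mu]_x smooth_bump (ratr a) (ratr b) n.+1%:R^-1 x) ->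
  {ae mu, forall x, c < x < d -> `|r x| <= M}.
Proof.
move=> ir H.
have H1 (a b : rat) : c < ratr a -> ratr a < ratr b :> R -> ratr b < d ->
    `|\int[mu]_(x in `](ratr a), (ratr b)[) r x| <= M * (ratr b - ratr a).
  move=> ca ab bd.
  have h1 : `|\int[mu]_x (r x * smooth_bump (ratr a) (ratr b) n.+1%:R^-1 x)|
      @[n --> \oo] --> `|\int[mu]_(x in `](ratr a), (ratr b)[) r x|.
    by apply: cvg_norm; exact: smooth_bump_itv_cvg.
  have h2 : M * \int[mu]_x smooth_bump (ratr a) (ratr b) n.+1%:R^-1 x @[n --> \oo]
      --> M * (ratr b - ratr a).
    by apply: cvgMr; exact: smooth_bump_mass_cvg.
  apply: (ler_cvg_to h1 h2); near=> n; exact: H.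
pose e (n : nat) : R := n.+1%:R^-1.
have e0 n : 0 < e n by rewrite invr_gt0.
(* Rational end points at distance between e n / 2 and e n from x: the interval [E x n] lies in the
   ball of radius e n and fills at least half of it, as a nicely shrinking family requires. *)
have exA x n : exists q : rat, x - e n < ratr q < x - e n / 2.
  have [|q] := @rat_in_itvoo R (x - e n) (x - e n / 2); first by have := e0 n; lra.
  by rewrite in_itv; exists q.
have exB x n : exists q : rat, x + e n / 2 < ratr q < x + e n.
  have [|q] := @rat_in_itvoo R (x + e n / 2) (x + e n); first by have := e0 n; lra.
  by rewrite in_itv; exists q.
pose A x n := projT1 (cid (exA x n)); pose B x n := projT1 (cid (exB x n)).
have HA x n : x - e n < ratr (A x n) < x - e n / 2 by rewrite /A; case: cid.
have HB x n : x + e n / 2 < ratr (B x n) < x + e n by rewrite /B; case: cid.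
pose E (x : R) n : set R := `](ratr (A x n)), (ratr (B x n))[%classic.
have AB x n : ratr (A x n) < ratr (B x n) :> R.
  by have := HA x n; have := HB x n; have := e0 n => ? /andP[? ?] /andP[? ?]; lra.
have muE x n : mu (E x n) = (ratr (B x n) - ratr (A x n))%:E.
  by rewrite lebesgue_measure_itv/= lte_fin AB.
have nE x : nicely_shrinking x (E x).
  split=> [n|]; first exact: measurable_itv.
  exists (2, fun n => PosNum (e0 n)); split => //=.
  - exact: cvg_harmonic.
  - move=> n y; rewrite /E /= in_itv/= /ball/= => /andP[h1 h2].
    have := HA x n; have := HB x n; have := e0 n => ? /andP[? ?] /andP[? ?].
    by rewrite ltr_distlC; apply/andP; split; lra.
  - move=> n; rewrite muE.
    have -> : mu (ball x (e n)) = (e n *+ 2)%:E by apply: lebesgue_measure_ball; exact: ltW.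
    rewrite -[leRHS]EFinM lee_fin.
    have := HA x n; have := HB x n; have := e0 n => ? /andP[? ?] /andP[? ?].
    by rewrite mulr2n; lra.
have locr : locally_integrable setT r.
  by apply: open_integrable_locally => //; exact: openT.
move: (locr) => /lebesgue_differentiation.
apply: filterS; first exact: (ae_filter_ringOfSetsType mu).
move=> x xr /andP[cx xd].
have h : (`|(mu (E x n))^-1 * \int[mu]_(y in E x n) (r y)%:E| @[n --> \oo] -->
    `|(r x)%:E|)%E.
  by apply: cvg_abse; exact: nice_lebesgue_differentiation.
rewrite -lee_fin; apply: (@cvge_le _ _ _ _ _ _ _ _ h).
have hc : 0 < Num.min (x - c) (d - x) by rewrite lt_min !subr_gt0 cx xd.
have : \forall n \near \oo, e n < Num.min (x - c) (d - x).
  exact: (near_infty_natSinv_lt (PosNum hc)).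
apply: filterS => n; rewrite lt_min => /andP[en1 en2].
have := HA x n; have := HB x n; have := e0 n => ? /andP[? ?] /andP[? ?].
have iE : mu.-integrable (E x n) (EFin \o r).
  by apply: integrableS ir => //; exact: measurable_itv.
have := H1 (A x n) (B x n); rewrite AB => /(_ _ isT _).
have -> : c < ratr (A x n) by lra.
have -> : ratr (B x n) < d by lra.
move=> /(_ isT isT) h1.
have EI : (\int[mu]_(y in E x n) (r y)%:E)%E = (\int[mu]_(y in E x n) r y)%:E.
  rewrite /Rintegral fineK//; apply: integrable_fin_num iE.
  exact: measurable_itv.
have BA : 0 < ratr (B x n) - ratr (A x n) :> R by rewrite subr_gt0.
rewrite EI muE inver gt_eqF// -EFinM lee_fin normrM normfV (gtr0_norm BA) mulrC.
by rewrite ler_pdivrMr.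
Unshelve. all: by end_near. Qed.

Definition window_mass (p l : R) : R := \int[mu]_y smooth_bump p (p + l) l y.

(** A smooth probability density on ]p, p + l[. The bump parameter is l itself, so windows of all
    lengths are rescaled copies of one profile and are bounded by a fixed multiple of 1 / l. *)
Definition window (p l y : R) : R := (window_mass p l)^-1 * smooth_bump p (p + l) l y.

(** The barycentre of the window: the average of an affine function is its value there. *)
Definition window_center (p l : R) : R := \int[mu]_y (y * window p l y).

Lemma bump_test1 (a b e : R) : a < b -> 0 < e ->
  test1 (a - 1) (b + 1) (smooth_bump a b e).
Proof. by move=> ab e0; apply: test1_bump => //; lra. Qed.

(** On the middle third both ends are at distance at least l / 3, so each of the two exponentials is
    at least exp(-3). *)
Lemma window_mass_ge (p l : R) : 0 < l -> expR (- 6) / 3 * l <= window_mass p l.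
Proof.
move=> l0; have pl : p < p + l by rewrite ltrDl.
have ib := test1_integrable (bump_test1 pl l0).
have -> : expR (- 6) / 3 * l = \int[mu]_(y in `[p + l / 3, p + 2 * l / 3]) (expR (- 6)).
  rewrite Rintegral_cst//= lebesgue_measure_itv/= lte_fin ifT; last by lra.
  by rewrite /=; field.
rewrite Rintegral_mkcond; apply: le_Rintegral => //.
- apply: Rrestrict_integrable => //.
  by apply: (@continuous_itv_integrable _ (cst _)); exact: cst_continuous.
- move=> y _; rewrite patchE; case: ifPn => [|_]; last exact: smooth_bump_ge0.
  rewrite inE/= in_itv/= => /andP[h1 h2].
  rewrite /smooth_bump !flat_exp1E !ifT; [|lra|lra].
  rewrite -expRD ler_expR.
  have k1 : l / (y - p) <= 3 by rewrite ler_pdivrMr; lra.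
  have k2 : l / (p + l - y) <= 3 by rewrite ler_pdivrMr; lra.
  lra.
Qed.

Lemma window_mass_gt0 (p l : R) : 0 < l -> 0 < window_mass p l.
Proof.
by move=> l0; apply: lt_le_trans (window_mass_ge p l0); rewrite mulr_gt0 ?divr_gt0 ?expR_gt0.
Qed.

Lemma window_ge0 (p l y : R) : 0 < l -> 0 <= window p l y.
Proof.
by move=> l0; rewrite mulr_ge0 ?smooth_bump_ge0// invr_ge0 ltW// window_mass_gt0.
Qed.

Lemma window_le (p l y : R) : 0 < l -> window p l y <= 3 * expR 6 / l.
Proof.
move=> l0; rewrite /window mulrC ler_pdivrMr ?window_mass_gt0//.
apply: le_trans (smooth_bump_le1 _ _ _ l0) _.
apply: (@le_trans _ _ (3 * expR 6 / l * (expR (- 6) / 3 * l))).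
  rewrite expRN le_eqVlt; apply/orP; left; apply/eqP; field.
  by rewrite !gt_eqF ?expR_gt0.
by rewrite ler_wpM2l ?window_mass_ge// divr_ge0 ?mulr_ge0 ?expR_ge0// ltW.
Qed.

Lemma window_out (p l y : R) : ~~ (p < y < p + l) -> window p l y = 0.
Proof. by move=> h; rewrite /window smooth_bump_out ?mulr0. Qed.

Lemma window_test1 (c d p l : R) : 0 < l -> c < p -> p + l < d -> test1 c d (window p l).
Proof. by move=> l0 cp pd; apply: test1Z; apply: test1_bump => //; lra. Qed.

Lemma window_test1' (p l : R) : 0 < l -> test1 (p - 1) (p + l + 1) (window p l).
Proof. by move=> l0; apply: window_test1 => //; lra. Qed.

Lemma window_int (p l : R) : 0 < l -> \int[mu]_y window p l y = 1.
Proof.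
move=> l0; have pl : p < p + l by rewrite ltrDl.
rewrite RintegralZl//; last exact: test1_integrable (bump_test1 pl l0).
by rewrite mulVf// gt_eqF// window_mass_gt0.
Qed.

Lemma window_center_itv (p l : R) : 0 < l -> p <= window_center p l <= p + l.
Proof.
move=> l0; have tw := window_test1' p l0.
have iw := test1_integrable tw.
have ik k : mu.-integrable setT (EFin \o (fun y => k * window p l y)).
  exact: test1_integrable (test1Z k tw).
have iy : mu.-integrable setT (EFin \o (fun y => y * window p l y)).
  apply: (@test1_integrable _ (p - 1) (p + l + 1)); split.
    by apply: smooth1M; [exact: smooth1_id|exact: tw.1].
  by apply: csuppM tw.2.
rewrite -[X in X <= _ <= _]mulr1 -[X in _ <= _ <= X]mulr1 -(window_int p l0).
rewrite -!RintegralZl//; apply/andP; split; apply: le_Rintegral => // y _.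
- have [/andP[h _]|/window_out ->] := boolP (p < y < p + l); last by rewrite !mulr0.
  by rewrite ler_wpM2r ?window_ge0// ltW.
- have [/andP[_ h]|/window_out ->] := boolP (p < y < p + l); last by rewrite !mulr0.
  by rewrite ler_wpM2r ?window_ge0// ltW.
Qed.

End bumps.

(** * Square-integrable functions *)

Section square_integrable.
Context d (T : measurableType d) (R : realType) (mu : {measure set T -> \bar R}).
Implicit Types (f g h : T -> R) (D : set T).

Definition sqi D f : \bar R := (\int[mu]_(x in D) ((f x) ^+ 2)%:E)%E.

Definition sqint f : Prop := measurable_fun setT f /\ (sqi setT f < +oo)%E.

Lemma measurable_sqr D f : measurable_fun D f ->
  measurable_fun D (fun x => ((f x) ^+ 2)%:E).
Proof. by move=> mf; apply/measurable_EFinP; exact: measurable_funX. Qed.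

Lemma sqi_ge0 D f : (0 <= sqi D f)%E.
Proof. by apply: integral_ge0 => x _; rewrite lee_fin sqr_ge0. Qed.

Lemma sqi_restrict D f : sqi setT (f \_ D) = sqi D f.
Proof.
rewrite /sqi [RHS]integral_mkcond; apply: eq_integral => x _.
by rewrite !patchE; case: ifP; rewrite // expr2 mul0r.
Qed.

Lemma sqi_subset A B f : measurable A -> measurable B -> A `<=` B ->
  measurable_fun B f -> (sqi A f <= sqi B f)%E.
Proof.
move=> mA mB AB mf; apply: ge0_subset_integral => //; first exact: measurable_sqr.
by move=> x _; rewrite lee_fin sqr_ge0.
Qed.

Lemma le_sqi D f g : measurable D -> measurable_fun D f -> measurable_fun D g ->
  (forall x, D x -> `|f x| <= `|g x|) -> (sqi D f <= sqi D g)%E.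
Proof.
move=> mD mf mg fg; apply: ge0_le_integral => //.
- by move=> x _; rewrite lee_fin sqr_ge0.
- exact: measurable_sqr.
- exact: measurable_sqr.
- move=> x Dx; rewrite lee_fin -[leLHS]real_normK ?num_real//.
  by rewrite -[leRHS]real_normK ?num_real// lerXn2r ?nnegrE//; exact: fg.
Qed.

Lemma sqiD D f g : measurable D -> measurable_fun D f -> measurable_fun D g ->
  (sqi D (fun x => f x + g x)%R <= 2%:E * sqi D f + 2%:E * sqi D g)%E.
Proof.
move=> mD mf mg.
have pos k x : D x -> (0 <= 2%:E * ((k x : R) ^+ 2)%:E)%E.
  by move=> _; rewrite -EFinM lee_fin mulr_ge0// sqr_ge0.
have mk k : measurable_fun D k -> measurable_fun D (fun x => 2%:E * ((k x : R) ^+ 2)%:E)%E.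
  by move=> mk; apply: measurable_funeM; exact: measurable_sqr.
rewrite -!ge0_integralZl_EFin//; try exact: measurable_sqr;
  try by move=> x _; rewrite lee_fin sqr_ge0.
rewrite -ge0_integralD//; [|exact: pos|exact: mk|exact: pos|exact: mk].
apply: ge0_le_integral => //.
- by move=> x _; rewrite lee_fin sqr_ge0.
- by apply: measurable_sqr; exact: measurable_funD.
- by apply: emeasurable_funD; exact: mk.
- move=> x _; rewrite -!EFinM -EFinD lee_fin -subr_ge0.
  by rewrite (_ : _ - _ = (f x - g x) ^+ 2) ?sqr_ge0//; ring.
Qed.

Lemma sqiZ D a f : measurable D -> measurable_fun D f ->
  sqi D (fun x => a * f x) = ((a ^+ 2)%:E * sqi D f)%E.
Proof.
move=> mD mf; rewrite /sqi -ge0_integralZl_EFin ?sqr_ge0//; last 2 first.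
- by move=> x _; rewrite lee_fin sqr_ge0.
- exact: measurable_sqr.
by apply: eq_integral => x _; rewrite exprMn EFinM.
Qed.

Lemma sqintD f g : sqint f -> sqint g -> sqint (fun x => f x + g x).
Proof.
move=> [mf If] [mg Ig]; split; first exact: measurable_funD.
apply: le_lt_trans (sqiD _ mf mg) _ => //.
by rewrite lte_add_pinfty// lte_mul_pinfty ?lee_fin.
Qed.

Lemma sqintZ a f : sqint f -> sqint (fun x => a * f x).
Proof.
move=> [mf If]; split; first exact: measurable_funM.
by rewrite sqiZ// lte_mul_pinfty// lee_fin sqr_ge0.
Qed.

Lemma sqintB f g : sqint f -> sqint g -> sqint (fun x => f x - g x).
Proof.
move=> sf /(sqintZ (-1)) sg; have := sqintD sf sg.
by congr sqint; apply/funext => x; rewrite mulN1r.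
Qed.

Lemma sqint0 : sqint (cst 0).
Proof.
split=> //; rewrite /sqi (eq_integral (cst 0%E)) ?integral0//.
by move=> x _; rewrite /= expr2 mul0r.
Qed.

Lemma sqint_restrict D f : measurable D -> sqint f -> sqint (f \_ D).
Proof.
move=> mD [mf If]; split.
  by apply/(measurable_restrictT _ _).1 => //; exact: measurable_funTS.
by rewrite sqi_restrict; apply: le_lt_trans If; exact: sqi_subset.
Qed.

Lemma sqint_on D f : measurable D -> measurable_fun D f -> (sqi D f < +oo)%E ->
  sqint (f \_ D).
Proof.
move=> mD mf If; split; last by rewrite sqi_restrict.
by apply/(measurable_restrictT _ _).1.
Qed.

Lemma sqintM_integrable f g : sqint f -> sqint g ->
  mu.-integrable setT (fun x => (f x * g x)%:E).
Proof.
move=> [mf If] [mg Ig]; apply/integrableP; split.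
  by apply/measurable_EFinP; exact: measurable_funM.
apply: (@le_lt_trans _ _ (sqi setT f + sqi setT g)%E); last by rewrite lte_add_pinfty.
rewrite -ge0_integralD//; try exact: measurable_sqr;
  try by move=> x _; rewrite lee_fin sqr_ge0.
apply: ge0_le_integral => //.
- by apply: measurableT_comp => //; apply/measurable_EFinP; exact: measurable_funM.
- by apply: emeasurable_funD; exact: measurable_sqr.
- move=> x _; rewrite -EFinD lee_fin /= ler_norml; apply/andP; split.
  + by have := sqr_ge0 (f x + g x); have := sqr_ge0 (f x - g x); nra.
  + by have := sqr_ge0 (f x + g x); have := sqr_ge0 (f x - g x); nra.
Qed.

Lemma sqint_fin f : sqint f -> sqi setT f = (\int[mu]_x (f x ^+ 2))%:E.
Proof.
by move=> [mf If]; rewrite /Rintegral fineK// ge0_fin_numE// sqi_ge0.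
Qed.

Definition dot f g : R := \int[mu]_x (f x * g x).

Lemma dot_sqi f : sqint f -> sqi setT f = (dot f f)%:E.
Proof. by move=> /sqint_fin ->; congr EFin; apply: eq_Rintegral => x _; rewrite expr2. Qed.

Lemma dotC f g : dot f g = dot g f.
Proof. by apply: eq_Rintegral => x _; rewrite mulrC. Qed.

Lemma dotDl f g h : sqint f -> sqint g -> sqint h ->
  dot (fun x => f x + g x) h = dot f h + dot g h.
Proof.
move=> sf sg sh; rewrite /dot -RintegralD//; try exact: sqintM_integrable.
by apply: eq_Rintegral => x _; rewrite mulrDl.
Qed.

Lemma dotZl a f h : sqint f -> sqint h -> dot (fun x => a * f x) h = a * dot f h.
Proof.
move=> sf sh; rewrite /dot -RintegralZl//; last exact: sqintM_integrable.
by apply: eq_Rintegral => x _; rewrite mulrA.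
Qed.

Lemma dotBl f g h : sqint f -> sqint g -> sqint h ->
  dot (fun x => f x - g x) h = dot f h - dot g h.
Proof.
move=> sf sg sh; rewrite /dot -RintegralB//; try exact: sqintM_integrable.
by apply: eq_Rintegral => x _; rewrite mulrBl.
Qed.

Lemma dot_ge0 f : 0 <= dot f f.
Proof. by apply: Rintegral_ge0 => x _; rewrite -expr2 sqr_ge0. Qed.

Lemma dot_CS f g : sqint f -> sqint g -> dot f g ^+ 2 <= dot f f * dot g g.
Proof.
move=> sf sg.
have key t : 0 <= dot f f - 2 * t * dot f g + t ^+ 2 * dot g g.
  have stg := sqintZ t sg; have sfg := sqintB sf stg.
  have := dot_ge0 (fun x => f x - t * g x).
  rewrite (dotBl sf stg sfg) dotC (dotBl sf stg sf).
  rewrite [dot (fun x => t * g x) (fun x => f x - _)]dotC (dotBl sf stg stg).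
  rewrite [dot f (fun x => t * g x)]dotC !(dotZl t sg)//.
  rewrite [dot g (fun x => t * g x)]dotC (dotZl t sg)// [dot g f]dotC.
  by congr (_ <= _); ring.
(* If g has norm zero the quadratic in t degenerates to an affine function; the value of t chosen
   below would give it the value -1. *)
have [g0|gn0] := eqVneq (dot g g) 0.
  rewrite g0 mulr0 real_exprn_even_le0//= .
  have [//|fgn0] := eqVneq (dot f g) 0.
  have := key ((dot f f + 1) / (2 * dot f g)); rewrite g0 mulr0 addr0.
  rewrite (_ : 2 * _ * _ = dot f f + 1); last by field; rewrite fgn0.
  by rewrite opprD addNKr leNgt ltrN10.
have g0 : 0 < dot g g by rewrite lt_def gn0 dot_ge0.
have := key (dot f g / dot g g).
rewrite (_ : _ + _ = dot f f - dot f g ^+ 2 / dot g g); last by field.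
by rewrite subr_ge0 ler_pdivrMr.
Qed.

(** Stated in the extended reals because it is applied on individual lines, where the square
    integral of f may be infinite. *)
Lemma Rintegral_CS f g (W : R) : measurable_fun setT f -> measurable_fun setT g ->
  0 < W -> (sqi setT g <= W%:E)%E -> ((dot f g ^+ 2)%:E <= W%:E * sqi setT f)%E.
Proof.
move=> mf mg W0 gW.
have sg : sqint g by split => //; apply: le_lt_trans gW _; rewrite ltry.
have [If|] := boolP (sqi setT f < +oo)%E; last first.
  rewrite -leNgt leye_eq => /eqP ->; rewrite mulry gtr0_sg// mul1e leey//.
have sf : sqint f by [].
rewrite dot_sqi// -EFinM lee_fin (le_trans (dot_CS sf sg))// mulrC ler_wpM2r ?dot_ge0//.
by rewrite -lee_fin -dot_sqi.
Qed.

End square_integrable.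

(** * Completeness of the space of square-integrable functions *)

Section completeness.
Context {R : realType}.

(** Shifted by plus or minus 2 C 2^-n the sequence becomes monotone, so that monotone convergence
    yields the limit together with the error bound. *)
Lemma geometric_cauchy_cvg (a : nat -> R) (C : R) :
  (forall k, `|a k.+1 - a k| <= C * 2^-1 ^+ k) ->
  exists l, a n @[n --> \oo] --> l /\ forall n, `|l - a n| <= 2 * C * 2^-1 ^+ n.
Proof.
move=> H.
pose b n := a n + 2 * C * 2^-1 ^+ n; pose b' n := a n - 2 * C * 2^-1 ^+ n.
have c0 : (2^-1 : R) ^+ n @[n --> \oo] --> (0 : R).
  by apply: cvg_expr; rewrite ger0_norm ?invr_ge0// invf_lt1// ltr1n.
have db : nonincreasing_seq b.
  apply/nonincreasing_seqP => n; have := H n; rewrite ler_norml => /andP[_].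
  by rewrite /b exprS; lra.
have ib' : nondecreasing_seq b'.
  apply/nondecreasing_seqP => n; have := H n; rewrite ler_norml => /andP[+ _].
  by rewrite /b' exprS; lra.
have C0 : 0 <= C by have := le_trans (normr_ge0 _) (H 0%N); rewrite expr0 mulr1.
have b'b n : b' n <= b n.
  rewrite /b /b' lerD2l; have : 0 <= 2 * C * 2^-1 ^+ n.
    by rewrite !mulr_ge0// exprn_ge0// invr_ge0.
  lra.
have cb : cvgn b.
  apply: nonincreasing_is_cvgn => //; exists (b' 0%N) => _ [n _ <-].
  by apply: le_trans (b'b n); exact: ib'.
have ca : a n @[n --> \oo] --> limn b.
  have -> : limn b = limn b - 2 * C * 0 by rewrite mulr0 subr0.
  rewrite (_ : a = fun n => b n - 2 * C * 2^-1 ^+ n); last first.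
    by apply/funext => n; rewrite /b addrK.
  by apply: cvgB => //; apply: cvgMr.
have cb' : b' n @[n --> \oo] --> limn b.
  have -> : limn b = limn b - 2 * C * 0 by rewrite mulr0 subr0.
  by apply: cvgB => //; apply: cvgMr.
exists (limn b); split => // n; rewrite ler_norml; apply/andP; split.
- have := nondecreasing_cvgn_le ib' (cvgP _ cb') n.
  by rewrite (cvg_lim _ cb')// /b'; lra.
- by have := nonincreasing_cvgn_ge db cb n; rewrite /b; lra.
Qed.

Context d (T : measurableType d) (mu : {measure set T -> \bar R}).

Lemma cauchy_extraction (P : R -> nat -> nat -> Prop) :
  (forall e : R, 0 < e -> exists N, forall m n, (N <= m)%N -> (N <= n)%N -> P e m n) ->
  forall e_ : nat -> R, (forall k, 0 < e_ k) ->
  exists s : nat -> nat, {homo s : m n / (m < n)%N} /\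
    forall k m n, (s k <= m)%N -> (s k <= n)%N -> P (e_ k) m n.
Proof.
move=> HP e_ e0.
have /choice[N HN] k := HP _ (e0 k).
(* Partial sums of the thresholds, increased by k, are strictly increasing and dominate each single
   threshold. *)
exists (fun k => \sum_(i < k.+1) N i + k)%N; split=> [|k m n sm sn].
  apply: homo_ltn; first exact: ltn_trans.
  by move=> n; rewrite [X in (_ < X + _)%N]big_ord_recr/= addnS ltnS addnAC leq_addr.
by apply: HN; [apply: leq_trans sm|apply: leq_trans sn];
  rewrite big_ord_recr/= addnAC leq_addl.
Qed.

(** The increments along a subsequence have squared norm at most 8^-k, so the series [S] of the
    functions 4^k (D k)^2 has integrals dominated by 2^-k. Where [S] is finite it majorises the
    increments by sqrt(S) 2^-k, which gives pointwise convergence with a square-integrable error. *)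
Lemma sqint_complete (f_ : nat -> T -> R) : (forall n, sqint mu (f_ n)) ->
  (forall e : R, 0 < e -> exists N, forall m n, (N <= m)%N -> (N <= n)%N ->
    (sqi mu setT (fun x => f_ m x - f_ n x)%R <= e%:E)%E) ->
  exists2 f, sqint mu f & forall e : R, 0 < e -> exists N, forall n, (N <= n)%N ->
    (sqi mu setT (fun x => f_ n x - f x)%R <= e%:E)%E.
Proof.
move=> sf Hc.
have h8 k : 0 < (8^-1 : R) ^+ k by rewrite exprn_gt0// invr_gt0.
have [s [sinc Hs]] := cauchy_extraction Hc h8.
pose D k x := f_ (s k.+1) x - f_ (s k) x.
have mf n : measurable_fun setT (f_ n) by case: (sf n).
have mD k : measurable_fun setT (D k) by exact: measurable_funB.
have ID k : (sqi mu setT (D k) <= (8^-1 ^+ k)%:E)%E.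
  by apply: Hs => //; apply: ltnW; exact: sinc.
pose S x : \bar R := (\sum_(0 <= k <oo) ((4 ^+ k * D k x ^+ 2)%:E))%E.
have t0 k x : (0 <= (4 ^+ k * D k x ^+ 2)%:E)%E.
  by rewrite lee_fin mulr_ge0 ?sqr_ge0// exprn_ge0.
have mt k : measurable_fun setT (fun x => (4 ^+ k * D k x ^+ 2)%:E).
  by apply/measurable_EFinP; apply: measurable_funM => //; exact: measurable_funX.
have S0 x : (0 <= S x)%E by exact: nneseries_ge0.
have mS : measurable_fun setT S by apply: ge0_emeasurable_sum => //.
have IS : (\int[mu]_x S x < +oo)%E.
  rewrite integral_nneseries//.
  have h2 : (\sum_(0 <= k <oo) ((2 : R) / (2 ^ k.+1)%:R)%:E <= (2 : R)%:E)%E.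
    exact: (@epsilon_trick0 R 2 xpredT).
  apply: le_lt_trans (ltry 2); apply: le_trans h2.
  apply: lee_nneseries => [k _ _|k _]; first exact: integral_ge0.
  rewrite (_ : (\int[mu]_x _)%E = ((4 ^+ k)%:E * sqi mu setT (D k))%E); last first.
    rewrite /sqi -ge0_integralZl_EFin ?exprn_ge0//; last 2 first.
    - by move=> x _; rewrite lee_fin sqr_ge0.
    - exact: measurable_sqr.
  apply: (@le_trans _ _ ((4 ^+ k)%:E * (8^-1 ^+ k)%:E)%E).
    by rewrite lee_wpmul2l ?lee_fin ?exprn_ge0.
  rewrite -!EFinM lee_fin -exprMn le_eqVlt; apply/orP; left; apply/eqP.
  rewrite (_ : 4 / 8 = 2^-1 :> R); last by field.
  by rewrite natrX exprS exprVn; field; rewrite expf_neq0.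
have [N [mN N0 NS]] : {ae mu, forall x, S x \is a fin_num}.
  have /integrable_ae : mu.-integrable setT S.
    by apply/integrableP; split => //; under eq_integral do rewrite gee0_abs//.
  by move=> /(_ measurableT); apply: filterS => x /(_ I).
(* Setting the sequence to zero on the null set makes it converge everywhere, so that the limit is
   measurable. *)
pose g k := f_ (s k) \_ (~` N).
have mCN : measurable (~` N) by exact: measurableC.
have mg k : measurable_fun setT (g k).
  by apply/(measurable_restrictT _ _).1 => //; exact: measurable_funTS.
have Sfin x : ~ N x -> S x = (fine (S x))%:E.
  move=> Nx; rewrite fineK//; apply/negPn/negP => h; apply: Nx; apply: NS => /=.
  by apply/negP.
have HD x k : ~ N x -> `|D k x| <= Num.sqrt (fine (S x)) * 2^-1 ^+ k.
  move=> Nx; rewrite -[leLHS]sqrtr_sqr.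
  have h : 4 ^+ k * D k x ^+ 2 <= fine (S x).
    rewrite -lee_fin -Sfin//.
    apply: le_trans (@nneseries_lim_ge R _ xpredT 0 k.+1 _); last by move=> *; exact: t0.
    by rewrite big_nat_recr//= leeDr// sume_ge0.
  rewrite (_ : 2^-1 ^+ k = Num.sqrt ((2^-1 ^+ k) ^+ 2)); last first.
    by rewrite sqrtr_sqr ger0_norm// exprn_ge0// invr_ge0.
  rewrite -sqrtrM ?fine_ge0// ler_wsqrtr//.
  have -> : (2^-1 ^+ k) ^+ 2 = (4 ^+ k)^-1 :> R.
    by rewrite -exprM mulnC exprM -exprVn; congr (_ ^+ k); field.
  by rewrite ler_pdivlMr ?exprn_gt0// mulrC.
have Hx x : exists l, g n x @[n --> \oo] --> l /\
    forall n, `|l - g n x| <= 2 * Num.sqrt (fine (S x)) * 2^-1 ^+ n.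
  apply: geometric_cauchy_cvg => k; rewrite /g !patchE.
  have [NNx|] := boolP (x \in ~` N).
    by apply: HD; move: NNx; rewrite inE.
  by rewrite subrr normr0 mulr_ge0 ?sqrtr_ge0// exprn_ge0// invr_ge0.
have [f Hf] := choice Hx.
have mff : measurable_fun setT f.
  by apply: (@measurable_fun_cvg _ _ _ _ g) => // x _; exact: (Hf x).1.
have fg k : (sqi mu setT (fun x => f x - f_ (s k) x)%R <=
    (4 * (4^-1) ^+ k)%:E * \int[mu]_x S x)%E.
  rewrite -ge0_integralZl_EFin ?mulr_ge0 ?exprn_ge0 ?invr_ge0//.
  apply: ae_ge0_le_integral => //.
  - by move=> x _; rewrite lee_fin sqr_ge0.
  - by apply: measurable_sqr; exact: measurable_funB.
  - by move=> x _; rewrite mule_ge0// lee_fin mulr_ge0// exprn_ge0// invr_ge0.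
  - exact: measurable_funeM.
  exists N; split => // x /= Hn; apply: contrapT => Nx; apply: Hn => _.
  have := (Hf x).2 k; rewrite /g patchE ifT; last by rewrite inE.
  move=> h; rewrite Sfin// -EFinM lee_fin.
  rewrite -real_normK ?num_real//.
  apply: (@le_trans _ _ ((2 * Num.sqrt (fine (S x)) * 2^-1 ^+ k) ^+ 2)).
    by rewrite lerXn2r// nnegrE// !mulr_ge0 ?sqrtr_ge0// exprn_ge0// invr_ge0.
  rewrite !exprMn sqr_sqrtr ?fine_ge0//.
  have -> : (2^-1 ^+ k) ^+ 2 = 4^-1 ^+ k :> R.
    by rewrite -exprM mulnC exprM; congr (_ ^+ k); field.
  by rewrite (_ : 2 ^+ 2 = 4 :> R) 1?mulrAC//; ring.
have sff : sqint mu f.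
  have : sqint mu (fun x => f x - f_ (s 0%N) x).
    split; first exact: measurable_funB.
    by apply: le_lt_trans (fg 0%N) _; rewrite lte_mul_pinfty// lee_fin mulr_ge0// exprn_ge0// invr_ge0.
  move=> /sqintD /(_ (sf (s 0%N))); congr sqint.
  by apply/funext => x; rewrite subrK.
exists f => // e e0.
have [I [I0 HI]] : exists I : R, 0 <= I /\ (\int[mu]_x S x = I%:E)%E.
  exists (fine (\int[mu]_x S x)); split; first by rewrite fine_ge0// integral_ge0.
  by rewrite fineK// ge0_fin_numE// integral_ge0.
have e4 : 0 < e / 4 by rewrite divr_gt0.
have [N1 HN1] := Hc _ e4.
have [k [Nk Hk]] : exists k, (N1 <= s k)%N /\ 4 * 4^-1 ^+ k * I <= e / 4.
  have c0 : 4 * (4^-1 : R) ^+ n * I @[n --> \oo] --> 4 * 0 * I.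
    apply: cvgMl; apply: cvgMr.
    by apply: cvg_expr; rewrite ger0_norm ?invr_ge0// invf_lt1// ltr1n.
  rewrite mulr0 mul0r in c0.
  have [k0 _ Hk0] : \forall n \near \oo, 4 * (4^-1 : R) ^+ n * I <= e / 4.
    exact: (cvgr_le _ c0).
  exists (maxn N1 k0); split; last by apply: Hk0; rewrite /= leq_maxr.
  apply: leq_trans (leq_maxl N1 k0) _.
  by elim: (maxn N1 k0) => // n IH; apply: leq_ltn_trans IH _; exact: sinc.
exists N1 => n Nn.
(* Convergence is known along the subsequence only; the Cauchy condition carries it over to the
   whole sequence. *)
rewrite (_ : (fun x => f_ n x - f x) = (fun x => (f_ n x - f_ (s k) x) +
   (-1) * (f x - f_ (s k) x))); last by apply/funext => x; ring.
apply: le_trans (sqiD _ _ _ _) _ => //.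
- exact: measurable_funB.
- by apply: measurable_funM => //; exact: measurable_funB.
rewrite sqiZ//; last exact: measurable_funB.
rewrite sqrrN expr1n mul1e.
have h1 := HN1 n (s k) Nn Nk.
have h2 : (sqi mu setT (fun x => f x - f_ (s k) x)%R <= (e / 4)%:E)%E.
  by apply: le_trans (fg k) _; rewrite HI -EFinM lee_fin.
apply: (@le_trans _ _ (2%:E * (e / 4)%:E + 2%:E * (e / 4)%:E)%E).
  by apply: leeD; rewrite lee_wpmul2l.
by rewrite -!EFinM -EFinD lee_fin; lra.
Qed.

End completeness.

Section almost_everywhere.
Context d (T : measurableType d) (R : realType) (mu : {measure set T -> \bar R}).

Lemma aeS (P Q : T -> Prop) : (forall x, P x -> Q x) ->
  {ae mu, forall x, P x} -> {ae mu, forall x, Q x}.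
Proof.
move=> PQ [N [mN N0 NP]]; exists N; split => // x nQ; apply: NP => Px.
exact: nQ (PQ _ Px).
Qed.

Lemma aeI (P Q : T -> Prop) : {ae mu, forall x, P x} -> {ae mu, forall x, Q x} ->
  {ae mu, forall x, P x /\ Q x}.
Proof.
move=> [N [mN N0 NP]] [M [mM M0 MQ]]; exists (N `|` M); split.
- exact: measurableU.
- by rewrite null_set_setU.
- move=> x /not_andP[/NP|/MQ]; [by left|by right].
Qed.

End almost_everywhere.

(** * Open sets, measurability and Fubini in the plane *)

Section plane.
Context {R : realType}.
Local Notation plane := (R * R)%type.
Local Notation leb1 := (@lebesgue_measure R).
Local Notation leb2 := (leb1 \x leb1)%E.

Definition box (c d c' d' : R) : set plane := [set x | c < x.1 < d /\ c' < x.2 < d'].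

Lemma open_tube (A : set plane) (c d z : R) : open A -> c <= d ->
  (forall y, c <= y <= d -> A (y, z)) ->
  exists2 e : R, 0 < e & forall y w, c - e <= y <= d + e -> z - e <= w <= z + e -> A (y, w).
Proof.
move=> oA cd Az.
pose P (e : R) (y : R) := forall y' w, `|y' - y| <= e -> `|w - z| <= e -> A (y', w).
have /compact_near_coveringP/(_ R (0^'+) P) : compact `[c, d]%classic by exact: segment_compact.
have F : Filter (0^'+ : set_system R) by exact: at_right_proper_filter.
move=> /(_ F) [].
  move=> y /=; rewrite in_itv/= => /Az Ay.
  have : nbhs (y, z) A by apply: open_nbhs_nbhs.
  move=> [[U V] /= [/nbhs_ballP[e1 /= e10 yU] /nbhs_ballP[e2 /= e20 zV]] UVA].
  pose e := Num.min e1 e2 / 2.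
  have e0 : 0 < e by rewrite divr_gt0// lt_min e10.
  have ee1 : e + e <= e1 by rewrite /e -splitr ge_min lexx.
  have ee2 : e + e <= e2 by rewrite /e -splitr ge_min lexx orbT.
  exists (ball y e, [set t | t < e]); first split => /=.
  - exact: nbhsx_ballx.
  - exact: nbhs_right_lt.
  - move=> [y1 e'] /= [yy1 ee'] y' w h1 h2; apply: (UVA (y', w)); split => /=.
      apply: yU; rewrite /ball/= in yy1 *.
      rewrite (_ : y - y' = (y - y1) - (y' - y1)); last by ring.
      apply: le_lt_trans (ler_normB _ _) _; lra.
    apply: zV; rewrite /ball/= distrC; lra.
move=> e /= e0 H.
have e20 : 0 < e / 2 by rewrite divr_gt0.
have {}H : `[c, d]%classic `<=` P (e / 2).
  apply: (H (e / 2)) => //=.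
  by rewrite sub0r normrN gtr0_norm// ltr_pdivrMr// ltr_pMr// ltr1n.
exists (e / 2) => // y w ycd wz.
have wze : `|w - z| <= e / 2 by rewrite ler_distlC; lra.
have [yc|cy] := ltP y c.
  apply: (H c) => //; first by rewrite /= in_itv/= lexx.
  by rewrite ler_distlC; lra.
have [dy|yd] := ltP d y.
  apply: (H d) => //; first by rewrite /= in_itv/= lexx andbT.
  by rewrite ler_distlC; lra.
apply: (H y) => //; first by rewrite /= in_itv/= cy.
by rewrite subrr normr0 ltW.
Qed.

Lemma open_rat_tube (A : set plane) (c d z : R) : open A -> c <= d ->
  (forall y, c <= y <= d -> A (y, z)) ->
  exists q : rat * rat * rat * rat,
    [/\ ratr q.1.1.1 < c, d < ratr q.1.1.2, ratr q.1.2 < z < ratr q.2 &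
     box (ratr q.1.1.1) (ratr q.1.1.2) (ratr q.1.2) (ratr q.2) `<=` A].
Proof.
move=> oA cd Az; have [e e0 H] := open_tube oA cd Az.
have [a] := @rat_in_itvoo R (c - e) c ltac:(lra).
have [b] := @rat_in_itvoo R d (d + e) ltac:(lra).
have [a'] := @rat_in_itvoo R (z - e) z ltac:(lra).
have [b'] := @rat_in_itvoo R z (z + e) ltac:(lra).
rewrite !in_itv/= => /andP[h1 h2] /andP[h3 h4] /andP[h5 h6] /andP[h7 h8].
exists (a, b, a', b'); split => //=; first by rewrite h1 h4.
by rewrite /box => -[y w] /= [/andP[h9 h10] /andP[h11 h12]]; apply: H; lra.
Qed.

Lemma measurable_box c d c' d' : measurable (box c d c' d').
Proof.
rewrite (_ : box c d c' d' = `]c, d[%classic `*` `]c', d'[%classic).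
  by apply: measurableX; exact: measurable_itv.
by apply/seteqP; split => -[y z] /=; rewrite /box/= !in_itv.
Qed.

(** The product sigma-algebra is generated by rectangles, so an open set is written as the countable
    union of the rational boxes that it contains. *)
Lemma open_plane_measurable (A : set plane) : open A -> measurable A.
Proof.
move=> oA.
pose B (q : rat * rat * rat * rat) : set plane :=
  box (ratr q.1.1.1) (ratr q.1.1.2) (ratr q.1.2) (ratr q.2).
pose F n : set plane := if unpickle n is Some q then
  (if `[< B q `<=` A >] then B q else set0) else set0.
have -> : A = \bigcup_n F n.
  apply/seteqP; split => [[y z] Ayz|x [n _]]; last first.
    by rewrite /F; case: unpickle => // q; case: ifP => // /asboolP; exact.
  have [|q [h1 h2 h3 h4]] := @open_rat_tube A y y z oA (lexx y).
    by move=> y' /andP[h1 h2]; rewrite (_ : y' = y)//; apply/eqP; rewrite eq_le h2.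
  exists (pickle q); first exact: I.
  rewrite /F pickleK; case: asboolP => // _.
  by rewrite /B /box/= h1 h2.
apply: bigcup_measurable => n _; rewrite /F; case: unpickle => // q.
by case: ifP => // _; exact: measurable_box.
Qed.

Lemma continuous_plane_measurable (f : plane -> R) : continuous f ->
  measurable_fun setT f.
Proof.
move=> /continuousP cf; apply: (measurability _ (RGenOpens.measurableE R)).
move=> _ [_ [a [b ->] <-]]; rewrite setTI; apply: open_plane_measurable.
exact/cf/interval_open.
Qed.

Lemma measurable_fst_comp (f : R -> R) : measurable_fun setT f ->
  measurable_fun setT (fun x : plane => f x.1).
Proof. by move=> mf; apply: measurableT_comp => //; exact: measurable_fst. Qed.

Lemma measurable_snd_comp (f : R -> R) : measurable_fun setT f ->
  measurable_fun setT (fun x : plane => f x.2).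
Proof. by move=> mf; apply: measurableT_comp => //; exact: measurable_snd. Qed.

(** No integrability is assumed: on lines where the section is not integrable the value is a default
    one, but it still comes from the difference of the integrals of the positive and negative parts,
    which is measurable. *)
Lemma measurable_Rsection (f : plane -> R) : measurable_fun setT f ->
  measurable_fun setT (fun z => \int[leb1]_y f (y, z)).
Proof.
move=> mf; have mEf : measurable_fun setT (EFin \o f) by exact/measurable_EFinP.
rewrite /Rintegral; apply: measurableT_comp => //.
rewrite (_ : (fun z => _) = (fun z => \int[leb1]_y ((EFin \o f)^\+ (y, z)) -
   \int[leb1]_y ((EFin \o f)^\- (y, z)))%E); last first.
  apply/funext => z; rewrite integralE; congr (_ - _)%E;
    by apply: eq_integral => y _; rewrite ?funeposE ?funenegE.
apply: emeasurable_funB.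
- apply: (@measurable_fun_fubini_tonelli_G _ _ _ _ _ leb1) => //.
  exact: measurable_funepos.
- apply: (@measurable_fun_fubini_tonelli_G _ _ _ _ _ leb1) => //.
  exact: measurable_funeneg.
Qed.

Lemma Rintegral_EFin d (T : measurableType d) (mu : {measure set T -> \bar R}) (f : T -> R) :
  mu.-integrable setT (EFin \o f) -> (\int[mu]_x (f x)%:E)%E = (\int[mu]_x f x)%:E.
Proof. by move=> fi; rewrite /Rintegral fineK//; exact: integrable_fin_num fi. Qed.

(** The inner real-valued integral is the true one off a null set of lines; the default values on
    that set do not affect the outer integral. *)
Lemma Rfubini2 (f : plane -> R) : leb2.-integrable setT (EFin \o f) ->
  leb1.-integrable setT (fun z => (\int[leb1]_y f (y, z))%:E) /\
  \int[leb2]_x f x = \int[leb1]_z \int[leb1]_y f (y, z).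
Proof.
move=> fi; have mf : measurable_fun setT f by apply/measurable_EFinP; exact: measurable_int fi.
have iG : leb1.-integrable setT (fubini_G leb1 (EFin \o f)).
  apply/integrableP; split; first exact: measurable_fubini_G fi.
  have mEf : measurable_fun setT (EFin \o f) by exact: measurable_int fi.
  apply: le_lt_trans ((integrable21ltyP leb1 leb1 mEf).1 fi).
  apply: ge0_le_integral => //.
  - by apply: measurableT_comp => //; exact: measurable_fubini_G fi.
  - apply: (@measurable_fun_fubini_tonelli_G _ _ _ _ _ leb1 (abse \o (EFin \o f))).
      exact: measurableT_comp.
    by move=> x; exact: abse_ge0.
  - move=> z _; apply: le_abse_integral => //.
    exact: measurable_fun_pair1 mEf.
have mG : measurable_fun setT (fun z => (\int[leb1]_y f (y, z))%:E).
  by apply/measurable_EFinP; exact: measurable_Rsection.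
have E : ae_eq leb1 setT (fubini_G leb1 (EFin \o f)) (fun z => (\int[leb1]_y f (y, z))%:E).
  apply: (aeS _ (ae_integrable2 fi)) => z iz _; exact: Rintegral_EFin iz.
have mFG : measurable_fun setT (fubini_G leb1 (EFin \o f)) by exact: measurable_int iG.
split.
  apply/integrableP; split => //.
  rewrite (@ae_eq_integral _ _ _ leb1 setT (abse \o fubini_G leb1 (EFin \o f)))//.
  - by case/integrableP : iG.
  - exact: measurableT_comp.
  - exact: measurableT_comp.
  - by apply: ae_eq_sym; exact: ae_eq_abse.
rewrite /Rintegral; congr fine.
transitivity (\int[leb1]_z fubini_G leb1 (EFin \o f) z)%E.
  exact: esym (integral21_prod_meas1 fi).
by apply: ae_eq_integral => //.
Qed.

Lemma leb2_ysection (A : set plane) : measurable A ->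
  leb2 A = (\int[leb1]_z leb1 (ysection A z))%E.
Proof.
move=> mA; transitivity (\int[leb2]_x (\1_A x)%:E)%E; first by rewrite integral_indic// setIT.
have m1 : measurable_fun setT (fun x : plane => (\1_A x : R)%:E).
  by apply/measurable_EFinP; exact: measurable_indic.
rewrite fubini_tonelli2//.
by rewrite indic_fubini_tonelli_GE.
Qed.

(** Tonelli for the exceptional set, whose measurability must be known beforehand. This is how
    estimates on almost every line become estimates almost everywhere in the plane. *)
Lemma ae_of_sections (P : plane -> Prop) : measurable [set x | ~ P x] ->
  {ae leb1, forall z, {ae leb1, forall y, P (y, z)}} -> {ae leb2, forall x, P x}.
Proof.
move=> mP H; exists [set x | ~ P x]; split => //.
rewrite leb2_ysection// (@ae_eq_integral _ _ _ _ _ (cst 0%E))//; first by rewrite integral0.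
- exact: measurable_fun_ysection.
- apply: (aeS _ H) => z [N [mN N0 NP]] _ /=; apply/eqP; rewrite -measure_le0 -N0 le_measure ?inE//.
    exact: measurable_ysection.
  by move=> y; rewrite /ysection/= inE/= => h; exact: NP.
Qed.

Lemma integral_swap (f : plane -> \bar R) : measurable_fun setT f ->
  (forall x, 0 <= f x)%E -> (\int[leb2]_x f (x.2, x.1))%E = (\int[leb2]_x f x)%E.
Proof.
move=> mf f0; rewrite [RHS]fubini_tonelli1// fubini_tonelli2//.
by apply: (measurableT_comp mf); exact: measurable_swap.
Qed.

End plane.

(** * Interpolation on rectangles *)

Section rectangles.
Context {R : realType}.
Local Notation plane := (R * R)%type.
Local Notation leb1 := (@lebesgue_measure R).
Local Notation leb2 := (leb1 \x leb1)%E.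
Implicit Types (u g : plane -> R).

Lemma ae_forall_count d (T : measurableType d) (mu : {measure set T -> \bar R})
    (I : countType) (P : I -> T -> Prop) :
  (forall i, {ae mu, forall x, P i x}) -> {ae mu, forall x, forall i, P i x}.
Proof.
move=> H; pose Q n x := if unpickle n is Some i then P i x else True.
have : {ae mu, forall x, forall n, Q n x}.
  apply: ae_foralln => n; rewrite /Q; case: unpickle => [i|]; first exact: H.
  exact: aeW.
by apply: aeS => x Hx i; have := Hx (pickle i); rewrite /Q pickleK.
Qed.

Lemma Rintegral_ae d (T : measurableType d) (mu : {measure set T -> \bar R}) (f h : T -> R) :
  measurable_fun setT f -> measurable_fun setT h ->
  {ae mu, forall x, f x = h x} -> \int[mu]_x f x = \int[mu]_x h x.
Proof.
move=> mf mh fh; rewrite /Rintegral; congr fine; apply: ae_eq_integral => //.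
- exact/measurable_EFinP.
- exact/measurable_EFinP.
- by apply: aeS fh => x -> _.
Qed.

Lemma integrable_eq d (T : measurableType d) (mu : {measure set T -> \bar R}) (f h : T -> R) :
  f =1 h -> mu.-integrable setT (EFin \o f) -> mu.-integrable setT (EFin \o h).
Proof. by move=> /funext ->. Qed.

Definition tensor (f h : R -> R) (x : plane) : R := f x.1 * h x.2.

(** The weak form of d^2 u / dy^2 = g, tested only against tensor products supported in a box of
    [Om]. Such test functions are made of one-variable ones, and they separate the horizontal
    lines. *)
Definition weak_yy (Om : set plane) u g := forall c d c' d' al be,
  box c d c' d' `<=` Om -> test1 c d al -> test1 c' d' be ->
  dot leb2 u (tensor (derive1 (derive1 al)) be) = dot leb2 g (tensor al be).

Lemma leb2_box c d c' d' : (leb2 (box c d c' d') < +oo)%E.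
Proof.
rewrite (_ : box c d c' d' = `]c, d[%classic `*` `]c', d'[%classic); last first.
  by apply/seteqP; split => -[y z] /=; rewrite /box/= !in_itv.
rewrite product_measure1E; [|exact: measurable_itv|exact: measurable_itv].
have fin a b : (leb1 `]a, b[%classic \is a fin_num).
  by rewrite lebesgue_measure_itv/=; case: ifP.
by apply: lte_mul_pinfty; [exact: measure_ge0|exact: fin|rewrite -ge0_fin_numE// fin].
Qed.

Lemma sqint_bounded (w : plane -> R) (M c d c' d' : R) : measurable_fun setT w ->
  (forall x, `|w x| <= M) -> (forall x, ~ box c d c' d' x -> w x = 0) ->
  sqint leb2 w.
Proof.
move=> mw wM w0; have mB := measurable_box c d c' d'.
have M0 : 0 <= M by apply: le_trans (wM (0, 0)).
rewrite (_ : w = w \_ (box c d c' d')); last first.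
  apply/funext => x; rewrite patchE; case: ifPn => //.
  by rewrite notin_setE => /w0.
apply: sqint_on => //; first exact: measurable_funTS.
apply: (@le_lt_trans _ _ ((M ^+ 2)%:E * leb2 (box c d c' d'))%E).
  rewrite -integral_cst//; apply: ge0_le_integral => //.
  - by move=> x _; rewrite lee_fin sqr_ge0.
  - by apply: measurable_sqr; exact: measurable_funTS.
  - by move=> x _; rewrite lee_fin -real_normK ?num_real// lerXn2r ?nnegrE.
by rewrite lte_mul_pinfty ?lee_fin ?sqr_ge0//; exact: leb2_box.
Qed.

Lemma measurable_tensor f h : measurable_fun setT f -> measurable_fun setT h ->
  measurable_fun setT (tensor f h).
Proof.
move=> mf mh; apply: measurable_funM; first exact: measurable_fst_comp.
exact: measurable_snd_comp.
Qed.

Lemma sqint_tensor (f h : R -> R) (M c d c' d' : R) :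
  measurable_fun setT f -> measurable_fun setT h ->
  (forall y, `|f y| <= M) -> (forall y, `|h y| <= M) ->
  (forall y, ~~ (c < y < d) -> f y = 0) -> (forall y, ~~ (c' < y < d') -> h y = 0) ->
  sqint leb2 (tensor f h).
Proof.
move=> mf mh fM hM f0 h0.
have M0 : 0 <= M by apply: le_trans (fM 0).
apply: (@sqint_bounded _ (M * M) c d c' d').
- exact: measurable_tensor.
- by move=> x; rewrite normrM ler_pM.
- move=> x xB; rewrite /tensor; have [h1|/f0 ->] := boolP (c < x.1 < d); last by rewrite mul0r.
  have [h2|/h0 ->] := boolP (c' < x.2 < d'); last by rewrite mulr0.
  by exfalso; apply: xB.
Qed.

Lemma sqint_tensor_test c d c' d' f h : test1 c d f -> test1 c' d' h ->
  sqint leb2 (tensor f h).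
Proof.
move=> tf th; have [M1 M10 fM] := test1_bounded tf; have [M2 M20 hM] := test1_bounded th.
apply: (@sqint_tensor _ _ (M1 + M2) c d c' d').
- exact: test1_measurable tf.
- exact: test1_measurable th.
- by move=> y; rewrite (le_trans (fM y))// lerDl.
- by move=> y; rewrite (le_trans (hM y))// lerDr.
- by move=> y; apply: csupp_out tf.2.
- by move=> y; apply: csupp_out th.2.
Qed.

Lemma sqint_tensor_indic c d c' d' f : test1 c d f ->
  sqint leb2 (tensor f (\1_(`]c', d'[%classic))).
Proof.
move=> tf; have [M1 M10 fM] := test1_bounded tf.
apply: (@sqint_tensor _ _ (M1 + 1) c d c' d').
- exact: test1_measurable tf.
- by apply: measurable_indic; exact: measurable_itv.
- by move=> y; rewrite (le_trans (fM y))// lerDl.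
- by move=> y; rewrite indicE; case: (_ \in _); rewrite ?normr1 ?normr0 ?lerDr// addr_ge0.
- by move=> y; apply: csupp_out tf.2.
- by move=> y yn; rewrite indicE memNset//= in_itv/=; exact/negP.
Qed.

(** A function of z whose integrals against all rational bumps vanish is zero almost everywhere. The
    exceptional null set depends on [K], so only countably many [K] can be used at the same time. *)
Lemma slice_identity (Om : set plane) u g c d c' d' K :
  sqint leb2 u -> sqint leb2 g -> weak_yy Om u g -> box c d c' d' `<=` Om ->
  test1 c d K ->
  {ae leb1, forall z, c' < z < d' ->
    \int[leb1]_y (u (y, z) * derive1 (derive1 K) y) = \int[leb1]_y (g (y, z) * K y)}.
Proof.
move=> su sg W QO tK; set k := derive1 (derive1 K).
have tk : test1 c d k by do 2 apply: test1_derive.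
(* The indicator cuts off in z: it changes nothing for z in ]c', d'[ and makes the products with [k]
   and [K] integrable over the plane. *)
pose I := (\1_(`]c', d'[%classic) : R -> R).
have sk := sqint_tensor_indic c' d' tk; have sK := sqint_tensor_indic c' d' tK.
have i1 := sqintM_integrable su sk; have i2 := sqintM_integrable sg sK.
pose F x := u x * tensor k I x - g x * tensor K I x.
have iF : leb2.-integrable setT (EFin \o F) by exact: (integrableB measurableT i1 i2).
have mF : measurable_fun setT F by apply/measurable_EFinP; exact: measurable_int iF.
have [ih _] := Rfubini2 iF.
set h := (fun z => (\int[leb1]_y F (y, z))%:E) in ih.
have ae1 := ae_integrable2 i1; have ae2 := ae_integrable2 i2.
have aeF := ae_integrable2 iF.
have h0 : {ae leb1, forall z, c' < z < d' -> `|\int[leb1]_y F (y, z)| <= 0}.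
  apply: smooth_bump_ae_bound => // a b n ca ab bd; rewrite mul0r normr_le0; apply/eqP.
  set be := smooth_bump _ _ _.
  have tbe : test1 c' d' be by apply: test1_bump.
  have [M M0 beM] := test1_bounded tbe.
  have mbe := test1_measurable tbe.
  have Ibe z : I z * be z = be z.
    rewrite /I indicE; have [|] := boolP (z \in _); first by rewrite mul1r.
    by rewrite notin_setE/= in_itv/= => /negP /(csupp_out tbe.2) ->; rewrite mulr0.
  have iFbe : leb2.-integrable setT (EFin \o (fun x => F x * be x.2)).
    have : leb2.-integrable setT (fun x => (M%:E * (EFin \o F) x)%E) by exact: integrableZl.
    apply: le_integrable => //.
      apply/measurable_EFinP; apply: measurable_funM => //.
      exact: measurable_snd_comp.
    move=> x _; change (`|F x * be x.2|%:E <= `|M * F x|%:E)%E.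
    rewrite lee_fin [leLHS]normrM [leRHS]normrM [`|M|]ger0_norm// [leLHS]mulrC.
    by apply: ler_wpM2r; [exact: normr_ge0|exact: beM].
  have [_ E] := Rfubini2 iFbe.
  transitivity (\int[leb2]_x (F x * be x.2)).
    rewrite E; apply: Rintegral_ae.
    - by apply: measurable_funM => //; exact: measurable_Rsection.
    - by apply: (@measurable_Rsection _ (fun x => F x * be x.2)); apply/measurable_EFinP; exact: measurable_int iFbe.
    - by apply: aeS aeF => z iz; apply/esym; exact: (RintegralZr (be z) measurableT iz).
  have := W _ _ _ _ K be QO tK tbe.
  have i3 := sqintM_integrable su (sqint_tensor_test tk tbe).
  have i4 := sqintM_integrable sg (sqint_tensor_test tK tbe).
  move/eqP; rewrite -subr_eq0 /dot -RintegralB// => /eqP <-.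
  apply: eq_Rintegral => x _; rewrite /F /tensor -/k mulrBl -!mulrA !Ibe//.
apply: aeS (aeI h0 (aeI ae1 ae2)) => z [Hz [j1 j2]] zcd.
have := Hz zcd; rewrite normr_le0 => /eqP.
have I1 : I z = 1 by rewrite /I indicE mem_set//= in_itv.
rewrite /F /tensor/= in j1 j2 *.
rewrite RintegralB// I1 => /eqP; rewrite subr_eq0 => /eqP E0.
transitivity (\int[leb1]_y (u (y, z) * (k y * 1))).
  by apply: eq_Rintegral => y _; rewrite mulr1.
by rewrite E0; apply: eq_Rintegral => y _; rewrite mulr1.
Qed.

(** The affine function of y that is 0 at the centre of the window at p and 1 at the centre of the
    window at p + 2 l. The weights 1 - t and t reproduce an affine function from its two window
    averages. *)
Definition interp_weight (p l y : R) : R :=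
  (y - window_center p l) / (window_center (p + 2 * l) l - window_center p l).

Lemma center_gap (p l : R) : 0 < l -> l <= window_center (p + 2 * l) l - window_center p l.
Proof.
move=> l0; have /andP[h1 h2] := window_center_itv p l0.
have /andP[h3 h4] := window_center_itv (p + 2 * l) l0.
move: (window_center p l) (window_center (p + 2 * l) l) h1 h2 h3 h4 => c1 c2 *; lra.
Qed.

(** The centres are at least l apart, and everything takes place in an interval of length at most 10
    l. *)
Lemma interp_weight_le (c d p l y : R) : 0 < l -> c < p -> p + 3 * l < d -> d - c <= 10 * l ->
  c < y < d -> `|interp_weight p l y| <= 10.
Proof.
move=> l0 cp pd dc /andP[cy yd]; have gl := center_gap p l0.
have g0 := lt_le_trans l0 gl.
rewrite /interp_weight normrM normfV (gtr0_norm g0) ler_pdivrMr//.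
have /andP[h1 h2] := window_center_itv p l0.
apply: (@le_trans _ _ (10 * l)); last by rewrite ler_pM2l.
by move: (window_center p l) h1 h2 => c1 h1 h2; clear gl g0; rewrite ler_norml; lra.
Qed.

Lemma interp_weight_affine (p l y : R) : 0 < l ->
  window_center p l * (1 - interp_weight p l y) +
  window_center (p + 2 * l) l * interp_weight p l y = y.
Proof.
move=> l0; have g0 := lt_le_trans l0 (center_gap p l0).
rewrite /interp_weight.
move: (window_center p l) (window_center (p + 2 * l) l) g0 => c1 c2 g0; field.
by rewrite gt_eqF.
Qed.

Lemma smooth1_onem (f : R -> R) : smooth1 f -> smooth1 (fun y => 1 - f y).
Proof. by move=> sf; apply: (@smooth1B _ (fun=> 1)) => //; exact: smooth1_cst. Qed.

Lemma smooth1_interp_weight (p l : R) : smooth1 (interp_weight p l).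
Proof.
have := @smooth1_affine R (fun x => x) ((window_center (p + 2 * l) l - window_center p l)^-1)
  (- window_center p l / (window_center (p + 2 * l) l - window_center p l)) smooth1_id.
congr smooth1; apply/funext => y; rewrite /interp_weight.
move: (window_center p l) (window_center (p + 2 * l) l) => c1 c2; ring.
Qed.

(** Subtracting from [be] the two multiples of the windows with the same total mass and first moment
    leaves a function that is the second derivative of a test function [K]. By duality, pairing with
    it measures the error of the affine interpolation. The corrected function has L^1 norm at most 1
    + 11 + 10 = 22 times that of [be], from the bounds 11 and 10 on the weights, and two
    integrations over a length of at most 10 l give 220 l. *)
Lemma moment_correction (c d p l : R) (be : R -> R) :
  0 < l -> c < p -> p + 3 * l < d -> d - c <= 10 * l -> test1 c d be ->
  (forall y, 0 <= be y) ->
  exists K, [/\ test1 c d K,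
    derive1 (derive1 K) = (fun y => be y
      - (\int[leb1]_s ((1 - interp_weight p l s) * be s)) * window p l y
      - (\int[leb1]_s (interp_weight p l s * be s)) * window (p + 2 * l) l y) &
    forall y, `|K y| <= 220 * l * \int[leb1]_s be s].
Proof.
move=> l0 cp pd dc tb b0; set t := interp_weight p l.
set A := \int[leb1]_s _; set B := \int[leb1]_s _.
set th1 := window p l; set th2 := window (p + 2 * l) l.
have t1 : test1 c d th1 by apply: window_test1 => //; lra.
have t2 : test1 c d th2 by apply: window_test1 => //; lra.
have tM f : smooth1 f -> forall k, test1 c d k -> test1 c d (fun y => f y * k y).
  by move=> sf k [sk ck]; split; [exact: smooth1M|exact: csuppM].
have st : smooth1 t by exact: smooth1_interp_weight.
have s1t : smooth1 (fun y => 1 - t y) by exact: smooth1_onem.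
have tA := tM _ s1t _ tb; have tB := tM _ st _ tb.
have iA := test1_integrable tA; have iB := test1_integrable tB.
have ib := test1_integrable tb; have i1 := test1_integrable t1; have i2 := test1_integrable t2.
have w1 : \int[leb1]_y th1 y = 1 by exact: window_int.
have w2 : \int[leb1]_y th2 y = 1 by exact: window_int.
have z1 a : \int[leb1]_y (a * th1 y) = a by rewrite RintegralZl// w1 mulr1.
have z2 a : \int[leb1]_y (a * th2 y) = a by rewrite RintegralZl// w2 mulr1.
pose k y := be y - A * th1 y - B * th2 y.
have tk : test1 c d k := test1B (test1B tb (test1Z A t1)) (test1Z B t2).
have AB : A + B = \int[leb1]_s be s.
  rewrite -RintegralD//; apply: eq_Rintegral => y _; ring.
have i1A := test1_integrable (test1Z A t1); have i2B := test1_integrable (test1Z B t2).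
have k0 : \int[leb1]_y k y = 0.
  rewrite /k RintegralB//; last by exact: test1_integrable (test1B tb (test1Z A t1)).
  rewrite RintegralB// z1 z2 -AB; ring.
have k1 : \int[leb1]_y (y * k y) = 0.
  have tid := tM _ (@smooth1_id R).
  have j1 := test1_integrable (tid _ t1); have j2 := test1_integrable (tid _ t2).
  transitivity (\int[leb1]_y (y * be y - A * (y * th1 y) - B * (y * th2 y))).
    by apply: eq_Rintegral => y _; rewrite /k; ring.
  have jb := test1_integrable (tid _ tb).
  have j1A := test1_integrable (test1Z A (tid _ t1)).
  have j2B := test1_integrable (test1Z B (tid _ t2)).
  rewrite RintegralB//; last by exact: test1_integrable (test1B (tid _ tb) (test1Z A (tid _ t1))).
  rewrite RintegralB// !RintegralZl// -/(window_center p l) -/(window_center (p + 2 * l) l).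
  have aff y : window_center p l * (1 - t y) + window_center (p + 2 * l) l * t y = y.
    exact: interp_weight_affine.
  move: (window_center (p + 2 * l) l) (window_center p l) aff => c2 c1 aff.
  have -> : \int[leb1]_y (y * be y) = c1 * A + c2 * B.
    rewrite -(RintegralZl c1 measurableT iA) -(RintegralZl c2 measurableT iB).
    rewrite -(RintegralD measurableT (test1_integrable (test1Z c1 tA))
                (test1_integrable (test1Z c2 tB))).
    apply: eq_Rintegral => y _.
    by rewrite -[X in X * _ = _](aff y); move: (t y) (be y) => ? ?; ring.
  by ring.
have [K [tK K2 KM]] := test1_antider2 tk k0 k1.
exists K; split => // y; apply: le_trans (KM y) _.
have b_ge0 : 0 <= \int[leb1]_s be s by apply: Rintegral_ge0.
have nk : \int[leb1]_z `|k z| <= 22 * \int[leb1]_s be s.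
  have nA : `|A| <= 11 * \int[leb1]_s be s.
    apply: le_trans (le_normr_Rintegral _ iA) _ => //.
    rewrite -RintegralZl//; apply: le_Rintegral => //.
    - exact: test1_norm_integrable tA.
    - exact: test1_integrable (test1Z 11 tb).
    - move=> s _; rewrite normrM (ger0_norm (b0 s)).
      have [scd|/(csupp_out tb.2) ->] := boolP (c < s < d); last by rewrite !mulr0.
      rewrite ler_wpM2r//; have := interp_weight_le l0 cp pd dc scd.
      rewrite -/t; move: (t s) => w; clear; rewrite !ler_norml; lra.
  have nB : `|B| <= 10 * \int[leb1]_s be s.
    apply: le_trans (le_normr_Rintegral _ iB) _ => //.
    rewrite -RintegralZl//; apply: le_Rintegral => //.
    - exact: test1_norm_integrable tB.
    - exact: test1_integrable (test1Z 10 tb).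
    - move=> s _; rewrite normrM (ger0_norm (b0 s)).
      have [scd|/(csupp_out tb.2) ->] := boolP (c < s < d); last by rewrite !mulr0.
      by rewrite ler_wpM2r//; have := interp_weight_le l0 cp pd dc scd.
  apply: (@le_trans _ _ (\int[leb1]_z (be z + `|A| * th1 z + `|B| * th2 z))).
    apply: le_Rintegral => //; first exact: test1_norm_integrable tk.
      exact: test1_integrable (test1D (test1D tb (test1Z _ t1)) (test1Z _ t2)).
    move=> s _; rewrite /k; apply: le_trans (ler_normB _ _) _.
    rewrite normrM (ger0_norm (window_ge0 _ _ l0)) lerD2r.
    apply: le_trans (ler_normB _ _) _.
    by rewrite normrM (ger0_norm (window_ge0 _ _ l0)) (ger0_norm (b0 s)).
  rewrite RintegralD//; last 2 first.
  - exact: test1_integrable (test1D tb (test1Z _ t1)).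
  - exact: test1_integrable (test1Z _ t2).
  rewrite RintegralD//; last exact: test1_integrable (test1Z _ t1).
  rewrite z1 z2; move: nA nB; move: (`|A|) (`|B|) (\int[leb1]_x be x).
  by clear=> a1 a2 a3 *; lra.
apply: (@le_trans _ _ (10 * l * (22 * \int[leb1]_s be s))); last first.
  by move: (\int[leb1]_s be s); clear=> w; lra.
rewrite ler_pM ?Rintegral_ge0//.
by clear -cp pd l0; lra.
Qed.

End rectangles.

(** * Affine interpolation on almost every horizontal line *)

Section slices.
Context {R : realType}.
Local Notation plane := (R * R)%type.
Local Notation leb1 := (@lebesgue_measure R).
Local Notation leb2 := (leb1 \x leb1)%E.
Implicit Types (u g : plane -> R).

Definition hslice u (z : R) : R -> R := fun y => u (y, z).

Lemma measurable_hslice u z : measurable_fun setT u -> measurable_fun setT (hslice u z).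
Proof. by move=> mu; exact: measurable_fun_pair1. Qed.

Lemma patch_prod (A Z : set R) (f : plane -> \bar R) y z :
  (f \_ (A `*` Z)) (y, z) = (if z \in Z then ((fun y => f (y, z)) \_ A) y else 0%E).
Proof.
rewrite !patchE; case: (boolP (z \in Z)) => hz; case: (boolP (y \in A)) => hy.
- by rewrite ifT//; move: hz hy; rewrite !inE.
- by rewrite ifF//; apply/negbTE; move: hy; rewrite !notin_setE => hy [].
- by rewrite ifF//; apply/negbTE; move: hz; rewrite !notin_setE => hz [].
- by rewrite ifF//; apply/negbTE; move: hz; rewrite !notin_setE => hz [].
Qed.

Lemma measurable_sqi_hslice (A : set R) u : measurable A -> measurable_fun setT u ->
  measurable_fun setT (fun z => sqi leb1 A (hslice u z)).
Proof.
move=> mA mu.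
have mAT : measurable (A `*` [set: R]) by exact: measurableX.
have mf : measurable_fun setT ((fun x => ((u x) ^+ 2)%:E) \_ (A `*` [set: R])).
  apply/(measurable_restrictT _ _).1 => //; apply: measurable_sqr.
  exact: measurable_funTS.
rewrite (_ : (fun z => _) = fubini_G leb1 ((fun x => ((u x) ^+ 2)%:E) \_ (A `*` [set: R]))).
  apply: measurable_fun_fubini_tonelli_G => // x.
  by rewrite patchE; case: ifP => // _; rewrite lee_fin sqr_ge0.
apply/funext => z; rewrite /sqi integral_mkcond /fubini_G.
by apply: eq_integral => y _; rewrite patch_prod in_setT.
Qed.

Lemma sqi_prod (A Z : set R) u : measurable A -> measurable Z -> measurable_fun setT u ->
  sqi leb2 (A `*` Z) u = (\int[leb1]_(z in Z) sqi leb1 A (hslice u z))%E.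
Proof.
move=> mA mZ mu; have mAZ : measurable (A `*` Z) by exact: measurableX.
rewrite /sqi integral_mkcond fubini_tonelli2; last 2 first.
- apply/(measurable_restrictT _ _).1 => //; apply: measurable_sqr.
  exact: measurable_funTS.
- by move=> x; rewrite patchE; case: ifP => // _; rewrite lee_fin sqr_ge0.
rewrite [RHS]integral_mkcond; apply: eq_integral => z _.
rewrite /fubini_G patchE; case: ifPn => hz; last first.
  by rewrite (eq_integral (cst 0%E)) ?integral0// => y _; rewrite patch_prod (negbTE hz).
rewrite [RHS]integral_mkcond; apply: eq_integral => y _.
by rewrite patch_prod hz.
Qed.

Definition avg (p l : R) u (z : R) : R := dot leb1 (hslice u z) (window p l).

Lemma measurable_avg p l u : 0 < l -> measurable_fun setT u ->
  measurable_fun setT (avg p l u).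
Proof.
move=> l0 mu; apply: (@measurable_Rsection _ (fun x => u x * window p l x.1)).
apply: measurable_funM => //; apply: measurable_fst_comp.
exact: test1_measurable (window_test1' p l0).
Qed.

Definition interp (p l : R) u (x : plane) : R :=
  (1 - interp_weight p l x.1) * avg p l u x.2 + interp_weight p l x.1 * avg (p + 2 * l) l u x.2.

Lemma measurable_interp p l u : 0 < l -> measurable_fun setT u ->
  measurable_fun setT (interp p l u).
Proof.
move=> l0 mu.
have mw : measurable_fun setT (fun x : plane => interp_weight p l x.1).
  apply: measurable_fst_comp; apply: continuous_measurable.
  exact: (smooth1_continuous (@smooth1_interp_weight R p l)).
apply: measurable_funD; apply: measurable_funM => //.
- by apply: measurable_funB.
- by apply: measurable_snd_comp; exact: measurable_avg.
- by apply: measurable_snd_comp; exact: measurable_avg.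
Qed.

Lemma test1M (h k : R -> R) c d : smooth1 h -> test1 c d k -> test1 c d (fun y => h y * k y).
Proof. by move=> sh [sk ck]; split; [exact: smooth1M|exact: csuppM]. Qed.

Lemma integrable_test1 (f k : R -> R) c d :
  leb1.-integrable setT (EFin \o (fun y => f y * \1_(`]c, d[%classic) y)) ->
  test1 c d k -> leb1.-integrable setT (EFin \o (fun y => f y * k y)).
Proof.
move=> fi tk; have [M M0 kM] := test1_bounded tk.
have : leb1.-integrable setT ((EFin \o k) \* (EFin \o (fun y => f y * \1_(`]c, d[%classic) y)%R))%E.
  apply: integrableMr => //; first exact: test1_measurable tk.
  exists M; split; first exact: num_real.
  by move=> M' MM' y _ /=; rewrite (le_trans (kM y))// ltW.
apply: integrable_eq => y; rewrite /= indicE.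
have [_|] := boolP (y \in _); first by rewrite mulr1 mulrC.
by rewrite notin_setE/= in_itv/= => /negP /(csupp_out tk.2) ->; rewrite mul0r mulr0.
Qed.

(* The remainder of the interpolation is tested against smooth bumps; the
   moment-corrected bumps are second derivatives of test functions. *)
Lemma slice_interp (f G : R -> R) c d p l :
  0 < l -> c < p -> p + 3 * l < d -> d - c <= 10 * l ->
  let I := \1_(`]c, d[%classic) in
  leb1.-integrable setT (EFin \o (fun y => f y * I y)) ->
  leb1.-integrable setT (EFin \o (fun y => G y * I y)) ->
  (forall (a b : rat) n, c < ratr a -> ratr a < ratr b :> R -> ratr b < d ->
    exists K, [/\ test1 c d K,
      derive1 (derive1 K) = (fun y => smooth_bump (ratr a) (ratr b) n.+1%:R^-1 y
      - (\int[leb1]_s ((1 - interp_weight p l s) * smooth_bump (ratr a) (ratr b) n.+1%:R^-1 s)) * window p l y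
      - (\int[leb1]_s (interp_weight p l s * smooth_bump (ratr a) (ratr b) n.+1%:R^-1 s)) * window (p + 2 * l) l y),
      forall y, `|K y| <= 220 * l * \int[leb1]_s smooth_bump (ratr a) (ratr b) n.+1%:R^-1 s &
      \int[leb1]_y (f y * derive1 (derive1 K) y) = \int[leb1]_y (G y * K y)]) ->
  {ae leb1, forall y, c < y < d ->
    `|f y - ((1 - interp_weight p l y) * dot leb1 f (window p l) +
             interp_weight p l y * dot leb1 f (window (p + 2 * l) l))|
      <= 220 * l * \int[leb1]_y (`|G y| * I y)}.
Proof.
move=> l0 cp pd dc I fi Gi H.
have t1 : test1 c d (window p l) by apply: window_test1 => //; lra.
have t2 : test1 c d (window (p + 2 * l) l) by apply: window_test1 => //; lra.
set m1 := dot leb1 f (window p l); set m2 := dot leb1 f (window (p + 2 * l) l).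
have st := @smooth1_interp_weight R p l; have s1t := @smooth1_onem R _ st.
have GIn : leb1.-integrable setT (EFin \o (fun y => `|G y| * I y)).
  have := integrable_norm Gi; apply: integrable_eq => y.
  by rewrite /= normrM [`|I y|]ger0_norm// /I indicE ler0n.
move: (window p l) (window (p + 2 * l) l) (interp_weight p l) @m1 @m2 t1 t2 st s1t H =>
  th1 th2 t m1 m2 t1 t2 st s1t H.
have if1 := integrable_test1 fi t1; have if2 := integrable_test1 fi t2.
pose P y := (1 - t y) * m1 + t y * m2.
have sP : smooth1 P.
  apply: smooth1D.
    by rewrite (_ : (fun x => _) = fun x => m1 * (1 - t x)); [exact: smooth1Z|apply/funext => y; rewrite mulrC].
  by rewrite (_ : (fun x => _) = fun x => m2 * t x); [exact: smooth1Z|apply/funext => y; rewrite mulrC].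
have iPI : leb1.-integrable setT (EFin \o (fun y => P y * I y)).
  have sub : `]c, d[%classic `<=` `[c, d]%classic.
    by move=> y /=; rewrite !in_itv/= => /andP[/ltW -> /ltW ->].
  have i0 : leb1.-integrable `[c, d] (EFin \o P).
    by apply: continuous_itv_integrable; exact: smooth1_continuous.
  have i1 : leb1.-integrable `]c, d[ (EFin \o P).
    by apply: integrableS i0 => //; exact: measurable_itv.
  have i2 : leb1.-integrable setT (EFin \o P \_ `]c, d[).
    by apply: Rrestrict_integrable => //; exact: measurable_itv.
  apply: integrable_eq i2 => y; rewrite patchE /I indicE.
  by case: (_ \in _); rewrite ?mulr1 ?mulr0.
have ir : leb1.-integrable setT (EFin \o (fun y => f y * I y - P y * I y)).
  exact: (integrableB measurableT fi iPI).
have : {ae leb1, forall y, c < y < d ->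
    `|f y * I y - P y * I y| <= 220 * l * \int[leb1]_y (`|G y| * I y)}.
  apply: smooth_bump_ae_bound => // a b n ca ab bd.
  have [K [tK K2 KM KE]] := H a b n ca ab bd.
  move: K2 KM KE; set be := smooth_bump (ratr a) (ratr b) n.+1%:R^-1 => K2 KM.
  rewrite K2 => KE; pose A := \int[leb1]_s ((1 - t s) * be s).
  pose B := \int[leb1]_s (t s * be s).
  have tb : test1 c d be by apply: test1_bump.
  have tM h : smooth1 h -> test1 c d (fun y => h y * be y).
    by move=> sh; exact: test1M.
  clearbody be.
  have ifb := integrable_test1 fi tb.
  have iA := test1_integrable (tM _ s1t); have iB := test1_integrable (tM _ st).
  (* The interpolant [P] is linear in the two averages of f, so pairing f - P with the bump is the
     same as pairing f with the moment-corrected bump. *)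
  have -> : \int[leb1]_x ((f x * I x - P x * I x) * be x) = \int[leb1]_y (G y * K y).
    rewrite -KE.
    transitivity (\int[leb1]_x (f x * be x - m1 * ((1 - t x) * be x) - m2 * (t x * be x))).
      apply: eq_Rintegral => y _; rewrite /P /I indicE.
      have [_|] := boolP (y \in _); first by rewrite !mulr1; ring.
      rewrite notin_setE/= in_itv/= => /negP /(csupp_out tb.2) ->.
      by rewrite !mulr0 !subr0.
    transitivity (\int[leb1]_x (f x * be x - A * (f x * th1 x) - B * (f x * th2 x))); last first.
      by apply: eq_Rintegral => y _; rewrite -/A -/B; ring.
    have j1 := integrableZl measurableT A if1; have j2 := integrableZl measurableT B if2.
    have k1 := integrableZl measurableT m1 iA; have k2 := integrableZl measurableT m2 iB.
    have q1 : leb1.-integrable setT (EFin \o (fun x => f x * be x - A * (f x * th1 x))).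
      exact: (integrableB measurableT ifb j1).
    have q2 : leb1.-integrable setT (EFin \o (fun x => f x * be x - m1 * ((1 - t x) * be x))).
      exact: (integrableB measurableT ifb k1).
    rewrite !RintegralB//.
    by rewrite !RintegralZl// -/A -/B -/m1 -/m2 /m1 /m2 /dot; ring.
  have iGK := integrable_test1 Gi tK.
  apply: le_trans (le_normr_Rintegral measurableT iGK) _.
  set bb := \int[leb1]_x be x.
  rewrite mulrAC -RintegralZl//; apply: le_Rintegral => //.
  - exact: integrable_norm iGK.
  - exact: (integrableZl measurableT (220 * l * bb) GIn).
  - move=> y _; rewrite normrM /I indicE.
    have [_|] := boolP (y \in _).
      by rewrite mulr1 [leLHS]mulrC; apply: ler_wpM2r; [exact: normr_ge0|exact: KM].
    rewrite notin_setE/= in_itv/= => /negP /(csupp_out tK.2) ->.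
    by rewrite normr0 !mulr0.
apply: aeS => y + ycd; move=> /(_ ycd).
have -> : I y = 1 by rewrite /I indicE mem_set//= in_itv.
by rewrite !mulr1.
Qed.

(** The corrected test functions are chosen for all rational bumps before the line is fixed, so the
    exceptional lines form a countable union of null sets. In the constant, (220 l)^2 is the square
    of the pointwise bound and 10 l is the Cauchy-Schwarz factor for an interval of length at most
    10 l. *)
Lemma rectangle_interp (Om : set plane) u g c d c' d' p l :
  sqint leb2 u -> sqint leb2 g -> weak_yy Om u g -> box c d c' d' `<=` Om ->
  0 < l -> c < p -> p + 3 * l < d -> d - c <= 10 * l ->
  {ae leb2, forall x, box c d c' d' x ->
    (((u x - interp p l u x) ^+ 2)%:E <=
       (220 ^+ 2 * 10 * l ^+ 3)%:E * sqi leb1 `]c, d[ (hslice g x.2))%E}.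
Proof.
move=> su sg W QO l0 cp pd dc.
have [mu _] := su; have [mg _] := sg.
have mbad : measurable [set x | ~ (box c d c' d' x ->
    (((u x - interp p l u x) ^+ 2)%:E <=
       (220 ^+ 2 * 10 * l ^+ 3)%:E * sqi leb1 `]c, d[ (hslice g x.2))%E)].
  set E : plane -> \bar R := fun x => ((u x - interp p l u x) ^+ 2)%:E.
  set F : plane -> \bar R := fun x => ((220 ^+ 2 * 10 * l ^+ 3)%:E * sqi leb1 `]c, d[ (hslice g x.2))%E.
  have mE : measurable_fun setT E.
    by apply: measurable_sqr; apply: measurable_funB => //; exact: measurable_interp.
  have mF : measurable_fun setT F.
    apply: measurable_funeM.
    have := measurable_sqi_hslice (measurable_itv `]c, d[) mg.
    by move=> h; apply: (measurableT_comp h); exact: measurable_snd.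
  rewrite (_ : [set x | _] = box c d c' d' `\` (setT `&` [set x | (E x <= F x)%E])).
    apply: measurableD; first exact: measurable_box.
    exact: measurable_lee.
  apply/seteqP; split => x /=; first by move=> /not_implyP [h1 h2]; split => // -[].
  by move=> [h1 h2] h; apply: h2; split => //; exact: h.
apply: ae_of_sections => //.
pose be (j : rat * rat * nat) := smooth_bump (ratr j.1.1) (ratr j.1.2) j.2.+1%:R^-1 : R -> R.
pose V (j : rat * rat * nat) : Prop :=
  [/\ c < ratr j.1.1, ratr j.1.1 < ratr j.1.2 :> R & ratr j.1.2 < d].
pose MC j K := [/\ test1 c d K,
    derive1 (derive1 K) = (fun y => be j y
      - (\int[leb1]_s ((1 - interp_weight p l s) * be j s)) * window p l y
      - (\int[leb1]_s (interp_weight p l s * be j s)) * window (p + 2 * l) l y) &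
    forall y, `|K y| <= 220 * l * \int[leb1]_s be j s].
have exK j : exists K, V j -> MC j K.
  have [[h1 h2 h3]|] := pselect (V j); last by exists (cst 0).
  have [||K HK] := @moment_correction R c d p l (be j) l0 cp pd dc.
  - by apply: test1_bump => //; rewrite invr_gt0.
  - by move=> y; exact: smooth_bump_ge0.
  by exists K.
have [K HK] := choice exK.
have aeK : {ae leb1, forall z, forall j, V j -> c' < z < d' ->
    \int[leb1]_y (u (y, z) * derive1 (derive1 (K j)) y) = \int[leb1]_y (g (y, z) * K j y)}.
  apply: ae_forall_count => j.
  have [Vj|] := pselect (V j); last by move=> nV; apply: aeW => z /nV.
  have [tK _ _] := HK j Vj.
  by apply: aeS (slice_identity su sg W QO tK) => z h _; exact: h.
pose I := (\1_(`]c, d[%classic) : R -> R); pose J := (\1_(`]c', d'[%classic) : R -> R).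
have sIJ : sqint leb2 (tensor I J).
  apply: (@sqint_tensor _ _ _ 1 c d c' d').
  - by apply: measurable_indic; exact: measurable_itv.
  - by apply: measurable_indic; exact: measurable_itv.
  - by move=> y; rewrite /I indicE; case: (_ \in _); rewrite ?normr1 ?normr0.
  - by move=> y; rewrite /J indicE; case: (_ \in _); rewrite ?normr1 ?normr0.
  - by move=> y yn; rewrite /I indicE memNset//= in_itv/=; exact/negP.
  - by move=> y yn; rewrite /J indicE memNset//= in_itv/=; exact/negP.
have aeu := ae_integrable2 (sqintM_integrable su sIJ).
have aeg := ae_integrable2 (sqintM_integrable sg sIJ).
apply: aeS (aeI aeK (aeI aeu aeg)) => z [HzK [iu ig]].
have [zcd|zcd] := boolP (c' < z < d'); last first.
  by apply: aeW => y [_ /=]; rewrite (negbTE zcd).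
have Jz : J z = 1 by rewrite /J indicE mem_set//= in_itv.
have iu' : leb1.-integrable setT (EFin \o (fun y => hslice u z y * I y)).
  by apply: integrable_eq iu => y; rewrite /tensor /= Jz mulr1.
have ig' : leb1.-integrable setT (EFin \o (fun y => hslice g z y * I y)).
  by apply: integrable_eq ig => y; rewrite /tensor /= Jz mulr1.
have := slice_interp l0 cp pd dc iu' ig'.
have HH : forall (a b : rat) n, c < ratr a -> ratr a < ratr b :> R -> ratr b < d ->
    exists K, [/\ test1 c d K,
      derive1 (derive1 K) = (fun y => smooth_bump (ratr a) (ratr b) n.+1%:R^-1 y
      - (\int[leb1]_s ((1 - interp_weight p l s) * smooth_bump (ratr a) (ratr b) n.+1%:R^-1 s)) * window p l y
      - (\int[leb1]_s (interp_weight p l s * smooth_bump (ratr a) (ratr b) n.+1%:R^-1 s)) * window (p + 2 * l) l y),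
      forall y, `|K y| <= 220 * l * \int[leb1]_s smooth_bump (ratr a) (ratr b) n.+1%:R^-1 s &
      \int[leb1]_y (hslice u z y * derive1 (derive1 K) y) = \int[leb1]_y (hslice g z y * K y)].
  move=> a b n ca ab bd; have Vj : V (a, b, n) by [].
  have [h1 h2 h3] := HK _ Vj.
  by exists (K (a, b, n)); split => //; exact: HzK.
move=> /(_ HH); apply: aeS => y Hy [/= ycd _]; have {}Hy := Hy ycd.
set N := \int[leb1]_y _ in Hy.
have N0 : 0 <= N.
  by apply: Rintegral_ge0 => s _; rewrite mulr_ge0// /I indicE ler0n.
have NG : ((N ^+ 2)%:E <= (10 * l)%:E * sqi leb1 `]c, d[ (hslice g z))%E.
  have mI : measurable_fun setT I by apply: measurable_indic; exact: measurable_itv.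
  have mrg := measurable_hslice z mg.
  pose h := (fun y => `|hslice g z y| * I y).
  have mh : measurable_fun setT h.
    by apply: measurable_funM => //; exact: measurableT_comp.
  have -> : sqi leb1 `]c, d[ (hslice g z) = sqi leb1 setT h.
    rewrite -sqi_restrict; apply: eq_integral => s _.
    rewrite patchE /h /I indicE; case: (_ \in _); rewrite /= ?mulr1 ?mulr0//.
    by rewrite real_normK ?num_real.
  have -> : N = dot leb1 h I.
    apply: eq_Rintegral => s _; rewrite /h -mulrA; congr (_ * _).
    by rewrite /I indicE; case: (_ \in _); rewrite ?mulr1 ?mulr0.
  apply: Rintegral_CS => //; first by rewrite mulr_gt0.
  apply: (@le_trans _ _ (leb1 `]c, d[%classic)); last first.
    by rewrite lebesgue_measure_itv/= lte_fin ifT ?lee_fin//; clear -cp pd l0; lra.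
  have -> : I = (fun _ => 1 : R) \_ (`]c, d[%classic).
    by apply/funext => s; rewrite /I patchE indicE; case: (_ \in _).
  rewrite sqi_restrict /sqi; under eq_integral do rewrite expr1n.
  by rewrite integral_cst ?mul1e//; exact: measurable_itv.
have -> : (u (y, z) - interp p l u (y, z)) ^+ 2 =
   `|hslice u z y - ((1 - interp_weight p l y) * avg p l u z + interp_weight p l y * avg (p + 2 * l) l u z)| ^+ 2.
  by rewrite real_normK ?num_real.
apply: (@le_trans _ _ ((220 * l * N) ^+ 2)%:E).
  have K0 : 0 <= 220 * l by rewrite mulr_ge0 ?ltW.
  rewrite lee_fin; move: (220 * l) K0 Hy => K1 K10 Hy.
  by apply: lerXn2r; rewrite ?nnegrE ?normr_ge0 ?(mulr_ge0 K10 N0).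
rewrite exprMn EFinM (_ : 220 ^+ 2 * 10 * l ^+ 3 = (220 * l) ^+ 2 * (10 * l)); last by ring.
rewrite (EFinM (_ ^+ 2) (10 * l)) -muleA; apply: lee_wpmul2l => //.
by rewrite lee_fin sqr_ge0.
Qed.

End slices.

(** * Thin sets joined to a window by horizontal segments *)

Section layers.
Context {R : realType}.
Local Notation plane := (R * R)%type.
Local Notation leb1 := (@lebesgue_measure R).
Local Notation leb2 := (leb1 \x leb1)%E.
Implicit Types (u g : plane -> R) (Om : set plane).

(* x is joined to the window [p, p + 3 l] by a horizontal segment inside Om. *)
Definition reach Om (p l : R) (x : plane) :=
  `|x.1 - p| <= 5 * l /\
  forall s, Num.min x.1 p <= s <= Num.max x.1 (p + 3 * l) -> Om (s, x.2).

(** The bound [e0] on the excess of the box over the segment is needed because the interpolation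
    estimate admits only boxes of length at most 10 l. *)
Lemma open_rat_tube_near Om (c d z e0 : R) : open Om -> c <= d -> 0 < e0 ->
  (forall y, c <= y <= d -> Om (y, z)) ->
  exists q : rat * rat * rat * rat,
    [/\ c - e0 < ratr q.1.1.1 < c, d < ratr q.1.1.2 < d + e0, ratr q.1.2 < z < ratr q.2 &
     box (ratr q.1.1.1) (ratr q.1.1.2) (ratr q.1.2) (ratr q.2) `<=` Om].
Proof.
move=> oA cd e00 Az; have [e1 e10 H1] := open_tube oA cd Az.
pose e := Num.min e1 e0.
have e0' : 0 < e by rewrite lt_min e10.
have ee1 : e <= e1 by rewrite ge_min lexx.
have ee0 : e <= e0 by rewrite ge_min lexx orbT.
have [a] := @rat_in_itvoo R (c - e) c ltac:(lra).
have [b] := @rat_in_itvoo R d (d + e) ltac:(lra).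
have [a'] := @rat_in_itvoo R (z - e) z ltac:(lra).
have [b'] := @rat_in_itvoo R z (z + e) ltac:(lra).
rewrite !in_itv/= => /andP[h1 h2] /andP[h3 h4] /andP[h5 h6] /andP[h7 h8].
exists (a, b, a', b'); split => /=; [lra|lra|lra|].
by rewrite /box => -[y w] /= [/andP[h9 h10] /andP[h11 h12]]; apply: H1; lra.
Qed.

Lemma interp_cst_ge0 : 0 <= 220 ^+ 2 * 10 :> R.
Proof. by clear; lra. Qed.

(** The segments vary with the point, but each of them lies in a rational box inside [Om], and
    countably many boxes leave a single null set. A segment together with its window has length at
    most 8 l, and a margin of l at each end keeps the box within 10 l and within 6 l of p. *)
Lemma interp_ae Om u g p l : open Om -> 0 < l ->
  sqint leb2 u -> sqint leb2 g -> weak_yy Om u g ->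
  {ae leb2, forall x, reach Om p l x ->
    (((u x - interp p l u x) ^+ 2)%:E <=
       (220 ^+ 2 * 10 * l ^+ 3)%:E * sqi leb1 `](p - 6 * l)%R, (p + 6 * l)%R[ (hslice g x.2))%E}.
Proof.
move=> oOm l0 su sg W.
pose V (q : rat * rat * rat * rat) : Prop :=
  [/\ box (ratr q.1.1.1) (ratr q.1.1.2) (ratr q.1.2) (ratr q.2) `<=` Om,
    ratr q.1.1.1 < p, p + 3 * l < ratr q.1.1.2, ratr q.1.1.2 - ratr q.1.1.1 <= 10 * l &
    p - 6 * l <= ratr q.1.1.1 /\ ratr q.1.1.2 <= p + 6 * l].
have : {ae leb2, forall x, forall q, V q ->
   box (ratr q.1.1.1) (ratr q.1.1.2) (ratr q.1.2) (ratr q.2) x ->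
    (((u x - interp p l u x) ^+ 2)%:E <=
       (220 ^+ 2 * 10 * l ^+ 3)%:E * sqi leb1 `](p - 6 * l)%R, (p + 6 * l)%R[ (hslice g x.2))%E}.
  apply: ae_forall_count => q.
  have [[h1 h2 h3 h4 [h5 h6]]|] := pselect (V q); last by move=> nV; apply: aeW => x /nV.
  apply: aeS (rectangle_interp su sg W h1 l0 h2 h3 h4) => x hx _ /hx h.
  apply: le_trans h _; apply: lee_wpmul2l.
    rewrite lee_fin; apply: mulr_ge0; first exact: interp_cst_ge0.
    by apply: exprn_ge0; exact: ltW.
  apply: sqi_subset; [exact: measurable_itv|exact: measurable_itv| |].
    by move=> y /=; rewrite !in_itv/= => /andP[h7 h8]; rewrite (le_lt_trans h5 h7) (lt_le_trans h8 h6).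
  by apply: measurable_funTS; apply: measurable_hslice; case: sg.
apply: aeS => -[y z] Hq [/= yp Hs].
have le3 : Num.min y p <= Num.max y (p + 3 * l).
  by rewrite ge_min le_max lexx.
have [q [h1 h2 h3 h4]] := @open_rat_tube_near Om (Num.min y p) (Num.max y (p + 3 * l)) z l oOm le3 l0 Hs.
move: yp; rewrite ler_norml => /andP[yp1 yp2].
have m1 : Num.min y p <= p by rewrite ge_min lexx orbT.
have m2 : Num.min y p <= y by rewrite ge_min lexx.
have m3 : p - 5 * l <= Num.min y p by rewrite le_min; apply/andP; split; clear -yp1 l0; lra.
have M1 : p + 3 * l <= Num.max y (p + 3 * l) by rewrite le_max lexx orbT.
have M2 : y <= Num.max y (p + 3 * l) by rewrite le_max lexx.
have M3 : Num.max y (p + 3 * l) <= p + 5 * l by rewrite ge_max; apply/andP; split; clear -yp2 l0; lra.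
have M4 : Num.max y (p + 3 * l) - Num.min y p <= 8 * l.
  have [yle|yge] := leP y p.
    rewrite (_ : Num.max y (p + 3 * l) = p + 3 * l); first by clear -yp1; lra.
    by apply/max_idPr; clear -yle l0; lra.
  by rewrite (_ : Num.max y (p + 3 * l) - p <= 8 * l)//; clear -M3 l0; lra.
move: h1 h2 => /andP[h1 h1'] /andP[h2 h2'].
apply: (Hq q); last first.
  by split => //=; clear -h1' h2 m2 M2; lra.
split => //; clear -h1 h1' h2 h2' m1 m2 m3 M1 M2 M3 M4 l0; lra.
Qed.

(** Cauchy-Schwarz: the window has integral 1 and supremum at most 3 exp(6) / l, which therefore
    bounds the integral of its square. *)
Lemma avg_le p l u z : 0 < l -> measurable_fun setT u ->
  ((avg p l u z ^+ 2)%:E <= (3 * expR 6 / l)%:E * sqi leb1 `[p, (p + l)%R] (hslice u z))%E.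
Proof.
move=> l0 mu; have W0 : 0 < 3 * expR 6 / l by rewrite divr_gt0// mulr_gt0// expR_gt0.
have tw := window_test1' p l0; have iw := test1_integrable tw.
have mw := test1_measurable tw.
have -> : avg p l u z = dot leb1 (hslice u z \_ `[p, p + l]) (window p l).
  apply: eq_Rintegral => y _; rewrite patchE; case: ifPn => //.
  rewrite notin_setE/= in_itv/= => /negP yn; rewrite (window_out (p:=p) (l:=l)) ?mulr0//.
  by apply: contra yn => /andP[/ltW -> /ltW ->].
rewrite -sqi_restrict; apply: Rintegral_CS => //.
  apply/(measurable_restrictT _ _).1; first exact: measurable_itv.
  by apply: measurable_funTS; exact: measurable_hslice.
apply: (@le_trans _ _ (\int[leb1]_y ((3 * expR 6 / l)%:E * (window p l y)%:E))%E).
  apply: ge0_le_integral => //.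
  - by move=> y _; rewrite lee_fin sqr_ge0.
  - exact: measurable_sqr.
  - by apply: measurable_funeM; exact/measurable_EFinP.
  - move=> y _; rewrite -EFinM lee_fin expr2.
    by apply: ler_wpM2r; [exact: window_ge0|exact: window_le].
rewrite ge0_integralZl_EFin//; last 3 first.
- by move=> y _; rewrite lee_fin window_ge0.
- exact/measurable_EFinP.
- exact: ltW.
by rewrite Rintegral_EFin// window_int// mule1.
Qed.

(** 442 = 2 (11^2 + 10^2): the two weights are at most 11 and 10, and (s + t)^2 is at most 2 s^2 + 2
    t^2. *)
Lemma interp_le p l u x : 0 < l -> measurable_fun setT u -> `|x.1 - p| <= 5 * l ->
  ((interp p l u x ^+ 2)%:E <=
     (442 * (3 * expR 6 / l))%:E * sqi leb1 `[p, (p + 3 * l)%R] (hslice u x.2))%E.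
Proof.
move=> l0 mu xp.
have [_ lt10] : True /\ `|interp_weight p l x.1| <= 10.
  split => //; have gl := center_gap p l0; have g0 := lt_le_trans l0 gl.
  rewrite /interp_weight normrM normfV (gtr0_norm g0) ler_pdivrMr//.
  have /andP[h1 h2] := window_center_itv p l0.
  apply: (@le_trans _ _ (10 * l)); last by rewrite ler_pM2l.
  move: (window_center p l) h1 h2 xp => c1 h1 h2; rewrite !ler_norml => /andP[h3 h4].
  by clear gl g0; apply/andP; split; lra.
set S := sqi _ _ _.
have mh : measurable_fun setT (hslice u x.2) by exact: measurable_hslice.
have S1 : ((avg p l u x.2 ^+ 2)%:E <= (3 * expR 6 / l)%:E * S)%E.
  apply: le_trans (avg_le p x.2 l0 mu) _; apply: lee_wpmul2l.
    by rewrite lee_fin divr_ge0 ?mulr_ge0 ?expR_ge0// ltW.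
  apply: sqi_subset; [exact: measurable_itv|exact: measurable_itv| |exact: measurable_funTS].
  by move=> y /=; rewrite !in_itv/= => /andP[h1 h2]; rewrite h1; clear -h2 l0; lra.
have S2 : ((avg (p + 2 * l) l u x.2 ^+ 2)%:E <= (3 * expR 6 / l)%:E * S)%E.
  apply: le_trans (avg_le (p + 2 * l) x.2 l0 mu) _; apply: lee_wpmul2l.
    by rewrite lee_fin divr_ge0 ?mulr_ge0 ?expR_ge0// ltW.
  apply: sqi_subset; [exact: measurable_itv|exact: measurable_itv| |exact: measurable_funTS].
  by move=> y /=; rewrite !in_itv/= => /andP[h1 h2]; apply/andP; split; clear -h1 h2 l0; lra.
move: S1 S2; rewrite /interp.
move: (avg p l u x.2) (avg (p + 2 * l) l u x.2) (interp_weight p l x.1) lt10 => a b t lt10.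
have [Sfin|] := boolP (S \is a fin_num); last first.
  rewrite ge0_fin_numE ?sqi_ge0// -leNgt leye_eq => /eqP ->.
  move=> _ _; have : 0 < 3 * expR 6 / l by rewrite divr_gt0// mulr_gt0// expR_gt0.
  move: (3 * expR 6 / l) => K K0.
  have K1 : 0 < 442 * K by clear -K0; lra.
  by move: (442 * K) K1 => K' K1; rewrite mulry gtr0_sg// mul1e leey.
rewrite -(fineK Sfin) -!EFinM !lee_fin; move: (3 * expR 6 / l) => K.
rewrite -[_ * K * _]mulrA; move: (K * fine S) => M aM bM.
move: lt10; rewrite ler_norml => /andP[t1 t2].
have k1 : ((1 - t) * a + t * b) ^+ 2 <= 2 * ((1 - t) ^+ 2 * a ^+ 2) + 2 * (t ^+ 2 * b ^+ 2).
  rewrite -subr_ge0 (_ : _ - _ = ((1 - t) * a - t * b) ^+ 2) ?sqr_ge0//; ring.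
apply: le_trans k1 _.
have k2 : (1 - t) ^+ 2 <= 121 by clear -t1 t2; nra.
have k3 : t ^+ 2 <= 100 by clear -t1 t2; nra.
have M0 : 0 <= M by apply: le_trans aM; exact: sqr_ge0.
have k4 : (1 - t) ^+ 2 * a ^+ 2 <= 121 * M by apply: ler_pM => //; exact: sqr_ge0.
have k5 : t ^+ 2 * b ^+ 2 <= 100 * M by apply: ler_pM => //; exact: sqr_ge0.
by clear -k4 k5; lra.
Qed.

(** Twice the sum of the constants of [interp_le] and [interp_ae], from u^2 <= 2 (u - P)^2 + 2 P^2
    for the interpolant P. *)
Definition Clayer : R := 2 * (442 * (3 * expR 6)) + 2 * (220 ^+ 2 * 10).

Lemma Clayer_gt0 : 0 < Clayer.
Proof.
by rewrite /Clayer; have := expR_gt0 (6 : R); move: (expR 6) interp_cst_ge0; clear=> e; lra.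
Qed.

Lemma Clayer_ge1 : 2 * (442 * (3 * expR 6)) <= Clayer.
Proof.
by rewrite /Clayer; move: (expR 6) interp_cst_ge0; clear=> e; lra.
Qed.

Lemma Clayer_ge2 : 2 * (220 ^+ 2 * 10) <= Clayer.
Proof.
by rewrite /Clayer; have := expR_gt0 (6 : R); move: (expR 6) interp_cst_ge0; clear=> e; lra.
Qed.

(** Thinness enters here: the pointwise bound does not depend on the position along the line, so
    integrating it over a horizontal section of [E] costs only the length of that section. *)
Lemma sqi_le_sections u (E : set plane) (Z : set R) (eta : R) (Phi : R -> \bar R) :
  measurable_fun setT u -> measurable_fun setT Phi -> (forall z, 0 <= Phi z)%E ->
  measurable E -> measurable Z -> 0 <= eta -> (forall x, E x -> Z x.2) ->
  {ae leb2, forall x, E x -> ((u x ^+ 2)%:E <= Phi x.2)%E} ->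
  (forall z, leb1 (ysection E z) <= eta%:E)%E ->
  (sqi leb2 E u <= eta%:E * \int[leb1]_(z in Z) Phi z)%E.
Proof.
move=> mu mPhi Phi0 mE mZ eta0 HE ptw Heta.
have mPhi2 : measurable_fun setT (fun x : plane => Phi x.2).
  by apply: (measurableT_comp mPhi); exact: measurable_snd.
have step1 : (sqi leb2 E u <= \int[leb2]_(x in E) Phi x.2)%E.
  apply: ae_ge0_le_integral => //.
  - by move=> x _; rewrite lee_fin sqr_ge0.
  - by apply: measurable_sqr; exact: measurable_funTS.
  - exact: measurable_funTS.
apply: le_trans step1 _.
rewrite integral_mkcond fubini_tonelli2; last 2 first.
- by apply/(measurable_restrictT _ _).1 => //; exact: measurable_funTS.
- by move=> x; rewrite patchE; case: ifP => // _.
have inner z : fubini_G leb1 ((fun x : plane => Phi x.2)%E \_ E) z =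
    (Phi z * leb1 (ysection E z))%E.
  rewrite /fubini_G -integral_cst; last exact: measurable_ysection.
  rewrite [RHS]integral_mkcond; apply: eq_integral => y _.
  rewrite !patchE; congr (if _ then _ else _).
  apply/idP/idP => h; first by rewrite inE /ysection/=.
  by move: h; rewrite inE /ysection/=.
apply: (@le_trans _ _ (\int[leb1]_z (Phi z * leb1 (ysection E z)))%E).
  by rewrite le_eqVlt; apply/orP; left; apply/eqP; apply: eq_integral => z _; exact: inner.
rewrite -ge0_integralZl_EFin//; last exact: measurable_funTS.
rewrite [leRHS]integral_mkcond; apply: ge0_le_integral => //.
- by move=> z _; apply: mule_ge0.
- by apply: emeasurable_funM => //; exact: measurable_fun_ysection.
- apply/(measurable_restrictT _ _).1 => //; apply: measurable_funTS.
  exact: measurable_funeM.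
- move=> z _; rewrite patchE; case: ifPn => hz.
    by rewrite muleC; apply: lee_wpmul2r.
  rewrite (_ : ysection E z = set0) ?measure0 ?mule0//.
  apply/seteqP; split => // y; rewrite /ysection/= inE => /HE /=.
  by move: hz; rewrite notin_setE.
Qed.

(** The gain is the factor eta in front of both terms: [E] may be arbitrarily thin while its window
    keeps the length 3 l. *)
Lemma layer_bound Om u g p l (E : set plane) (Z : set R) (eta : R) :
  open Om -> 0 < l -> 0 <= eta -> measurable E -> measurable Z ->
  sqint leb2 u -> sqint leb2 g -> weak_yy Om u g ->
  (forall x, E x -> Z x.2 /\ reach Om p l x) ->
  (forall z, leb1 (ysection E z) <= eta%:E)%E ->
  (sqi leb2 E u <= (Clayer * eta)%:E *
     ((l^-1)%:E * sqi leb2 (`[p, (p + 3 * l)%R]%classic `*` Z) u +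
      (l ^+ 3)%:E * sqi leb2 (`](p - 6 * l)%R, (p + 6 * l)%R[%classic `*` Z) g))%E.
Proof.
move=> oOm l0 eta0 mE mZ su sg W HE Heta.
have [mu _] := su; have [mg _] := sg.
set A1 := `[p, (p + 3 * l)%R]%classic; set A2 := `](p - 6 * l)%R, (p + 6 * l)%R[%classic.
have mA1 : measurable A1 by exact: measurable_itv.
have mA2 : measurable A2 by exact: measurable_itv.
pose Phi z : \bar R := ((l^-1)%:E * sqi leb1 A1 (hslice u z) + (l ^+ 3)%:E * sqi leb1 A2 (hslice g z))%E.
have Phi0 z : (0 <= Phi z)%E.
  by apply: adde_ge0; apply: mule_ge0; rewrite ?sqi_ge0// lee_fin ?invr_ge0 ?exprn_ge0// ltW.
have m1 := measurable_sqi_hslice mA1 mu; have m2 := measurable_sqi_hslice mA2 mg.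
have mPhi : measurable_fun setT Phi.
  by apply: emeasurable_funD; exact: measurable_funeM.
have C0 := ltW Clayer_gt0.
have ptw : {ae leb2, forall x, E x -> ((u x ^+ 2)%:E <= Clayer%:E * Phi x.2)%E}.
  apply: aeS (@interp_ae Om u g p l oOm l0 su sg W) => x Hx Ex.
  have [_ rx] := HE _ Ex; have {Hx}h1 := Hx rx; have h2 := interp_le l0 mu rx.1.
  apply: (@le_trans _ _ (2%:E * ((u x - interp p l u x) ^+ 2)%:E + 2%:E * (interp p l u x ^+ 2)%:E)%E).
    rewrite -!EFinM -EFinD lee_fin -subr_ge0.
    rewrite (_ : _ - _ = (u x - 2 * interp p l u x) ^+ 2) ?sqr_ge0//; ring.
  rewrite /Phi ge0_muleDr; last 2 first.
  - by apply: mule_ge0; rewrite ?sqi_ge0// lee_fin ?invr_ge0 ?exprn_ge0// ltW.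
  - by apply: mule_ge0; rewrite ?sqi_ge0// lee_fin ?invr_ge0 ?exprn_ge0// ltW.
  rewrite addeC; apply: leeD.
  - apply: (@le_trans _ _ (2%:E * ((442 * (3 * expR 6 / l))%:E * sqi leb1 A1 (hslice u x.2)))%E).
      by apply: lee_wpmul2l.
    rewrite !muleA -!EFinM; apply: lee_wpmul2r; first exact: sqi_ge0.
    rewrite lee_fin !mulrA; apply: ler_wpM2r; first by rewrite invr_ge0 ltW.
    by rewrite -!mulrA; exact: Clayer_ge1.
  - apply: (@le_trans _ _ (2%:E * ((220 ^+ 2 * 10 * l ^+ 3)%:E * sqi leb1 A2 (hslice g x.2)))%E).
      by apply: lee_wpmul2l.
    rewrite !muleA -!EFinM; apply: lee_wpmul2r; first exact: sqi_ge0.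
    rewrite lee_fin [2 * _]mulrA; apply: ler_wpM2r; first by rewrite exprn_ge0// ltW.
    exact: Clayer_ge2.
have mP : measurable_fun setT (fun z => Clayer%:E * Phi z)%E by exact: measurable_funeM.
have P0 z : (0 <= Clayer%:E * Phi z)%E by apply: mule_ge0.
have HZ x : E x -> Z x.2 by case/HE.
apply: le_trans (sqi_le_sections mu mP P0 mE mZ eta0 HZ ptw Heta) _.
rewrite ge0_integralZl_EFin//; last first.
  exact: measurable_funTS.
rewrite muleA -EFinM [eta * _]mulrC.
apply: lee_wpmul2l; first by rewrite lee_fin mulr_ge0.
rewrite ge0_integralD//; first last.
- by apply: measurable_funTS; exact: measurable_funeM.
- by move=> z _; apply: mule_ge0; rewrite ?sqi_ge0// lee_fin exprn_ge0// ltW.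
- by apply: measurable_funTS; exact: measurable_funeM.
- by move=> z _; apply: mule_ge0; rewrite ?sqi_ge0// lee_fin invr_ge0 ltW.
rewrite !ge0_integralZl_EFin ?invr_ge0 ?exprn_ge0 ?(ltW l0)//; try (by move=> *; exact: sqi_ge0);
  try exact: measurable_funTS.
by rewrite !sqi_prod.
Qed.

End layers.

(** * Squares: control by four moments *)

Section squares.
Context {R : realType}.
Local Notation plane := (R * R)%type.
Local Notation leb1 := (@lebesgue_measure R).
Local Notation leb2 := (leb1 \x leb1)%E.
Implicit Types (u g : plane -> R) (Om : set plane).

Definition weak_zz (Om : set plane) u g := forall c d c' d' al be,
  box c d c' d' `<=` Om -> test1 c d al -> test1 c' d' be ->
  dot leb2 u (tensor al (derive1 (derive1 be))) = dot leb2 g (tensor al be).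

Lemma sqi_avg_le p l u (Z : set R) : 0 < l -> measurable_fun setT u -> measurable Z ->
  (sqi leb1 Z (avg p l u) <= (3 * expR 6 / l)%:E * sqi leb2 (`[p, (p + l)%R]%classic `*` Z) u)%E.
Proof.
move=> l0 mu mZ; rewrite sqi_prod//.
have mh : measurable_fun setT (fun z => sqi leb1 `[p, (p + l)%R] (hslice u z)).
  by apply: measurable_sqi_hslice => //; exact: measurable_itv.
have K0 : 0 <= 3 * expR 6 / l by rewrite divr_ge0 ?mulr_ge0 ?expR_ge0 ?ltW.
rewrite -ge0_integralZl_EFin//; last 2 first.
- by move=> z _; exact: sqi_ge0.
- exact: measurable_funTS.
apply: ge0_le_integral => //.
- by move=> z _; rewrite lee_fin sqr_ge0.
- by apply: measurable_sqr; apply: measurable_funTS; exact: measurable_avg.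
- by apply: measurable_funTS; exact: measurable_funeM.
- by move=> z _; exact: avg_le.
Qed.

Lemma sqint_avg p l u : 0 < l -> sqint leb2 u -> sqint leb1 (avg p l u).
Proof.
move=> l0 [mu fu]; split; first exact: measurable_avg.
apply: le_lt_trans (sqi_avg_le p l0 mu measurableT) _.
rewrite lte_mul_pinfty ?lee_fin//; first by rewrite divr_ge0 ?mulr_ge0 ?expR_ge0 ?ltW.
apply: le_lt_trans fu; apply: sqi_subset => //.
by apply: measurableX => //; exact: measurable_itv.
Qed.

Lemma sqint_indic_itv (c d : R) : sqint leb1 (\1_(`]c, d[%classic)).
Proof.
have mI : measurable `]c, d[%classic by exact: measurable_itv.
rewrite (_ : \1__ = (fun=> 1 : R) \_ `]c, d[); last first.
  by apply/funext => y; rewrite patchE indicE; case: (_ \in _).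
apply: sqint_on => //; apply: (@le_lt_trans _ _ (leb1 `]c, d[%classic)).
  rewrite /sqi; under eq_integral do rewrite expr1n.
  by rewrite integral_cst ?mul1e.
by rewrite lebesgue_measure_itv/=; case: ifP => // _; rewrite ltry.
Qed.

Lemma avg_dot c' d' p l v k : 0 < l -> sqint leb2 v -> test1 c' d' k ->
  dot leb1 (avg p l v) k = dot leb2 v (tensor (window p l) k).
Proof.
move=> l0 sv tk; have tw := window_test1' p l0.
have iv := sqintM_integrable sv (sqint_tensor_test tw tk).
have [mv _] := sv.
have [_ E] := Rfubini2 iv; rewrite /dot E; apply: Rintegral_ae.
- apply: measurable_funM; first exact: measurable_avg.
  exact: test1_measurable tk.
- by apply: (@measurable_Rsection _ (fun x => v x * tensor (window p l) k x)); apply/measurable_EFinP; exact: measurable_int iv.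
have sI := sqint_tensor_indic c' d' tw.
have ai := ae_integrable2 (sqintM_integrable sv sI).
apply: aeS ai => z iz /=.
have [zcd|/(csupp_out tk.2) k0] := boolP (c' < z < d'); last first.
  rewrite k0 mulr0 /Rintegral (_ : integral _ _ _ = 0%E)//; apply: integral0_eq => y _.
  by rewrite /tensor/= k0 !mulr0.
rewrite /avg /dot -RintegralZr//; last first.
  apply: integrable_eq iz => y; rewrite /tensor/= indicE mem_set/= ?in_itv//=.
  by rewrite mulr1.
by apply: eq_Rintegral => y _; rewrite /tensor/hslice/= mulrA.
Qed.

(** The window is itself an admissible first factor of a tensor test function, so the averages of u
    satisfy the one-dimensional identity in z for every [K], without exceptional sets. *)
Lemma avg_slice_identity Om u g c d c' d' p l K : 0 < l ->
  sqint leb2 u -> sqint leb2 g -> weak_zz Om u g -> box c d c' d' `<=` Om ->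
  c < p -> p + l < d -> test1 c' d' K ->
  \int[leb1]_z (avg p l u z * derive1 (derive1 K) z) = \int[leb1]_z (avg p l g z * K z).
Proof.
move=> l0 su sg W QO cp pd tK.
have tw : test1 c d (window p l) by exact: window_test1.
have tk : test1 c' d' (derive1 (derive1 K)) by do 2 apply: test1_derive.
rewrite -/(dot leb1 (avg p l u) _) -/(dot leb1 (avg p l g) _).
by rewrite (avg_dot _ l0 su tk) (avg_dot _ l0 sg tK); exact: W QO tw tK.
Qed.

(** A Poincare inequality modulo affine functions: the affine part is controlled by two window
    averages, the rest by the second derivative. *)
Lemma itv_sqi_bound : exists2 C : R, 0 < C & forall (f G : R -> R) p l, 0 < l ->
  sqint leb1 f -> sqint leb1 G ->
  (forall K, test1 (p - l) (p + 4 * l) K ->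
     \int[leb1]_y (f y * derive1 (derive1 K) y) = \int[leb1]_y (G y * K y)) ->
  (sqi leb1 `[p, (p + 3 * l)%R] f <=
    (C * l * (dot leb1 f (window p l) ^+ 2 + dot leb1 f (window (p + 2 * l) l) ^+ 2))%:E +
    (C * l ^+ 4)%:E * sqi leb1 `](p - l)%R, (p + 4 * l)%R[ G)%E.
Proof.
(* The interpolation constant 220 is kept as an opaque [c0], so that the estimates below stay
   symbolic. *)
have [c0 [c00 c0E]] : exists c0 : R, 0 < c0 /\ forall P : R -> Prop, P 220 -> P c0.
  by exists 220; split; [clear; lra|move=> P; exact].
(* Integrating the pointwise bound [M] over a length 3 l produces 30 c0^2 for the remainder and 3 *
   484 = 1452 for the averages; both fit under this constant. *)
have [C [C0 CE]] : exists C : R, 0 < C /\ C = 60 * c0 ^+ 2 + 1452.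
  exists (60 * c0 ^+ 2 + 1452); split; last by reflexivity.
  by have := sqr_ge0 c0; move: (c0 ^+ 2); clear=> x; lra.
exists C => //.
move=> f G p l l0 sf sG HK.
set c := p - l; set d := p + 4 * l; pose I := (\1_(`]c, d[%classic) : R -> R).
have cp : c < p by rewrite /c; clear -l0; lra.
have pd : p + 3 * l < d by rewrite /d; clear -l0; lra.
have dc : d - c <= 10 * l by rewrite /c /d; clear -l0; lra.
have sI := sqint_indic_itv c d.
have [mf _] := sf; have [mG _] := sG.
have HH (a b : rat) n : c < ratr a -> ratr a < ratr b :> R -> ratr b < d ->
    exists K, [/\ test1 c d K,
      derive1 (derive1 K) = (fun y => smooth_bump (ratr a) (ratr b) n.+1%:R^-1 y
      - (\int[leb1]_s ((1 - interp_weight p l s) * smooth_bump (ratr a) (ratr b) n.+1%:R^-1 s)) * window p l y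
      - (\int[leb1]_s (interp_weight p l s * smooth_bump (ratr a) (ratr b) n.+1%:R^-1 s)) * window (p + 2 * l) l y),
      forall y, `|K y| <= 220 * l * \int[leb1]_s smooth_bump (ratr a) (ratr b) n.+1%:R^-1 s &
      \int[leb1]_y (f y * derive1 (derive1 K) y) = \int[leb1]_y (G y * K y)].
  move=> ca ab bd.
  have [||K [tK K2 KM]] := @moment_correction R c d p l (smooth_bump (ratr a) (ratr b) n.+1%:R^-1) l0 cp pd dc.
  - by apply: test1_bump => //; rewrite invr_gt0.
  - by move=> y; exact: smooth_bump_ge0.
  by exists K; split => //; exact: HK.
have := slice_interp l0 cp pd dc (sqintM_integrable sf sI) (sqintM_integrable sG sI) HH.
move=> /(c0E (fun c1 : R => {ae leb1, forall y, c < y < d -> `|_| <= c1 * l * _})) Hae0.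
move: Hae0; set m1 := dot leb1 f (window p l); set m2 := dot leb1 f (window (p + 2 * l) l).
set N := \int[leb1]_y (`|G y| * \1_(`]c, d[%classic) y) => Hae.
clearbody m1 m2.
set S := sqi leb1 `]c, d[ G.
have Sfin : S \is a fin_num.
  rewrite ge0_fin_numE ?sqi_ge0//; case: sG => _; apply: le_lt_trans.
  by apply: sqi_subset => //; exact: measurable_itv.
have N0 : 0 <= N.
  by apply: Rintegral_ge0 => s _; rewrite mulr_ge0// indicE ler0n.
have NS : N ^+ 2 <= 5 * l * fine S.
  rewrite -lee_fin [(_ * fine S)%:E]EFinM (fineK Sfin) /S.
  have -> : sqi leb1 `]c, d[ G = sqi leb1 setT (fun y => `|G y| * I y).
    rewrite -sqi_restrict; apply: eq_integral => s _.
    rewrite patchE /I indicE; case: (_ \in _); rewrite /= ?mulr1 ?mulr0//.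
    by rewrite real_normK ?num_real.
  have -> : N = dot leb1 (fun y => `|G y| * I y) I.
    apply: eq_Rintegral => s _; rewrite -mulrA; congr (_ * _).
    by rewrite /I indicE; case: (_ \in _); rewrite ?mulr1 ?mulr0.
  have [mI _] := sI.
  apply: Rintegral_CS => //; [|by rewrite mulr_gt0|].
    by apply: measurable_funM => //; exact: measurableT_comp.
  apply: (@le_trans _ _ (leb1 `]c, d[%classic)); last first.
    by rewrite lebesgue_measure_itv/= lte_fin ifT ?lee_fin// /c /d; clear -l0; lra.
  have -> : I = (fun _ => 1 : R) \_ (`]c, d[%classic).
    by apply/funext => s; rewrite /I patchE indicE; case: (_ \in _).
  rewrite sqi_restrict /sqi; under eq_integral do rewrite expr1n.
  by rewrite integral_cst ?mul1e//; exact: measurable_itv.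
set M := 2 * (c0 * l) ^+ 2 * (5 * l * fine S) + 484 * (m1 ^+ 2 + m2 ^+ 2).
have fM : {ae leb1, forall y, `[p, (p + 3 * l)%R]%classic y -> ((f y ^+ 2)%:E <= M%:E)%E}.
  apply: aeS Hae => y Hy /=; rewrite in_itv/= => /andP[y1 y2].
  have ycd : c < y < d by apply/andP; split; [clear -y1 cp|clear -y2 pd]; lra.
  have lt10 := interp_weight_le l0 cp pd dc ycd.
  have {Hy} := Hy ycd; move: (interp_weight p l y) lt10 => t; rewrite ler_norml => /andP[t1 t2].
  set P := _ + t * m2 => Hy; rewrite lee_fin.
  have k1 : f y ^+ 2 <= 2 * (f y - P) ^+ 2 + 2 * P ^+ 2.
    rewrite -subr_ge0 (_ : _ - _ = (f y - 2 * P) ^+ 2) ?sqr_ge0//; ring.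
  have k2 : (f y - P) ^+ 2 <= (c0 * l) ^+ 2 * (5 * l * fine S).
    apply: (@le_trans _ _ ((c0 * l * N) ^+ 2)).
      rewrite -[X in X <= _]real_normK ?num_real//; apply: lerXn2r; rewrite ?nnegrE ?normr_ge0//.
      by apply: mulr_ge0 => //; apply: mulr_ge0; apply: ltW.
    by rewrite exprMn; apply: ler_wpM2l => //; exact: sqr_ge0.
  have k3 : P ^+ 2 <= 242 * (m1 ^+ 2 + m2 ^+ 2).
    have k4 : (1 - t) ^+ 2 <= 121 by clear -t1 t2; nra.
    have k5 : t ^+ 2 <= 100 by clear -t1 t2; nra.
    have k6 : P ^+ 2 <= 2 * ((1 - t) ^+ 2 * m1 ^+ 2) + 2 * (t ^+ 2 * m2 ^+ 2).
      rewrite /P -subr_ge0 (_ : _ - _ = ((1 - t) * m1 - t * m2) ^+ 2) ?sqr_ge0//; ring.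
    have k7 : (1 - t) ^+ 2 * m1 ^+ 2 <= 121 * m1 ^+ 2 by apply: ler_wpM2r => //; exact: sqr_ge0.
    have k8 : t ^+ 2 * m2 ^+ 2 <= 121 * m2 ^+ 2.
      by apply: ler_wpM2r; [exact: sqr_ge0|clear -k5; lra].
    clearbody P; apply: le_trans k6 _; clear -k7 k8.
    move: ((1 - t) ^+ 2 * m1 ^+ 2) (t ^+ 2 * m2 ^+ 2) (m1 ^+ 2) (m2 ^+ 2) k7 k8 => a b e h; lra.
  rewrite /M; clearbody P; clear -k1 k2 k3.
  move: (f y ^+ 2) ((f y - P) ^+ 2) ((c0 * l) ^+ 2) (5 * l * fine S) (P ^+ 2) (m1 ^+ 2 + m2 ^+ 2) k1 k2 k3.
  by move=> a b e S' P2 m h1 h2 h3; rewrite -mulrA; move: (e * S') h2 => e' h2; lra.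
have mJ : measurable `[p, (p + 3 * l)%R]%classic by exact: measurable_itv.
apply: (@le_trans _ _ (\int[leb1]_(y in `[p, (p + 3 * l)%R]) M%:E)%E).
  apply: ae_ge0_le_integral => //.
  - by move=> y _; rewrite lee_fin sqr_ge0.
  - by apply: measurable_sqr; exact: measurable_funTS.
  - move=> y _; rewrite lee_fin /M.
    have := fine_ge0 (sqi_ge0 leb1 `]c, d[ G); rewrite -/S => S0.
    have e1 : 0 <= (c0 * l) ^+ 2 * (l * fine S).
      by apply: mulr_ge0; [exact: sqr_ge0|apply: mulr_ge0 => //; exact: ltW].
    have m0 : 0 <= m1 ^+ 2 + m2 ^+ 2 by apply: addr_ge0; exact: sqr_ge0.
    rewrite (_ : _ * (5 * l * fine S) = 10 * ((c0 * l) ^+ 2 * (l * fine S))); last by ring.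
    by move: (_ ^+ 2 * _) (_ + m2 ^+ 2) e1 m0; clear=> a b a0 b0; lra.
have E1 : leb1 `[p, (p + 3 * l)%R]%classic = (3 * l)%:E.
  rewrite lebesgue_measure_itv/= lte_fin ifT; last by clear -l0; lra.
  by rewrite -EFinD; congr EFin; ring.
rewrite integral_cst// [X in (_ * X <= _)%E]E1.
rewrite -EFinM -[X in (_ <= _ + _ * X)%E](fineK Sfin) -EFinM -EFinD lee_fin /M.
have := fine_ge0 (sqi_ge0 leb1 `]c, d[ G); rewrite -/S.
move: (fine S) => s s0.
have m0 : 0 <= m1 ^+ 2 + m2 ^+ 2 by rewrite addr_ge0 ?sqr_ge0.
move: (m1 ^+ 2 + m2 ^+ 2) m0 => m m0.
rewrite CE -subr_ge0.
rewrite (_ : _ - _ = (60 * c0 ^+ 2) * (l * m) + 30 * c0 ^+ 2 * (l ^+ 4 * s) + 1452 * (l ^+ 4 * s)); last by ring.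
have e0 : 0 <= l * m by rewrite mulr_ge0// ltW.
have e1 : 0 <= l ^+ 4 * s by rewrite mulr_ge0// exprn_ge0// ltW.
have e2 : 0 <= c0 ^+ 2 by exact: sqr_ge0.
have e3 := mulr_ge0 e2 e0; have e4 := mulr_ge0 e2 e1.
rewrite -[60 * _ * _]mulrA -[30 * _ * _]mulrA.
move: (c0 ^+ 2 * (l * m)) (c0 ^+ 2 * (l ^+ 4 * s)) (l ^+ 4 * s) e3 e4 e1.
by clear=> x y z x0 y0 z0; lra.
Qed.

Lemma interp_sqr_le p l u x : 0 < l -> p <= x.1 <= p + 3 * l ->
  interp p l u x ^+ 2 <= 242 * (avg p l u x.2 ^+ 2 + avg (p + 2 * l) l u x.2 ^+ 2).
Proof.
move=> l0 /andP[x1 x2].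
have lt10 : `|interp_weight p l x.1| <= 10.
  apply: (@interp_weight_le _ (p - l) (p + 4 * l) p l x.1 l0); clear -x1 x2 l0; lra.
rewrite /interp; move: (avg p l u x.2) (avg (p + 2 * l) l u x.2) lt10 => m1 m2.
move: (interp_weight p l x.1) => t; rewrite ler_norml => /andP[t1 t2].
have k4 : (1 - t) ^+ 2 <= 121 by clear -t1 t2; nra.
have k5 : t ^+ 2 <= 100 by clear -t1 t2; nra.
have k6 : ((1 - t) * m1 + t * m2) ^+ 2 <= 2 * ((1 - t) ^+ 2 * m1 ^+ 2) + 2 * (t ^+ 2 * m2 ^+ 2).
  rewrite -subr_ge0 (_ : _ - _ = ((1 - t) * m1 - t * m2) ^+ 2) ?sqr_ge0//; ring.
have k7 : (1 - t) ^+ 2 * m1 ^+ 2 <= 121 * m1 ^+ 2 by apply: ler_wpM2r => //; exact: sqr_ge0.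
have k8 : t ^+ 2 * m2 ^+ 2 <= 121 * m2 ^+ 2.
  by apply: ler_wpM2r; [exact: sqr_ge0|clear -k5; lra].
apply: le_trans k6 _; clear -k7 k8.
move: ((1 - t) ^+ 2 * m1 ^+ 2) (t ^+ 2 * m2 ^+ 2) (m1 ^+ 2) (m2 ^+ 2) k7 k8 => a b e h; lra.
Qed.

Definition moment u (l i j : R) : R := dot leb2 u (tensor (window i l) (window j l)) ^+ 2.

(** Interpolation in y reduces u on the square to two averages, which are functions of z; the
    one-dimensional bound reduces each of these to two numbers. The four double averages determine a
    function of the form a + b y + c z + d y z, and such functions are all that the two pure second
    derivatives leave undetected. *)
Lemma square_bound : exists2 C : R, 0 < C & forall Om u g1 g2 p p' l, 0 < l ->
  sqint leb2 u -> sqint leb2 g1 -> sqint leb2 g2 -> weak_yy Om u g1 -> weak_zz Om u g2 ->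
  box (p - l) (p + 4 * l) (p' - l) (p' + 4 * l) `<=` Om ->
  (sqi leb2 (`[p, (p + 3 * l)%R]%classic `*` `[p', (p' + 3 * l)%R]%classic) u <=
   (C * l ^+ 2 * (moment u l p p' + moment u l p (p' + 2 * l) +
     (moment u l (p + 2 * l) p' + moment u l (p + 2 * l) (p' + 2 * l))))%R%:E +
   (C * l ^+ 4)%:E * (sqi leb2 (box (p - l) (p + 4 * l) (p' - l) (p' + 4 * l)) g1 +
                      sqi leb2 (box (p - l) (p + 4 * l) (p' - l) (p' + 4 * l)) g2))%E.
Proof.
have [C1 C10 H1] := itv_sqi_bound.
have C2 : 0 < 3 * expR (6 : R) by rewrite mulr_gt0// expR_gt0.
have [K3 [K30 K3E]] : exists K3 : R, 0 < K3 /\ forall P : R -> Prop, P (220 ^+ 2 * 10) -> P K3.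
  by exists (220 ^+ 2 * 10); split; [clear; lra|move=> P; exact].
have [K4 [K40 K4E]] : exists K4 : R, 0 < K4 /\ forall x : R, 2 * (242 * x) = K4 * x.
  by exists 484; split; [clear; lra|move=> x; rewrite mulrA; congr (_ * _); lra].
exists (6 * K3 + 3 * K4 * C1 + 6 * K4 * C1 * (3 * expR 6)).
  have e1 := mulr_gt0 K40 C10; have e2 := mulr_gt0 e1 C2.
  rewrite -[6 * K4 * C1]mulrA -[3 * K4 * C1]mulrA -[6 * _ * (3 * _)]mulrA.
  by move: (K4 * C1 * (3 * expR 6)) (K4 * C1) e1 e2; clear -K30 => x y x0 y0; lra.
have := fun p l u Z => @sqi_avg_le p l u Z.
move: (3 * expR 6) C2 => K K0 avgle.
move=> Om u g1 g2 p p' l l0 su s1 s2 W1 W2; set c := p - l; set d := p + 4 * l.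
set c' := p' - l; set d' := p' + 4 * l => QO; set q := moment u l.
have [mu _] := su; have [m1 _] := s1; have [m2 _] := s2.
set Y := `[p, (p + 3 * l)%R]%classic; set Z := `[p', (p' + 3 * l)%R]%classic.
have mY : measurable Y by exact: measurable_itv.
have mZ : measurable Z by exact: measurable_itv.
have cp : c < p by rewrite /c; clear -l0; lra.
have pd : p + 3 * l < d by rewrite /d; clear -l0; lra.
have dc : d - c <= 10 * l by rewrite /c /d; clear -l0; lra.
set B := box c d c' d'.
have BE : B = `]c, d[%classic `*` `]c', d'[%classic.
  by apply/seteqP; split => -[y z] /=; rewrite /B /box/= !in_itv.
have mcd : measurable `]c, d[%classic by exact: measurable_itv.
have mcd' : measurable `]c', d'[%classic by exact: measurable_itv.
have mB : measurable B by exact: measurable_box.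
have ZS : Z `<=` `]c', d'[%classic.
  move=> y; rewrite /Z /= !in_itv/= /c' /d' => /andP[h1 h2].
  by clear -h1 h2 l0; lra.
pose a := avg p l u; pose b := avg (p + 2 * l) l u.
have ma : measurable_fun setT a by exact: measurable_avg.
have mb : measurable_fun setT b by exact: measurable_avg.
have avb r : c < r -> r + l < d -> (sqi leb1 Z (avg r l u) <=
    (C1 * l * (q r p' + q r (p' + 2 * l)))%:E + (C1 * K * l ^+ 3)%:E * sqi leb2 B g2)%E.
  move=> cr rd.
  have := H1 (avg r l u) (avg r l g2) p' l l0 (sqint_avg r l0 su) (sqint_avg r l0 s2).
  move=> /(_ (fun k tk => avg_slice_identity l0 su s2 W2 QO cr rd tk)).
  rewrite !(avg_dot r l0 su (window_test1' _ l0)) -/(moment u l r p') -/(moment u l r (p' + 2 * l)) -/q.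
  rewrite -/c' -/d' -/Z => /le_trans; apply; apply: leeD => //.
  apply: (@le_trans _ _ ((C1 * l ^+ 4)%:E * ((K / l)%:E * sqi leb2 B g2))%E).
    apply: lee_wpmul2l; first by rewrite lee_fin mulr_ge0 ?exprn_ge0 ?ltW.
    apply: le_trans (avgle r l g2 _ l0 m2 mcd') _.
    apply: lee_wpmul2l; first by rewrite lee_fin divr_ge0 ?ltW.
    apply: sqi_subset => //; [apply: measurableX => //; exact: measurable_itv| |exact: measurable_funTS].
    rewrite BE => -[y z] /= []; rewrite !in_itv/= => /andP[h1 h2] h3; split => //.
    by rewrite (lt_le_trans cr h1) (le_lt_trans h2 rd).
  rewrite muleA -EFinM (_ : C1 * l ^+ 4 * (K / l) = C1 * K * l ^+ 3)//.
  by field; rewrite gt_eqF.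
have pl : p + l < d by rewrite /d; clear -l0; lra.
have cp2 : c < p + 2 * l by rewrite /c; clear -l0; lra.
have p2l : p + 2 * l + l < d by rewrite /d; clear -l0; lra.
have A1 := avb p cp pl; have A2 := avb (p + 2 * l) cp2 p2l.
rewrite -/a in A1; rewrite -/b in A2.
have Iab x : p <= x.1 <= p + 3 * l -> interp p l u x ^+ 2 <= 242 * (a x.2 ^+ 2 + b x.2 ^+ 2).
  exact: interp_sqr_le.
have q0 i j : 0 <= q i j by exact: sqr_ge0.
clearbody a b q; clear avb.
have K4' : (0 <= K4%:E)%E by rewrite lee_fin ltW.
pose Phi z : \bar R := ((2 * K3 * l ^+ 3)%:E * sqi leb1 `]c, d[ (hslice g1 z) +
   (K4%:E * (a z ^+ 2)%:E + K4%:E * (b z ^+ 2)%:E))%E.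
have l3 : 0 <= 2 * K3 * l ^+ 3 by rewrite !mulr_ge0// ?exprn_ge0// ltW.
have ms := measurable_sqi_hslice mcd m1.
have msa : measurable_fun setT (fun z => K4%:E * (a z ^+ 2)%:E)%E.
  exact: (measurable_funeM _ (measurable_sqr ma)).
have msb : measurable_fun setT (fun z => K4%:E * (b z ^+ 2)%:E)%E.
  exact: (measurable_funeM _ (measurable_sqr mb)).
have ms1 : measurable_fun setT (fun z => (2 * K3 * l ^+ 3)%:E * sqi leb1 `]c, d[ (hslice g1 z))%E.
  exact: measurable_funeM.
have mPhi : measurable_fun setT Phi.
  by apply: emeasurable_funD => //; exact: emeasurable_funD.
have K4a x : (0 <= K4%:E * (x ^+ 2)%:E)%E.
  by rewrite -EFinM lee_fin mulr_ge0 ?sqr_ge0// ltW.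
have s0 z : (0 <= (2 * K3 * l ^+ 3)%:E * sqi leb1 `]c, d[ (hslice g1 z))%E.
  by apply: mule_ge0; rewrite ?lee_fin// sqi_ge0.
have Phi0 z : (0 <= Phi z)%E by apply: adde_ge0 => //; exact: adde_ge0.
have ptw : {ae leb2, forall x, (Y `*` Z) x -> ((u x ^+ 2)%:E <= Phi x.2)%E}.
  apply: aeS (rectangle_interp su s1 W1 QO l0 cp pd dc) => x Hx [].
  rewrite /Y /=; rewrite in_itv/= => xY xZ.
  have xB : box c d c' d' x.
    split; last by have := ZS _ xZ; rewrite /= in_itv.
    by move: xY => /andP[h1 h2]; rewrite (lt_le_trans cp h1) (le_lt_trans h2 pd).
  have {}Hx := K3E (fun c1 => (_ <= (c1 * _)%:E * _)%E) (Hx xB).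
  have h2 := Iab _ xY.
  apply: (@le_trans _ _ (2%:E * ((u x - interp p l u x) ^+ 2)%:E + 2%:E * (interp p l u x ^+ 2)%:E)%E).
    rewrite -!EFinM -EFinD lee_fin -subr_ge0.
    rewrite (_ : _ - _ = (u x - 2 * interp p l u x) ^+ 2) ?sqr_ge0//; ring.
  rewrite /Phi; apply: leeD.
    apply: (@le_trans _ _ (2%:E * ((K3 * l ^+ 3)%:E * sqi leb1 `]c, d[ (hslice g1 x.2)))%E).
      exact: lee_wpmul2l.
    by rewrite muleA -EFinM !mulrA.
  rewrite -!EFinM -EFinD lee_fin -!K4E.
  move: (interp p l u x ^+ 2) h2; move: (a x.2 ^+ 2) (b x.2 ^+ 2).
  by clear=> x1 x2 x3 h; lra.
have Heta z : (leb1 (ysection (Y `*` Z) z) <= (3 * l)%:E)%E.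
  apply: (@le_trans _ _ (leb1 Y)).
    apply: le_measure; rewrite ?inE//; first by apply: measurable_ysection; exact: measurableX.
    by move=> y; rewrite /ysection/= inE => -[].
  rewrite lebesgue_measure_itv/= lte_fin; case: ifP => _; last by rewrite lee_fin mulr_ge0// ltW.
  by rewrite -EFinD lee_fin; clear; lra.
have HZ x : (Y `*` Z) x -> Z x.2 by case.
have l30 : 0 <= 3 * l by rewrite mulr_ge0// ltW.
have mYZ : measurable (Y `*` Z) by exact: measurableX.
apply: le_trans (sqi_le_sections mu mPhi Phi0 mYZ mZ l30 HZ ptw Heta) _.
rewrite /Phi ge0_integralD//; last 3 first.
- exact: measurable_funTS.
- by move=> z _; exact: adde_ge0.
- by apply: measurable_funTS; exact: emeasurable_funD.
rewrite ge0_integralD//; last 2 first.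
- exact: measurable_funTS.
- exact: measurable_funTS.
rewrite !ge0_integralZl_EFin ?(ltW K40)//; try (by move=> *; rewrite ?sqi_ge0 ?lee_fin ?sqr_ge0);
  try (by apply: measurable_funTS => //; exact: measurable_sqr).
rewrite -/(sqi leb1 Z a) -/(sqi leb1 Z b) -sqi_prod//.
have SB : (sqi leb2 (`]c, d[%classic `*` Z) g1 <= sqi leb2 B g1)%E.
  apply: sqi_subset => //; [exact: measurableX| |exact: measurable_funTS].
  by rewrite BE => -[y z] /= [h1 h2]; split => //; exact: ZS.
have fB (g : plane -> R) : sqint leb2 g -> sqi leb2 B g \is a fin_num.
  move=> [mg fg]; rewrite ge0_fin_numE ?sqi_ge0//; apply: le_lt_trans fg.
  by apply: sqi_subset.
apply: (@le_trans _ _ ((3 * l)%:E * ((2 * K3 * l ^+ 3)%:E * sqi leb2 B g1 +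
   (K4%:E * ((C1 * l * (q p p' + q p (p' + 2 * l)))%:E + (C1 * K * l ^+ 3)%:E * sqi leb2 B g2) +
    K4%:E * ((C1 * l * (q (p + 2 * l) p' + q (p + 2 * l) (p' + 2 * l)))%:E +
       (C1 * K * l ^+ 3)%:E * sqi leb2 B g2))))%E).
  apply: lee_wpmul2l; first by rewrite lee_fin.
  apply: leeD; first by apply: lee_wpmul2l; rewrite ?lee_fin.
  exact: (leeD (lee_wpmul2l K4' A1) (lee_wpmul2l K4' A2)).
rewrite -(fineK (fB _ s1)) -(fineK (fB _ s2)) -?(EFinM, EFinD) lee_fin.
have := fine_ge0 (sqi_ge0 leb2 B g1); have := fine_ge0 (sqi_ge0 leb2 B g2).
move: (fine _) (fine _) => t2 t1 t20 t10.
have := addr_ge0 (addr_ge0 (q0 p p') (q0 p (p' + 2 * l)))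
  (addr_ge0 (q0 (p + 2 * l) p') (q0 (p + 2 * l) (p' + 2 * l))).
move: (q p p') (q p (p' + 2 * l)) (q (p + 2 * l) p') (q (p + 2 * l) (p' + 2 * l)) => x1 x2 x3 x4 x0.
rewrite -subr_ge0 (_ : _ - _ = (6 * K3 + 6 * K4 * C1 * K) * l ^+ 2 * (x1 + x2 + (x3 + x4)) +
   (3 * K4 * C1 + 6 * K4 * C1 * K) * l ^+ 4 * t2 + (6 * K3 + 3 * K4 * C1) * l ^+ 4 * t1); last by ring.
have [K0' K30' K40' C10'] : [/\ 0 <= K, 0 <= K3, 0 <= K4 & 0 <= C1] by split; exact: ltW.
by rewrite !addr_ge0// !mulr_ge0// ?addr_ge0// ?mulr_ge0// ?exprn_ge0// ltW.
Qed.

End squares.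

(** If [P] failed for [K], the complements in K of the sets with [P] would generate a proper filter.
    It has a cluster point in K, and a neighbourhood of that point with [P] contradicts this. *)
Lemma compact_local_ind (T : topologicalType) (K : set T) (P : set T -> Prop) :
  compact K -> P set0 -> (forall A B, A `<=` B -> P B -> P A) ->
  (forall A B, P A -> P B -> P (A `|` B)) ->
  (forall x, K x -> exists2 U, nbhs x U & P U) -> P K.
Proof.
move=> cK P0 Ps PU PK; apply: contrapT => nPK.
pose F : set_system T := fun S => exists2 B, P B & K `\` B `<=` S.
have FF : Filter F.
  split.
  - by exists set0 => // x.
  - move=> S1 S2 [B1 PB1 h1] [B2 PB2 h2]; exists (B1 `|` B2); first exact: PU.
    by move=> x [Kx nB]; split; [apply: h1|apply: h2]; split => // h; apply: nB; [left|right].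
  - by move=> S1 S2 S12 [B PB h]; exists B => // x /h /S12.
have PF : ProperFilter F.
  split => // -[B PB h]; apply: nPK; apply: Ps PB => x Kx.
  by apply: contrapT => nB; exact: (h x).
have FK : F K by exists set0 => // x [].
have [x [Kx clx]] := cK F PF FK.
have [U Ux PU'] := PK x Kx.
have FU : F (~` U) by exists U => // y [].
by have [y []] := clx _ _ FU Ux.
Qed.

(** * Precompactness *)

Section compactness.
Context {R : realType}.
Local Notation plane := (R * R)%type.
Local Notation leb1 := (@lebesgue_measure R).
Local Notation leb2 := (leb1 \x leb1)%E.
Implicit Types (u g w : plane -> R) (Om A B E : set plane).

Definition twice_diff Om u g1 g2 :=
  [/\ sqint leb2 u, sqint leb2 g1, sqint leb2 g2, weak_yy Om u g1 & weak_zz Om u g2].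

Definition energy u g1 g2 : R := dot leb2 u u + dot leb2 g1 g1 + dot leb2 g2 g2.

Definition moments (ws : seq (plane -> R)) u : R := \sum_(w <- ws) dot leb2 u w ^+ 2.

(* Up to finitely many moments, u^2 has mass at most del * energy on E. *)
Definition almost_small Om E (del : R) := exists2 ws, List.Forall (sqint leb2) ws &
  forall u g1 g2, twice_diff Om u g1 g2 ->
    (sqi leb2 E u <= (moments ws u + del * energy u g1 g2)%:E)%E.

(** The measurable enlargement [B] spares any measurability requirement on [E], which is convenient
    for neighbourhoods and closures. *)
Definition precompact_on Om E := forall del, 0 < del ->
  exists B, [/\ measurable B, E `<=` B & almost_small Om B del].

Lemma energy_ge0 u g1 g2 : 0 <= energy u g1 g2.
Proof. by rewrite !addr_ge0// dot_ge0. Qed.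

Lemma almost_smallW Om A B (del del' : R) : measurable A -> measurable B -> A `<=` B ->
  del <= del' -> almost_small Om B del -> almost_small Om A del'.
Proof.
move=> mA mB AB dd [ws sws H]; exists ws => // u g1 g2 Wu.
have [[mu _] _ _ _ _] := Wu.
apply: (@le_trans _ _ (sqi leb2 B u)).
  by apply: sqi_subset => //; exact: measurable_funTS.
apply: le_trans (H _ _ _ Wu) _; rewrite lee_fin lerD2l.
by apply: ler_wpM2r => //; exact: energy_ge0.
Qed.

Lemma sqiU A B u : measurable A -> measurable B -> measurable_fun setT u ->
  (sqi leb2 (A `|` B) u <= sqi leb2 A u + sqi leb2 B u)%E.
Proof.
move=> mA mB mu.
rewrite (_ : A `|` B = A `|` (B `\` A)); last first.
  apply/seteqP; split => x [hA|hB]; [by left| |by left|by case: hB; right].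
  by have [hA|hA] := pselect (A x); [left|right].
rewrite /sqi ge0_integral_setU//.
- apply: leeD => //; apply: sqi_subset => //; [exact: measurableD|exact: measurable_funTS].
- exact: measurableD.
- by apply: measurable_sqr; exact: measurable_funTS.
- by move=> x _; rewrite lee_fin sqr_ge0.
- by rewrite disj_set2E; apply/eqP; apply/seteqP; split => // x [h1 [_ h2]].
Qed.

Lemma almost_smallU Om A B (del del' : R) : measurable A -> measurable B ->
  almost_small Om A del -> almost_small Om B del' -> almost_small Om (A `|` B) (del + del').
Proof.
move=> mA mB [ws sws H] [ws' sws' H']; exists (ws ++ ws').
  by apply/List.Forall_app.
move=> u g1 g2 Wu; have [[mu _] _ _ _ _] := Wu.
apply: le_trans (sqiU mA mB mu) _; apply: le_trans (leeD (H _ _ _ Wu) (H' _ _ _ Wu)) _.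
by rewrite -EFinD lee_fin /moments big_cat/= mulrDl addrACA.
Qed.

Lemma almost_small_le Om E (del : R) :
  (forall u g1 g2, twice_diff Om u g1 g2 -> (sqi leb2 E u <= (del * energy u g1 g2)%:E)%E) ->
  almost_small Om E del.
Proof.
move=> H; exists [::]; first exact: List.Forall_nil.
by move=> u g1 g2 /H; rewrite /moments big_nil add0r.
Qed.

Lemma precompact_onW Om A B : A `<=` B -> precompact_on Om B -> precompact_on Om A.
Proof.
move=> AB H del d0; have [C [mC BC HC]] := H _ d0.
by exists C; split => //; exact: subset_trans BC.
Qed.

Lemma precompact_onU Om A B : precompact_on Om A -> precompact_on Om B ->
  precompact_on Om (A `|` B).
Proof.
move=> HA HB del d0; have d2 : 0 < del / 2 by rewrite divr_gt0.
have [C [mC AC HC]] := HA _ d2; have [D [mD BD HD]] := HB _ d2.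
exists (C `|` D); split; [exact: measurableU|exact: setUSS|].
by rewrite (splitr del); exact: almost_smallU.
Qed.

Lemma precompact_on0 Om : precompact_on Om set0.
Proof.
move=> del d0; exists set0; split => //; apply: almost_small_le => u g1 g2 Wu.
by rewrite /sqi integral_set0 lee_fin mulr_ge0 ?energy_ge0// ltW.
Qed.

Lemma precompact_on_compact Om K E : compact K -> E `<=` K ->
  (forall x, K x -> exists2 U, nbhs x U & precompact_on Om (U `&` E)) ->
  precompact_on Om E.
Proof.
move=> cK EK H.
apply: (@precompact_onW _ _ (K `&` E)); first by move=> x Ex; split => //; exact: EK.
apply: (@compact_local_ind _ K (fun U => precompact_on Om (U `&` E)) cK).
- by rewrite set0I; exact: precompact_on0.
- by move=> A B AB; apply: precompact_onW; exact: setSI.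
- by move=> A B HA HB; rewrite setIUl; exact: precompact_onU.
- exact: H.
Qed.

Definition tile (p p' l : R) : set plane :=
  `[p, (p + 3 * l)%R]%classic `*` `[p', (p' + 3 * l)%R]%classic.

Lemma measurable_tile p p' l : measurable (tile p p' l).
Proof. by apply: measurableX; exact: measurable_itv. Qed.

(** Halving l divides the error C l^4 of a tile by 16, while the number of tiles is multiplied by 4.
    Each subdivision therefore gains a factor 4 in the total error, at the price of more moments. *)
Lemma tile_almost_small : exists2 C : R, 0 < C & forall Om k p p' l, 0 < l ->
  box (p - l) (p + 4 * l) (p' - l) (p' + 4 * l) `<=` Om ->
  almost_small Om (tile p p' l) (C * l ^+ 4 / 4 ^+ k).
Proof.
have [C C0 H] := square_bound (R := R); exists C => // Om; elim => [|k IH] p p' l l0 QO.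
  (* The factor sqrt(C l^2) puts the constant of [square_bound] into the functional, since [moments]
     carries no coefficients. *)
  pose w i j x := Num.sqrt (C * l ^+ 2) * tensor (window i l) (window j l) x.
  exists [:: w p p'; w p (p' + 2 * l); w (p + 2 * l) p'; w (p + 2 * l) (p' + 2 * l)].
    have sw i j : sqint leb2 (w i j).
      apply: sqintZ; apply: sqint_tensor_test; exact: window_test1'.
    by do 4 (apply: List.Forall_cons; first exact: sw); exact: List.Forall_nil.
  move=> u g1 g2 [su s1 s2 W1 W2].
  have dw i j : dot leb2 u (w i j) ^+ 2 = C * l ^+ 2 * moment u l i j.
    have st : sqint leb2 (tensor (window i l) (window j l)).
      by apply: sqint_tensor_test; exact: window_test1'.
    rewrite dotC (dotZl _ st su) exprMn sqr_sqrtr; first by rewrite /moment dotC.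
    by rewrite mulr_ge0 ?sqr_ge0// ltW.
  have := H Om u g1 g2 p p' l l0 su s1 s2 W1 W2 QO.
  rewrite -/(tile p p' l) => /le_trans; apply.
  move: dw; move: w (moment u l) => w m dw.
  have -> : moments [:: w p p'; w p (p' + 2 * l); w (p + 2 * l) p'; w (p + 2 * l) (p' + 2 * l)] u
      = C * l ^+ 2 * (m p p' + m p (p' + 2 * l) + (m (p + 2 * l) p' + m (p + 2 * l) (p' + 2 * l))).
    rewrite /moments 4!big_cons big_nil 4!dw.
    move: (m p p') (m p _) (m _ p') (m _ _) => x1 x2 x3 x4; ring.
  rewrite expr0 divr1 EFinD; apply: leeD => //.
  set S := box _ _ _ _; have mS : measurable S by exact: measurable_box.
  have sS g : sqint leb2 g -> (sqi leb2 S g <= (dot leb2 g g)%:E)%E.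
    by move=> sg; rewrite -dot_sqi//; case: sg => mg _; apply: sqi_subset.
  rewrite [leRHS]EFinM; apply: lee_wpmul2l; first by rewrite lee_fin mulr_ge0 ?exprn_ge0// ltW.
  apply: le_trans (leeD (sS _ s1) (sS _ s2)) _.
  by rewrite -EFinD lee_fin /energy -addrA lerDr dot_ge0.
have h0 : 0 < l / 2 by rewrite divr_gt0.
have e4 : C * l ^+ 4 / 4 ^+ k.+1 = C * (l / 2) ^+ 4 / 4 ^+ k + C * (l / 2) ^+ 4 / 4 ^+ k
   + (C * (l / 2) ^+ 4 / 4 ^+ k + C * (l / 2) ^+ 4 / 4 ^+ k).
  have -> : C * (l / 2) ^+ 4 = C * l ^+ 4 / 16 by field.
  have e0 : 4 ^+ k != 0 :> R by rewrite expf_neq0.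
  rewrite [4 ^+ k.+1]exprS; move: (4 ^+ k) e0 => e e0; by field.
set q := p + 3 * (l / 2); set q' := p' + 3 * (l / 2).
have mt := measurable_tile.
apply: (@almost_smallW _ _ ((tile p p' (l / 2) `|` tile q p' (l / 2)) `|`
    (tile p q' (l / 2) `|` tile q q' (l / 2))) _ _ _ _ _ (lexx _)).
- exact: mt.
- by do !apply: measurableU; exact: mt.
- move=> [y z] [/=]; rewrite !in_itv/= => /andP[y1 y2] /andP[z1 z2].
  rewrite /tile /q /q'.
  have [yq|yq] := leP y (p + 3 * (l / 2)); have [zq|zq] := leP z (p' + 3 * (l / 2)).
  + by left; left; split; rewrite /= in_itv/=; apply/andP; split.
  + right; left; split; rewrite /= in_itv/=; apply/andP; split => //; first exact: ltW.
    by clear -z2; lra.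
  + left; right; split; rewrite /= in_itv/=; apply/andP; split => //; first exact: ltW.
    by clear -y2; lra.
  + right; right; split; rewrite /= in_itv/=; apply/andP; split => //; try exact: ltW.
      by clear -y2; lra.
    by clear -z2; lra.
- have IHq a b : p <= a <= p + 3 * (l / 2) -> p' <= b <= p' + 3 * (l / 2) ->
      almost_small Om (tile a b (l / 2)) (C * (l / 2) ^+ 4 / 4 ^+ k).
    move=> /andP[a1 a2] /andP[b1 b2]; apply: IH => // -[y z] [/= /andP[y1 y2] /andP[z1 z2]].
    apply: QO; split => /=; [clear -a1 a2 y1 y2 h0|clear -b1 b2 z1 z2 h0];
      move: (l / 2) h0 (splitr l) => m m0 lm; lra.
  have mU a b c d : measurable (tile a b (l / 2) `|` tile c d (l / 2)) by exact: measurableU.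
  have pq : p <= q by rewrite lerDl mulr_ge0// ltW.
  have pq' : p' <= q' by rewrite lerDl mulr_ge0// ltW.
  by rewrite e4; apply: almost_smallU => //; apply: almost_smallU => //; try exact: mt;
    apply: IHq; rewrite ?lexx ?pq ?pq'.
Qed.

Lemma precompact_on_tile Om p p' l : 0 < l ->
  box (p - l) (p + 4 * l) (p' - l) (p' + 4 * l) `<=` Om -> precompact_on Om (tile p p' l).
Proof.
move=> l0 QO del d0; have [C C0 H] := tile_almost_small.
have c0 : ((4^-1 : R) ^+ n) @[n --> \oo] --> (0 : R).
  by apply: cvg_expr; rewrite ger0_norm ?invr_ge0// invf_lt1// ltr1n.
have X0 : 0 < C * l ^+ 4 by rewrite mulr_gt0// exprn_gt0.
have [k _ Hk] : \forall n \near \oo, (4^-1 : R) ^+ n < del / (C * l ^+ 4).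
  by move/cvgr_lt : c0; apply; rewrite divr_gt0.
exists (tile p p' l); split => //; first exact: measurable_tile.
apply: almost_smallW (H Om k p p' l l0 QO) => //; try exact: measurable_tile.
have := Hk k (leqnn _); rewrite ltr_pdivlMr// => /ltW; rewrite exprVn mulrC//.
Qed.

Lemma open_box (A : set plane) (x : plane) : open A -> A x ->
  exists2 e : R, 0 < e & box (x.1 - e) (x.1 + e) (x.2 - e) (x.2 + e) `<=` A.
Proof.
move=> oA; case: x => y z Az; have [|e e0 He] := @open_tube _ A y y z oA (lexx _).
  move=> s; rewrite -eq_le => /eqP <- //.
exists e => // -[s t] [/= /andP[h1 h2] /andP[h3 h4]]; apply: He; by rewrite !ltW.
Qed.

Lemma nbhs_box (x : plane) (e : R) : 0 < e ->
  nbhs x (box (x.1 - e) (x.1 + e) (x.2 - e) (x.2 + e)).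
Proof.
move=> e0; apply: filterS (@nbhsx_ballx R plane x e e0) => -[s t] [/= h1 h2].
move: h1 h2; rewrite /ball/= ltr_distlC ltr_distlC => /andP[h1 h2] /andP[h3 h4].
by split => /=; apply/andP; split.
Qed.

Lemma precompact_on_inside Om K : open Om -> compact K -> K `<=` Om -> precompact_on Om K.
Proof.
move=> oOm cK KO; apply: (precompact_on_compact cK) => // x Kx.
have [e e0 He] := open_box oOm (KO _ Kx).
have l0 : 0 < e / 3 by rewrite divr_gt0.
exists (box (x.1 - e / 3) (x.1 + e / 3) (x.2 - e / 3) (x.2 + e / 3)); first exact: nbhs_box.
have e3 : e = 3 * (e / 3) by field.
move: (e / 3) l0 e3 => l l0 e3.
apply: (@precompact_onW _ _ (tile (x.1 - 3 / 2 * l) (x.2 - 3 / 2 * l) l)).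
  move=> [y z] [[/= /andP[y1 y2] /andP[z1 z2]] _].
  by split; rewrite /= in_itv/=; apply/andP; split; [clear -y1 l0|clear -y2 l0|clear -z1 l0|clear -z2 l0]; lra.
apply: precompact_on_tile => // -[y z] [/= /andP[y1 y2] /andP[z1 z2]].
apply: He; split; apply/andP; split; rewrite /= e3;
 [clear -y1 l0|clear -y2 l0|clear -z1 l0|clear -z2 l0]; lra.
Qed.

End compactness.

(** * Exchange of the two coordinates *)

Section swapping.
Context {R : realType}.
Local Notation plane := (R * R)%type.
Local Notation leb1 := (@lebesgue_measure R).
Local Notation leb2 := (leb1 \x leb1)%E.
Implicit Types (u g w : plane -> R) (Om A B E : set plane).

Definition flip (x : plane) : plane := (x.2, x.1).

Lemma flipK : cancel flip flip.
Proof. by case. Qed.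

Lemma measurable_flip : measurable_fun setT flip.
Proof. exact: measurable_swap. Qed.

Lemma continuous_flip : continuous flip.
Proof. exact: (@swap_continuous R R). Qed.

Lemma continuous_pairing (f h : plane -> R) : continuous f -> continuous h ->
  continuous (fun x => (f x, h x) : plane).
Proof. by move=> cf ch x; exact: (cvg_pair (cf x) (ch x)). Qed.

Lemma Rintegral_flip (f : plane -> R) : measurable_fun setT f ->
  \int[leb2]_x f (flip x) = \int[leb2]_x f x.
Proof.
move=> mf; have mE : measurable_fun setT (EFin \o f) by exact/measurable_EFinP.
rewrite /Rintegral integralE [in RHS]integralE; congr (fine (_ - _)%E).
  rewrite -(integral_swap (measurable_funepos mE))//.
  by apply: eq_integral => x _; rewrite !funeposE.
rewrite -(integral_swap (measurable_funeneg mE))//.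
by apply: eq_integral => x _; rewrite !funenegE.
Qed.

Lemma sqi_flip B u : measurable B -> measurable_fun setT u ->
  sqi leb2 (flip @^-1` B) (u \o flip) = sqi leb2 B u.
Proof.
move=> mB mu; rewrite /sqi [RHS]integral_mkcond -integral_swap; last 2 first.
- apply/(measurable_restrictT _ _).1 => //; apply: measurable_sqr.
  exact: measurable_funTS.
- by move=> x; rewrite patchE; case: ifP => // _; rewrite lee_fin sqr_ge0.
rewrite [LHS]integral_mkcond; apply: eq_integral => x _.
by rewrite !patchE; congr (if _ then _ else _); apply/idP/idP; rewrite !inE.
Qed.

Lemma measurable_preflip B : measurable B -> measurable (flip @^-1` B).
Proof. by move=> mB; have := measurable_flip measurableT mB; rewrite setTI. Qed.

Lemma sqint_flip u : sqint leb2 u -> sqint leb2 (u \o flip).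
Proof.
move=> [mu fu]; split; first exact: (measurableT_comp mu measurable_flip).
by have := sqi_flip measurableT mu; rewrite preimage_setT => ->.
Qed.

Lemma dot_flip u w : sqint leb2 u -> sqint leb2 w ->
  dot leb2 (u \o flip) (w \o flip) = dot leb2 u w.
Proof.
move=> [mu _] [mw _]; rewrite /dot -[RHS]Rintegral_flip//.
exact: measurable_funM.
Qed.

Lemma twice_diff_flip Om u g1 g2 : twice_diff Om u g1 g2 ->
  twice_diff (flip @^-1` Om) (u \o flip) (g2 \o flip) (g1 \o flip).
Proof.
move=> [su s1 s2 W1 W2]; split; try exact: sqint_flip.
- move=> c d c' d' al be QO ta tb.
  have tf a b : tensor a b = tensor b a \o flip :> (plane -> R).
    by apply/funext => x; rewrite /tensor /= mulrC.
  have tk : test1 c d (derive1 (derive1 al)) by do 2 apply: test1_derive.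
  rewrite (tf (derive1 _) be) (tf al be).
  rewrite (dot_flip su (sqint_tensor_test tb tk)) (dot_flip s2 (sqint_tensor_test tb ta)).
  apply: (W2 c' d' c d) => // -[y z] [h1 h2].
  exact: (QO (z, y)).
- move=> c d c' d' al be QO ta tb.
  have tf a b : tensor a b = tensor b a \o flip :> (plane -> R).
    by apply/funext => x; rewrite /tensor /= mulrC.
  have tk : test1 c' d' (derive1 (derive1 be)) by do 2 apply: test1_derive.
  rewrite (tf al (derive1 _)) (tf al be).
  rewrite (dot_flip su (sqint_tensor_test tk ta)) (dot_flip s1 (sqint_tensor_test tb ta)).
  apply: (W1 c' d' c d) => // -[y z] [h1 h2].
  exact: (QO (z, y)).
Qed.

Lemma precompact_on_flip Om E :
  precompact_on (flip @^-1` Om) (flip @^-1` E) -> precompact_on Om E.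
Proof.
move=> H del d0; have [B [mB EB [ws sws HB]]] := H _ d0.
exists (flip @^-1` B); split; first exact: measurable_preflip.
  by move=> x Ex; apply: EB; rewrite /= flipK.
exists [seq w \o flip | w <- ws].
  elim: ws sws {HB} => [|w ws IH] sws; first exact: List.Forall_nil.
  by inversion_clear sws; apply: List.Forall_cons; [exact: sqint_flip|exact: IH].
move=> u g1 g2 Wu; have [su s1 s2 _ _] := Wu.
have := HB _ _ _ (twice_diff_flip Wu).
have -> : sqi leb2 B (u \o flip) = sqi leb2 (flip @^-1` B) u.
  have [mu _] := su; rewrite -(sqi_flip (measurable_preflip mB) mu).
  by congr sqi; apply/seteqP; split => x /=; rewrite flipK.
have -> : moments ws (u \o flip) = moments [seq w \o flip | w <- ws] u.
  rewrite /moments big_map; elim: ws sws {HB} => [|w ws IH] sws; first by rewrite !big_nil.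
  inversion_clear sws; rewrite !big_cons IH//; congr (_ ^+ 2 + _).
  have sw := sqint_flip H0; rewrite -(dot_flip su sw); congr dot.
  by apply/funext => x /=; rewrite flipK.
by rewrite /energy !dot_flip// addrAC.
Qed.

End swapping.

(** * Thin layers along the boundary *)

Section boundary.
Context {R : realType}.
Local Notation plane := (R * R)%type.
Local Notation leb1 := (@lebesgue_measure R).
Local Notation leb2 := (leb1 \x leb1)%E.
Implicit Types (u g w : plane -> R) (Om A B E : set plane).

Definition square (x : plane) (r : R) : set plane := box (x.1 - r) (x.1 + r) (x.2 - r) (x.2 + r).

Lemma layer_energy Om p l (E : set plane) (Z : set R) (eta : R) : open Om -> 0 < l -> 0 <= eta ->
  measurable E -> measurable Z -> (forall x, E x -> Z x.2 /\ reach Om p l x) ->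
  (forall z, leb1 (ysection E z) <= eta%:E)%E ->
  almost_small Om E (Clayer * eta * (l^-1 + l ^+ 3)).
Proof.
move=> oOm l0 eta0 mE mZ HE Heta; apply: almost_small_le => u g1 g2 [su s1 s2 W1 W2].
apply: le_trans (layer_bound oOm l0 eta0 mE mZ su s1 W1 HE Heta) _.
have Ce : 0 <= (Clayer : R) * eta by rewrite mulr_ge0// ltW// Clayer_gt0.
rewrite -[_ * _ * energy _ _ _]mulrA [leRHS]EFinM; apply: lee_wpmul2l; first by rewrite lee_fin.
have sE g (S : set plane) : sqint leb2 g -> measurable S -> (sqi leb2 S g <= (dot leb2 g g)%:E)%E.
  by move=> sg mS; rewrite -dot_sqi//; case: sg => mg _; apply: sqi_subset.
rewrite [_ * energy _ _ _]mulrDl [leRHS]EFinD; apply: leeD.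
  rewrite [leRHS]EFinM; apply: lee_wpmul2l; first by rewrite lee_fin invr_ge0 ltW.
  apply: le_trans (sE _ _ su _) _; first by apply: measurableX => //; exact: measurable_itv.
  by rewrite lee_fin /energy -addrA lerDl addr_ge0// dot_ge0.
rewrite [leRHS]EFinM; apply: lee_wpmul2l; first by rewrite lee_fin exprn_ge0// ltW.
apply: le_trans (sE _ _ s1 _) _; first by apply: measurableX => //; exact: measurable_itv.
by rewrite lee_fin /energy addrAC lerDr addr_ge0// dot_ge0.
Qed.

(** Moving against the direction [s] decreases psi and stays in [Om], so windows can be placed on
    that side. Points that leave {psi < 0} after a shift by eta in the direction [s] form a layer
    [E1] with short horizontal sections; all other points lie in a compact subset of [Om]. *)
Lemma monotone_boundary Om (psi : plane -> R) (p0 : plane) (s r : R) :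
  open Om -> 0 < r -> continuous psi -> s = 1 \/ s = -1 ->
  (forall x, square p0 (9 * r) x -> Om x <-> psi x < 0) ->
  (forall y y' z, square p0 (9 * r) (y, z) -> square p0 (9 * r) (y', z) -> 0 < s * (y' - y) ->
     psi (y, z) < psi (y', z)) ->
  precompact_on Om (square p0 r `&` Om).
Proof.
move=> oOm r0 cpsi s1 HOm Hmon del d0.
have l0 : 0 < 2 * r by rewrite mulr_gt0.
set l := 2 * r in l0; pose K := (Clayer : R) * 2 * (l^-1 + l ^+ 3).
have K0 : 0 < K by rewrite !mulr_gt0 ?Clayer_gt0// addr_gt0 ?invr_gt0 ?exprn_gt0.
pose eta := Num.min r (del / 2 / K).
have e0 : 0 < eta by rewrite lt_min r0 !divr_gt0.
have er : eta <= r by rewrite ge_min lexx.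
have ed : eta * K <= del / 2 by rewrite -ler_pdivlMr// ge_min lexx orbT.
pose sh (x : plane) : plane := (x.1 + s * eta, x.2).
have csh : continuous sh.
  apply: continuous_pairing; last by move=> x; exact: cvg_snd.
  by move=> x; apply: cvgD; [exact: cvg_fst|exact: cvg_cst].
have cps : continuous (psi \o sh) by move=> x; apply: continuous_comp; [exact: csh|exact: cpsi].
have sabs : `|s * eta| <= r.
  by case: s1 => ->; rewrite ?mul1r ?mulN1r ?normrN gtr0_norm.
have shQ x : square p0 (2 * r) x -> square p0 (9 * r) (sh x).
  move: sabs; rewrite ler_norml => /andP[a1 a2] [/andP[h1 h2] /andP[h3 h4]].
  by rewrite /sh; split; apply/andP; split => /=; clear -a1 a2 h1 h2 h3 h4 r0; lra.
have subQ r' x : r' <= 9 * r -> square p0 r' x -> square p0 (9 * r) x.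
  move=> rr [/andP[h1 h2] /andP[h3 h4]].
  by split; apply/andP; split; clear -h1 h2 h3 h4 rr; lra.
pose E1 := square p0 r `&` Om `&` [set x | 0 <= (psi \o sh) x].
have mE1 : measurable E1.
  apply: measurableI.
    by apply: measurableI; [exact: measurable_box|exact: open_plane_measurable].
  rewrite (_ : [set x | _] = ~` [set x | (psi \o sh) x < 0]); last first.
    by apply/seteqP; split => x /=; rewrite leNgt => /negP.
  apply: measurableC; apply: open_plane_measurable.
  by apply: (@open_comp _ _ (psi \o sh) [set x | x < 0]) => //.
(* The condition is closed, so [E2] is compact; strict monotonicity of psi still puts its points
   inside [Om], because the shift increases psi. *)
pose E2 := (`[p0.1 - r, p0.1 + r]%classic `*` `[p0.2 - r, p0.2 + r]%classic)
   `&` [set x | (psi \o sh) x <= 0].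
have cE2 : compact E2.
  apply: compact_closedI; first by apply: compact_setX; exact: segment_compact.
  by apply: (@closed_comp _ _ (psi \o sh) [set x | x <= 0]) => //.
have E2O : E2 `<=` Om.
  move=> [y z] [[/=]]; rewrite !in_itv/= => /andP[y1 y2] /andP[z1 z2] sle.
  have q2 : square p0 (2 * r) (y, z) by split => /=; apply/andP; split; clear -y1 y2 z1 z2 r0; lra.
  have q9 : square p0 (9 * r) (y, z) by apply: subQ q2; clear -r0; lra.
  apply/(HOm _ q9); apply: lt_le_trans sle; apply: Hmon => //; first exact: (shQ _ q2).
  by rewrite addrC addKr mulrA; case: s1 => ->; rewrite ?mulrNN !mulr1 mul1r.
have [B2 [mB2 EB2 HB2]] := precompact_on_inside oOm cE2 E2O (divr_gt0 d0 (ltr0n _ 2)).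
exists (E1 `|` B2); split; first exact: measurableU.
  move=> x [Qx Ox]; have [h|h] := leP 0 ((psi \o sh) x); first by left.
  right; apply: EB2; split; last exact: ltW.
  by move: Qx => [/andP[h1 h2] /andP[h3 h4]]; split; rewrite /= in_itv/= !ltW.
rewrite (splitr del); apply: almost_smallU => //.
(* With l = 2 r the window is [p0.1 - 7 r, p0.1 - r] if s = 1 and [p0.1 + r, p0.1 + 7 r] if s = -1:
   beside the small square, on the inner side of the boundary, and within the large square. *)
have HE x : E1 x -> [set: R] x.2 /\ reach Om (p0.1 - 3 * r - s * (4 * r)) l x.
  move=> [[Qx Ox] _]; split => //; have Q9 : square p0 (9 * r) x.
    by apply: subQ Qx; clear -r0; lra.
  have px := (HOm _ Q9).1 Ox; case: x Qx Q9 px {Ox} => y z [/= /andP[h1 h2] /andP[h3 h4]] Q9 px.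
  have Qz t : p0.1 - 9 * r < t < p0.1 + 9 * r -> square p0 (9 * r) (t, z).
    by move=> ht; split => //=; apply/andP; split; clear -h3 h4 r0; lra.
  have key t : p0.1 - 9 * r < t < p0.1 + 9 * r -> 0 <= s * (y - t) -> Om (t, z).
    move=> ht; rewrite le_eqVlt => /orP[/eqP ts|ts].
      have /eqP : s * (y - t) = 0 by [].
      rewrite mulf_eq0 subr_eq0 => /orP[/eqP s0|/eqP <-]; last exact/(HOm _ Q9).
      by case: s1; rewrite s0 => /eqP; rewrite ?(eq_sym 0) ?oppr_eq0 oner_eq0.
    apply/(HOm _ (Qz _ ht)); apply: lt_trans px; apply: Hmon => //; exact: Qz.
  rewrite /l; split => /=.
    rewrite ler_norml; case: s1 => ->; apply/andP; split; clear -h1 h2 r0; lra.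
  move=> t; rewrite ge_min le_max => /andP[t1 t2]; case: s1 key t1 t2 => -> key t1 t2.
    have ty : t <= y.
      by case/orP: t2 => //; clear -h1 h2 r0; lra.
    apply: key; last by rewrite mul1r subr_ge0.
    by apply/andP; split; [case/orP: t1; clear -h1 h2 r0|clear -ty h2 r0]; lra.
  have ty : y <= t.
    by case/orP: t1 => //; clear -h1 h2 r0; lra.
  apply: key; last by rewrite mulN1r opprB subr_ge0.
  by apply/andP; split; [clear -ty h1 r0|case/orP: t2; clear -h1 h2 r0]; lra.
(* Two points of [E1] on one line are at most eta apart. Otherwise, shifting the inner one by eta
   would leave it on the inner side of the other, where psi is negative. *)
have Heta z : (leb1 (ysection E1 z) <= (2 * eta)%:E)%E.
  have [[y0 Ey0]|/nonemptyPn ->] := pselect (ysection E1 z !=set0); last first.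
    by rewrite measure0 lee_fin mulr_ge0// ltW.
  apply: (@le_trans _ _ (leb1 `[(y0 - eta)%R, (y0 + eta)%R]%classic)); last first.
    rewrite lebesgue_measure_itv/= lte_fin; case: ifP => _; last by rewrite lee_fin mulr_ge0// ltW.
    by rewrite -EFinD lee_fin; clear; lra.
  apply: le_measure; rewrite ?inE; [exact: measurable_ysection|exact: measurable_itv|].
  have main y1 y2 : E1 (y1, z) -> E1 (y2, z) -> ~ (y1 + eta < y2).
    move=> [[Q1 O1] g1] [[Q2 O2] g2] y12.
    have q1 : square p0 (9 * r) (y1, z) by apply: subQ Q1; clear -r0; lra.
    have q2 : square p0 (9 * r) (y2, z) by apply: subQ Q2; clear -r0; lra.
    have w1 : square p0 (2 * r) (y1, z) by case: Q1 => /= /andP[? ?] /andP[? ?]; split => /=; apply/andP; split; lra.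
    have w2 : square p0 (2 * r) (y2, z) by case: Q2 => /= /andP[? ?] /andP[? ?]; split => /=; apply/andP; split; lra.
    have n1 := (HOm _ q1).1 O1; have n2 := (HOm _ q2).1 O2.
    move: g1 g2; rewrite /= /sh /= => g1 g2.
    have v1 := shQ _ w1; have v2 := shQ _ w2; rewrite /sh /= in v1 v2.
    case: s1 Hmon g1 g2 v1 v2 => -> Hmon g1 g2 v1 v2.
      have : psi (y1 + 1 * eta, z) < psi (y2, z).
        by apply: Hmon => //; rewrite !mul1r; clear -y12; lra.
      by move/(le_lt_trans g1) => /(lt_trans n2); rewrite ltxx.
    have : psi (y2 + -1 * eta, z) < psi (y1, z).
      by apply: Hmon => //; clear -y12; lra.
    by move/(le_lt_trans g2) => /(lt_trans n1); rewrite ltxx.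
  move=> y; rewrite /ysection/= inE in_itv/= => Ey; rewrite /ysection/= inE in Ey0.
  by apply/andP; split; rewrite leNgt; apply/negP => h;
    [apply: (main _ _ Ey Ey0)|apply: (main _ _ Ey0 Ey)]; clear -h; lra.
have := layer_energy oOm l0 (mulr_ge0 (ler0n _ 2) (ltW e0)) mE1 measurableT HE Heta.
apply: almost_smallW => //.
by apply: le_trans ed; rewrite /K; move: (Clayer : R) (_ + l ^+ 3) => a b; rewrite le_eqVlt; apply/orP; left; apply/eqP; ring.
Qed.

End boundary.

Section domain_boundary.
Context {R : realType}.
Local Notation plane := (R * R)%type.
Implicit Types (psi D : plane -> R) (Om : set plane).

Lemma near_square (x : plane) (P : plane -> Prop) : (\forall y \near x, P y) ->
  exists2 e : R, 0 < e & forall y, square x e y -> P y.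
Proof.
move=> /nbhs_ballP[e /= e0 He]; exists e => // y [/andP[h1 h2] /andP[h3 h4]].
by apply: He; split; rewrite /ball/= ltr_distlC; apply/andP; split.
Qed.

Lemma slice_mean_value psi D (y y' z : R) :
  (forall t, is_derive (t : R) 1 (fun t => psi (t, z)) (D (t, z))) -> y < y' ->
  exists2 c, y < c < y' & psi (y', z) - psi (y, z) = D (c, z) * (y' - y).
Proof.
move=> H yy'; have [|c] := @MVT R (fun t => psi (t, z)) (fun t => D (t, z)) y y' yy' (fun t _ => H t).
  apply: continuous_subspaceT => t; apply: differentiable_continuous.
  by apply/derivable1_diffP; have [] := H t.
by rewrite in_itv/= => h E; exists c.
Qed.

(** By continuity the partial derivative [D] keeps its sign near p, and the mean value theorem makes
    psi strictly monotone along horizontal lines. This is all that is needed of the boundary being a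
    graph there. *)
Lemma graph_boundary Om psi D (p : plane) : open Om -> continuous psi -> continuous D ->
  D p != 0 ->
  (forall t z, is_derive (t : R) 1 (fun t => psi (t, z)) (D (t, z))) ->
  (\forall x \near p, Om x <-> psi x < 0) ->
  exists2 U, nbhs p U & precompact_on Om (U `&` Om).
Proof.
move=> oOm cpsi cD Dp0 HD nOm.
pose s : R := if 0 < D p then 1 else -1.
have s1 : s = 1 \/ s = -1 by rewrite /s; case: ifP; [left|right].
have sD : 0 < s * D p.
  rewrite /s; have [h|h] := ltP 0 (D p); first by rewrite mul1r.
  by rewrite mulN1r oppr_gt0 lt_neqAle Dp0.
have csD : continuous (fun x => s * D x) by move=> x; apply: cvgM; [exact: cvg_cst|exact: cD].
have nD : \forall x \near p, 0 < s * D x by move/cvgr_gt : (csD p); exact.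
have [e e0 He] := near_square (filterI nOm nD).
have r0 : 0 < e / 9 by rewrite divr_gt0.
have e9 : 9 * (e / 9) = e by field.
exists (square p (e / 9)); first exact: nbhs_box.
apply: (@monotone_boundary _ _ psi p s) => //; rewrite e9.
  by move=> x /He [].
move=> y y' z Q Q'.
have inQ c : (y < c < y') || (y' < c < y) -> 0 < s * D (c, z).
  move=> hc; have [] := He (c, z) _ => //.
  move: Q Q' => [/= /andP[h1 h2] h3] [/= /andP[h4 h5] _]; split => //=.
  case/orP: hc => /andP[h6 h7]; apply/andP; split;
   [clear -h1 h6|clear -h5 h7|clear -h4 h6|clear -h2 h7]; lra.
case: s1 inQ => -> inQ; rewrite ?mul1r ?mulN1r => h.
  have yy' : y < y' by clear -h; lra.
  have [c hc E] := slice_mean_value (HD^~ z) yy'.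
  rewrite -subr_gt0 E mulr_gt0//.
  by have := inQ c; rewrite hc mul1r; exact.
have yy' : y' < y by clear -h; lra.
have [c hc E] := slice_mean_value (HD^~ z) yy'.
rewrite -subr_lt0 E nmulr_rlt0 ?subr_gt0//.
by have := inQ c; rewrite hc orbT mulN1r oppr_gt0; exact.
Qed.

Lemma slice_is_derive psi (t z : R) : derivable psi (t, z) (1, 0) ->
  is_derive (t : R) 1 (fun t => psi (t, z)) ('D_(1, 0) psi (t, z)).
Proof.
have E : (fun h : R => h^-1 *: (((fun t => psi (t, z)) \o shift t) (h *: (1 : R)) - psi (t, z))) =
         (fun h : R => h^-1 *: ((psi \o shift (t, z)) (h *: ((1, 0) : plane)) - psi (t, z))).
  apply/funext => h /=; congr (_ *: (psi _ - _)).
  by congr pair; rewrite /= ?scaler0 ?add0r.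
rewrite /derivable => dp; split; first by rewrite /derivable E.
by rewrite /derive E.
Qed.

Lemma slice_is_derive2 psi (y z : R) : derivable psi (y, z) (0, 1) ->
  is_derive (z : R) 1 (fun t => psi (y, t)) ('D_(0, 1) psi (y, z)).
Proof.
have E : (fun h : R => h^-1 *: (((fun t => psi (y, t)) \o shift z) (h *: (1 : R)) - psi (y, z))) =
         (fun h : R => h^-1 *: ((psi \o shift (y, z)) (h *: ((0, 1) : plane)) - psi (y, z))).
  apply/funext => h /=; congr (_ *: (psi _ - _)).
  by congr pair; rewrite /= ?scaler0 ?add0r.
rewrite /derivable => dp; split; first by rewrite /derivable E.
by rewrite /derive E.
Qed.

Lemma boundary_precompact Om p : open Om -> smooth_boundary Om -> frontier Om p ->
  exists2 U, nbhs p U & precompact_on Om (U `&` Om).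
Proof.
move=> oOm sOm /sOm [psi [spsi gpsi nOm]].
have [cpsi dpsi] := spsi [::].
have [c1 _] := spsi [:: ((1, 0) : plane)]; have [c2 _] := spsi [:: ((0, 1) : plane)].
rewrite /= in cpsi dpsi c1 c2.
have [D1|D1] := eqVneq ('D_(1, 0) psi p) 0; last first.
  by apply: (@graph_boundary Om psi _ p oOm cpsi c1 D1) => // t z; exact: slice_is_derive.
(* The gradient does not vanish, so if the first partial derivative is zero the second is not, and
   the coordinates are exchanged. *)
have D2 : 'D_(0, 1) psi p != 0.
  by apply/eqP => D2; apply: gpsi; rewrite /pderiv/= D1 D2.
have cf := @continuous_flip R.
have oO' : open (flip @^-1` Om) by apply: open_comp => // x _; exact: cf.
have [|||||U nU HU] := @graph_boundary (flip @^-1` Om) (psi \o flip) ('D_(0, 1) psi \o flip) (flip p) oO'.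
- by move=> x; apply: continuous_comp; [exact: cf|exact: cpsi].
- by move=> x; apply: continuous_comp; [exact: cf|exact: c2].
- by rewrite /= flipK.
- by move=> t z; exact: slice_is_derive2.
- have nO' : nbhs (flip (flip p)) [set x | Om x <-> psi x < 0] by rewrite flipK.
  exact: (cf (flip p) _ nO').
exists (flip @^-1` U); first by have := cf p; move=> /(_ _ nU).
apply: precompact_on_flip; apply: precompact_onW HU => x [/=]; rewrite flipK => h1 h2.
by split.
Qed.

End domain_boundary.

Lemma sqi_bigcup_le d (T : measurableType d) (R : realType) (mu : {measure set T -> \bar R})
    (F : nat -> set T) (f : T -> R) (M : \bar R) :
  nondecreasing_seq F -> (forall N, measurable (F N)) -> measurable_fun setT f ->
  (forall N, sqi mu (F N) f <= M)%E -> (sqi mu (\bigcup_N F N) f <= M)%E.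
Proof.
move=> ndF mF mf HM.
have cvF : sqi mu (F N) f @[N --> \oo] --> sqi mu (\bigcup_N F N) f.
  apply: ge0_nondecreasing_set_cvg_integral => //.
  - by move=> N; apply: measurable_sqr; exact: measurable_funTS.
  - by move=> N x _; rewrite lee_fin sqr_ge0.
by apply: cvge_le cvF; exact: nearW.
Qed.

(** * The far part of the peak *)

Section tail.
Context {R : realType}.
Local Notation plane := (R * R)%type.
Local Notation leb1 := (@lebesgue_measure R).
Local Notation leb2 := (leb1 \x leb1)%E.
Implicit Types (u g : plane -> R) (Om E : set plane) (H : R -> R).

(** The mean value theorem for ln H on [y, y + l]: once the logarithmic derivative is below ln q /
    l, the logarithm of H changes by at most ln q over that interval. *)
Lemma fast_decay H (y0 : R) : (forall t, y0 < t -> 0 < H t) ->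
  (forall t, y0 < t -> derivable H t 1) ->
  derive1 (fun t => ln (H t)) t @[t --> +oo%R] --> -oo%R ->
  forall l q : R, 0 < l -> 0 < q -> exists2 rho, y0 < rho &
    forall y, rho <= y -> H (y + l) <= q * H y.
Proof.
move=> Hpos dH Hlog l q l0 q0.
have nA : \forall t \near +oo%R, derive1 (fun t => ln (H t)) t <= ln q / l.
  by move/cvgrNyPler : Hlog; apply; exact: num_real.
have [rho yr [A HA]] := pinfty_ex_gt (num_real y0) (filterI (nbhs_pinfty_gt (num_real y0)) nA).
have [A' [_ HA']] := nA.
exists (Num.max rho (A' + 1)); first by rewrite lt_max yr.
move=> y; rewrite ge_max => /andP[ry Ay].
have yl : y < y + l by rewrite ltrDl.
have Dln t : y0 < t -> is_derive (t : R) 1 (fun t => ln (H t)) (derive1 (fun t => ln (H t)) t).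
  move=> yt; have Ht := Hpos _ yt; rewrite derive1E; apply: derivableP.
  have := dH _ yt => dHt.
  by have [] := is_derive1_comp (is_derive1_ln Ht) (derivableP dHt).
have y0y t : y <= t -> y0 < t by apply: lt_le_trans; exact: lt_le_trans ry.
have dt t : t \in `]y, y + l[ -> is_derive (t : R) 1 (fun t => ln (H t)) (derive1 (fun t => ln (H t)) t).
  by rewrite in_itv/= => /andP[/ltW h _]; apply: Dln; exact: y0y.
have [|c] := MVT yl dt.
  apply: continuous_in_subspaceT => t; rewrite inE/= in_itv/= => /andP[h _].
  apply: differentiable_continuous; apply/derivable1_diffP.
  by have [] := Dln _ (y0y _ h).
rewrite in_itv/= => /andP[c1 c2] E.
have Hy : 0 < H y by apply: Hpos; exact: y0y.
have Hyl : 0 < H (y + l) by apply: Hpos; apply: y0y; exact: ltW.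
have Ac : A' < c by apply: lt_trans c1; apply: lt_le_trans Ay; rewrite ltrDl.
have := HA' _ Ac; rewrite -(ler_pM2r l0) divfK ?gt_eqF//.
rewrite (_ : y + l - y = l) in E; last by rewrite addrC addKr.
rewrite -E; rewrite lerBlDr -lnM ?posrE//.
by rewrite ler_ln ?posrE ?mulr_gt0.
Qed.

(** The vertical use of [layer_bound]. Passing from height h to height d gains a factor of order d /
    h in the mass of u. *)
Lemma thin_rectangle Om u g1 g2 (Y : set R) (d h : R) : open Om -> twice_diff Om u g1 g2 ->
  measurable Y -> 0 < h -> 0 <= d -> d <= h / 5 ->
  (forall y z, Y y -> `|z| < h -> Om (y, z)) ->
  (sqi leb2 (Y `*` `](- d)%R, d[%classic) u <= (Clayer * (2 * d))%:E *
     (((h / 5)^-1)%:E * sqi leb2 (Y `*` setT) u + ((h / 5) ^+ 3)%:E * sqi leb2 (Y `*` setT) g2))%E.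
Proof.
move=> oOm Wu mY h0 d0 dh YO; have [su s1 s2 _ W2] := Wu.
have [[mu _] [m2 _]] := (su, s2).
have [su' s2' _ W' _] := twice_diff_flip Wu.
have l0 : 0 < h / 5 by rewrite divr_gt0.
have h5 : h = 5 * (h / 5) by field.
move: (h / 5) l0 h5 dh => l l0 h5 dh; rewrite {}h5 in h0 YO.
have oO' : open (flip @^-1` Om) by apply: open_comp => // x _; exact: (@continuous_flip R).
have mD : measurable `](- d)%R, d[%classic by exact: measurable_itv.
have mE : measurable (Y `*` `](- d)%R, d[%classic) by exact: measurableX.
have mE' : measurable (`](- d)%R, d[%classic `*` Y) by exact: measurableX.
have fX (A B : set R) : flip @^-1` (A `*` B) = B `*` A.
  by apply/seteqP; split => -[y z] /= [].
(* With l = h / 5 the window [- 3 l / 2, 3 l / 2] is centred at height 0, and everything up to |z| <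
   5 l is available. *)
have HE x : (`](- d)%R, d[%classic `*` Y) x -> Y x.2 /\ reach (flip @^-1` Om) (- (3 / 2 * l)) l x.
  case: x => z y [/=]; rewrite in_itv/= => /andP[z1 z2] Yy; split => //; split => /=.
    by rewrite ler_norml; apply/andP; split; clear -z1 z2 dh l0; lra.
  move=> s; rewrite ge_min le_max => /andP[e1 e2]; apply: YO => //=.
  rewrite ltr_norml; apply/andP; split.
    by case/orP: e1 => e1; clear -e1 z1 dh l0; lra.
  by case/orP: e2 => e2; clear -e2 z2 dh l0; lra.
have Heta z : (leb1 (ysection (`](- d)%R, d[%classic `*` Y) z) <= (2 * d)%:E)%E.
  apply: (@le_trans _ _ (leb1 `](- d)%R, d[%classic)).
    apply: le_measure; rewrite ?inE//; first exact: measurable_ysection.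
    by move=> y; rewrite /ysection/= inE => -[].
  rewrite lebesgue_measure_itv/= lte_fin; case: ifP => _; last by rewrite lee_fin mulr_ge0.
  by rewrite -EFinB lee_fin; clear; lra.
rewrite -(sqi_flip mE mu) fX.
apply: le_trans (layer_bound oO' l0 (mulr_ge0 (ler0n _ 2) d0) mE' mY su' s2' W' HE Heta) _.
apply: lee_wpmul2l; first by rewrite lee_fin !mulr_ge0// ltW// Clayer_gt0.
have mYT : measurable (Y `*` [set: R]) by exact: measurableX.
have mTY : measurable ([set: R] `*` Y) by exact: measurableX.
rewrite -(sqi_flip mYT mu) -(sqi_flip mYT m2) fX.
have [[mu' _] [m2' _]] := (su', s2').
apply: leeD.
  apply: lee_wpmul2l; first by rewrite lee_fin invr_ge0 ltW.
  apply: sqi_subset => //; [apply: measurableX => //; exact: measurable_itv| |exact: measurable_funTS].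
  by move=> x [].
apply: lee_wpmul2l; first by rewrite lee_fin exprn_ge0// ltW.
apply: sqi_subset => //; [apply: measurableX => //; exact: measurable_itv| |exact: measurable_funTS].
by move=> x [].
Qed.

Definition strip (a b : R) : set plane := `[a, b[%classic `*` setT.

Lemma measurable_strip a b : measurable (strip a b).
Proof. by apply: measurableX => //; exact: measurable_itv. Qed.

(** Two steps. Horizontally, the slab is compared with the window [a - 4 l, a - l] cut at |z| <
    H(a); the segments stay in the peak because H decreases. Over that window [Om] reaches at least
    the height H(a - l), which exceeds H(a) by the factor 1 / q, so the vertical estimate makes the
    mass of u on the window small. *)
Lemma tail_slab Om H (y0 a l q : R) u g1 g2 : open Om -> twice_diff Om u g1 g2 ->
  (forall t, y0 <= t -> 0 < H t) -> (forall s t, y0 <= s -> s <= t -> H t <= H s) ->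
  Om `&` [set x | y0 < x.1] = peak H y0 ->
  0 < l -> y0 < a - 4 * l -> 0 < q <= 5^-1 -> H a <= q * H (a - l) ->
  (sqi leb2 (Om `&` strip a (a + l)) u <=
    (Clayer * (10 * q * Clayer))%:E * sqi leb2 (strip (a - 10 * l) (a + 2 * l)) u +
    ((Clayer * l ^+ 4)%:E * sqi leb2 (strip (a - 10 * l) (a + 2 * l)) g1 +
     (Clayer * (2 * q * H y0 ^+ 4 * Clayer))%:E * sqi leb2 (strip (a - 10 * l) (a + 2 * l)) g2))%E.
Proof.
move=> oOm Wu Hpos Hdec Opk l0 ya /andP[q0 q5] Ha; have [su s1 s2 W1 W2] := Wu.
have [[mu _] [m1 _] [m2 _]] := And3 su s1 s2.
have Omx x : y0 < x.1 -> Om x <-> - H x.1 < x.2 < H x.1.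
  move=> yx; split => [Ox|hx].
    by have : (Om `&` [set x | y0 < x.1]) x by []; rewrite Opk => -[].
  by have : peak H y0 x by []; rewrite -Opk => -[].
set h := H (a - l) in Ha.
have h0 : 0 < h by apply: Hpos; clear -ya l0; lra.
have d0 : 0 < H a by apply: Hpos; clear -ya l0; lra.
set d := H a in d0 Ha.
set Y := `[(a - 4 * l)%R, (a - 4 * l + 3 * l)%R]%classic; set Z := `](- d)%R, d[%classic.
set X := `](a - 4 * l - 6 * l)%R, (a - 4 * l + 6 * l)%R[%classic.
have mY : measurable Y by exact: measurable_itv.
have mZ : measurable Z by exact: measurable_itv.
have mX : measurable X by exact: measurable_itv.
set S := strip (a - 10 * l) (a + 2 * l).
have mS : measurable S by exact: measurable_strip.
set E := Om `&` strip a (a + l).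
have mE : measurable E by apply: measurableI; [exact: open_plane_measurable|exact: measurable_strip].
have HE x : E x -> Z x.2 /\ reach Om (a - 4 * l) l x.
  case: x => y z [Ox [/=]]; rewrite in_itv/= => /andP[y1 y2] _.
  have yy : y0 < y by clear -ya l0 y1; lra.
  have := (Omx (y, z) yy).1 Ox => /= /andP[z1 z2].
  have yd t : y0 <= t -> t <= y -> - H t < z < H t.
    move=> yt ty; have Hd := Hdec _ _ yt ty.
    by apply/andP; split; clear -z1 z2 Hd; lra.
  split; first by rewrite /Z/= in_itv/=; apply: yd => //; clear -ya l0; lra.
  split => /=; first by rewrite ler_norml; apply/andP; split; clear -y1 y2 l0; lra.
  move=> s; rewrite ge_min le_max => /andP[e1 e2].
  have e1' : a - 4 * l <= s by case/orP: e1 => //; clear -y1 l0; lra.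
  have e2' : s <= y by case/orP: e2 => //; clear -y1 l0; lra.
  by apply/(Omx (s, z)) => /=; [|apply: yd => //]; clear -e1' ya; lra.
have Heta z : (leb1 (ysection E z) <= l%:E)%E.
  apply: (@le_trans _ _ (leb1 `[a, (a + l)%R[%classic)).
    apply: le_measure; rewrite ?inE; [exact: measurable_ysection|exact: measurable_itv|].
    by move=> y; rewrite /ysection/= inE => -[_ []].
  rewrite lebesgue_measure_itv/= lte_fin; case: ifP => _; last by rewrite lee_fin ltW.
  by rewrite -EFinB lee_fin; clear; lra.
apply: le_trans (layer_bound oOm l0 (ltW l0) mE mZ su s1 W1 HE Heta) _.
have YO y z : Y y -> `|z| < h -> Om (y, z).
  rewrite /Y/= in_itv/= ltr_norml => /andP[y1 y2] /andP[z1 z2].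
  have yy : y0 < y by clear -ya y1 l0; lra.
  have Hh : h <= H y by apply: Hdec; [exact: ltW|clear -y2; lra].
  by apply/(Omx (y, z) yy) => /=; apply/andP; split; clear -Hh z1 z2; lra.
have dh : d <= h / 5.
  by apply: le_trans Ha _; rewrite mulrC ler_pM2l.
have T1 := thin_rectangle oOm Wu mY h0 (ltW d0) dh YO.
have C0 : 0 <= Clayer :> R by rewrite ltW// Clayer_gt0.
have YS g : measurable_fun setT g -> (sqi leb2 (Y `*` setT) g <= sqi leb2 S g)%E.
  move=> mg; apply: sqi_subset => //; [exact: measurableX| |exact: measurable_funTS].
  move=> -[y z] [/=]; rewrite /Y /= in_itv/= => /andP[y1 y2] _; split => //=.
  by rewrite in_itv/=; apply/andP; split; clear -y1 y2 l0; lra.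
have XS : (sqi leb2 (X `*` Z) g1 <= sqi leb2 S g1)%E.
  apply: sqi_subset => //; [exact: measurableX| |exact: measurable_funTS].
  move=> -[y z] [/=]; rewrite /X /= in_itv/= => /andP[y1 y2] _; split => //=.
  by rewrite in_itv/=; apply/andP; split; clear -y1 y2 l0; lra.
have hh : h <= H y0 by apply: Hdec => //; clear -ya l0; lra.
have fS g : sqint leb2 g -> sqi leb2 S g \is a fin_num.
  move=> [mg fg]; rewrite ge0_fin_numE ?sqi_ge0//; apply: le_lt_trans fg.
  by apply: sqi_subset.
apply: (@le_trans _ _ ((Clayer * l)%:E * ((l^-1)%:E * ((Clayer * (2 * d))%:E *
     (((h / 5)^-1)%:E * sqi leb2 S u + ((h / 5) ^+ 3)%:E * sqi leb2 S g2)) +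
      (l ^+ 3)%:E * sqi leb2 S g1))%E).
  have Cl : (0 <= (Clayer * l)%:E)%E by rewrite lee_fin mulr_ge0// ltW.
  apply: lee_wpmul2l => //; apply: leeD; last first.
    by apply: lee_wpmul2l => //; rewrite lee_fin exprn_ge0// ltW.
  apply: lee_wpmul2l; first by rewrite lee_fin invr_ge0 ltW.
  apply: le_trans T1 _; apply: lee_wpmul2l; first by rewrite lee_fin !mulr_ge0// ltW.
  apply: leeD; apply: lee_wpmul2l; rewrite ?lee_fin ?invr_ge0 ?exprn_ge0 ?divr_ge0 ?(ltW h0)//;
    exact: YS.
rewrite -(fineK (fS _ su)) -(fineK (fS _ s1)) -(fineK (fS _ s2)) -?(EFinM, EFinD) lee_fin.
have := fine_ge0 (sqi_ge0 leb2 S u); have := fine_ge0 (sqi_ge0 leb2 S g1).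
have := fine_ge0 (sqi_ge0 leb2 S g2).
move: (fine (sqi leb2 S u)) (fine (sqi leb2 S g1)) (fine (sqi leb2 S g2)) => tu t1 t2 t20 t10 tu0.
move: (Clayer : R) C0 => C C0.
(* The decisive ratio: d / h is at most q by the decay hypothesis on H. *)
have k1 : 2 * d * (h / 5)^-1 <= 10 * q.
  rewrite invf_div mulrA ler_pdivrMr// -mulrA [10 * q * h]mulrAC.
  by move: Ha; clear; rewrite [q * h]mulrC; lra.
have k2 : 2 * d * (h / 5) ^+ 3 <= 2 * q * H y0 ^+ 4.
  have a1 : 2 * d <= 2 * q * H y0.
    by rewrite -[leRHS]mulrA ler_pM2l// (le_trans Ha)// ler_pM2l.
  have a2 : (h / 5) ^+ 3 <= H y0 ^+ 3.
    have hH : h / 5 <= H y0 by apply: le_trans hh; clear -h0; lra.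
    apply: lerXn2r => //; first by rewrite nnegrE divr_ge0// ltW.
    by rewrite nnegrE (le_trans (ltW h0)).
  rewrite [_ ^+ 4]exprS mulrA; apply: ler_pM => //; first by rewrite mulr_ge0// ltW.
  by rewrite exprn_ge0// divr_ge0// ltW.
have -> : C * l * (l^-1 * (C * (2 * d) * ((h / 5)^-1 * tu + (h / 5) ^+ 3 * t2)) + l ^+ 3 * t1) =
   C * (2 * d * (h / 5)^-1 * C) * tu + (C * l ^+ 4 * t1 + C * (2 * d * (h / 5) ^+ 3 * C) * t2).
  by field; rewrite !gt_eqF.
apply: lerD; first by rewrite ler_wpM2r// ler_wpM2l// ler_wpM2r.
by rewrite lerD2l ler_wpM2r// ler_wpM2l// ler_wpM2r.
Qed.

(** Increments over overlapping strips, each m steps long, still telescope, up to m terms at each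
    end. *)
Lemma telescope_shift (Psi : nat -> R) (m N : nat) :
  \sum_(k < N) (Psi (k + m)%N - Psi k) = \sum_(i < m) Psi (N + i)%N - \sum_(i < m) Psi i.
Proof.
elim: N => [|N IH]; first by rewrite big_ord0 subrr.
rewrite big_ord_recr/= IH.
case: m {IH} => [|m]; first by rewrite !big_ord0 addn0 !subrr addr0.
rewrite [X in X - _ + _]big_ord_recl [X in _ = X - _]big_ord_recr/= addn0.
rewrite (eq_bigr (fun i : 'I_m => Psi (N.+1 + i)%N)); last by move=> i _; rewrite addnS.
rewrite addnS addSn; move: (\sum_(i < m) _) (\sum_(i < m.+1) _) (Psi _) (Psi _) => x y z t; ring.
Qed.

(** Masses of strips are written as increments of t -> mass of [below t], so that their sum over
    consecutive slabs telescopes. *)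
Definition below (t : R) : set plane := `]-oo, t[%classic `*` setT.

Lemma measurable_below t : measurable (below t).
Proof. by apply: measurableX => //; exact: measurable_itv. Qed.

Lemma sqi_strip g s t : sqint leb2 g -> s <= t ->
  sqi leb2 (strip s t) g = (fine (sqi leb2 (below t) g) - fine (sqi leb2 (below s) g))%:E.
Proof.
move=> sg st; have [mg fg] := sg.
have mb := measurable_below; have ms := measurable_strip s t.
have fin A : measurable A -> sqi leb2 A g \is a fin_num.
  move=> mA; rewrite ge0_fin_numE ?sqi_ge0//; apply: le_lt_trans fg; exact: sqi_subset.
have bE : below t = below s `|` strip s t.
  apply/seteqP; split => -[y z] /=.
    move=> [/=]; rewrite in_itv/= => yt _; have [ys|ys] := ltP y s; [left|right]; split => //=.
    by rewrite in_itv/= ys.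
  move=> [[/=]|[/=]]; rewrite in_itv/=; first by move=> ys _; split => //=; rewrite in_itv/= (lt_le_trans ys).
  by move=> /andP[_ yt] _; split => //=; rewrite in_itv.
have E : sqi leb2 (below t) g = (sqi leb2 (below s) g + sqi leb2 (strip s t) g)%E.
  rewrite /sqi bE ge0_integral_setU//.
  - exact: mb.
  - by apply: measurable_sqr; exact: measurable_funTS.
  - by move=> x _; rewrite lee_fin sqr_ge0.
  - rewrite disj_set2E; apply/eqP; apply/seteqP; split => // -[y z] /= [[/=]].
    rewrite in_itv/= => ys _ [/=]; rewrite in_itv/= => /andP[sy _].
    by have := le_lt_trans sy ys; rewrite ltxx.
rewrite E; move: (sqi leb2 (below s) g) (sqi leb2 (strip s t) g) (fin _ (mb s)) (fin _ ms).
by move=> [x| |] [y| |] //= _ _; rewrite addrAC subrr add0r.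
Qed.

(** Each slab is bounded by [kap] times the energy in a strip 12 slabs wide. The strips overlap 12
    times, so the sum over all slabs is at most 12 kap = del times the total energy, with a bound
    independent of the number of slabs. *)
Lemma tail_small Om H (y0 : R) : open Om ->
  (forall t, y0 <= t -> 0 < H t) -> (forall s t, y0 <= s -> s <= t -> H t <= H s) ->
  (forall t, y0 < t -> derivable H t 1) ->
  derive1 (fun t => ln (H t)) t @[t --> +oo%R] --> -oo%R ->
  Om `&` [set x | y0 < x.1] = peak H y0 ->
  forall del, 0 < del -> exists rho, almost_small Om (Om `&` [set x | rho <= x.1]) del.
Proof.
move=> oOm Hpos Hdec dH Hlog Opk del d0.
pose kap := del / 12; have k0 : 0 < kap by rewrite divr_gt0.
pose K := Clayer : R; have K0 : 0 < K by exact: Clayer_gt0.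
have H0 := Hpos _ (lexx y0).
(* The order of choices matters: l makes the horizontal energy term small, then q the two remaining
   terms, and only then is rho taken so far out that H shrinks by q over the length l. *)
pose l := Num.min 1 (kap / K); have l0 : 0 < l by rewrite lt_min ltr01 divr_gt0.
have Kl : K * l ^+ 4 <= kap.
  have l1 : l <= 1 by rewrite ge_min lexx.
  have ll : K * l <= kap by rewrite mulrC -ler_pdivlMr// ge_min lexx orbT.
  apply: le_trans ll; rewrite ler_pM2l// exprS ler_piMr ?(ltW l0)//.
  by rewrite exprn_ile1// ltW.
pose M1 := K * (10 * K); pose M2 := K * (2 * H y0 ^+ 4 * K).
have M10 : 0 < M1 by rewrite /M1 !mulr_gt0.
have M20 : 0 < M2 by rewrite /M2 !mulr_gt0// exprn_gt0.
pose q := Num.min 5^-1 (Num.min (kap / M1) (kap / M2)).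
have q0 : 0 < q by rewrite !lt_min invr_gt0 ltr0n !divr_gt0.
have q5 : q <= 5^-1 by rewrite ge_min lexx.
have q1 : q * M1 <= kap by rewrite -ler_pdivlMr// !ge_min lexx /= orbT.
have q2 : q * M2 <= kap by rewrite -ler_pdivlMr// !ge_min lexx /= !orbT.
have eM1 : Clayer * (10 * q * Clayer) <= kap.
  by apply: le_trans q1; rewrite /M1 -/K; move: (K) => c; rewrite le_eqVlt; apply/orP; left; apply/eqP; ring.
have eM2 : Clayer * (2 * q * H y0 ^+ 4 * Clayer) <= kap.
  by apply: le_trans q2; rewrite /M2 -/K; move: (K) => c; rewrite le_eqVlt; apply/orP; left; apply/eqP; ring.
have Hpos' t : y0 < t -> 0 < H t by move=> /ltW; exact: Hpos.
have [rho yr Hrho] := fast_decay Hpos' dH Hlog l0 q0.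
(* The offset 5 l ensures a k - 4 l > y0, so that the windows lie in the peak, and a k - l >= rho,
   where the decay estimate holds. *)
pose a (k : nat) := rho + 5 * l + k%:R * l.
exists (a 0%N); apply: almost_small_le => u g1 g2 Wu; have [su s1 s2 _ _] := Wu.
have [[mu fu] [m1 _] [m2 _]] := And3 su s1 s2.
(* b k = a k - 10 l is the left end of the strip for the slab k; its right end a k + 2 l is b (k +
   12). *)
pose b (k : nat) := rho - 5 * l + k%:R * l.
pose Phi g (k : nat) := fine (sqi leb2 (below (b k)) g).
pose Psi k := Phi u k + Phi g1 k + Phi g2 k.
have PhiB g k : sqint leb2 g -> 0 <= Phi g k <= dot leb2 g g.
  move=> sg; rewrite /Phi fine_ge0 ?sqi_ge0//= -lee_fin -dot_sqi//.
  have [mg fg] := sg; have mb := measurable_below (b k).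
  have sub : (sqi leb2 (below (b k)) g <= sqi leb2 setT g)%E by apply: sqi_subset.
  rewrite fineK// ge0_fin_numE ?sqi_ge0//; exact: le_lt_trans fg.
have PsiB k : 0 <= Psi k <= energy u g1 g2.
  have /andP[h1 h2] := PhiB _ k su; have /andP[h3 h4] := PhiB _ k s1.
  have /andP[h5 h6] := PhiB _ k s2.
  by rewrite /Psi /energy !addr_ge0//= !lerD.
have aS k : a k.+1 = a k + l.
  by rewrite /a (_ : k.+1%:R = k%:R + 1); [ring|rewrite natr1].
have slab k : (sqi leb2 (Om `&` strip (a k) (a k.+1)) u <= (kap * (Psi (k + 12)%N - Psi k))%:E)%E.
  have kl0 : 0 <= k%:R * l by rewrite mulr_ge0// ltW.
  have ya : y0 < a k - 4 * l by rewrite /a; move: (k%:R * l) kl0 => x x0; clear -yr l0 x0; lra.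
  have Ha : H (a k) <= q * H (a k - l).
    have -> : H (a k) = H ((a k - l) + l) by rewrite subrK.
    by apply: Hrho; rewrite /a; move: (k%:R * l) kl0 => x x0; clear -l0 x0; lra.
  have qq : 0 < q <= 5^-1 by rewrite q0.
  rewrite aS; apply: le_trans (tail_slab oOm Wu Hpos Hdec Opk l0 ya qq Ha) _.
  have bk : a k - 10 * l = b k by rewrite /a /b; ring.
  have bk12 : a k + 2 * l = b (k + 12)%N by rewrite /a /b natrD; ring.
  have bb : b k <= b (k + 12)%N.
    by rewrite -bk -bk12; move: (a k) => x; clear -l0; lra.
  rewrite bk bk12 !sqi_strip// -?(EFinM, EFinD) lee_fin -/(Phi u k) -/(Phi g1 k) -/(Phi g2 k).
  rewrite -/(Phi u (k + 12)%N) -/(Phi g1 (k + 12)%N) -/(Phi g2 (k + 12)%N).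
  have mono g : sqint leb2 g -> 0 <= Phi g (k + 12)%N - Phi g k.
    by move=> sg; rewrite -lee_fin /Phi -sqi_strip// sqi_ge0.
  have e1 := mono _ su; have e2 := mono _ s1; have e3 := mono _ s2.
  have -> : Psi (k + 12)%N - Psi k = (Phi u (k + 12)%N - Phi u k) +
     ((Phi g1 (k + 12)%N - Phi g1 k) + (Phi g2 (k + 12)%N - Phi g2 k)) by rewrite /Psi; ring.
  move: (Phi u _ - _) (Phi g1 _ - _) (Phi g2 _ - _) e1 e2 e3 => x y z x0 y0' z0.
  rewrite [kap * _]mulrDr [kap * (y + z)]mulrDr.
  by apply: lerD; [|apply: lerD]; apply: ler_wpM2r.
pose F N := Om `&` strip (a 0%N) (a N).
have mF N : measurable (F N).
  by apply: measurableI; [exact: open_plane_measurable|exact: measurable_strip].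
have a_homo (N N' : nat) : (N <= N')%N -> a N <= a N'.
  by move=> NN; rewrite /a lerD2l ler_wpM2r ?(ltW l0)// ler_nat.
have sumF N : (sqi leb2 (F N) u <= (\sum_(k < N) kap * (Psi (k + 12)%N - Psi k))%:E)%E.
  elim: N => [|N IH].
    rewrite big_ord0 (_ : F 0%N = set0) ?/sqi ?integral_set0//.
    apply/seteqP; split => // -[y z] [_ [/=]]; rewrite in_itv/= => /andP[h1 h2].
    by have := le_lt_trans h1 h2; rewrite ltxx.
  have mS : measurable (Om `&` strip (a N) (a N.+1)).
    by apply: measurableI; [exact: open_plane_measurable|exact: measurable_strip].
  rewrite big_ord_recr/= EFinD.
  apply: le_trans (leeD IH (slab N)); apply: le_trans (sqiU (mF N) mS mu).
  have mU : measurable (F N `|` (Om `&` strip (a N) (a N.+1))) by exact: measurableU.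
  apply: sqi_subset; [exact: mF|exact: mU| |exact: measurable_funTS].
  move=> [y z] [Ox [/=]]; rewrite in_itv/= => /andP[h1 h2] _.
  by have [h|h] := ltP y (a N); [left|right]; split => //; split => //=; rewrite in_itv/= ?h1 ?h.
have boundF N : (sqi leb2 (F N) u <= (del * energy u g1 g2)%:E)%E.
  apply: le_trans (sumF N) _; rewrite -mulr_sumr telescope_shift lee_fin.
  have dk : del = kap * 12 by rewrite /kap divfK.
  rewrite dk -mulrA ler_pM2l//.
  have s0 : 0 <= \sum_(i < 12) Psi i by apply: sumr_ge0 => i _; have /andP[] := PsiB i.
  have : \sum_(i < 12) Psi (N + i)%N <= \sum_(i < 12) energy u g1 g2.
    by apply: ler_sum => i _; have /andP[] := PsiB (N + i)%N.
  rewrite sumr_const card_ord -[_ *+ 12]mulr_natl => h.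
  by apply: le_trans h; rewrite gerBl.
have UF : Om `&` [set x | a 0%N <= x.1] = \bigcup_N F N.
  apply/seteqP; split => [[y z] [Ox /= h]|[y z] [N _ [Ox [/=]]]]; last first.
    by rewrite in_itv/= => /andP[h _] _.
  pose t := (y - a 0%N) / l.
  exists (Num.truncn t).+1 => //; split => //; split => //=; rewrite in_itv/= h/=.
  have := truncnS_gt t; rewrite /t ltr_pdivrMr// /a; move: (Num.truncn _).+1 => n.
  by rewrite mul0r addr0; clear; lra.
rewrite UF; apply: sqi_bigcup_le => //.
move=> N N' NN; apply/subsetPset => -[y z] [Ox [/=]]; rewrite in_itv/= => /andP[h1 h2] _.
by split => //; split => //=; rewrite in_itv/= h1 (lt_le_trans h2)// a_homo.
Qed.

End tail.

Lemma increasing_ge_id (s : nat -> nat) : {homo s : m n / (m < n)%N} -> forall n, (n <= s n)%N.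
Proof. by move=> hs; elim=> // n IH; apply: leq_ltn_trans IH _; exact: hs. Qed.

(** Iterated Bolzano-Weierstrass: [S k.+1] refines [S k] so that c k converges along it. From the
    rank i on, the diagonal is extracted from [S i.+1], hence the index [S n.+1 n]. *)
Lemma diagonal_extraction (R : realType) (c : nat -> nat -> R) :
  (forall i, exists M, forall n, `|c i n| <= M) ->
  exists s : nat -> nat, {homo s : m n / (m < n)%N} /\
    forall i e, 0 < e -> exists N, forall m n, (N <= m)%N -> (N <= n)%N ->
      `|c i (s m) - c i (s n)| < e.
Proof.
move=> bc.
have /choice[f Hf] : forall p : nat * (nat -> nat), exists t : nat -> nat,
    {homo t : m n / (m < n)%N} /\ cvgn (c p.1 \o (p.2 \o t)).
  move=> [i s] /=; have [M HM] := bc i.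
  have bu : bounded_fun (c i \o s).
    exists M; split; first exact: num_real.
    by move=> M' MM' n _ /=; apply: le_trans (HM _) _; exact: ltW.
  have [t /increasing_seqP ti ct] := bolzano_weierstrass bu.
  exists t; split; last exact: ct.
  by apply: homo_ltn => // x y z; exact: ltn_trans.
pose S := fix S (k : nat) : nat -> nat := if k is k'.+1 then S k' \o f (k', S k') else id.
have SS k : S k.+1 = S k \o f (k, S k) by [].
have fh p : {homo f p : m n / (m < n)%N} by have [] := Hf p.
have Sh k : {homo S k : m n / (m < n)%N}.
  by elim: k => [//|k IH] m n mn; rewrite SS /=; apply: IH; exact: fh.
have Sfac k m : exists2 r : nat -> nat, {homo r : m n / (m < n)%N} & S (k + m)%N = S k \o r.
  elim: m => [|m [r rh rE]]; first by exists id => //; rewrite addn0.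
  exists (r \o f ((k + m)%N, S (k + m)%N)); first by move=> x y xy; apply: rh; exact: fh.
  by rewrite addnS SS {1}rE.
exists (fun n => S n.+1 n); split.
  apply: homo_ltn => [x y z|n]; first exact: ltn_trans.
  rewrite [S n.+2]SS /=; apply: Sh; apply: (fh _).
  exact: (increasing_ge_id (fh _)).
move=> i e e0.
have [_ cc] := Hf (i, S i); rewrite /= -SS in cc.
have /cvg_ex[l cl] := cc.
have e2 : 0 < e / 2 by rewrite divr_gt0.
have [N _ HN] : \forall n \near \oo, `|l - (c i \o (S i \o f (i, S i))) n| < e / 2.
  by move/cvgrPdist_lt : cl; apply.
exists (maxn i N) => m n; rewrite !geq_max => /andP[im Nm] /andP[in_ Nn].
have near_l k : (i <= k)%N -> (N <= k)%N -> `|l - c i (S k.+1 k)| < e / 2.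
  move=> ik Nk; have [r rh rE] := Sfac i.+1 (k - i)%N.
  rewrite (_ : k.+1 = (i.+1 + (k - i))%N); last by rewrite addSn subnKC.
  rewrite rE SS; apply: HN => /=; apply: leq_trans Nk _.
  exact: (increasing_ge_id rh).
rewrite (splitr e); apply: le_lt_trans (ltrD (near_l _ im Nm) (near_l _ in_ Nn)).
rewrite (_ : c i (S m.+1 m) - _ = (l - c i (S n.+1 n)) - (l - c i (S m.+1 m))); last by ring.
by apply: le_trans (ler_normB _ _) _; rewrite addrC.
Qed.

(** * Precompactness on the whole domain and Cauchy subsequences *)

Section peaked_domain.
Context {R : realType}.
Local Notation plane := (R * R)%type.
Local Notation leb1 := (@lebesgue_measure R).
Local Notation leb2 := (leb1 \x leb1)%E.
Implicit Types (Om E : set plane) (H : R -> R) (u g w : plane -> R).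

Lemma smooth_ray_derivable (a : R) H : smooth_on_ray a H -> forall t, a < t -> derivable H t 1.
Proof.
move=> [g sg Hg] t at_; have dg := sg 0%N t; rewrite /= in dg.
apply: near_eq_derivable dg.
by apply: filterS (lt_nbhsr at_) => s as_; rewrite Hg// ltW.
Qed.

(** Half of del is spent on the far peak. What remains has compact closure, and each point of that
    closure lies either in [Om] or on the frontier, so the interior and boundary results apply
    locally. *)
Lemma domain_precompact Om H (y0 : R) : open Om -> smooth_boundary Om ->
  (forall t, y0 <= t -> 0 < H t) -> (forall s t, y0 <= s -> s <= t -> H t <= H s) ->
  (forall t, y0 < t -> derivable H t 1) ->
  derive1 (fun t => ln (H t)) t @[t --> +oo%R] --> -oo%R ->
  Om `&` [set x | y0 < x.1] = peak H y0 ->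
  bounded_set (Om `\` [set x | y0 < x.1]) ->
  precompact_on Om Om.
Proof.
move=> oOm sOm Hpos Hdec dH Hlog Opk bOm del d0.
have d2 : 0 < del / 2 by rewrite divr_gt0.
have [rho Hrho] := tail_small oOm Hpos Hdec dH Hlog Opk d2.
pose E0 := Om `&` [set x | x.1 <= rho].
have [M M0 HM] := pinfty_ex_gt0 bOm.
(* M bounds the part outside the peak; in the peak up to rho, |rho| and |y0| bound the first
   coordinate and H y0 the second. *)
pose M' := M + `|rho| + H y0 + `|y0|.
have E0sub : E0 `<=` `[- M', M']%classic `*` `[- M', M']%classic.
  move=> [y z] [Ox /= yr]; have Hy0 := Hpos _ (lexx y0).
  have r1 := ler_norm rho; have y1 := ler_norm (- y0); rewrite normrN in y1.
  have n1 := normr_ge0 rho; have n2 := normr_ge0 y0.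
  have [y0y|yy0] := ltP y0 y.
    have : (Om `&` [set x | y0 < x.1]) (y, z) by [].
    rewrite Opk => -[_ /= /andP[z1 z2]]; have Hy := Hdec _ _ (lexx y0) (ltW y0y).
    rewrite /M'; move: (`|rho|) (`|y0|) r1 y1 n1 n2 => a b r1 y1 n1 n2.
    by split; rewrite /= in_itv/=; apply/andP; split; lra.
  have : (Om `\` [set x | y0 < x.1]) (y, z) by split => //=; rewrite ltNge yy0.
  move=> /HM /=; rewrite prod_normE /= ge_max => /andP[].
  rewrite !ler_norml => /andP[h1 h2] /andP[h3 h4].
  rewrite /M'; move: (`|rho|) (`|y0|) n1 n2 => a b n1 n2.
  by split; rewrite /= in_itv/=; apply/andP; split; lra.
have cR : compact (`[- M', M']%classic `*` `[- M', M']%classic : set plane).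
  by apply: compact_setX; exact: segment_compact.
have cK : compact (closure E0).
  apply: (subclosed_compact _ cR); first exact: closed_closure.
  have clR : closed (`[- M', M']%classic `*` `[- M', M']%classic : set plane).
    by apply: compact_closed => //; exact: norm_hausdorff.
  by rewrite closureE => x; apply; split.
have pE0 : precompact_on Om E0.
  apply: (precompact_on_compact cK); first exact: subset_closure.
  move=> x clx; have [Ox|nOx] := pselect (Om x).
    have [e e0 He] := open_box oOm Ox; have e2 : 0 < e / 2 by rewrite divr_gt0.
    exists (square x (e / 2)); first exact: nbhs_box.
    apply: (@precompact_onW _ _ _ (`[x.1 - e / 2, x.1 + e / 2]%classic `*` `[x.2 - e / 2, x.2 + e / 2]%classic)).
      by move=> [y z] [[/= /andP[h1 h2] /andP[h3 h4]] _]; split; rewrite /= in_itv/= !ltW.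
    apply: precompact_on_inside => //; first by apply: compact_setX; exact: segment_compact.
    move=> [y z] [/=]; rewrite !in_itv/= => /andP[h1 h2] /andP[h3 h4].
    by apply: He; split; apply/andP; split => /=; clear -h1 h2 h3 h4 e0; lra.
  have fx : frontier Om x.
    split; first by apply: closure_subset clx => y [].
    exact: subset_closure.
  have [U nU HU] := boundary_precompact oOm sOm fx.
  by exists U => //; apply: precompact_onW HU => y [Uy [Oy _]].
have [B [mB EB HB]] := pE0 _ d2.
exists (B `|` (Om `&` [set x | rho <= x.1])).
have mT : measurable (Om `&` [set x : plane | rho <= x.1]).
  apply: measurableI; first exact: open_plane_measurable.
  rewrite (_ : [set x : plane | rho <= x.1] = `[rho, +oo[%classic `*` setT); last first.
    by apply/seteqP; split => [x /= h|x [/=]]; rewrite ?in_itv/= andbT.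
  by apply: measurableX => //; exact: measurable_itv.
split; first exact: measurableU.
  by move=> x Ox; have [h|h] := leP rho x.1; [right|left; apply: EB; split => //=; exact: ltW].
by rewrite (splitr del); exact: almost_smallU.
Qed.

Lemma dotB_le u w : sqint leb2 u -> sqint leb2 w ->
  dot leb2 (fun x => u x - w x) (fun x => u x - w x) <= 2 * dot leb2 u u + 2 * dot leb2 w w.
Proof.
move=> su sw; have sd := sqintB su sw; have [[mu _] [mw _]] := (su, sw).
rewrite -lee_fin -dot_sqi// EFinD !EFinM -!dot_sqi//.
have -> : (fun x => u x - w x) = (fun x => u x + (-1) * w x) by apply/funext => x; rewrite mulN1r.
have mw' : measurable_fun setT (fun x => (-1) * w x) by exact: measurable_funM.
apply: le_trans (sqiD leb2 measurableT mu mw') _.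
by rewrite sqiZ// sqrrN expr1n mul1e.
Qed.

Lemma twice_diffB Om u g1 g2 u' g1' g2' : twice_diff Om u g1 g2 -> twice_diff Om u' g1' g2' ->
  twice_diff Om (fun x => u x - u' x) (fun x => g1 x - g1' x) (fun x => g2 x - g2' x).
Proof.
move=> [su s1 s2 W1 W2] [su' s1' s2' W1' W2']; split; try exact: sqintB.
- move=> c d c' d' al be QO ta tb.
  have tk : test1 c d (derive1 (derive1 al)) by do 2 apply: test1_derive.
  rewrite (dotBl su su' (sqint_tensor_test tk tb)) (dotBl s1 s1' (sqint_tensor_test ta tb)).
  by rewrite (W1 _ _ _ _ _ _ QO ta tb) (W1' _ _ _ _ _ _ QO ta tb).
- move=> c d c' d' al be QO ta tb.
  have tk : test1 c' d' (derive1 (derive1 be)) by do 2 apply: test1_derive.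
  rewrite (dotBl su su' (sqint_tensor_test ta tk)) (dotBl s2 s2' (sqint_tensor_test ta tb)).
  by rewrite (W2 _ _ _ _ _ _ QO ta tb) (W2' _ _ _ _ _ _ QO ta tb).
Qed.

(** For each precision 1 / (k + 1) there is a finite list of functionals, which makes countably many
    in all. A diagonal subsequence along which all of them converge is Cauchy, since the energy of
    differences stays bounded. *)
Lemma cauchy_subsequence Om : measurable Om -> precompact_on Om Om ->
  forall (u_ g1_ g2_ : nat -> plane -> R) (M : R),
  (forall n, twice_diff Om (u_ n) (g1_ n) (g2_ n)) ->
  (forall n, energy (u_ n) (g1_ n) (g2_ n) <= M) ->
  exists s : nat -> nat, {homo s : m n / (m < n)%N} /\
    forall e, 0 < e -> exists N, forall m n, (N <= m)%N -> (N <= n)%N ->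
      (sqi leb2 Om (fun x => u_ (s m) x - u_ (s n) x)%R <= e%:E)%E.
Proof.
move=> mOm pO u_ g1_ g2_ M HW HM.
have M0 : 0 <= M by apply: le_trans (HM 0%N); exact: energy_ge0.
have /choice[ws Hws] : forall k : nat, exists ws, List.Forall (sqint leb2) ws /\
    forall u g1 g2, twice_diff Om u g1 g2 ->
    (sqi leb2 Om u <= (moments ws u + k.+1%:R^-1 * energy u g1 g2)%:E)%E.
  move=> k; have [|B [mB OB [ws sws Hws]]] := pO k.+1%:R^-1; first by rewrite invr_gt0.
  exists ws; split => // u g1 g2 Wu; apply: le_trans (Hws _ _ _ Wu).
  by have [[mu _] _ _ _ _] := Wu; apply: sqi_subset => //; exact: measurable_funTS.
(* An enumeration of all functions of all the lists, with 0 as filler. *)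
pose wt (j : nat) : plane -> R :=
  if (unpickle j : option (nat * nat)) is Some (k, i) then nth (cst 0) (ws k) i else cst 0.
have swk k i : sqint leb2 (nth (cst 0) (ws k) i).
  have [+ _] := Hws k; elim: (ws k) i => [|w l IH] [|i] /= sw; try exact: sqint0.
    by inversion sw.
  by apply: IH; inversion sw.
have swt j : sqint leb2 (wt j).
  by rewrite /wt; case: unpickle => [[k i]|]; [exact: swk|exact: sqint0].
have [|s [sh sc]] := @diagonal_extraction R (fun j n => dot leb2 (u_ n) (wt j)).
  move=> j; exists (Num.sqrt (M * dot leb2 (wt j) (wt j))) => n.
  have [su s1 s2 _ _] := HW n.
  rewrite -sqrtr_sqr ler_sqrt ?mulr_ge0 ?dot_ge0//.
  apply: le_trans (dot_CS su (swt j)) _; apply: ler_wpM2r; first exact: dot_ge0.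
  by apply: le_trans (HM n); rewrite /energy -addrA lerDl addr_ge0// dot_ge0.
exists s; split => // e e0.
have e2 : 0 < e / 2 by rewrite divr_gt0.
(* 4 M bounds the energy of a difference of two members of energy at most M. *)
have [k kM] : exists k : nat, k.+1%:R^-1 * (4 * M) <= e / 2.
  exists (Num.truncn ((4 * M) / (e / 2))).
  by rewrite ler_pdivrMl// -ler_pdivrMr// ltW// truncnS_gt.
have [_ Hk] := Hws k.
have [N HN] : exists N, forall m n, (N <= m)%N -> (N <= n)%N ->
    moments (ws k) (fun x => u_ (s m) x - u_ (s n) x) <= e / 2.
  have key (i : nat) d : 0 < d -> exists N, forall m n, (N <= m)%N -> (N <= n)%N ->
      dot leb2 (fun x => u_ (s m) x - u_ (s n) x) (nth (cst 0) (ws k) i) ^+ 2 <= d.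
    move=> dd0; have sd : 0 < Num.sqrt d by rewrite sqrtr_gt0.
    have [N HN] := sc (pickle (k, i)) _ sd; exists N => m n Nm Nn.
    have := HN _ _ Nm Nn; rewrite /wt pickleK => h.
    have [sm _ _ _ _] := HW (s m); have [sn _ _ _ _] := HW (s n).
    rewrite (dotBl sm sn (swk k i)) -[leRHS]sqr_sqrtr ?(ltW dd0)//.
    by rewrite -[leLHS]real_normK ?num_real// lerXn2r ?nnegrE ?sqrtr_ge0// ltW.
  have mE v : moments (ws k) v = \sum_(i < size (ws k)) dot leb2 v (nth (cst 0) (ws k) i) ^+ 2.
    by rewrite /moments (big_nth (cst 0)) big_mkord.
  have : forall j d, 0 < d -> exists N, forall m n, (N <= m)%N -> (N <= n)%N ->
    \sum_(i < j) dot leb2 (fun x => u_ (s m) x - u_ (s n) x) (nth (cst 0) (ws k) i) ^+ 2 <= d.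
    elim=> [|j IH] d dd0; first by exists 0%N => m n _ _; rewrite big_ord0 ltW.
    have d20 : 0 < d / 2 by rewrite divr_gt0.
    have [N1 H1] := IH _ d20; have [N2 H2] := key j _ d20.
    exists (maxn N1 N2) => m n; rewrite !geq_max => /andP[m1 m2] /andP[n1 n2].
    by rewrite big_ord_recr/= (splitr d) lerD// ?H1 ?H2.
  by move=> /(_ (size (ws k)) _ e2) [N HN]; exists N => m n Nm Nn; rewrite mE; exact: HN.
exists N => m n Nm Nn.
have Wmn := twice_diffB (HW (s m)) (HW (s n)).
apply: le_trans (Hk _ _ _ Wmn) _; rewrite lee_fin (splitr e); apply: lerD; first exact: HN.
apply: le_trans kM; apply: ler_wpM2l => //.
have [a1 a2 a3 _ _] := HW (s m); have [b1 b2 b3 _ _] := HW (s n).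
have := dotB_le a1 b1; have := dotB_le a2 b2; have := dotB_le a3 b3.
have := HM (s m); have := HM (s n); rewrite /energy.
move: (dot leb2 _ _) (dot leb2 _ _) (dot leb2 _ _) (dot leb2 _ _) (dot leb2 _ _)
  (dot leb2 _ _) (dot leb2 _ _) (dot leb2 _ _) (dot leb2 _ _).
by clear=> x1 x2 x3 x4 x5 x6 x7 x8 x9; lra.
Qed.

End peaked_domain.

(** * Weak derivatives and traces *)

Section L2_spaces.
Context {R : realType}.
Local Notation plane := (R * R)%type.
Local Notation leb1 := (@lebesgue_measure R).
Local Notation leb2 := (leb1 \x leb1)%E.
Implicit Types (Om : set plane) (u v w f g : plane -> R).

Lemma L2normE Om u : L2norm Om u = sqrte (sqi leb2 Om u).
Proof.
rewrite /L2norm unlock -poweR12_sqrt ?sqi_ge0// -sqi_restrict /sqi; congr (_ `^ _)%E.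
apply: eq_integral => x _ /=; rewrite powR_mulrn//.
by rewrite real_normK ?num_real.
Qed.

Lemma L2P Om u : L2 Om u <-> sqint leb2 (u \_ Om).
Proof.
rewrite /L2 /sqint sqi_restrict.
have fE : finite_norm leb2 2%:E (u \_ Om) <-> (sqi leb2 Om u < +oo)%E.
  rewrite /finite_norm -/(L2norm Om u) L2normE; have := sqi_ge0 leb2 Om u.
  by case: sqi => [r| |]//= _; rewrite !ltry.
split => [h|[mu fu]].
  by split; [have := sub_Lfun_mfun h|have := sub_Lfun_finLfun h]; rewrite inE// => /fE.
by apply/andP; split; rewrite inE//=; exact/fE.
Qed.

Lemma L2norm_cvg0P Om (f : nat -> plane -> R) :
  L2norm Om (f n) @[n --> \oo] --> 0%E <->
  forall e : R, 0 < e -> exists N, forall n, (N <= n)%N -> (sqi leb2 Om (f n) <= e%:E)%E.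
Proof.
split => [/fine_cvgP[ff cf] e e0|H].
  have se : 0 < Num.sqrt e by rewrite sqrtr_gt0.
  have [N _ HN] : \forall n \near \oo, `|0 - fine (L2norm Om (f n))| < Num.sqrt e.
    by move/cvgrPdist_lt : cf; apply.
  have [N' _ HN'] := ff; exists (maxn N N') => n; rewrite geq_max => /andP[/HN /= + /HN' /=].
  rewrite L2normE; have := sqi_ge0 leb2 Om (f n).
  case: sqi => [r| |]//=; rewrite !lee_fin => r0.
  by rewrite sub0r normrN ger0_norm ?sqrtr_ge0// ltr_sqrt// => /ltW.
have H' (e : R) : 0 < e -> exists N, forall n, (N <= n)%N ->
    exists2 r, sqi leb2 Om (f n) = r%:E & 0 <= r <= e.
  move=> /H[N HN]; exists N => n /HN; have := sqi_ge0 leb2 Om (f n).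
  by case: sqi => [r| |]//; rewrite !lee_fin => r0 re; exists r; rewrite ?r0.
apply/fine_cvgP; split.
  have [N HN] := H' 1 ltr01; exists N => // n /HN[r + _].
  by rewrite /= L2normE => ->.
apply/cvgrPdist_le => e e0; have [N HN] := H' _ (exprn_gt0 2 e0).
exists N => // n /HN[r + /andP[r0 re]]; rewrite /= L2normE => ->.
rewrite sub0r normrN /= ger0_norm ?sqrtr_ge0//.
by rewrite -[leRHS]gtr0_norm// -sqrtr_sqr ler_sqrt ?sqr_ge0.
Qed.

End L2_spaces.

(** * Tensor products as smooth functions of two variables *)

Section tensors.
Context {R : realType}.
Local Notation plane := (R * R)%type.
Implicit Types (Om : set plane) (f g : plane -> R).

Lemma line_is_derive (F : plane -> R) x v (l : R) :
  is_derive (0 : R) 1 (fun t : R => F (t *: v + x)) l -> is_derive x v F l.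
Proof.
have E : (fun h : R => h^-1 *: (((fun t : R => F (t *: v + x)) \o shift 0) (h *: (1 : R))
            - F (0 *: v + x))) =
         (fun h : R => h^-1 *: ((F \o shift x) (h *: v) - F x)).
  apply/funext => h /=; congr (_ *: (F _ - F _)); last by rewrite scale0r add0r.
  by rewrite addr0 -[h *: 1]/(h * 1) mulr1.
move=> [d1 d2]; split; first by move: d1; rewrite /derivable E.
by move: d2; rewrite /derive E.
Qed.

Lemma is_derive_tensor (a b : R -> R) (x v : plane) : smooth1 a -> smooth1 b ->
  is_derive x v (tensor a b) (v.1 * tensor (derive1 a) b x + v.2 * tensor a (derive1 b) x).
Proof.
move=> sa sb; apply: line_is_derive.
have comp (h : R -> R) c d : smooth1 h -> is_derive (0 : R) 1 (fun t : R => h (t * c + d)) (c * derive1 h d).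
  move=> sh; have dl : is_derive (0 : R) 1 (fun t : R => t * c + d) c.
    have := is_deriveD (is_deriveM (is_derive_id (0 : R) 1) (is_derive_cst c (0 : R) 1))
      (is_derive_cst d (0 : R) 1).
    move=> h1; apply: is_derive_eq h1 _; rewrite scaler0 add0r addr0.
    by rewrite -[c *: 1]/(c * 1) mulr1.
  have dh : is_derive ((fun t : R => t * c + d) 0) 1 h (derive1 h d).
    by have := smooth1_is_derive d sh; rewrite /= mul0r add0r.
  by have := @is_derive1_comp _ h (fun t : R => t * c + d) 0 _ _ dh dl; rewrite mulrC.
have := is_deriveM (comp _ v.1 x.1 sa) (comp _ v.2 x.2 sb).
move=> h; apply: is_derive_eq h _; rewrite /tensor !mul0r !add0r.
rewrite -[_ *: (_ * derive1 b _)]/(_ * _) -[_ *: (_ * derive1 a _)]/(_ * _); ring.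
Qed.

Lemma continuous_tensor (a b : R -> R) : continuous a -> continuous b -> continuous (tensor a b : plane -> R).
Proof.
move=> ca cb x; apply: cvgM.
  by apply: (@continuous_comp _ _ _ fst a); [exact: cvg_fst|exact: ca].
by apply: (@continuous_comp _ _ _ snd b); [exact: cvg_snd|exact: cb].
Qed.

(** A directional derivative of a tensor product is a combination of two tensor products. The span
    is closed under all directional derivatives, as [smooth2] demands. *)
Inductive tensor_span : (plane -> R) -> Prop :=
| tensor_span_tensor a b : smooth1 a -> smooth1 b -> tensor_span (tensor a b)
| tensor_spanD f g : tensor_span f -> tensor_span g -> tensor_span (fun x => f x + g x)
| tensor_spanZ c f : tensor_span f -> tensor_span (fun x => c * f x).

Lemma tensor_span_derive f : tensor_span f -> continuous f /\
  forall v, (forall x, derivable f x v) /\ tensor_span ('D_v f).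
Proof.
elim=> {f} [a b sa sb|f g sf [cf IHf] sg [cg IHg]|c f sf [cf IHf]].
- split; first by apply: continuous_tensor; exact: smooth1_continuous.
  move=> v; split => [x|]; first by have [] := is_derive_tensor x v sa sb.
  have -> : 'D_v (tensor a b) = fun x => v.1 * tensor (derive1 a) b x + v.2 * tensor a (derive1 b) x.
    by apply/funext => x; have [] := is_derive_tensor x v sa sb.
  exact: (tensor_spanD (tensor_spanZ _ (tensor_span_tensor (smooth1_derive sa) sb))
    (tensor_spanZ _ (tensor_span_tensor sa (smooth1_derive sb)))).
- split; first by move=> x; apply: cvgD; [exact: cf|exact: cg].
  move=> v; have [df tf] := IHf v; have [dg tg] := IHg v.
  have d x := is_deriveD (derivableP (df x)) (derivableP (dg x)).
  split => [x|]; first by have [] := d x.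
  have -> : 'D_v (fun x => f x + g x) = fun x => 'D_v f x + 'D_v g x.
    by apply/funext => x; have [] := d x.
  exact: tensor_spanD.
- split; first by move=> x; apply: cvgM; [exact: cvg_cst|exact: cf].
  move=> v; have [df tf] := IHf v.
  have d x := is_deriveZ c (derivableP (df x)).
  split => [x|]; first by have [] := d x.
  have -> : 'D_v (fun x => c * f x) = fun x => c * 'D_v f x.
    by apply/funext => x; have [] := d x.
  exact: tensor_spanZ.
Qed.

Lemma smooth2_tensor_span f : tensor_span f -> smooth2 f.
Proof.
move=> tf s /=; suff : tensor_span (foldr (fun (v : plane) (g : plane -> R) => 'D_v g) f s).
  by move=> /tensor_span_derive[cs H]; split => // x v; have [] := H v.
by elim: s => //= v s IH; have [_ /(_ v)[]] := tensor_span_derive IH.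
Qed.

Lemma smooth2_tensor (a b : R -> R) : smooth1 a -> smooth1 b -> smooth2 (tensor a b : plane -> R).
Proof. by move=> sa sb; apply: smooth2_tensor_span; exact: tensor_span_tensor. Qed.

Lemma derive_tensor1 (a b : R -> R) : smooth1 a -> smooth1 b ->
  'D_((1, 0) : plane) (tensor a b) = tensor (derive1 a) b.
Proof.
move=> sa sb; apply/funext => x; have [_ ->] := is_derive_tensor x (1, 0) sa sb.
by rewrite /= mul1r mul0r addr0.
Qed.

Lemma derive_tensor2 (a b : R -> R) : smooth1 a -> smooth1 b ->
  'D_((0, 1) : plane) (tensor a b) = tensor a (derive1 b).
Proof.
move=> sa sb; apply/funext => x; have [_ ->] := is_derive_tensor x (0, 1) sa sb.
by rewrite /= mul1r mul0r add0r.
Qed.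

Lemma pderiv_tensor (i j : nat) (a b : R -> R) : smooth1 a -> smooth1 b ->
  pderiv (i, j) (tensor a b) = tensor (derive1n i a) (derive1n j b) :> (plane -> R).
Proof.
move=> sa sb; rewrite /pderiv /=.
have sn (h : R -> R) n : smooth1 h -> smooth1 (derive1n n h).
  move=> sh; elim: n => [|n IH]; first exact: sh.
  by rewrite derive1nS; apply: smooth1_derive; exact: IH.
have -> : iter j (fun g : plane -> R => 'D_(0, 1) g) (tensor a b) = tensor a (derive1n j b).
  elim: j => [|j IH] /=; first by reflexivity.
  by rewrite IH (derive_tensor2 sa (sn b j sb)) -derive1nS; reflexivity.
elim: i => [|i IH] /=; first by reflexivity.
by rewrite IH (derive_tensor1 (sn a i sa) (sn b j sb)) -derive1nS; reflexivity.
Qed.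

Lemma test_function_tensor Om c d c' d' (a b : R -> R) : box c d c' d' `<=` Om ->
  test1 c d a -> test1 c' d' b -> test_function Om (tensor a b).
Proof.
move=> QO [sa [c1 [d1 [cc1 cd1 dd1 Ha]]]] [sb [c2 [d2 [cc2 cd2 dd2 Hb]]]].
split; first exact: smooth2_tensor.
exists (`[c1, d1]%classic `*` `[c2, d2]%classic); split.
- by apply: compact_setX; exact: segment_compact.
- move=> [y z] [/=]; rewrite !in_itv/= => /andP[y1 y2] /andP[z1 z2]; apply: QO.
  by split => /=; rewrite ?(lt_le_trans cc1) ?(lt_le_trans cc2) ?(le_lt_trans y2) ?(le_lt_trans z2).
- move=> [y z] nK; rewrite /tensor/=; have [hy|/Ha ->] := boolP (c1 <= y <= d1); last by rewrite mul0r.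
  have [hz|/Hb ->] := boolP (c2 <= z <= d2); last by rewrite mulr0.
  by exfalso; apply: nK; split; rewrite /= in_itv.
Qed.

End tensors.

(** * Test functions determine locally integrable functions *)

Section weak_derivatives.
Context {R : realType}.
Local Notation plane := (R * R)%type.
Local Notation leb1 := (@lebesgue_measure R).
Local Notation leb2 := (leb1 \x leb1)%E.
Implicit Types (Om K : set plane) (u v w f g phi psi : plane -> R).

Lemma integrable_boundedM (f w : plane -> R) (M : R) : leb2.-integrable setT (EFin \o f) ->
  measurable_fun setT w -> (forall x, `|w x| <= M) ->
  leb2.-integrable setT (EFin \o (fun x => f x * w x)).
Proof.
move=> fi mw wM; have M0 : 0 <= M by apply: le_trans (wM (0, 0)).
have mf : measurable_fun setT f by apply/measurable_EFinP; exact: measurable_int fi.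
have : leb2.-integrable setT (fun x => (M%:E * (EFin \o f) x)%E) by exact: integrableZl.
apply: le_integrable => //.
  by apply/measurable_EFinP; exact: measurable_funM.
move=> x _; change (`|f x * w x|%:E <= `|M * f x|%:E)%E.
rewrite lee_fin [leLHS]normrM [leRHS]normrM [`|M|]ger0_norm// [leLHS]mulrC.
by apply: ler_wpM2r; [exact: normr_ge0|exact: wM].
Qed.

(** The bump criterion with bound 0 is used twice: in z for each fixed rational bump in y, then in y
    on almost every line. *)
Lemma tensor_vanish f (c d c' d' : R) : leb2.-integrable setT (EFin \o f) ->
  (forall (a b a' b' : rat) n m, c < ratr a -> ratr a < ratr b :> R -> ratr b < d ->
     c' < ratr a' -> ratr a' < ratr b' :> R -> ratr b' < d' ->
     dot leb2 f (tensor (smooth_bump (ratr a) (ratr b) n.+1%:R^-1)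
       (smooth_bump (ratr a') (ratr b') m.+1%:R^-1)) = 0) ->
  {ae leb2, forall x, box c d c' d' x -> f x = 0}.
Proof.
move=> fi H; have mf : measurable_fun setT f by apply/measurable_EFinP; exact: measurable_int fi.
apply: ae_of_sections.
  rewrite (_ : [set x | _] = box c d c' d' `&` (f @^-1` (~` [set 0]))); last first.
    by apply/seteqP; split => x /=; [move=> /not_implyP|move=> [h1 h2] h; apply: h2; exact: h].
  apply: measurableI; first exact: measurable_box.
  by rewrite -[X in measurable X]setTI; apply: mf => //; apply: measurableC; exact: measurable_set1.
pose be (j : rat * rat * nat) := smooth_bump (ratr j.1.1) (ratr j.1.2) j.2.+1%:R^-1 : R -> R.
have mbe j : measurable_fun setT (be j).
  by apply: continuous_measurable; apply: smooth1_continuous; apply: smooth1_bump; rewrite invr_gt0.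
have be1 j y : `|be j y| <= 1.
  by rewrite ger0_norm ?smooth_bump_ge0// smooth_bump_le1// invr_gt0.
pose V (j : rat * rat * nat) : Prop :=
  [/\ c < ratr j.1.1, ratr j.1.1 < ratr j.1.2 :> R & ratr j.1.2 < d].
have iF j : leb2.-integrable setT (EFin \o (fun x => f x * be j x.1)).
  by apply: (integrable_boundedM fi (M := 1)) => //; exact: measurable_fst_comp.
have aej : {ae leb1, forall z, forall j, V j -> c' < z < d' ->
    `|\int[leb1]_y (f (y, z) * be j y)| <= 0}.
  apply: ae_forall_count => j.
  have [[h1 h2 h3]|] := pselect (V j); last by move=> nV; apply: aeW => z /nV.
  have [ih _] := Rfubini2 (iF j).
  have : {ae leb1, forall z, c' < z < d' -> `|\int[leb1]_y (f (y, z) * be j y)| <= 0}.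
    apply: smooth_bump_ae_bound => // a' b' m ca ab bd; rewrite mul0r normr_le0; apply/eqP.
    set be' := smooth_bump _ _ _.
    have iFb : leb2.-integrable setT (EFin \o (fun x => f x * be j x.1 * be' x.2)).
      apply: (integrable_boundedM (iF j) (M := 1)); first exact: (measurable_snd_comp (mbe (a', b', m))).
      by move=> x; exact: (be1 (a', b', m)).
    have [_ E] := Rfubini2 iFb.
    transitivity (\int[leb2]_x (f x * be j x.1 * be' x.2)).
      rewrite E; apply: Rintegral_ae.
      - apply: measurable_funM; last exact: (mbe (a', b', m)).
        apply: (@measurable_Rsection _ (fun x => f x * be j x.1)).
        by apply/measurable_EFinP; exact: measurable_int (iF j).
      - by apply: (@measurable_Rsection _ (fun x => f x * be j x.1 * be' x.2)); apply/measurable_EFinP; exact: measurable_int iFb.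
      - by apply: aeS (ae_integrable2 (iF j)) => z iz; apply/esym; exact: (RintegralZr (be' z) measurableT iz).
    rewrite -(H _ _ _ _ j.2 m h1 h2 h3 ca ab bd); apply: eq_Rintegral => x _.
    by rewrite /tensor -mulrA.
  by apply: aeS => z hz _.
apply: aeS (aeI aej (ae_integrable2 fi)) => z [Hz iz].
have [zc|zc] := boolP (c' < z < d'); last first.
  by apply: aeW => y [_ /=]; rewrite (negbTE zc).
have : {ae leb1, forall y, c < y < d -> `|f (y, z)| <= 0}.
  apply: smooth_bump_ae_bound => // a b n ca ab bd.
  rewrite mul0r; apply: (Hz (a, b, n)) => //.
by apply: aeS => y Hy [/= /Hy]; rewrite normr_le0 => /eqP.
Qed.

Definition compactly_supported Om psi := continuous psi /\
  exists K, [/\ compact K, K `<=` Om & forall x, ~ K x -> psi x = 0].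

Lemma compactly_supported_bounded Om psi : compactly_supported Om psi ->
  exists2 M, 0 <= M & forall x, `|psi x| <= M.
Proof.
move=> [cpsi [K [cK KO psi0]]].
have cimg : compact (psi @` K) by apply: continuous_compact => //; exact: continuous_subspaceT.
have [M [Mr HM]] := compact_bounded cimg.
exists (`|M| + 1); first by rewrite addr_ge0.
move=> x; have [Kx|/psi0 ->] := pselect (K x); last by rewrite normr0 addr_ge0.
by apply: (HM (`|M| + 1)) => //; rewrite (le_lt_trans (ler_norm _))// ltrDl.
Qed.

Lemma compact_plane_measurable K : compact K -> measurable K.
Proof.
move=> cK; rewrite -[K]setCK; apply: measurableC; apply: open_plane_measurable.
by rewrite openC; apply: compact_closed => //; exact: norm_hausdorff.
Qed.

Lemma loc_integrable_test Om g psi : loc_integrable Om g -> compactly_supported Om psi ->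
  leb2.-integrable setT (EFin \o (fun x => (g \_ Om) x * psi x)).
Proof.
move=> [_ ig] tpsi; have [M M0 HM] := compactly_supported_bounded tpsi.
have [cpsi [K [cK KO psi0]]] := tpsi.
have mK := compact_plane_measurable cK.
have iK : leb2.-integrable setT (EFin \o (g \_ K)).
  by apply: Rrestrict_integrable => //; exact: ig.
have := integrable_boundedM iK (continuous_plane_measurable cpsi) HM.
apply: eq_integrable => // x _ /=; congr (_ %:E).
rewrite !patchE; have [Kx|/psi0 ->] := pselect (K x); last by rewrite !mulr0.
by rewrite !mem_set//; exact: KO.
Qed.

Lemma Rintegral_patch Om u psi :
  \int[leb2]_(x in Om) (u x * psi x) = dot leb2 (u \_ Om) psi.
Proof.
rewrite /dot Rintegral_mkcond; apply: eq_Rintegral => x _.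
by rewrite !patchE; case: ifP => // _; rewrite mul0r.
Qed.

Lemma compact_box K : compact K -> exists r : R, K `<=` box (- r) r (- r) r.
Proof.
move=> cK; have [M [Mr HM]] := compact_bounded cK; exists (`|M| + 2) => -[y z] Kx.
have : `|(y, z)| <= `|M| + 1.
  by apply: (HM (`|M| + 1)) => //; rewrite (le_lt_trans (ler_norm _))// ltrDl.
rewrite prod_normE /= ge_max => /andP[]; rewrite !ler_norml => /andP[h1 h2] /andP[h3 h4].
by split => /=; apply/andP; split; clear -h1 h2 h3 h4; lra.
Qed.

Lemma compactly_supported_sqint Om psi : compactly_supported Om psi -> sqint leb2 psi.
Proof.
move=> cp; have [M _ HM] := compactly_supported_bounded cp.
have [cpsi [K [cK _ psi0]]] := cp; have [r Kr] := compact_box cK.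
apply: (@sqint_bounded _ _ M (- r) r (- r) r) => //; first exact: continuous_plane_measurable.
by move=> x nx; apply: psi0 => /Kr.
Qed.

Lemma sqint_loc_integrable Om u : measurable Om -> sqint leb2 (u \_ Om) -> loc_integrable Om u.
Proof.
move=> mOm su; have [mu fu] := su; split.
  by apply/(measurable_restrictT _ _).2.
move=> K cK KO; have mK := compact_plane_measurable cK.
have [r KB] := compact_box cK.
have s1 : sqint leb2 (\1_K : plane -> R).
  apply: (@sqint_bounded _ _ 1 (- r) r (- r) r).
  - exact: measurable_indic.
  - by move=> x; rewrite indicE; case: (_ \in _); rewrite ?normr1 ?normr0.
  - by move=> x /= nb; rewrite indicE memNset// => /KB.
have i1 := sqintM_integrable su s1.
have : leb2.-integrable K (EFin \o (fun x => (u \_ Om) x * (\1_K : plane -> R) x)).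
  by apply: integrableS i1.
apply: eq_integrable => // x; rewrite inE => Kx /=; congr (_%:E).
by rewrite patchE indicE !mem_set ?mulr1//; exact: KO.
Qed.

(** Integrability is available only on compact subsets of [Om], so the criterion is applied on each
    closed rational rectangle inside [Om]; their interiors cover [Om]. *)
Lemma test_functions_separate Om g h : open Om -> loc_integrable Om g -> loc_integrable Om h ->
  (forall phi, test_function Om phi ->
     dot leb2 (g \_ Om) phi = dot leb2 (h \_ Om) phi) ->
  {ae leb2, forall x, Om x -> g x = h x}.
Proof.
move=> oOm lg lh H.
pose cb (q : rat * rat * rat * rat) : set plane :=
  `[ratr q.1.1.1, ratr q.1.1.2]%classic `*` `[ratr q.1.2, ratr q.2]%classic.
have cc q : compact (cb q) by apply: compact_setX; exact: segment_compact.
have key q : {ae leb2, forall x, cb q `<=` Om ->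
    box (ratr q.1.1.1) (ratr q.1.1.2) (ratr q.1.2) (ratr q.2) x -> g x = h x}.
  have [qO|nq] := pselect (cb q `<=` Om); last by apply: aeW => x /nq.
  have mq := compact_plane_measurable (cc q).
  pose f := (fun x => g x - h x) \_ (cb q).
  have ig := lg.2 _ (cc q) qO; have ih := lh.2 _ (cc q) qO.
  have fi : leb2.-integrable setT (EFin \o f).
    by apply: Rrestrict_integrable => //; exact: integrableB ig ih.
  have := tensor_vanish fi; move=> /(_ (ratr q.1.1.1) (ratr q.1.1.2) (ratr q.1.2) (ratr q.2)) K.
  have QO : box (ratr q.1.1.1) (ratr q.1.1.2) (ratr q.1.2) (ratr q.2) `<=` cb q.
    move=> [y z] [/= /andP[h1 h2] /andP[h3 h4]].
    by split; rewrite /= in_itv/= !ltW.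
  have : {ae leb2, forall x, box (ratr q.1.1.1) (ratr q.1.1.2) (ratr q.1.2) (ratr q.2) x -> f x = 0}.
    apply: K => a b a' b' n m a1 ab b1 a2 ab' b2.
    set phi := tensor _ _.
    have tphi : test_function (cb q) phi.
      by apply: test_function_tensor QO _ _; apply: test1_bump; rewrite ?invr_gt0.
    have tphiO : test_function Om phi.
      case: tphi => sphi [K' [cK' KO' H']]; split => //; exists K'; split => //.
      exact: subset_trans qO.
    have cphi : compactly_supported Om phi.
      by case: tphiO => /(_ [::])[/= cphi _] HK; split.
    have ig1 := loc_integrable_test lg cphi; have ih1 := loc_integrable_test lh cphi.
    have := H _ tphiO; move/eqP; rewrite -subr_eq0 /dot -RintegralB// => /eqP <-.
    apply: eq_Rintegral => x _; rewrite /f !patchE.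
    have [_ [K' [_ K'q phi0]]] := tphi.
    have [Kx|nKx] := pselect (cb q x); first by rewrite !mem_set ?mulrBl//; exact: qO.
    by rewrite phi0 ?mulr0 ?subr0// => /K'q.
  apply: aeS => x Hx _ Qx; have := Hx Qx.
  by rewrite /f patchE mem_set; [move/eqP; rewrite subr_eq0 => /eqP|exact: QO].
apply: aeS (ae_forall_count key) => x Hx Ox.
have [e e0 He] := open_box oOm Ox.
have r1 : x.1 - e < x.1 by rewrite ltrBlDr ltrDl.
have r2 : x.1 < x.1 + e by rewrite ltrDl.
have r3 : x.2 - e < x.2 by rewrite ltrBlDr ltrDl.
have r4 : x.2 < x.2 + e by rewrite ltrDl.
have [a] := rat_in_itvoo r1; have [b] := rat_in_itvoo r2.
have [a'] := rat_in_itvoo r3; have [b'] := rat_in_itvoo r4.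
rewrite !in_itv/= => /andP[h1 h2] /andP[h3 h4] /andP[h5 h6] /andP[h7 h8].
apply: (Hx (a, b, a', b')); last by split; apply/andP; split.
move=> [y z] [/=]; rewrite !in_itv/= => /andP[y1 y2] /andP[z1 z2].
by apply: He; split => /=; apply/andP; split; clear -y1 y2 z1 z2 h1 h2 h3 h4 h5 h6 h7 h8; lra.
Qed.

End weak_derivatives.

(** * Calculus of weak derivatives *)

Section weak_calculus.
Context {R : realType}.
Local Notation plane := (R * R)%type.
Local Notation leb1 := (@lebesgue_measure R).
Local Notation leb2 := (leb1 \x leb1)%E.
Implicit Types (Om K : set plane) (u v w f g h phi psi : plane -> R) (a : nat * nat).

Lemma smooth2_derive phi (v : plane) : smooth2 phi -> smooth2 ('D_v phi).
Proof. by move=> sp s; have := sp (rcons s v); rewrite foldr_rcons. Qed.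

Lemma test_function_derive Om phi (v : plane) : test_function Om phi -> test_function Om ('D_v phi).
Proof.
move=> [sp [K [cK KO phi0]]]; split; first exact: smooth2_derive.
exists K; split => // x nK.
have oK : open (~` K) by rewrite openC; apply: compact_closed => //; exact: norm_hausdorff.
have : \forall y \near x, phi y = cst 0 y.
  by apply: filterS (open_nbhs_nbhs (conj oK nK)) => y /phi0.
by move=> /near_eq_derive ->; rewrite derive_cst.
Qed.

Lemma test_function_pderiv Om phi a : test_function Om phi -> test_function Om (pderiv a phi).
Proof.
move=> tp; rewrite /pderiv; elim: a.1 => [|n IH] /=; last exact: test_function_derive.
by elim: a.2 => [//|n IH] /=; exact: test_function_derive.
Qed.

Lemma test_function_supported Om phi : test_function Om phi -> compactly_supported Om phi.
Proof. by move=> [/(_ [::])[/= cp _] HK]. Qed.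

(** Schwarz's theorem: the second difference of phi over a small square of side k is k^2 times
    either mixed derivative, taken at some point of the square. It is needed because [pderiv] fixes
    an order of derivation. *)
Lemma derive_comm phi : smooth2 phi ->
  'D_((0, 1) : plane) ('D_((1, 0) : plane) phi) = 'D_((1, 0) : plane) ('D_((0, 1) : plane) phi).
Proof.
move=> sp; apply/funext => -[y z].
have [c12 _] := sp [:: ((0, 1) : plane); ((1, 0) : plane)].
have [c21 _] := sp [:: ((1, 0) : plane); ((0, 1) : plane)].
have [_ d0] := sp [::]; have [_ d1] := sp [:: ((1, 0) : plane)]; have [_ d2] := sp [:: ((0, 1) : plane)].
rewrite /= in c12 c21 d0 d1 d2.
set A := 'D_(0, 1) ('D_(1, 0) phi) in c12 *; set B := 'D_(1, 0) ('D_(0, 1) phi) in c21 *.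
apply/eqP; rewrite -subr_eq0; apply/negP => /negP AB.
pose e := `|A (y, z) - B (y, z)| / 2.
have e0 : 0 < e by rewrite divr_gt0// normr_gt0.
have nA : \forall x \near (y, z), `|A (y, z) - A x| < e by move/cvgrPdist_lt : (c12 (y, z)); apply.
have nB : \forall x \near (y, z), `|B (y, z) - B x| < e by move/cvgrPdist_lt : (c21 (y, z)); apply.
have [r r0 Hr] := near_square (filterI nA nB).
pose k := r / 2; have k0 : 0 < k by rewrite divr_gt0.
have kr : k < r by rewrite ltr_pdivrMr// ltr_pMr// ltr1n.
have yk : y < y + k by rewrite ltrDl.
have zk : z < z + k by rewrite ltrDl.
have yk' : y + k - y = k by rewrite addrC addKr.
have zk' : z + k - z = k by rewrite addrC addKr.
pose Del := phi (y + k, z + k) - phi (y + k, z) - (phi (y, z + k) - phi (y, z)).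
have inQ s t : y < s < y + k -> z < t < z + k -> square (y, z) r (s, t).
  by move=> /andP[s1 s2] /andP[t1 t2]; split => /=; apply/andP; split; clear -s1 s2 t1 t2 kr r0; lra.
have [s1 [t1 [hs1 ht1 E1]]] : exists s t, [/\ y < s < y + k, z < t < z + k & Del = A (s, t) * k * k].
  pose F := fun x : plane => phi (x.1, z + k) - phi (x.1, z).
  have [|s hs Es] := @slice_mean_value _ F (fun x => 'D_(1, 0) phi (x.1, z + k) - 'D_(1, 0) phi (x.1, z)) y (y + k) z _ yk.
    move=> t; apply: is_deriveB; exact: slice_is_derive.
  have [|t ht Et] := @slice_mean_value _ ('D_(1, 0) phi \o flip) (A \o flip) z (z + k) s _ zk.
    by move=> t; exact: slice_is_derive2.
  exists s, t; split; [exact: hs|exact: ht|]; move: Es Et; rewrite /F /flip/= /Del => ->.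
  by rewrite yk' zk' => ->.
have [s2 [t2 [hs2 ht2 E2]]] : exists s t, [/\ y < s < y + k, z < t < z + k & Del = B (s, t) * k * k].
  pose F := fun x : plane => phi (y + k, x.1) - phi (y, x.1).
  have [|t ht Et] := @slice_mean_value _ F (fun x => 'D_(0, 1) phi (y + k, x.1) - 'D_(0, 1) phi (y, x.1)) z (z + k) y _ zk.
    move=> t; apply: is_deriveB; exact: slice_is_derive2.
  have [|s hs Es] := @slice_mean_value _ ('D_(0, 1) phi) B y (y + k) t _ yk.
    by move=> s; exact: slice_is_derive.
  exists s, t; split; [exact: hs|exact: ht|].
  have -> : Del = phi (y + k, z + k) - phi (y, z + k) - (phi (y + k, z) - phi (y, z)) by rewrite /Del; ring.
  by rewrite yk' in Es; rewrite /F /= zk' Es in Et; exact: Et.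
clearbody A B Del k; clear AB.
have Eq : A (s1, t1) = B (s2, t2).
  have kk : k * k != 0 by rewrite mulf_neq0// gt_eqF.
  by apply: (mulIf kk); rewrite !mulrA -E1 -E2.
have [hA _] := Hr _ (inQ _ _ hs1 ht1); have [_ hB] := Hr _ (inQ _ _ hs2 ht2).
have : `|A (y, z) - B (y, z)| < e + e.
  rewrite (_ : A (y, z) - B (y, z) = (A (y, z) - A (s1, t1)) - (B (y, z) - B (s2, t2))).
    by apply: le_lt_trans (ler_normB _ _) _; exact: ltrD.
  by rewrite Eq; ring.
by rewrite /e -splitr ltxx.
Qed.

Definition ae_eq_on Om f g := {ae leb2, forall x, Om x -> f x = g x}.

Lemma ae_eq_on_trans Om f g h : ae_eq_on Om f g -> ae_eq_on Om g h -> ae_eq_on Om f h.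
Proof. by move=> h1 h2; apply: aeS (aeI h1 h2) => x [e1 e2] Ox; rewrite e1// e2. Qed.

Lemma ae_eq_on_patch Om f g : ae_eq_on Om f g -> {ae leb2, forall x, (f \_ Om) x = (g \_ Om) x}.
Proof. by apply: aeS => x h; rewrite !patchE; case: ifPn => //; rewrite inE => /h. Qed.

Lemma weak_derivativeP Om a u g : weak_derivative Om a u g <-> loc_integrable Om g /\
  forall phi, test_function Om phi ->
    dot leb2 (u \_ Om) (pderiv a phi) = (-1) ^+ (a.1 + a.2) * dot leb2 (g \_ Om) phi.
Proof.
split=> -[lg H]; split => // phi /H; by rewrite !Rintegral_patch.
Qed.

Lemma weak_derivative_unique Om a u g h : open Om ->
  weak_derivative Om a u g -> weak_derivative Om a u h -> ae_eq_on Om g h.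
Proof.
move=> oOm /weak_derivativeP[lg Hg] /weak_derivativeP[lh Hh].
apply: test_functions_separate => // phi tp.
have s0 : (-1) ^+ (a.1 + a.2) != 0 :> R by rewrite expf_neq0// oppr_eq0 oner_eq0.
by apply: (mulfI s0); rewrite -Hg// -Hh.
Qed.

Lemma weak_derivative_wD Om a u g : weak_derivative Om a u g -> weak_derivative Om a u (wD Om a u).
Proof. by move=> Hg; apply: (@xgetPex _ _ (weak_derivative Om a u)); exists g. Qed.

Lemma wD_ae Om a u g : open Om -> weak_derivative Om a u g -> ae_eq_on Om (wD Om a u) g.
Proof. by move=> oOm Hg; apply: (weak_derivative_unique oOm (weak_derivative_wD Hg) Hg). Qed.

Lemma patch_lin Om u v c :
  (fun x => u x + c * v x) \_ Om = (fun x => (u \_ Om) x + c * (v \_ Om) x).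
Proof. by apply/funext => x; rewrite !patchE; case: ifP => // _; rewrite mulr0 addr0. Qed.

Lemma dot_test_lin Om u v psi c : loc_integrable Om u -> loc_integrable Om v ->
  compactly_supported Om psi ->
  dot leb2 ((fun x => u x + c * v x) \_ Om) psi = dot leb2 (u \_ Om) psi + c * dot leb2 (v \_ Om) psi.
Proof.
move=> lu lv cp; have iu := loc_integrable_test lu cp; have iv := loc_integrable_test lv cp.
have icv : leb2.-integrable setT (EFin \o (fun x => c * ((v \_ Om) x * psi x))).
  exact: (integrableZl measurableT c iv).
rewrite /dot -RintegralZl// -RintegralD//; apply: eq_Rintegral => x _.
by rewrite patch_lin; ring.
Qed.

Lemma loc_integrable_lin Om u v c : open Om -> loc_integrable Om u -> loc_integrable Om v ->
  loc_integrable Om (fun x => u x + c * v x).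
Proof.
move=> oOm [mu iu] [mv iv]; split.
  by apply: measurable_funD => //; exact: measurable_funM.
move=> K cK KO; have mK := compact_plane_measurable cK.
have icv : leb2.-integrable K (fun x => (c%:E * (EFin \o v) x)%E).
  by apply: integrableZl => //; exact: iv.
by have := integrableD _ (iu K cK KO) icv; apply.
Qed.

Lemma weak_derivative_lin Om a u v g h c : open Om -> loc_integrable Om u -> loc_integrable Om v ->
  weak_derivative Om a u g -> weak_derivative Om a v h ->
  weak_derivative Om a (fun x => u x + c * v x) (fun x => g x + c * h x).
Proof.
move=> oOm lu lv /weak_derivativeP[lg Hg] /weak_derivativeP[lh Hh].
apply/weak_derivativeP; split; first exact: loc_integrable_lin.
move=> phi tp; have tp' := test_function_supported (test_function_pderiv a tp).
rewrite dot_test_lin// (dot_test_lin _ lg lh (test_function_supported tp)) Hg// Hh//; ring.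
Qed.

Lemma weak_derivative0 Om u : loc_integrable Om u -> weak_derivative Om (0, 0)%N u u.
Proof. by move=> lu; apply/weak_derivativeP; split => // phi tp; rewrite expr0 mul1r. Qed.

Lemma weak_derivative_comp1 Om (i j : nat) u g h : loc_integrable Om h ->
  weak_derivative Om (1, 0)%N u g -> weak_derivative Om (i.+1, j) u h ->
  weak_derivative Om (i, j) g h.
Proof.
move=> lh /weak_derivativeP[lg Hg] /weak_derivativeP[_ Hh]; apply/weak_derivativeP; split => // phi tp.
have := Hg _ (test_function_pderiv (i, j) tp); have := Hh _ tp.
rewrite /pderiv /= => ->; rewrite addSn exprS expr1 -mulrA !mulN1r => /eqP.
by rewrite eqr_opp => /eqP <-.
Qed.

(** Here the z-derivative is applied after those in y, against the order built into [pderiv]. The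
    boolean [i] limits the order in y to at most 1, so that a single exchange suffices. *)
Lemma weak_derivative_comp2 Om (i : bool) (j : nat) u g h : loc_integrable Om h ->
  weak_derivative Om (0, 1)%N u g -> weak_derivative Om (i : nat, j.+1) u h ->
  weak_derivative Om (i : nat, j) g h.
Proof.
move=> lh /weak_derivativeP[lg Hg] /weak_derivativeP[_ Hh]; apply/weak_derivativeP; split => // phi tp.
have := Hg _ (test_function_pderiv (i : nat, j) tp); have := Hh _ tp.
have [sp _] := test_function_pderiv (0%N, j) tp.
have -> : pderiv (0, 1)%N (pderiv (i : nat, j) phi) = pderiv (i : nat, j.+1) phi.
  by case: i {Hh}; rewrite /pderiv /=; [exact: (derive_comm sp)|reflexivity].
move=> ->; rewrite /= addnS exprS expr1 -mulrA !mulN1r => /eqP.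
by rewrite eqr_opp => /eqP <-.
Qed.

Lemma ae_eq_on_sqi Om f g : measurable_fun setT (f \_ Om) -> measurable_fun setT (g \_ Om) ->
  ae_eq_on Om f g -> sqi leb2 Om f = sqi leb2 Om g.
Proof.
move=> mf mg fg; rewrite -[LHS]sqi_restrict -[RHS]sqi_restrict; apply: ae_eq_integral.
- exact: measurableT.
- exact: measurable_sqr.
- exact: measurable_sqr.
- by apply: aeS (ae_eq_on_patch fg) => x -> _.
Qed.

Lemma loc_integrable_measurable Om g : open Om -> loc_integrable Om g -> measurable_fun setT (g \_ Om).
Proof.
by move=> oOm [mg _]; apply/(measurable_restrictT _ _).1 => //; exact: open_plane_measurable.
Qed.

Lemma sqint_ae_eq_on Om f g : open Om -> loc_integrable Om f -> ae_eq_on Om f g ->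
  sqint leb2 (g \_ Om) -> sqint leb2 (f \_ Om).
Proof.
move=> oOm lf fg [mg gg]; have mf := loc_integrable_measurable oOm lf.
by split => //; rewrite sqi_restrict (ae_eq_on_sqi mf mg fg) -sqi_restrict.
Qed.

(** The representative picked by [wD] agrees almost everywhere on [Om] with the square-integrable
    one, hence is square integrable too. *)
Lemma sobolev_wD k Om u a : open Om -> sobolev k Om u -> (a.1 + a.2 <= k)%N ->
  weak_derivative Om a u (wD Om a u) /\ sqint leb2 (wD Om a u \_ Om).
Proof.
move=> oOm [_ H] ak; have [g /L2P Lg Hg] := H a ak.
have HD := weak_derivative_wD Hg; split => //.
apply: (sqint_ae_eq_on oOm _ (wD_ae oOm Hg) Lg).
by case: HD.
Qed.

End weak_calculus.

(** * Compactness of the embedding of H^2 *)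

Section embedding.
Context {R : realType}.
Local Notation plane := (R * R)%type.
Local Notation leb1 := (@lebesgue_measure R).
Local Notation leb2 := (leb1 \x leb1)%E.
Implicit Types (Om : set plane) (u v w f g h phi psi : plane -> R) (a : nat * nat).

Lemma sobolev_sqint k Om u : sobolev k Om u -> sqint leb2 (u \_ Om).
Proof. by move=> [/L2P]. Qed.

Lemma weak_yy_patch Om u g : weak_derivative Om (2, 0)%N u g -> weak_yy Om (u \_ Om) (g \_ Om).
Proof.
move=> /weak_derivativeP[_ H] c d c' d' al be QO ta tb.
have := H _ (test_function_tensor QO ta tb).
by rewrite pderiv_tensor ?sqrrN ?expr1n ?mul1r//; [case: ta|case: tb].
Qed.

Lemma weak_zz_patch Om u g : weak_derivative Om (0, 2)%N u g -> weak_zz Om (u \_ Om) (g \_ Om).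
Proof.
move=> /weak_derivativeP[_ H] c d c' d' al be QO ta tb.
have := H _ (test_function_tensor QO ta tb).
by rewrite pderiv_tensor ?sqrrN ?expr1n ?mul1r//; [case: ta|case: tb].
Qed.

Lemma twice_diff_patch Om u g1 g2 : sqint leb2 (u \_ Om) -> sqint leb2 (g1 \_ Om) ->
  sqint leb2 (g2 \_ Om) -> weak_derivative Om (2, 0)%N u g1 -> weak_derivative Om (0, 2)%N u g2 ->
  twice_diff Om (u \_ Om) (g1 \_ Om) (g2 \_ Om).
Proof. by move=> su s1 s2 W1 W2; split => //; [exact: weak_yy_patch|exact: weak_zz_patch]. Qed.

Lemma patchB Om u v : (fun x => u x - v x) \_ Om = (fun x => (u \_ Om) x - (v \_ Om) x).
Proof. by apply/funext => x; rewrite !patchE; case: ifP => // _; rewrite subr0. Qed.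

Lemma sqi_eq Om f g : (forall x, Om x -> f x = g x) -> sqi leb2 Om f = sqi leb2 Om g.
Proof. by move=> H; apply: eq_integral => x; rewrite inE => /H ->. Qed.

Lemma sqi_patchB Om u v :
  sqi leb2 Om (fun x => (u \_ Om) x - (v \_ Om) x) = sqi leb2 Om (fun x => u x - v x).
Proof. by apply: sqi_eq => x Ox; rewrite !patchE mem_set. Qed.

Lemma L2_complete Om (u_ : nat -> plane -> R) : measurable Om -> (forall n, sqint leb2 (u_ n \_ Om)) ->
  (forall e : R, 0 < e -> exists N, forall m n, (N <= m)%N -> (N <= n)%N ->
    (sqi leb2 Om (fun x => u_ m x - u_ n x)%R <= e%:E)%E) ->
  exists2 v, L2 Om v & forall e : R, 0 < e -> exists N, forall n, (N <= n)%N ->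
    (sqi leb2 Om (fun x => u_ n x - v x)%R <= e%:E)%E.
Proof.
move=> mOm su Hc; have [|f sf Hf] := sqint_complete su.
  move=> e /Hc[N HN]; exists N => m n Nm Nn.
  by rewrite -patchB sqi_restrict; exact: HN.
have sf2 : sqint leb2 (f : plane -> R) by exact: sf.
have sf3 : sqint leb2 (f \_ Om) by exact: sqint_restrict.
exists f; first exact/L2P.
move=> e /Hf[N HN]; exists N => n Nn; apply: le_trans (HN n Nn).
have sd := sqintB (su n) sf3; have [md _] := sd.
have sd' := sqintB (su n) sf2; have [md' _] := sd'.
rewrite -sqi_restrict patchB; apply: le_sqi => // x _.
by rewrite !patchE; case: ifP => // _; rewrite subr0 normr0.
Qed.

Lemma H2norm_ge Om u i j : (i + j <= 2)%N -> forall M : R, (H2norm Om u <= M%:E)%E ->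
  (sqi leb2 Om (wD Om (i, j) u) <= (M ^+ 2)%:E)%E.
Proof.
move=> ij M; rewrite /H2norm.
set X := (X in (X `^ _)%E).
have t0 k l : (0 <= L2norm Om (wD Om (k, l) u) ^+ 2)%E by rewrite expe2 sqre_ge0.
have X0 : (0 <= X)%E by apply: sume_ge0 => k _; apply: sume_ge0 => l _.
have i3 : (i < 3)%N by rewrite ltnS; apply: leq_trans ij; exact: leq_addr.
have j3 : (j < 3)%N by rewrite ltnS; apply: leq_trans ij; exact: leq_addl.
have tX : (L2norm Om (wD Om (i, j) u) ^+ 2 <= X)%E.
  rewrite /X (bigD1 (Ordinal i3))//= (bigD1 (Ordinal j3))//= -addeA leeDl//.
  by apply: adde_ge0; apply: sume_ge0 => k _; [exact: t0|apply: sume_ge0 => l _; exact: t0].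
rewrite poweR12_sqrt// => XM.
have : (sqi leb2 Om (wD Om (i, j) u) <= X)%E.
  apply: le_trans tX; rewrite L2normE; have := sqi_ge0 leb2 Om (wD Om (i, j) u).
  move: (sqi _ _ _) => S; case: S => [r| |]//= r0.
  by rewrite -EFinM -expr2 sqr_sqrtr.
move/le_trans; apply; move: X0 XM {tX}; case: X => [r| |]//=; rewrite !lee_fin => r0 rM.
by rewrite -(sqr_sqrtr r0) lerXn2r ?nnegrE ?sqrtr_ge0 ?(le_trans _ rM) ?sqrtr_ge0.
Qed.

Lemma sobolev_compact Om : open Om -> precompact_on Om Om -> H2_compactly_embedded Om.
Proof.
move=> oOm pO u_ su [M HM]; have mOm := open_plane_measurable oOm.
have D20 n := sobolev_wD oOm (su n) (isT : ((2, 0).1 + (2, 0).2 <= 2)%N).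
have D02 n := sobolev_wD oOm (su n) (isT : ((0, 2).1 + (0, 2).2 <= 2)%N).
have squ n := sobolev_sqint (su n).
have W n := twice_diff_patch (squ n) (D20 n).2 (D02 n).2 (D20 n).1 (D02 n).1.
(* One M^2 for each of u and its two pure second derivatives. *)
have [|s [sh sc]] := cauchy_subsequence mOm pO W (M := 3 * M ^+ 2).
  move=> n; rewrite /energy; have lu := sqint_loc_integrable mOm (squ n).
  (* The H^2 norm contains the chosen derivative of order (0, 0), which equals u only almost
     everywhere. *)
  have e00 := wD_ae oOm (weak_derivative0 lu).
  have [l00 _] := weak_derivative_wD (weak_derivative0 lu).
  have E0 : sqi leb2 Om (u_ n) = sqi leb2 Om (wD Om (0, 0)%N (u_ n)).
    apply/esym; apply: ae_eq_on_sqi e00; exact: loc_integrable_measurable.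
  have b i j : (i + j <= 2)%N -> sqint leb2 (wD Om (i, j) (u_ n) \_ Om) ->
      dot leb2 (wD Om (i, j) (u_ n) \_ Om) (wD Om (i, j) (u_ n) \_ Om) <= M ^+ 2.
    by move=> ij sw; rewrite -lee_fin -dot_sqi// sqi_restrict; exact: H2norm_ge (HM n).
  have b0 : dot leb2 (u_ n \_ Om) (u_ n \_ Om) <= M ^+ 2.
    by rewrite -lee_fin -dot_sqi// sqi_restrict E0; exact: H2norm_ge (HM n).
  have b1 := b 2%N 0%N isT (D20 n).2; have b2 := b 0%N 2%N isT (D02 n).2.
  have -> : 3 * M ^+ 2 = M ^+ 2 + M ^+ 2 + M ^+ 2 by ring.
  exact: (lerD (lerD b0 b1) b2).
have [|v Lv Hv] := @L2_complete Om (fun n => u_ (s n)) mOm (fun n => squ (s n)).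
  move=> e /sc[N HN]; exists N => m n Nm Nn; have := HN m n Nm Nn.
  by rewrite sqi_patchB.
exists s, v; split => //; apply/L2norm_cvg0P; exact: Hv.
Qed.

End embedding.

(** * Linearity of traces and of the plate space *)

Section plate_space_linear.
Context {R : realType}.
Local Notation plane := (R * R)%type.
Local Notation leb1 := (@lebesgue_measure R).
Local Notation leb2 := (leb1 \x leb1)%E.
Implicit Types (Om : set plane) (u v w f g h phi psi : plane -> R) (a : nat * nat) (c : R).

Lemma ecvg0P (x : nat -> \bar R) : (forall n, (0 <= x n)%E) ->
  x n @[n --> \oo] --> 0%E <->
  forall e : R, 0 < e -> exists N, forall n, (N <= n)%N -> (x n <= e%:E)%E.
Proof.
move=> x0; split => [/fine_cvgP[ff cf] e e0|H].
  have [N _ HN] : \forall n \near \oo, `|0 - fine (x n)| < e by move/cvgrPdist_lt : cf; apply.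
  have [N' _ HN'] := ff; exists (maxn N N') => n; rewrite geq_max => /andP[/HN /= + /HN' /=].
  move: (x n) (x0 n) => y; case: y => [r| |]//=; rewrite !lee_fin => r0.
  by rewrite sub0r normrN ger0_norm// => /ltW.
have H' (e : R) : 0 < e -> exists N, forall n, (N <= n)%N -> exists2 r, x n = r%:E & 0 <= r <= e.
  move=> /H[N HN]; exists N => n /HN; move: (x n) (x0 n) => y.
  by case: y => [r| |]//; rewrite !lee_fin => r0 re; exists r; rewrite ?r0.
apply/fine_cvgP; split.
  by have [N HN] := H' 1 ltr01; exists N => // n /HN[r + _] => /= ->.
apply/cvgrPdist_le => e e0; have [N HN] := H' _ e0.
exists N => // n /HN[r + /andP[r0 re]] => /= -> /=.
by rewrite sub0r normrN ger0_norm.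
Qed.

Lemma vanish_lin (P Q S : nat -> \bar R) c :
  (forall n, (S n <= 2%:E * P n + (2 * c ^+ 2)%:E * Q n)%E) ->
  (forall e : R, 0 < e -> exists N, forall n, (N <= n)%N -> (P n <= e%:E)%E) ->
  (forall e : R, 0 < e -> exists N, forall n, (N <= n)%N -> (Q n <= e%:E)%E) ->
  forall e : R, 0 < e -> exists N, forall n, (N <= n)%N -> (S n <= e%:E)%E.
Proof.
move=> SPQ HP HQ e e0; have k0 : 0 < 2 * c ^+ 2 + 1 by rewrite ltr_wpDl// mulr_ge0// sqr_ge0.
have e4 : 0 < e / 4 by rewrite divr_gt0.
have ek : 0 < e / 2 / (2 * c ^+ 2 + 1) by rewrite !divr_gt0.
have [N HN] := HP _ e4; have [N' HN'] := HQ _ ek.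
exists (maxn N N') => n; rewrite geq_max => /andP[/HN Pn /HN' Qn].
apply: le_trans (SPQ n) _.
have -> : e = 2 * (e / 4) + e / 2 by field.
have cc : 0 <= 2 * c ^+ 2 by rewrite mulr_ge0// sqr_ge0.
rewrite (EFinD (2 * (e / 4)) (e / 2)); apply: leeD; first by rewrite EFinM lee_pmul2l.
apply: (@le_trans _ _ ((2 * c ^+ 2)%:E * (e / 2 / (2 * c ^+ 2 + 1))%:E)%E).
  exact: lee_wpmul2l.
rewrite -(EFinM (2 * c ^+ 2)) lee_fin mulrCA ger_pMr ?divr_gt0// ler_pdivrMr//; lra.
Qed.

Lemma smooth2_lin phi psi c : smooth2 phi -> smooth2 psi ->
  smooth2 (fun x => phi x + c * psi x) /\
  forall s : seq plane,
    foldr (fun (v : plane) (g : plane -> R) => 'D_v g) (fun x => phi x + c * psi x) s =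
    fun x => foldr (fun (v : plane) (g : plane -> R) => 'D_v g) phi s x
           + c * foldr (fun (v : plane) (g : plane -> R) => 'D_v g) psi s x.
Proof.
move=> sp sq.
have E (s : seq plane) : foldr (fun (v : plane) (g : plane -> R) => 'D_v g) (fun x => phi x + c * psi x) s =
    fun x => foldr (fun (v : plane) (g : plane -> R) => 'D_v g) phi s x
           + c * foldr (fun (v : plane) (g : plane -> R) => 'D_v g) psi s x.
  elim: s => [//|v s IH] /=; rewrite IH; have [_ d1] := sp s; have [_ d2] := sq s.
  apply/funext => x.
  by have [] := is_deriveD (derivableP (d1 x v)) (is_deriveZ c (derivableP (d2 x v))).
split; last exact: E.
move=> s; have [c1 d1] := sp s; have [c2 d2] := sq s; rewrite /= E; split.
  by move=> x; apply: cvgD; [exact: c1|apply: cvgM; [exact: cvg_cst|exact: c2]].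
move=> x v.
by have [] := is_deriveD (derivableP (d1 x v)) (is_deriveZ c (derivableP (d2 x v))).
Qed.

Lemma pderivE a phi : pderiv a phi = foldr (fun (v : plane) (g : plane -> R) => 'D_v g) phi
  (nseq a.1 ((1, 0) : plane) ++ nseq a.2 ((0, 1) : plane)).
Proof.
rewrite foldr_cat /pderiv; elim: a.1 => [|n /= <-//]; rewrite /=.
by elim: a.2 => [//|n /= <-].
Qed.

Lemma smooth2_continuous phi : smooth2 phi -> continuous phi.
Proof. by move=> /(_ [::])[]. Qed.

Lemma pderiv_continuous a phi : smooth2 phi -> continuous (pderiv a phi).
Proof. by move=> sp; rewrite pderivE; have [] := sp (nseq a.1 ((1, 0) : plane) ++ nseq a.2 ((0, 1) : plane)). Qed.

Lemma pderiv_lin a phi psi c : smooth2 phi -> smooth2 psi ->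
  pderiv a (fun x => phi x + c * psi x) = fun x => pderiv a phi x + c * pderiv a psi x.
Proof. by move=> sp sq; rewrite !pderivE; have [_ ->] := smooth2_lin c sp sq. Qed.

Lemma smooth2_0 : smooth2 (fun _ : plane => 0 : R).
Proof.
move=> s /=.
have -> : foldr (fun (v : plane) (g : plane -> R) => 'D_v g) (fun=> 0) s = cst 0.
  by elim: s => //= v s ->; apply/funext => x; rewrite derive_cst.
by split => [x|x v]; [exact: cvg_cst|exact: derivable_cst].
Qed.

Lemma pderiv0 a : pderiv a (fun _ : plane => 0 : R) = cst 0.
Proof.
rewrite pderivE; elim: (_ ++ _) => //= v s ->.
by apply/funext => x; rewrite derive_cst.
Qed.

Lemma sqi_lin d (T : measurableType d) (mu : {measure set T -> \bar R}) (D : set T)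
    (f g : T -> R) c : measurable D -> measurable_fun D f -> measurable_fun D g ->
  (sqi mu D (fun x => f x + c * g x)%R <=
   2%:E * sqi mu D f + (2 * c ^+ 2)%:E * sqi mu D g)%E.
Proof.
move=> mD mf mg; have mcg : measurable_fun D (fun x => c * g x) by exact: measurable_funM.
apply: le_trans (sqiD mu mD mf mcg) _; rewrite sqiZ// muleA -EFinM; exact: lexx.
Qed.

Lemma curve_measurable (c1 c2 : R -> R) g : smooth1 c1 -> smooth1 c2 ->
  measurable_fun setT g -> measurable_fun setT (fun t => g (c1 t, c2 t)).
Proof.
move=> s1 s2 mg; apply: (measurableT_comp mg).
by apply: measurable_fun_pair; apply: continuous_measurable_fun; exact: smooth1_continuous.
Qed.

Lemma eucl_measurable (c1 c2 : R -> R) : smooth1 c1 -> smooth1 c2 ->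
  measurable_fun setT (fun t => eucl (derive1 c1 t, derive1 c2 t)).
Proof.
move=> s1 s2; apply: continuous_measurable_fun => t.
apply: (@continuous_comp _ _ _ (fun t => derive1 c1 t ^+ 2 + derive1 c2 t ^+ 2) Num.sqrt).
  have d1 := smooth1_derive s1; have d2 := smooth1_derive s2.
  exact: (smooth1_continuous (smooth1D (smooth1M d1 d1) (smooth1M d2 d2))).
exact: sqrt_continuous.
Qed.

(** Linearity is required of the chosen derivatives, and only almost everywhere, instead of an
    equation between w, w1 and w2. In this form the lemma also applies when these functions are
    themselves chosen first derivatives. *)
Lemma is_trace_lin Om w w1 w2 g1 g2 c : open Om ->
  (forall a, (a.1 + a.2 <= 1)%N ->
    [/\ loc_integrable Om (wD Om a w), loc_integrable Om (wD Om a w1),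
        loc_integrable Om (wD Om a w2) &
        ae_eq_on Om (wD Om a w) (fun x => wD Om a w1 x + c * wD Om a w2 x)]) ->
  is_trace Om w1 g1 -> is_trace Om w2 g2 -> is_trace Om w (fun x => g1 x + c * g2 x).
Proof.
move=> oOm Hw [mg1 [phi [sphi Hphi Tphi]]] [mg2 [psi [spsi Hpsi Tpsi]]]; split.
  by apply: measurable_funD => //; exact: measurable_funM.
exists (fun k x => phi k x + c * psi k x); split.
- by move=> k; have [] := smooth2_lin c (sphi k) (spsi k).
- move=> r a r0 a1; apply/L2norm_cvg0P.
  have /L2norm_cvg0P H1 := Hphi r a r0 a1; have /L2norm_cvg0P H2 := Hpsi r a r0 a1.
  have [[mw _] [mw1 _] [mw2 _] ew] := Hw a a1.
  set D := Om `&` _ in H1 H2 *.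
  have mD : measurable D by apply: open_plane_measurable; apply: openI => //; exact: ball_open.
  have DO : D `<=` Om by move=> x [].
  have mOm := open_plane_measurable oOm.
  have m1 k : measurable_fun D (fun x => pderiv a (phi k) x - wD Om a w1 x).
    apply: measurable_funB; last exact: measurable_funS mw1.
    exact: measurable_funTS (continuous_plane_measurable (pderiv_continuous (sphi k))).
  have m2 k : measurable_fun D (fun x => pderiv a (psi k) x - wD Om a w2 x).
    apply: measurable_funB; last exact: measurable_funS mw2.
    exact: measurable_funTS (continuous_plane_measurable (pderiv_continuous (spsi k))).
  apply: (@vanish_lin _ _ _ c _ H1 H2) => k.
  apply: le_trans (sqi_lin leb2 c mD (m1 k) (m2 k)).
  rewrite (pderiv_lin _ _ (sphi k) (spsi k)).
  rewrite (@ae_eq_on_sqi _ D _ (fun x => (pderiv a (phi k) x - wD Om a w1 x)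
    + c * (pderiv a (psi k) x - wD Om a w2 x)))//.
  + apply/(measurable_restrictT _ _).1 => //; apply: measurable_funB; last exact: measurable_funS mw.
    have mp := measurable_funTS (continuous_plane_measurable (pderiv_continuous (a := a) (sphi k))).
    have mq := measurable_funTS (continuous_plane_measurable (pderiv_continuous (a := a) (spsi k))).
    by apply: measurable_funD => //; exact: measurable_funM.
  + apply/(measurable_restrictT _ _).1 => //; apply: measurable_funD; first exact: m1.
    by apply: measurable_funM => //; exact: m2.
  + by apply: aeS ew => x /[swap] /DO Ox /(_ Ox) ->; ring.
- move=> c1 c2 arc; have [s1 s2 _ _ _] := arc.
  (* Putting the square root of the arc-length density into the integrand turns the boundary
     integral into a [sqi], to which the general estimates apply. *)
  have E (f : plane -> R) : (\int[leb1]_(t in `[0%R, 1%R])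
      ((f (c1 t, c2 t)) ^+ 2 * eucl (derive1 c1 t, derive1 c2 t))%:E)%E =
      sqi leb1 `[0, 1] (fun t => f (c1 t, c2 t) * Num.sqrt (eucl (derive1 c1 t, derive1 c2 t))).
    by apply: eq_integral => t _; rewrite exprMn sqr_sqrtr// sqrtr_ge0.
  have ms : measurable_fun setT (fun t => Num.sqrt (eucl (derive1 c1 t, derive1 c2 t))).
    apply: (measurableT_comp _ (eucl_measurable s1 s2)).
    by apply: continuous_measurable_fun => t; exact: sqrt_continuous.
  have mf (f g : plane -> R) : continuous f -> measurable_fun setT g -> measurable_fun (`[0%R, 1%R] : set R)
      (fun t => (f (c1 t, c2 t) - g (c1 t, c2 t)) * Num.sqrt (eucl (derive1 c1 t, derive1 c2 t))).
    move=> cf mg; apply: measurable_funTS; apply: measurable_funM => //.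
    apply: measurable_funB; apply: curve_measurable => //.
    exact: continuous_plane_measurable.
  apply/ecvg0P => [k|].
    by have e3 := E (fun x => phi k x + c * psi k x - (g1 x + c * g2 x)); rewrite /= in e3; rewrite e3 sqi_ge0.
  have /ecvg0P H1 := Tphi _ _ arc; have /ecvg0P H2 := Tpsi _ _ arc.
  have p1 k := E (fun x => phi k x - g1 x); rewrite /= in p1.
  have p2 k := E (fun x => psi k x - g2 x); rewrite /= in p2.
  have {}H1 : forall e : R, 0 < e -> exists N, forall n, (N <= n)%N ->
    (sqi leb1 `[0%R, 1%R] (fun t => (phi n (c1 t, c2 t) - g1 (c1 t, c2 t)) *
      Num.sqrt (eucl (derive1 c1 t, derive1 c2 t)))%R <= e%:E)%E.
    move=> e e0; have [|N HN] := H1 _ e e0; first by move=> k; rewrite p1 sqi_ge0.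
    by exists N => k /HN; rewrite p1.
  have {}H2 : forall e : R, 0 < e -> exists N, forall n, (N <= n)%N ->
    (sqi leb1 `[0%R, 1%R] (fun t => (psi n (c1 t, c2 t) - g2 (c1 t, c2 t)) *
      Num.sqrt (eucl (derive1 c1 t, derive1 c2 t)))%R <= e%:E)%E.
    move=> e e0; have [|N HN] := H2 _ e e0; first by move=> k; rewrite p2 sqi_ge0.
    by exists N => k /HN; rewrite p2.
  apply: (@vanish_lin _ _ _ c _ H1 H2) => k.
  have := sqi_lin leb1 c (measurable_itv _) (mf _ _ (smooth2_continuous (sphi k)) mg1) (mf _ _ (smooth2_continuous (spsi k)) mg2).
  have e3 := E (fun x => phi k x + c * psi k x - (g1 x + c * g2 x)); rewrite /= in e3; rewrite e3.
  apply: le_trans; rewrite le_eqVlt; apply/orP; left; apply/eqP.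
  by apply: eq_integral => t _; congr (_ ^+ 2)%:E; ring.
Qed.

Lemma sobolev_lin k Om u v c : open Om -> sobolev k Om u -> sobolev k Om v ->
  sobolev k Om (fun x => u x + c * v x).
Proof.
move=> oOm su sv; have mOm := open_plane_measurable oOm.
have lin (f g : plane -> R) : sqint leb2 (f \_ Om) -> sqint leb2 (g \_ Om) ->
    L2 Om (fun x => f x + c * g x).
  by move=> sf sg; apply/L2P; rewrite patch_lin; apply: sqintD => //; exact: sqintZ.
have [qu qv] := (sobolev_sqint su, sobolev_sqint sv); split; first exact: (lin _ _ qu qv).
move=> a ak; have [du qdu] := sobolev_wD oOm su ak; have [dv qdv] := sobolev_wD oOm sv ak.
exists (fun x => wD Om a u x + c * wD Om a v x); first exact: (lin _ _ qdu qdv).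
by apply: weak_derivative_lin => //; exact: sqint_loc_integrable.
Qed.

Lemma sobolev_weak k Om u a : open Om -> sobolev k Om u -> (a.1 + a.2 <= k)%N ->
  weak_derivative Om a u (wD Om a u).
Proof. by move=> oOm su ak; have [] := sobolev_wD oOm su ak. Qed.

Lemma wD_lin k Om u v a c : open Om -> sobolev k Om u -> sobolev k Om v -> (a.1 + a.2 <= k)%N ->
  ae_eq_on Om (wD Om a (fun x => u x + c * v x)) (fun x => wD Om a u x + c * wD Om a v x).
Proof.
move=> oOm su sv ak; have mOm := open_plane_measurable oOm.
apply: wD_ae => //; apply: weak_derivative_lin => //.
- exact: sqint_loc_integrable (sobolev_sqint su).
- exact: sqint_loc_integrable (sobolev_sqint sv).
- exact: sobolev_weak su ak.
- exact: sobolev_weak sv ak.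
Qed.

(** The boolean encodes the direction, false for y and true for z, so that both first derivatives
    are treated at once. *)
Lemma weak_derivative_first Om u (b : bool) a : open Om -> sobolev 2 Om u -> (a.1 + a.2 <= 1)%N ->
  weak_derivative Om a (wD Om (~~ b : nat, b : nat) u) (wD Om (~~ b + a.1, b + a.2)%N u).
Proof.
move=> oOm su a1.
have W := sobolev_weak oOm su (a := (~~ b + a.1, b + a.2)%N).
have {}W : weak_derivative Om (~~ b + a.1, b + a.2)%N u (wD Om (~~ b + a.1, b + a.2)%N u).
  by apply: W; rewrite /=; case: b; rewrite /= ?add0n ?add1n ?addSn ?addnS ltnS.
have W1 := sobolev_weak oOm su (a := (~~ b : nat, b : nat)).
have {}W1 : weak_derivative Om (~~ b : nat, b : nat) u (wD Om (~~ b : nat, b : nat) u).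
  by apply: W1; case: (b).
have [lW _] := W.
move: a1 W W1 lW; case: a => i j /=; case: b => /=; rewrite ?add0n ?add1n => a1 W W1 lW.
  case: i a1 W lW => [|[|i]] a1 W lW; last by [].
    exact: (weak_derivative_comp2 (i := false) lW W1 W).
  exact: (weak_derivative_comp2 (i := true) lW W1 W).
exact: (weak_derivative_comp1 lW W1 W).
Qed.

Lemma is_trace_first Om u v (b : bool) g1 g2 c : open Om -> sobolev 2 Om u -> sobolev 2 Om v ->
  let D := wD Om (~~ b : nat, b : nat) in
  is_trace Om (D u) g1 -> is_trace Om (D v) g2 ->
  is_trace Om (D (fun x => u x + c * v x)) (fun x => g1 x + c * g2 x).
Proof.
move=> oOm su sv D; have suv := sobolev_lin c oOm su sv.
apply: is_trace_lin => // a a1.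
have W1 := weak_derivative_first b oOm su a1; have W2 := weak_derivative_first b oOm sv a1.
have W := weak_derivative_first b oOm suv a1.
have [[[l1 _] [l2 _]] [l _]] := (weak_derivative_wD W1, weak_derivative_wD W2, weak_derivative_wD W).
split; [exact: l|exact: l1|exact: l2|].
have ak : ((~~ b + a.1, b + a.2)%N.1 + (~~ b + a.1, b + a.2)%N.2 <= 2)%N.
  by rewrite /=; case: (b); rewrite /= ?add0n ?add1n ?addSn ?addnS ltnS.
apply: ae_eq_on_trans (wD_ae oOm W) _; apply: ae_eq_on_trans (wD_lin c oOm su sv ak) _.
by apply: aeS (aeI (wD_ae oOm W1) (wD_ae oOm W2)) => x [h1 h2] Ox; rewrite h1// h2.
Qed.

Lemma plate_space_lin Om GD GM u v c : open Om -> plate_space Om GD GM u -> plate_space Om GD GM v ->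
  plate_space Om GD GM (fun x => u x + c * v x).
Proof.
move=> oOm [su [g tg g0] [g1 [g2 [t1 t2 B]]]] [sv [h th h0] [h1 [h2 [t1' t2' B']]]].
have suv := sobolev_lin c oOm su sv; split => //.
  exists (fun x => g x + c * h x); last by move=> p Gp; rewrite g0// h0// mulr0 addr0.
  apply: is_trace_lin tg th => // a a1; have a2 := leqW a1.
  have [[[l1 _] [l2 _]] [l _]] :=
    (sobolev_weak oOm su a2, sobolev_weak oOm sv a2, sobolev_weak oOm suv a2).
  by split => //; exact: wD_lin su sv a2.
exists (fun x => g1 x + c * h1 x), (fun x => g2 x + c * h2 x); split.
- exact: (is_trace_first (b := false) c oOm su sv t1 t1').
- exact: (is_trace_first (b := true) c oOm su sv t2 t2').
- move=> p n Gp np; have := B p n Gp np; have := B' p n Gp np => e1 e2.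
  have -> : n.1 * (g1 p + c * h1 p) + n.2 * (g2 p + c * h2 p) =
    (n.1 * g1 p + n.2 * g2 p) + c * (n.1 * h1 p + n.2 * h2 p) by ring.
  by rewrite e1 e2 mulr0 addr0.
Qed.

Lemma weak_derivative_zero Om a : open Om -> weak_derivative Om a (fun=> 0) (fun=> 0).
Proof.
move=> oOm; split; last first.
  have Z (f : plane -> R) : \int[leb2]_(x in Om) (0 * f x) = 0.
    by rewrite /Rintegral integral0_eq// => x _; rewrite mul0r.
  by move=> phi _; rewrite !Z mulr0.
split => // K cK KO; exact: integrable0.
Qed.

Lemma is_trace0 Om w : open Om ->
  (forall a, (a.1 + a.2 <= 1)%N -> loc_integrable Om (wD Om a w) /\ ae_eq_on Om (wD Om a w) (fun=> 0)) ->
  is_trace Om w (fun=> 0).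
Proof.
move=> oOm Hw; split => //; exists (fun _ _ => 0); split.
- by move=> _; exact: smooth2_0.
- move=> r a r0 a1; have [[mw _] ew] := Hw a a1; apply/L2norm_cvg0P => e e0; exists 0%N => n _.
  set D := Om `&` _.
  have mD : measurable D by apply: open_plane_measurable; apply: openI => //; exact: ball_open.
  rewrite pderiv0 (@ae_eq_on_sqi _ D _ (fun=> 0))//.
  + rewrite /sqi (eq_integral (cst 0%E)) ?integral0 ?lee_fin ?ltW//.
    by move=> x _; rewrite expr2 mulr0.
  + apply/(measurable_restrictT _ _).1 => //; apply: measurable_funB => //.
    by apply: measurable_funS mw => //; [exact: open_plane_measurable|move=> x []].
  + by apply/(measurable_restrictT _ _).1.
  + by apply: aeS ew => x /[swap] -[Ox _] /(_ Ox) ->; rewrite subr0.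
- move=> c1 c2 _; apply/ecvg0P => [n|e e0]; first by apply: integral_ge0 => t _; rewrite lee_fin mulr_ge0 ?sqr_ge0 ?sqrtr_ge0.
  exists 0%N => n _; rewrite (eq_integral (cst 0%E)) ?integral0 ?lee_fin ?ltW//.
  by move=> x _; rewrite subr0 expr2 !mul0r.
Qed.

Lemma plate_space0 Om GD GM : open Om -> plate_space Om GD GM (fun=> 0).
Proof.
move=> oOm; have W a := weak_derivative_zero a oOm.
have s0 : sobolev 2 Om (fun _ : plane => 0 : R).
  have L0 : L2 Om (fun _ : plane => 0 : R).
    by apply/L2P; apply: sqint_restrict; [exact: open_plane_measurable|exact: sqint0].
  by split => // a _; exists (fun=> 0).
have T b : is_trace Om (wD Om (~~ b : nat, b : nat) (fun _ : plane => 0 : R)) (fun=> 0).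
  apply: is_trace0 => // a a1; have F := weak_derivative_first b oOm s0 a1.
  have [l _] := weak_derivative_wD F; split => //.
  exact: ae_eq_on_trans (wD_ae oOm F) (wD_ae oOm (W _)).
split => //.
  exists (fun=> 0) => //; apply: is_trace0 => // a _.
  by have [l _] := weak_derivative_wD (W a); split => //; exact: wD_ae (W a).
exists (fun=> 0), (fun=> 0); split; [exact: (T false)|exact: (T true)|].
by move=> *; rewrite !mulr0 addr0.
Qed.


End plate_space_linear.

(** * Closed forms and the Fredholm alternative *)

Section forms.
Context {R : realType} {V : lmodType R}.
Implicit Types (W D : V -> Prop) (p q : V -> V -> R) (u v w : V) (c : R).

Definition lsubspace W := W 0 /\ forall u v c, W u -> W v -> W (u + c *: v).

(** A semi-inner product relative to W. Linearity is restricted to W because outside it chosen weak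
    derivatives are default values; definiteness is absent because functions equal almost everywhere
    on [Om] are not identified. *)
Definition form_on W p := [/\ forall u v, p u v = p v u,
  forall u v w c, W u -> W v -> W w -> p (u + c *: v) w = p u w + c * p v w &
  forall u, W u -> 0 <= p u u].

Definition form_tends p (u_ : nat -> V) u := p (u_ n - u) (u_ n - u) @[n --> \oo] --> (0 : R).

Definition form_cauchy p (u_ : nat -> V) := forall e : R, 0 < e -> exists N, forall m n,
  (N <= m)%N -> (N <= n)%N -> p (u_ m - u_ n) (u_ m - u_ n) <= e.

Definition form_complete W p := forall u_ : nat -> V, (forall n, W (u_ n)) -> form_cauchy p u_ ->
  exists2 u, W u & form_tends p u_ u.

Lemma cvg0P (x : nat -> R) : (forall n, 0 <= x n) ->
  x n @[n --> \oo] --> (0 : R) <->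
  forall e, 0 < e -> exists N, forall n, (N <= n)%N -> x n <= e.
Proof.
move=> x0; split => [cx e e0|H].
  have [N _ HN] : \forall n \near \oo, `|0 - x n| <= e by move/cvgrPdist_le : cx; apply.
  by exists N => n /HN /=; rewrite sub0r normrN ger0_norm.
apply/cvgrPdist_le => e /H[N HN]; exists N => // n /HN.
by rewrite /= sub0r normrN ger0_norm.
Qed.

Lemma inv_nat_small (e : R) : 0 < e -> exists N : nat, forall n, (N <= n)%N -> n.+1%:R^-1 <= e.
Proof.
by move=> e0; apply: (cvg0P _).1 (@cvg_harmonic R) e e0 => n; rewrite /harmonic invr_ge0.
Qed.

Lemma cvg0_le (x y : nat -> R) : (forall n, 0 <= x n <= y n) ->
  y n @[n --> \oo] --> (0 : R) -> x n @[n --> \oo] --> (0 : R).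
Proof.
move=> xy cy; apply: (@squeeze_cvgr _ _ _ _ (cst 0) y) => //; last exact: cvg_cst.
exact: nearW.
Qed.

Lemma cvg0_sqr_le (x y : nat -> R) : (forall n, x n ^+ 2 <= y n) ->
  y n @[n --> \oo] --> (0 : R) -> x n @[n --> \oo] --> (0 : R).
Proof.
move=> xy cy; apply: norm_cvg0.
apply: (@cvg0_le _ (fun n => Num.sqrt (y n))).
  by move=> n; rewrite normr_ge0/= -sqrtr_sqr ler_sqrt// (le_trans _ (xy n))// sqr_ge0.
by rewrite -[X in _ --> X]sqrtr0; apply: cvg_comp cy _; exact: sqrt_continuous.
Qed.

Lemma discriminant_le (e a c : R) : 0 <= c -> (forall t, 0 <= e + 2 * t * a + t ^+ 2 * c) ->
  a ^+ 2 <= e * c.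
Proof.
move=> c0 H; have e0 := H 0; rewrite !(mulr0, mul0r, expr0n, addr0) in e0.
move: c0; rewrite le_eqVlt => /predU1P[c0|c0].
  suff -> : a = 0 by rewrite expr0n mulr_ge0// -c0.
  apply/eqP/negPn/negP => a0; have := H (- (e + 1) / (2 * a)).
  rewrite -c0 mulr0 addr0; have -> : 2 * (- (e + 1) / (2 * a)) * a = - (e + 1) by field.
  by rewrite leNgt => /negP; apply; lra.
have := H (- a / c).
have -> : e + 2 * (- a / c) * a + (- a / c) ^+ 2 * c = e - a ^+ 2 / c by field; rewrite gt_eqF.
by rewrite subr_ge0 ler_pdivrMr.
Qed.

Section on_subspace.
Variables (W : V -> Prop) (p : V -> V -> R).
Hypotheses (sW : lsubspace W) (fp : form_on W p).

Lemma lsubspace0 : W 0. Proof. by case: sW. Qed.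

Lemma lsubspaceL u v c : W u -> W v -> W (u + c *: v). Proof. by case: sW => _; exact. Qed.

Lemma lsubspaceB u v : W u -> W v -> W (u - v).
Proof. by move=> Wu Wv; rewrite -scaleN1r; exact: lsubspaceL. Qed.

Lemma lsubspaceD u v : W u -> W v -> W (u + v).
Proof. by move=> Wu Wv; rewrite -[v]scale1r; exact: lsubspaceL. Qed.

Lemma lsubspaceZ c v : W v -> W (c *: v).
Proof. by move=> Wv; rewrite -[_ *: _]add0r; apply: lsubspaceL => //; exact: lsubspace0. Qed.

Lemma form_sym u v : p u v = p v u. Proof. by case: fp. Qed.

Lemma form_ge0 u : W u -> 0 <= p u u. Proof. by case: fp => _ _; exact. Qed.

Lemma form_linl u v w c : W u -> W v -> W w -> p (u + c *: v) w = p u w + c * p v w.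
Proof. by case: fp => _ + _; exact. Qed.

Lemma form_linr u v w c : W u -> W v -> W w -> p w (u + c *: v) = p w u + c * p w v.
Proof. by move=> Wu Wv Ww; rewrite form_sym form_linl// !(form_sym w). Qed.

Lemma form_subl u v w : W u -> W v -> W w -> p (u - v) w = p u w - p v w.
Proof. by move=> Wu Wv Ww; rewrite -scaleN1r form_linl// mulN1r. Qed.

Lemma form_subr u v w : W u -> W v -> W w -> p w (u - v) = p w u - p w v.
Proof. by move=> Wu Wv Ww; rewrite form_sym form_subl// !(form_sym w). Qed.

Lemma form_zerol w : W w -> p 0 w = 0.
Proof.
by move=> Ww; have := form_subl lsubspace0 lsubspace0 Ww; rewrite !subrr.
Qed.

Lemma form_scale c v w : W v -> W w -> p (c *: v) w = c * p v w.
Proof. by move=> Wv Ww; rewrite -[_ *: _]add0r form_linl ?form_zerol ?add0r//; exact: lsubspace0. Qed.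

Lemma form_sqrL u v c : W u -> W v ->
  p (u + c *: v) (u + c *: v) = p u u + 2 * c * p u v + c ^+ 2 * p v v.
Proof.
move=> Wu Wv; rewrite form_linl ?form_linr//; last exact: lsubspaceL.
by rewrite (form_sym v u); ring.
Qed.

Lemma form_sqrB u v : W u -> W v -> p (u - v) (u - v) = p u u - 2 * p u v + p v v.
Proof. by move=> Wu Wv; rewrite -scaleN1r form_sqrL//; ring. Qed.

Lemma form_sqrBC u v : W u -> W v -> p (u - v) (u - v) = p (v - u) (v - u).
Proof. by move=> Wu Wv; rewrite !form_sqrB// (form_sym v u); ring. Qed.

Lemma form_CS u v : W u -> W v -> p u v ^+ 2 <= p u u * p v v.
Proof.
move=> Wu Wv; apply: discriminant_le; first exact: form_ge0.
by move=> t; rewrite -form_sqrL//; apply: form_ge0; exact: lsubspaceL.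
Qed.

Lemma form_sqrB_le u v : W u -> W v -> p (u - v) (u - v) <= 2 * p u u + 2 * p v v.
Proof.
move=> Wu Wv; have := form_ge0 (lsubspaceD Wu Wv).
by rewrite -[X in _ + X]scale1r form_sqrL// form_sqrB//; lra.
Qed.

Lemma form_tri u v w : W u -> W v -> W w ->
  p (u - v) (u - v) <= 2 * p (u - w) (u - w) + 2 * p (v - w) (v - w).
Proof.
move=> Wu Wv Ww; have -> : u - v = (u - w) - (v - w).
  by rewrite opprB addrA subrK.
by apply: form_sqrB_le; exact: lsubspaceB.
Qed.

Lemma form_tends_le (u_ : nat -> V) u : (forall n, W (u_ n)) -> W u -> form_tends p u_ u <->
  forall e, 0 < e -> exists N, forall n, (N <= n)%N -> p (u_ n - u) (u_ n - u) <= e.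
Proof. by move=> Wn Wu; apply: cvg0P => n; apply: form_ge0; exact: lsubspaceB. Qed.

Lemma form_tends_cauchy (u_ : nat -> V) u : (forall n, W (u_ n)) -> W u ->
  form_tends p u_ u -> form_cauchy p u_.
Proof.
move=> Wn Wu /(form_tends_le Wn Wu) H e e0; have [N HN] := H (e / 4) ltac:(by rewrite divr_gt0).
exists N => m n /HN Hm /HN Hn; apply: le_trans (form_tri (Wn m) (Wn n) Wu) _.
by move: Hm Hn; lra.
Qed.

Lemma form_cvg_r (u_ : nat -> V) u v : (forall n, W (u_ n)) -> W u -> W v ->
  form_tends p u_ u -> p (u_ n) v @[n --> \oo] --> p u v.
Proof.
move=> Wn Wu Wv tu; apply/subr_cvg0.
apply: (@cvg0_sqr_le _ (fun n => p (u_ n - u) (u_ n - u) * p v v)).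
  by move=> n; rewrite -form_subl//; apply: form_CS => //; exact: lsubspaceB.
by rewrite -[X in _ --> X](mul0r (p v v)); apply: cvgM => //; exact: cvg_cst.
Qed.

Lemma form_cvg2 (u_ v_ : nat -> V) u v : (forall n, W (u_ n)) -> (forall n, W (v_ n)) -> W u -> W v ->
  form_tends p u_ u -> form_tends p v_ v -> p (u_ n) (v_ n) @[n --> \oo] --> p u v.
Proof.
move=> Wn Wn' Wu Wv tu tv.
have E : (fun n => p (u_ n) (v_ n)) = (fun n => p (u_ n - u) (v_ n - v) + (p (u_ n) v + p (v_ n) u - p u v)).
  apply/funext => n; have Wd := lsubspaceB (Wn' n) Wv.
  by rewrite form_subl// !form_subr// (form_sym (v_ n) u); ring.
rewrite E -[X in _ --> X]add0r; apply: cvgD.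
  apply: (@cvg0_sqr_le _ (fun n => p (u_ n - u) (u_ n - u) * p (v_ n - v) (v_ n - v))).
    by move=> n; apply: form_CS; exact: lsubspaceB.
  by rewrite -[X in _ --> X](mul0r (0 : R)); exact: cvgM.
rewrite -[X in _ --> X](_ : p u v + p v u - p u v = p u v); last by rewrite (form_sym v u); ring.
apply: cvgB; last exact: cvg_cst.
by apply: cvgD; exact: form_cvg_r.
Qed.

Lemma form_cvg_sqr (u_ : nat -> V) u : (forall n, W (u_ n)) -> W u ->
  form_tends p u_ u -> p (u_ n) (u_ n) @[n --> \oo] --> p u u.
Proof. by move=> Wn Wu tu; exact: form_cvg2. Qed.

End on_subspace.

Definition form_closure W p (S : V -> Prop) u := W u /\
  exists2 u_ : nat -> V, forall n, S (u_ n) & form_tends p u_ u.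

Section closure.
Variables (W : V -> Prop) (p : V -> V -> R) (S : V -> Prop).
Hypotheses (sW : lsubspace W) (fp : form_on W p) (sS : lsubspace S) (SW : forall u, S u -> W u).

Lemma form_closure_lsubspace : lsubspace (form_closure W p S).
Proof.
split.
  split; first exact: lsubspace0 sW.
  exists (fun=> 0); first by move=> _; exact: lsubspace0 sS.
  by rewrite /form_tends subrr (form_zerol sW fp)//; [exact: cvg_cst|exact: lsubspace0 sW].
move=> u v c [Wu [u_ Su tu]] [Wv [v_ Sv tv]]; split; first exact: lsubspaceL.
exists (fun n => u_ n + c *: v_ n); first by move=> n; exact: lsubspaceL.
have Wd n := lsubspaceB sW (SW (Su n)) Wu; have Wd' n := lsubspaceB sW (SW (Sv n)) Wv.
apply: (@cvg0_le _ (fun n => 2 * p (u_ n - u) (u_ n - u) + 2 * c ^+ 2 * p (v_ n - v) (v_ n - v))).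
  move=> n; have -> : u_ n + c *: v_ n - (u + c *: v) = (u_ n - u) - (- c) *: (v_ n - v).
    by rewrite opprD addrACA -scalerBr scaleNr opprK.
  have Wc := lsubspaceZ sW (- c) (Wd' n).
  apply/andP; split; first by apply: (form_ge0 fp); exact: lsubspaceB.
  apply: le_trans (form_sqrB_le sW fp (Wd n) Wc) _.
  rewrite (form_scale sW fp)// (form_sym fp) (form_scale sW fp)//.
  by rewrite le_eqVlt; apply/orP; left; apply/eqP; ring.
rewrite -[X in _ --> X](_ : 2 * 0 + 2 * c ^+ 2 * 0 = 0); last by rewrite !mulr0 addr0.
by apply: cvgD; apply: cvgM => //; exact: cvg_cst.
Qed.

Lemma form_closure_complete : form_complete W p -> form_complete (form_closure W p S) p.
Proof.
move=> cW u_ Hu cu; have Wu n : W (u_ n) by case: (Hu n).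
have [u Wu' tu] := cW u_ Wu cu; exists u => //; split => //.
(* A diagonal sequence: [w_ n] lies in S at squared distance at most 1 / (n + 1) from [u_ n]. *)
have /choice[w_ Hw] : forall n, exists w, S w /\ p (w - u_ n) (w - u_ n) <= n.+1%:R^-1.
  move=> n; have [_ [v_ Sv tv]] := Hu n.
  have /(form_tends_le sW fp (fun k => SW (Sv k)) (Wu n)) H := tv.
  have [|N HN] := H n.+1%:R^-1; first by rewrite invr_gt0.
  by exists (v_ N); split => //; exact: HN.
exists w_; first by move=> n; have [] := Hw n.
have Ww n : W (w_ n) by apply: SW; have [] := Hw n.
apply: (@cvg0_le _ (fun n => 2 * n.+1%:R^-1 + 2 * p (u_ n - u) (u_ n - u))).
  move=> n; apply/andP; split; first by apply: (form_ge0 fp); exact: lsubspaceB.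
  apply: le_trans (form_tri sW fp (Ww n) Wu' (Wu n)) _.
  rewrite (form_sqrBC sW fp Wu' (Wu n)) lerD2r ler_pM2l//.
  by have [] := Hw n.
rewrite -[X in _ --> X](_ : 2 * 0 + 2 * 0 = 0); last by rewrite !mulr0 addr0.
apply: cvgD; apply: cvgM => //; try exact: cvg_cst.
exact: cvg_harmonic.
Qed.

End closure.

End forms.

(** * Riesz theorem, Fredholm alternative and eigenvalues for a compact form *)

Section fredholm.
Context {R : realType} {V : lmodType R}.
Implicit Types (D : V -> Prop) (p q : V -> V -> R) (u v w : V) (c : R).

Definition bounded_functional D p (l : V -> R) :=
  (forall u v c, D u -> D v -> l (u + c *: v) = l u + c * l v) /\
  exists s, 0 <= s /\ forall v, D v -> l v ^+ 2 <= s * p v v.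

(** A minimising sequence for p v v - 2 l v. Near-minimality in every direction is a quadratic
    inequality in t, whose discriminant gives the approximate equation [key]. Applied to u_m - u_n
    it shows that the sequence is Cauchy; in the limit it becomes the exact equation. *)
Lemma riesz D p (l : V -> R) : lsubspace D -> form_on D p -> form_complete D p ->
  bounded_functional D p l -> exists2 u, D u & forall v, D v -> p u v = l v.
Proof.
move=> sD fp cD [ll [s [s0 ls]]]; pose J v := p v v - 2 * l v.
have Js v : D v -> - s <= J v.
  move=> Dv; have := ls v Dv; have := form_ge0 fp Dv; rewrite /J.
  move: (p v v) (l v) => P L P0 LsP; rewrite leNgt; apply/negP => H.
  have : (s + P) ^+ 2 < (2 * L) ^+ 2 by rewrite ltrXn2r//; lra.
  by rewrite ltNge => /negP; apply; have := sqr_ge0 (s - P); nra.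
pose E := [set J v | v in D].
have iE : has_inf E.
  split; first by exists (J 0), 0 => //; exact: lsubspace0 sD.
  by exists (- s) => _ [v Dv <-]; exact: Js.
have mJ v : D v -> inf E <= J v by move=> Dv; apply: ge_inf; [case: iE|exists v].
have /choice[u_ Hu] : forall n, exists u, D u /\ J u < inf E + n.+1%:R^-1.
  move=> n; have n0 : 0 < n.+1%:R^-1 :> R by rewrite invr_gt0.
  by have [_ [u Du <-] H] := inf_adherent n0 iE; exists u.
have Du n : D (u_ n) by have [] := Hu n.
have key n v : D v -> (p (u_ n) v - l v) ^+ 2 <= n.+1%:R^-1 * p v v.
  move=> Dv; apply: discriminant_le; first exact: (form_ge0 fp).
  move=> t; have := mJ _ (lsubspaceL sD t (Du n) Dv); have [_] := Hu n.
  rewrite /J (form_sqrL sD fp)// ll//.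
  move: (n.+1%:R^-1) (p (u_ n) (u_ n)) (p (u_ n) v) (p v v) (l v) (l (u_ n)) (inf E) => *; nra.
have [|u Du' tu] := cD u_ Du.
  move=> e e0; have [N HN] : exists N : nat, forall n, (N <= n)%N -> n.+1%:R^-1 <= e / 4.
    by apply: inv_nat_small; rewrite divr_gt0.
  exists N => m n /HN Hm /HN Hn; have Dd := lsubspaceB sD (Du m) (Du n).
  have Km := key m _ Dd; have Kn := key n _ Dd.
  have X0 := form_ge0 fp Dd.
  have E1 : p (u_ m - u_ n) (u_ m - u_ n) = (p (u_ m) (u_ m - u_ n) - l (u_ m - u_ n))
      - (p (u_ n) (u_ m - u_ n) - l (u_ m - u_ n)) by rewrite (form_subl fp)//; ring.
  move: E1 Km Kn X0; set X := p (u_ m - u_ n) _; set a := _ - l _; set b := _ - l _.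
  move: (m.+1%:R^-1) (n.+1%:R^-1) Hm Hn => em en Hm Hn.
  move: X a b => X a b Xab Ka Kb X0; rewrite leNgt; apply/negP => eX.
  have : X ^+ 2 <= 2 * a ^+ 2 + 2 * b ^+ 2 by rewrite Xab; have := sqr_ge0 (a + b); nra.
  by nra.
exists u => // v Dv; apply/eqP; rewrite -subr_eq0; apply/eqP.
have c1 : p (u_ n) v - l v @[n --> \oo] --> p u v - l v.
  by apply: cvgB; [exact: (form_cvg_r sD fp)|exact: cvg_cst].
apply: (cvg_unique _ c1) => //; apply: (@cvg0_sqr_le _ _ (fun n => n.+1%:R^-1 * p v v)).
  by move=> n; exact: key.
rewrite -[X in _ --> X](mul0r (p v v)); apply: cvgM; last exact: cvg_cst.
exact: cvg_harmonic.
Qed.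

Variables (D : V -> Prop) (p b : V -> V -> R).
Hypotheses (sD : lsubspace D) (fp : form_on D p) (fb : form_on D b) (cD : form_complete D p)
  (bp : forall u, D u -> b u u <= p u u)
  (compact_b : forall u_ : nat -> V, (forall n, D (u_ n)) ->
    (exists M, forall n, p (u_ n) (u_ n) <= M) ->
    exists2 s : nat -> nat, {homo s : m n / (m < n)%N} & form_cauchy b (u_ \o s)).

Lemma square_sub_le (mu x z k : R) : x ^+ 2 <= k -> z ^+ 2 <= k ->
  (x - mu * z) ^+ 2 <= (2 + 2 * mu ^+ 2) * k.
Proof.
move=> xk zk; have := sqr_ge0 (x + mu * z); have := ler_wpM2l (sqr_ge0 mu) zk.
have -> : (x - mu * z) ^+ 2 = 2 * x ^+ 2 + 2 * (mu ^+ 2 * z ^+ 2) - (x + mu * z) ^+ 2 by ring.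
have -> : (2 + 2 * mu ^+ 2) * k = 2 * k + 2 * (mu ^+ 2 * k) by ring.
move: (mu ^+ 2 * _) (mu ^+ 2 * _) (_ ^+ 2) xk => A B C ? ? ?; lra.
Qed.

(** Null vectors are allowed, so that these form a subspace; genuine eigenvectors are singled out by
    [b u u != 0]. *)
Definition eigenvector mu u := D u /\ forall v, D v -> p u v = mu * b u v.

Lemma form_tends_weaker (u_ : nat -> V) u : (forall n, D (u_ n)) -> D u ->
  form_tends p u_ u -> form_tends b u_ u.
Proof.
move=> Dn Du; apply: cvg0_le => n; have Dd := lsubspaceB sD (Dn n) Du.
by rewrite bp// andbT; exact: (form_ge0 fb).
Qed.

Section regular_value.
Variable mu : R.
Hypothesis regular : forall u, eigenvector mu u -> b u u = 0.

Let e u v := p u v - mu * b u v.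

(** The number s bounds the squared dual norm of e u. If no C worked, there would be unit vectors
    with e tending to 0. Compactness makes a subsequence Cauchy for b; since p = e + mu b, it is
    then Cauchy for p, and its limit is an eigenvector with p u u = 1, which regularity forbids. *)
Lemma fredholm_bound : exists C, 0 <= C /\ forall u s, D u -> 0 <= s ->
  (forall v, D v -> e u v ^+ 2 <= s * p v v) -> p u u <= C * s.
Proof.
apply: contrapT => nC.
have /choice[w_ Hw] : forall n : nat, exists w, [/\ D w, p w w = 1 &
    forall v, D v -> e w v ^+ 2 <= n.+1%:R^-1 * p v v].
  move=> n; apply: contrapT => nw; apply: nC; exists n.+1%:R; split => // u s Du s0 Hs.
  rewrite leNgt; apply/negP => us; apply: nw.
  have P0 : 0 < p u u by apply: le_lt_trans us; rewrite mulr_ge0.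
  have r0 : 0 < Num.sqrt (p u u) by rewrite sqrtr_gt0.
  have rr := sqr_sqrtr (ltW P0); set r := Num.sqrt _ in r0 rr.
  have Dw := lsubspaceZ sD r^-1 Du; exists (r^-1 *: u); split => //.
    rewrite (form_scale sD fp)// (form_sym fp) (form_scale sD fp)// -rr.
    by field; rewrite gt_eqF.
  move=> v Dv; have -> : e (r^-1 *: u) v = r^-1 * e u v.
    by rewrite /e (form_scale sD fp)// (form_scale sD fb)//; ring.
  have pv := form_ge0 fp Dv; rewrite exprMn exprVn rr mulrC ler_pdivrMr//.
  apply: le_trans (Hs v Dv) _; rewrite mulrAC ler_wpM2r// mulrC ler_pdivlMr//.
  by rewrite mulrC ltW.
have Dw n : D (w_ n) by have [] := Hw n.
have [|s sh sc] := compact_b Dw; first by exists 1 => n; have [_ ->] := Hw n.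
pose y n := w_ (s n); have Dy n : D (y n) by exact: Dw.
have ey n v : D v -> e (y n) v ^+ 2 <= n.+1%:R^-1 * p v v.
  move=> Dv; have [_ _ H] := Hw (s n); apply: le_trans (H v Dv) _.
  apply: ler_wpM2r; first exact: (form_ge0 fp).
  by rewrite lef_pV2 ?posrE// ler_nat ltnS increasing_ge_id.
have [|u Du tu] := cD Dy.
  move=> d d0; have [N HN] : exists N : nat, forall n, (N <= n)%N -> n.+1%:R^-1 <= d / 8.
    by apply: inv_nat_small; rewrite divr_gt0.
  have k0 : 0 < 4 * (`|mu| + 1) by rewrite mulr_gt0// ltr_wpDl.
  have [N' HN'] := sc (d / (4 * (`|mu| + 1))) (divr_gt0 d0 k0).
  exists (maxn N N') => m n; rewrite !geq_max => /andP[/HN Hm /HN' Hm'] /andP[/HN Hn Hn'].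
  have := Hm' n Hn'; rewrite /= -!/(y _) => Hb {Hm' Hn'}.
  have Dd := lsubspaceB sD (Dy m) (Dy n).
  have Em := ey m _ Dd; have En := ey n _ Dd; have X0 := form_ge0 fp Dd.
  have B0 := form_ge0 fb Dd.
  have : p (y m - y n) (y m - y n) = e (y m) (y m - y n) - e (y n) (y m - y n)
      + mu * b (y m - y n) (y m - y n).
    by rewrite /e (form_subl fp)// (form_subl fb)//; ring.
  move: Em En X0 B0 Hb; move: (p _ _) (e (y m) _) (e (y n) _) (b _ _) => X am an B.
  move: (m.+1%:R^-1) (n.+1%:R^-1) Hm Hn => em en Hm Hn Em En X0 B0 Hb XE.
  have muB : mu * B <= d / 4.
    apply: le_trans (ler_norm _) _; rewrite normrM (ger0_norm B0).
    move: Hb; rewrite ler_pdivlMr// => Hb.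
    have : 0 <= `|mu| by []. move: `|mu| Hb => M Hb M0; nra.
  (* Each of the two e-terms is at most X / 4 + d / 8, so half of X is absorbed on the left;
     together with [muB] this leaves X <= d. *)
  have half (x eps : R) : eps <= d / 8 -> x ^+ 2 <= eps * X -> x <= X / 4 + d / 8.
    move=> ed xX; rewrite leNgt; apply/negP => H.
    have : (X / 4 + d / 8) ^+ 2 < x ^+ 2 by rewrite ltrXn2r//; lra.
    by have := sqr_ge0 (X / 4 - d / 8); nra.
  have h1 := half _ _ Hm Em; have h2 : - an <= X / 4 + d / 8 by apply: half Hn _; rewrite sqrrN.
  by lra.
have eu v : D v -> e u v = 0.
  move=> Dv; have tb := form_tends_weaker Dy Du tu.
  have c1 : e (y n) v @[n --> \oo] --> e u v.
    apply: cvgB; first exact: (form_cvg_r sD fp).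
    by apply: cvgM; [exact: cvg_cst|exact: (form_cvg_r sD fb)].
  apply: (cvg_unique _ c1) => //; apply: (@cvg0_sqr_le _ _ (fun n => n.+1%:R^-1 * p v v)).
    by move=> n; exact: ey.
  rewrite -[X in _ --> X](mul0r (p v v)); apply: cvgM; last exact: cvg_cst.
  exact: cvg_harmonic.
have eig : eigenvector mu u.
  by split => // v /eu /eqP; rewrite subr_eq0 => /eqP.
have p1 : p u u = 1.
  apply: (cvg_unique _ (form_cvg_sqr sD fp Dy Du tu)) => //.
  rewrite (_ : (fun n => _) = cst 1); first exact: cvg_cst.
  by apply/funext => n; have [_ ->] := Hw (s n).
by have [_ /(_ u Du)] := eig; rewrite regular// mulr0 p1 => /eqP; rewrite oner_eq0.
Qed.

(** The form e is indefinite, so the Riesz theorem does not apply to it directly. [T] represents e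
    with respect to p, and q u v = p (T u) (T v) is positive and equivalent to p by the a priori
    bound. Riesz for q gives g with q g v = l v, and since e is symmetric, T g solves the
    equation. *)
Lemma fredholm_solve (l : V -> R) : bounded_functional D p l ->
  exists2 u, D u & forall v, D v -> p u v - mu * b u v = l v.
Proof.
move=> [ll [s [s0 ls]]]; have [C [C0 HC]] := fredholm_bound.
have /choice[B HB] : forall u, exists w, D u -> D w /\ forall v, D v -> p w v = b u v.
  move=> u; have [Du|nDu] := pselect (D u); last by exists u => /nDu.
  have [|w Dw Hw] := riesz sD fp cD (l := b u); last by exists w.
  split; first by move=> v w c Dv Dw; exact: (form_linr fb).
  exists (b u u); split; first exact: (form_ge0 fb).
  move=> v Dv; apply: le_trans (form_CS sD fb Du Dv) _.
  by rewrite ler_wpM2l ?bp//; exact: (form_ge0 fb).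
pose T u := u - mu *: B u.
have DT u : D u -> D (T u).
  by move=> Du; have [DB _] := HB u Du; apply: (lsubspaceB sD) => //; exact: lsubspaceZ.
have pT u v : D u -> D v -> p (T u) v = e u v.
  move=> Du Dv; have [DB HBu] := HB u Du.
  by rewrite (form_subl fp)//; [rewrite (form_scale sD fp)// HBu|exact: lsubspaceZ].
have eC u v : e u v = e v u by rewrite /e (form_sym fp) (form_sym fb).
pose q u v := p (T u) (T v).
have fq : form_on D q.
  split=> [u v|u v w c Du Dv Dw|u Du]; first exact: (form_sym fp).
    have DTw := DT w Dw; rewrite /q !pT//; last exact: lsubspaceL.
    by rewrite /e (form_linl fp)// (form_linl fb)//; ring.
  by apply: (form_ge0 fp); exact: DT.
have pq u : D u -> p u u <= C * q u u.
  move=> Du; apply: HC => //; first exact: (form_ge0 fq).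
  by move=> v Dv; rewrite -pT//; apply: (form_CS sD fp) => //; exact: DT.
have K0 : 0 <= 2 + 2 * mu ^+ 2 by rewrite addr_ge0// mulr_ge0// sqr_ge0.
have qp u : D u -> q u u <= (2 + 2 * mu ^+ 2) * p u u.
  move=> Du; have DTu := DT u Du; have pTu := form_ge0 fp DTu; have pu := form_ge0 fp Du.
  have CSp := form_CS sD fp Du DTu; have CSb := form_CS sD fb Du DTu.
  have bu := bp Du; have bTu := bp DTu.
  have b0 := form_ge0 fb Du; have bT0 := form_ge0 fb DTu.
  have E : q u u = e u (T u) by rewrite /q pT.
  have E2 : q u u ^+ 2 <= (2 + 2 * mu ^+ 2) * p u u * q u u.
    rewrite {1}E /e -/(q u u).
    have bb : b u (T u) ^+ 2 <= p u u * p (T u) (T u).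
      by apply: le_trans CSb _; exact: ler_pM.
    rewrite -mulrA; apply: square_sub_le bb; exact: CSp.
  move: pTu E2; rewrite -/(q u u); move: (q u u) => Q Q0.
  rewrite le_eqVlt in Q0; case/predU1P : Q0 => [<- _|Q0].
    by apply: mulr_ge0.
  by rewrite expr2 ler_pM2r.
have cq : form_complete D q.
  move=> u_ Du cu; have [|u Du' tu] := cD Du.
    move=> d d0; have k0 : 0 < C + 1 by rewrite ltr_wpDl.
    have [N HN] := cu (d / (C + 1)) (divr_gt0 d0 k0).
    exists N => m n Nm Nn; have Dd := lsubspaceB sD (Du m) (Du n).
    apply: le_trans (pq _ Dd) _; have := HN m n Nm Nn; have := form_ge0 fq Dd.
    by move: (q _ _) => Q Q0; rewrite ler_pdivlMr//; nra.
  exists u => //; apply: (@cvg0_le _ _ (fun n => (2 + 2 * mu ^+ 2) * p (u_ n - u) (u_ n - u))).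
    move=> n; have Dd := lsubspaceB sD (Du n) Du'.
    by rewrite qp// andbT; exact: (form_ge0 fq).
  rewrite -[X in _ --> X](mulr0 (2 + 2 * mu ^+ 2)); apply: cvgM => //; exact: cvg_cst.
have [|g Dg Hg] := riesz sD fq cq (l := l).
  split => //; exists (s * C); split; first exact: mulr_ge0.
  move=> v Dv; apply: le_trans (ls v Dv) _; rewrite -mulrA ler_wpM2l//; exact: pq.
exists (T g); first exact: DT.
move=> v Dv; have DTg := DT g Dg; rewrite -(Hg v Dv).
by rewrite [LHS](eC (T g) v) -(pT v (T g) Dv DTg); exact: (form_sym fp).
Qed.

End regular_value.

Definition orthonormal (s : seq V) := uniq s /\ {in s &, forall v w, b v w = (v == w)%:R}.

(** Otherwise one could go on choosing vectors forever. The resulting sequence is bounded for p, but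
    its members have squared b-distance 2 from one another, so no subsequence is Cauchy for b. *)
Lemma orthonormal_maximal (P : V -> Prop) M : (forall u, P u -> [/\ D u, b u u = 1 & p u u <= M]) ->
  exists s : seq V, [/\ {in s, forall v, P v}, orthonormal s &
    forall u, P u -> exists2 v, v \in s & b u v != 0].
Proof.
move=> HP; apply: contrapT => nE.
have /choice[f Hf] : forall s : seq V, exists u, {in s, forall v, P v} -> orthonormal s ->
    P u /\ {in s, forall v, b u v = 0}.
  move=> s; apply: contrapT => ns; apply: nE; exists s; split.
  - by apply: contrapT => nP; apply: ns; exists 0 => /nP.
  - by apply: contrapT => nP; apply: ns; exists 0 => _ /nP.
  - move=> u Pu; apply: contrapT => nu; apply: ns; exists u => _ _; split => // v vs.
    by apply/eqP/negPn/negP => buv; apply: nu; exists v.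
pose S := fix S n := if n is m.+1 then f (S m) :: S m else [::].
have HS n : {in S n, forall v, P v} /\ orthonormal (S n).
  elim: n => [|n [IP IO]] /=; first by split => //; split.
  have [Pf bf] := Hf _ IP IO; have [_ b1 _] := HP _ Pf; split.
    by move=> v; rewrite inE => /predU1P[->//|/IP].
  have nf : f (S n) \notin S n.
    by apply/negP => /bf /eqP; rewrite b1 oner_eq0.
  have [uS oS] := IO; split; first by rewrite /= nf.
  move=> v w; rewrite !inE => /predU1P[->|vS] /predU1P[->|wS].
  - by rewrite eqxx.
  - by rewrite bf//; case: eqP wS => // <-; rewrite (negPf nf).
  - by rewrite (form_sym fb) bf//; case: eqP vS => // ->; rewrite (negPf nf).
  - exact: oS.
pose u n := f (S n).
have Pu n : P (u n) /\ {in S n, forall v, b (u n) v = 0} by have [IP IO] := HS n; exact: Hf.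
have Du n : D (u n) by have [/HP[]] := Pu n.
have mS m n : (m < n)%N -> u m \in S n.
  elim: n => // n IH; rewrite ltnS leq_eqVlt => /predU1P[->|/IH] /=; rewrite inE ?eqxx// => ->.
  by rewrite orbT.
have [|s sh sc] := compact_b Du; first by exists M => n; have [/HP[]] := Pu n.
have [N HN] := sc 1 ltr01.
have := HN N.+1 N (leqnSn N) (leqnn N); rewrite /= (form_sqrB sD fb)//.
have [[/HP[_ -> _] bu] [/HP[_ -> _] _]] := (Pu (s N.+1), Pu (s N)).
by rewrite bu ?mulr0; [lra|apply: mS; exact: sh].
Qed.

Lemma eigenvectorL mu u v c : eigenvector mu u -> eigenvector mu v -> eigenvector mu (u + c *: v).
Proof.
move=> [Du Hu] [Dv Hv]; split; first exact: lsubspaceL.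
by move=> w Dw; rewrite (form_linl fp)// (form_linl fb)// Hu// Hv//; ring.
Qed.

Lemma eigenvector0 mu : eigenvector mu 0.
Proof.
split; first exact: lsubspace0 sD.
by move=> w Dw; rewrite (form_zerol sD fp)// (form_zerol sD fb)// mulr0.
Qed.

Lemma eigenvectorZ mu c u : eigenvector mu u -> eigenvector mu (c *: u).
Proof. by move=> Hu; rewrite -[_ *: _]add0r; apply: eigenvectorL => //; exact: eigenvector0. Qed.

Lemma eigenvector_normalize mu u : eigenvector mu u -> b u u != 0 ->
  exists2 c, c != 0 & b (c *: u) (c *: u) = 1 /\ eigenvector mu (c *: u).
Proof.
move=> Hu bu; have [Du _] := Hu; have b0 : 0 < b u u by rewrite lt_def bu; exact: (form_ge0 fb).
have r0 : 0 < Num.sqrt (b u u) by rewrite sqrtr_gt0.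
have rr := sqr_sqrtr (ltW b0); set r := Num.sqrt _ in r0 rr.
exists r^-1; first by rewrite invr_eq0 gt_eqF.
split; last exact: eigenvectorZ.
have Dw := lsubspaceZ sD r^-1 Du.
rewrite (form_scale sD fb)// (form_sym fb) (form_scale sD fb)// -rr.
by field; rewrite gt_eqF.
Qed.

Lemma eigenvalueE mu u : eigenvector mu u -> b u u = 1 -> p u u = mu.
Proof. by move=> [Du ->//] ->; rewrite mulr1. Qed.

(** The remainder [w] of the projection onto a maximal orthonormal family of the eigenspace is an
    eigenvector orthogonal to the family; if it were not null, its normalisation would contradict
    maximality. As b is only a semi-inner product, the conclusion is b w w = 0 and not w = 0. *)
Lemma eigenspace_finite mu : exists s : seq V, forall u, eigenvector mu u ->
  let w := u + (-1) *: (\sum_(v <- s) b u v *: v) in D w /\ b w w = 0.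
Proof.
have [|s [sP [us os] smax]] := @orthonormal_maximal (fun u => eigenvector mu u /\ b u u = 1) mu.
  by move=> u [eu bu]; split => //; [case: eu|rewrite (eigenvalueE eu bu)].
exists s => u eu; set y := \sum_(v <- s) _; rewrite /=; set w := u + _.
have [Du _] := eu; have ey : eigenvector mu y.
  rewrite /y big_seq; apply: (big_ind (eigenvector mu)) => [|v v' ev ev'|v vs].
  - exact: eigenvector0.
  - by rewrite -[v']scale1r; exact: eigenvectorL.
  - by apply: eigenvectorZ; have [] := sP v vs.
have by_ v : v \in s -> b y v = b u v.
  move=> vs; have Dv : D v by have [[]] := sP v vs.
  have Ey (r : seq V) : {subset r <= s} -> D (\sum_(z <- r) b u z *: z) /\
      b (\sum_(z <- r) b u z *: z) v = \sum_(z <- r) b u z * b z v.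
    elim: r => [|z r IH] rs; first by rewrite !big_nil (form_zerol sD fb)//; split => //; exact: lsubspace0 sD.
    have [|Dr Er] := IH; first by move=> x xr; apply: rs; rewrite inE xr orbT.
    have Dz : D z by have [[]] := sP z (rs z (mem_head _ _)).
    rewrite !big_cons; split; first by apply: (lsubspaceD sD) => //; exact: lsubspaceZ.
    by rewrite addrC (form_linl fb)// Er addrC.
  have [_ ->] := Ey s (fun _ => id); rewrite (bigD1_seq v)//= (os v v)// eqxx mulr1 big_seq_cond big1 ?addr0//.
  by move=> z /andP[zs /negPf zv]; rewrite (os z v)// zv mulr0.
have ew : eigenvector mu w by exact: eigenvectorL.
split; first by case: ew.
apply/eqP/negPn/negP => /(eigenvector_normalize ew)[c c0 [bc ec]].
have [v vs] := smax _ (conj ec bc); have Dv : D v by have [[]] := sP v vs.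
have [[Dw _] [Dy _]] := (ew, ey).
by rewrite (form_scale sD fb)// (form_linl fb)// by_// mulN1r subrr mulr0 eqxx.
Qed.

(** Eigenvectors for different eigenvalues are b-orthogonal. A maximal orthonormal family of
    eigenvectors with eigenvalues near t, but different from t, is finite, so its eigenvalues keep a
    distance d from t. An eigenvector closer to t is not orthogonal to some member, hence shares its
    eigenvalue. *)
Lemma eigenvalues_isolated t : exists2 d, 0 < d & forall mu u, eigenvector mu u -> b u u != 0 ->
  mu != t -> d <= `|mu - t|.
Proof.
apply: contrapT => nd.
have HE d : 0 < d -> exists mu u, [/\ eigenvector mu u, b u u = 1, mu != t & `|mu - t| < d].
  move=> d0; apply: contrapT => nE; apply: nd; exists d => // mu u eu bu mt.
  rewrite leNgt; apply/negP => md; apply: nE.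
  by have [c _ [bc ec]] := eigenvector_normalize eu bu; exists mu, (c *: u).
(* For b u u = 1 the eigenvalue is p u u, so it can be read off from the vector. *)
pose P u := [/\ eigenvector (p u u) u, b u u = 1, p u u != t & `|p u u - t| < 1].
have [|s [sP _ smax]] := @orthonormal_maximal P (t + 1).
  move=> u [[Du _] bu _]; rewrite ltr_norml => /andP[_ h]; split => //; lra.
have [d d0 Hd] : exists2 d, 0 < d & {in s, forall v, d <= `|p v v - t|}.
  elim: s sP {smax} => [|v s IH] sP; first by exists 1.
  have [|d d0 Hd] := IH; first by move=> x xs; apply: sP; rewrite inE xs orbT.
  have [_ _ vt _] := sP v (mem_head _ _).
  exists (Num.min d `|p v v - t|); first by rewrite lt_min d0 normr_gt0 subr_eq0.
  move=> x; rewrite inE => /predU1P[->|/Hd h]; first by rewrite ge_min lexx orbT.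
  by rewrite ge_min h.
have [mu [u [eu bu mt md]]] := HE (Num.min d 1) ltac:(by rewrite lt_min d0 ltr01).
have pu := eigenvalueE eu bu; move: md; rewrite lt_min => /andP[md m1].
have [|v vs /negP] := smax u; first by rewrite /P pu.
apply; have [[Dv ev] _ _ _] := sP v vs; have [Du Hu] := eu.
have := Hu v Dv; rewrite (form_sym fp) ev// (form_sym fb) => /eqP; rewrite -subr_eq0 -mulrBl mulf_eq0.
case/orP => // /eqP/subr0_eq vm; have := Hd v vs.
by rewrite vm leNgt md.
Qed.

End fredholm.

(** * The plate form *)

Section plate_forms.
Context {R : realType}.
Local Notation plane := (R * R)%type.
Local Notation leb1 := (@lebesgue_measure R).
Local Notation leb2 := (leb1 \x leb1)%E.
Local Notation E := (plane -> R^o).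
Implicit Types (Om : set plane) (u v w f g h phi psi : plane -> R) (a : nat * nat) (c : R).

Lemma form_sum (W : E -> Prop) (p q : E -> E -> R) (al : R) : form_on W p -> form_on W q -> 0 <= al ->
  form_on W (fun u v => p u v + al * q u v).
Proof.
move=> fp fq al0; split=> [u v|u v w c Wu Wv Ww|u Wu].
- by rewrite (form_sym fp) (form_sym fq).
- by rewrite (form_linl fp)// (form_linl fq)//; ring.
- by rewrite addr_ge0 ?mulr_ge0 ?(form_ge0 fp) ?(form_ge0 fq).
Qed.

Lemma form_ext (W : E -> Prop) (p q : E -> E -> R) : lsubspace W -> (forall u v, W u -> W v -> p u v = q u v) ->
  (forall u v, p u v = p v u) -> form_on W q -> form_on W p.
Proof.
move=> sW pq ps fq; split=> [//|u v w c Wu Wv Ww|u Wu].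
  by rewrite !pq ?(form_linl fq)//; exact: lsubspaceL.
by rewrite pq ?(form_ge0 fq).
Qed.

Lemma dot_form (W : E -> Prop) (d : E -> E) : (forall u, W u -> sqint leb2 (d u : plane -> R)) ->
  lsubspace W ->
  (forall u v c, W u -> W v -> {ae leb2, forall x, d (u + c *: v) x = d u x + c * d v x}) ->
  form_on W (fun u v => dot leb2 (d u) (d v)).
Proof.
move=> sd sW dl; split=> [u v|u v w c Wu Wv Ww|u Wu]; first exact: dotC.
  have Wuv := lsubspaceL sW c Wu Wv.
  have [[mu _] [mv _]] := (sd u Wu, sd v Wv); have [mw _] := sd w Ww; have [muv _] := sd _ Wuv.
  transitivity (dot leb2 (fun x => d u x + c * d v x) (d w)).
    apply: Rintegral_ae.
    - exact: measurable_funM.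
    - by apply: measurable_funM => //; apply: measurable_funD => //; exact: measurable_funM.
    - by apply: aeS (dl u v c Wu Wv) => x ->.
  rewrite dotDl ?dotZl//; [exact: sd|exact: sd|exact: sd|by apply: sqintZ; exact: sd|exact: sd].
exact: dot_ge0.
Qed.

(** The natural space of the form: first derivatives do not enter the form, and a limit in the form
    norm is only known to have second derivatives in L^2. *)
Definition hessian_sqint Om u := sqint leb2 (u \_ Om) /\ forall a, (a.1 + a.2 = 2)%N ->
  weak_derivative Om a u (wD Om a u) /\ sqint leb2 (wD Om a u \_ Om).

Lemma hessian_sqintI Om u : open Om -> sqint leb2 (u \_ Om) ->
  (forall a, (a.1 + a.2 = 2)%N -> exists2 g, weak_derivative Om a u g & sqint leb2 (g \_ Om)) ->
  hessian_sqint Om u.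
Proof.
move=> oOm su H; split => // a a2; have [g Wg sg] := H a a2.
have W := weak_derivative_wD Wg; split => //.
by apply: (sqint_ae_eq_on oOm _ (wD_ae oOm Wg) sg); case: W.
Qed.

Lemma sobolev_hessian Om u : open Om -> sobolev 2 Om u -> hessian_sqint Om u.
Proof.
move=> oOm su; split; first exact: sobolev_sqint su.
by move=> a a2; apply: (sobolev_wD oOm su); rewrite a2.
Qed.

Lemma hessian_wD_lin Om u v a c : open Om -> hessian_sqint Om u -> hessian_sqint Om v -> (a.1 + a.2 = 2)%N ->
  weak_derivative Om a (fun x => u x + c * v x) (fun x => wD Om a u x + c * wD Om a v x).
Proof.
move=> oOm [su Hu] [sv Hv] a2; have mOm := open_plane_measurable oOm.
have [Wu _] := Hu a a2; have [Wv _] := Hv a a2.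
by apply: weak_derivative_lin => //; exact: sqint_loc_integrable.
Qed.

Lemma hessian_sqint_lsubspace Om : open Om -> lsubspace (hessian_sqint Om : E -> Prop).
Proof.
move=> oOm; have mOm := open_plane_measurable oOm; split.
  have s0 : sqint leb2 ((fun _ : plane => 0 : R) \_ Om) by apply: sqint_restrict => //; exact: sqint0.
  by apply: hessian_sqintI => // a _; exists (fun=> 0) => //; exact: weak_derivative_zero.
move=> u v c Hu Hv; have [su Du] := Hu; have [sv Dv] := Hv.
have lin (f g : plane -> R) : sqint leb2 (f \_ Om) -> sqint leb2 (g \_ Om) ->
    sqint leb2 ((fun x => f x + c * g x) \_ Om).
  by move=> sf sg; rewrite patch_lin; apply: sqintD => //; exact: sqintZ.
apply: hessian_sqintI => //; first exact: (lin _ _ su sv).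
move=> a a2; have [_ sDu] := Du a a2; have [_ sDv] := Dv a a2.
exists (fun x => wD Om a u x + c * wD Om a v x); last exact: (lin _ _ sDu sDv).
exact: hessian_wD_lin.
Qed.

Lemma hessian_patch_lin Om u v a c : open Om -> hessian_sqint Om u -> hessian_sqint Om v -> (a.1 + a.2 = 2)%N ->
  {ae leb2, forall x, (wD Om a (fun x => u x + c * v x) \_ Om) x = (wD Om a u \_ Om) x + c * (wD Om a v \_ Om) x}.
Proof.
move=> oOm Hu Hv a2; have := wD_ae oOm (hessian_wD_lin c oOm Hu Hv a2).
by move/ae_eq_on_patch; rewrite patch_lin.
Qed.

Definition dotD Om a (u v : E) := dot leb2 (wD Om a u \_ Om) (wD Om a v \_ Om).

Definition laplacian Om u : plane -> R := fun x => (wD Om (2, 0)%N u \_ Om) x + (wD Om (0, 2)%N u \_ Om) x.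

Lemma dotD_form Om a : open Om -> (a.1 + a.2 = 2)%N -> form_on (hessian_sqint Om) (dotD Om a).
Proof.
move=> oOm a2; apply: (@dot_form _ (fun u => wD Om a u \_ Om)).
- by move=> u [_ /(_ a a2)[]].
- exact: hessian_sqint_lsubspace.
- by move=> u v c Hu Hv; exact: hessian_patch_lin.
Qed.

Lemma laplacian_sqint Om u : hessian_sqint Om u -> sqint leb2 (laplacian Om u).
Proof.
move=> [_ Hu]; have [_ s20] := Hu (2, 0)%N erefl; have [_ s02] := Hu (0, 2)%N erefl.
exact: (sqintD s20 s02).
Qed.

Lemma addr_lin (x y x' y' c : R) : (x + c * y) + (x' + c * y') = (x + x') + c * (y + y').
Proof. by ring. Qed.

Lemma laplacian_form Om : open Om ->
  form_on (hessian_sqint Om) (fun u v : E => dot leb2 (laplacian Om u) (laplacian Om v)).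
Proof.
move=> oOm; apply: (@dot_form _ (fun u => laplacian Om u)).
- by move=> u; exact: laplacian_sqint.
- exact: hessian_sqint_lsubspace.
- move=> u v c Hu Hv.
  apply: aeS (aeI (hessian_patch_lin (a := (2, 0)%N) c oOm Hu Hv erefl)
                  (hessian_patch_lin (a := (0, 2)%N) c oOm Hu Hv erefl)) => x [h1 h2].
  exact: etrans (congr2 +%R h1 h2) (addr_lin _ _ _ _ _).
Qed.

Lemma L2dotE Om u v : L2dot Om u v = dot leb2 (u \_ Om) (v \_ Om).
Proof.
rewrite /L2dot /dot Rintegral_mkcond; apply: eq_Rintegral => x _.
by rewrite !patchE; case: ifP => // _; rewrite mul0r.
Qed.

Lemma L2dot_form Om : open Om -> form_on (hessian_sqint Om) (L2dot Om : E -> E -> R).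
Proof.
move=> oOm; apply: (@form_ext _ _ (fun u v => dot leb2 (u \_ Om) (v \_ Om))).
- exact: hessian_sqint_lsubspace.
- by move=> u v _ _; exact: L2dotE.
- by move=> u v; rewrite !L2dotE; exact: dotC.
- apply: (@dot_form _ (fun u => u \_ Om)).
  + by move=> u [].
  + exact: hessian_sqint_lsubspace.
  + by move=> u v c _ _; apply: aeW => x; rewrite patch_lin.
Qed.

Lemma sum_of_squares_dot nu (f g h f' g' h' : plane -> R) :
  sqint leb2 f -> sqint leb2 g -> sqint leb2 h -> sqint leb2 f' -> sqint leb2 g' -> sqint leb2 h' ->
  \int[leb2]_x (f x * f' x + g x * g' x + 2 * (1 - nu) * (h x * h' x) + nu * (f x * g' x + g x * f' x)) =
  (1 - nu) * (dot leb2 f f' + dot leb2 g g' + 2 * dot leb2 h h')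
    + nu * dot leb2 (fun x => f x + g x) (fun x => f' x + g' x).
Proof.
move=> sf sg sh sf' sg' sh'.
have D (c : R) (k k' m : plane -> R) : sqint leb2 k -> sqint leb2 k' -> 
    leb2.-integrable setT (EFin \o m) ->
    \int[leb2]_x (m x + c * (k x * k' x)) = \int[leb2]_x m x + c * dot leb2 k k'.
  move=> sk sk' im; have ik := sqintM_integrable sk sk'.
  have ick : leb2.-integrable setT (EFin \o (fun x => c * (k x * k' x))) by exact: (integrableZl measurableT c ik).
  by rewrite /dot -RintegralZl// -RintegralD.
have I (c : R) (k k' m : plane -> R) : sqint leb2 k -> sqint leb2 k' ->
    leb2.-integrable setT (EFin \o m) -> leb2.-integrable setT (EFin \o (fun x => m x + c * (k x * k' x))).
  move=> sk sk' im; have ik := sqintM_integrable sk sk'.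
  have ick : leb2.-integrable setT (EFin \o (fun x => c * (k x * k' x))) by exact: (integrableZl measurableT c ik).
  by apply: integrableD im ick.
have sfg := sqintD sf sg; have sfg' := sqintD sf' sg'.
have i1 := sqintM_integrable sf sf'.
have i2 := I (1 - nu) _ _ _ sg sg' (I (- nu) _ _ _ sf sf' i1).
have i3 := I (2 * (1 - nu)) _ _ _ sh sh' i2.
transitivity (\int[leb2]_x (f x * f' x + (- nu) * (f x * f' x) + (1 - nu) * (g x * g' x)
   + 2 * (1 - nu) * (h x * h' x) + nu * ((f x + g x) * (f' x + g' x)))).
  by apply: eq_Rintegral => x _; ring.
have e1 := D nu _ _ _ sfg sfg' i3; have e2 := D (2 * (1 - nu)) _ _ _ sh sh' i2.
have e3 := D (1 - nu) _ _ _ sg sg' (I (- nu) _ _ _ sf sf' i1); have e4 := D (- nu) _ _ _ sf sf' i1.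
cbv beta in e1, e2, e3, e4; rewrite e1 e2 e3 e4 -[\int[leb2]_x (f x * f' x)]/(dot leb2 f f').
set A := dot leb2 f f'; set B := dot leb2 g g'; set C := dot leb2 h h'; set L := dot leb2 _ _.
by clearbody A B C L; ring.
Qed.

(* The cross term 2 nu D_11 u D_22 u is absorbed in nu times the squared
   Laplacian, which exhibits the form as a sum of squares. *)
Lemma plate_formE Om nu u v : hessian_sqint Om u -> hessian_sqint Om v ->
  plate_form Om nu u v = (1 - nu) * (dotD Om (2, 0)%N u v + dotD Om (0, 2)%N u v
    + 2 * dotD Om (1, 1)%N u v) + nu * dot leb2 (laplacian Om u) (laplacian Om v).
Proof.
move=> [_ Hu] [_ Hv].
have [_ u20] := Hu (2, 0)%N erefl; have [_ v20] := Hv (2, 0)%N erefl.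
have [_ u02] := Hu (0, 2)%N erefl; have [_ v02] := Hv (0, 2)%N erefl.
have [_ u11] := Hu (1, 1)%N erefl; have [_ v11] := Hv (1, 1)%N erefl.
apply: etrans (sum_of_squares_dot nu u20 u02 u11 v20 v02 v11).
rewrite /plate_form Rintegral_mkcond; apply: eq_Rintegral => x _.
clear; move: (wD Om (2, 0)%N u) (wD Om (0, 2)%N u) (wD Om (1, 1)%N u).
move: (wD Om (2, 0)%N v) (wD Om (0, 2)%N v) (wD Om (1, 1)%N v) => f g h f' g' h'.
by rewrite !patchE; case: ifP => // _; rewrite !(mulr0, addr0).
Qed.

Lemma plate_formC Om nu u v : plate_form Om nu u v = plate_form Om nu v u.
Proof.
rewrite /plate_form; apply: eq_Rintegral => x _.
move: (wD Om (2, 0)%N u x) (wD Om (0, 2)%N u x) (wD Om (1, 1)%N u x).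
move: (wD Om (2, 0)%N v x) (wD Om (0, 2)%N v x) (wD Om (1, 1)%N v x) => *; ring.
Qed.

Section coercive.
Variables (Om : set plane) (nu : R).
Hypotheses (oOm : open Om) (nu01 : 0 <= nu < 1).

Lemma plate_form_form : form_on (hessian_sqint Om) (plate_form Om nu : E -> E -> R).
Proof.
have /andP[nu0 nu1] := nu01.
(* The summand 0 and the factor 1 give the expression the shape of iterated [form_sum]. *)
apply: (@form_ext _ _ (fun u v : E => 0 + (1 - nu) * (dotD Om (2, 0)%N u v + 1 * dotD Om (0, 2)%N u v
    + 2 * dotD Om (1, 1)%N u v) + nu * dot leb2 (laplacian Om u) (laplacian Om v))).
- exact: hessian_sqint_lsubspace.
- by move=> u v Hu Hv; rewrite plate_formE// add0r mul1r.
- by move=> u v; exact: plate_formC.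
have z : form_on (hessian_sqint Om) (fun _ _ : E => 0).
  by split => // *; rewrite mulr0 addr0.
have n1 : 0 <= 1 - nu by rewrite subr_ge0 ltW.
apply: (form_sum (form_sum z _ n1) (laplacian_form oOm) nu0).
have f20 := dotD_form (a := (2, 0)%N) oOm erefl; have f02 := dotD_form (a := (0, 2)%N) oOm erefl.
have f11 := dotD_form (a := (1, 1)%N) oOm erefl.
exact: (form_sum (form_sum f20 f02 ler01) f11 (ler0n _ 2)).
Qed.

Lemma plate_form_coercive u a : hessian_sqint Om u -> (a.1 + a.2 = 2)%N ->
  (1 - nu) * dotD Om a u u <= plate_form Om nu u u.
Proof.
have /andP[nu0 nu1] := nu01; have n1 : 0 < 1 - nu by rewrite subr_gt0.
move=> Hu a2; rewrite plate_formE//.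
have L0 : 0 <= nu * dot leb2 (laplacian Om u) (laplacian Om u) by rewrite mulr_ge0// dot_ge0.
rewrite -[leLHS]addr0; apply: lerD L0; rewrite ler_pM2l//.
have : 0 <= dotD Om (2, 0)%N u u by exact: dot_ge0.
have : 0 <= dotD Om (0, 2)%N u u by exact: dot_ge0.
have : 0 <= dotD Om (1, 1)%N u u by exact: dot_ge0.
case: a a2 => [[|[|[|i]]] [|[|[|j]]]] a2; try discriminate a2;
  move: (dotD Om (2, 0)%N u u) (dotD Om (0, 2)%N u u) (dotD Om (1, 1)%N u u) => A B C; lra.
Qed.

(** The form of A + 1, whose square root is the form norm. It dominates the L^2 form, and an
    eigenvalue lam of A becomes lam + 1. *)
Definition full_form u v := plate_form Om nu u v + 1 * L2dot Om u v.

Lemma full_form_form : form_on (hessian_sqint Om) (full_form : E -> E -> R).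
Proof. exact: form_sum plate_form_form (L2dot_form oOm) ler01. Qed.

Lemma L2dot_le_full u : hessian_sqint Om u -> L2dot Om u u <= full_form u u.
Proof. by move=> Hu; rewrite /full_form mul1r lerDr; exact: (form_ge0 plate_form_form). Qed.

Lemma plate_form_le_full u : hessian_sqint Om u -> plate_form Om nu u u <= full_form u u.
Proof. by move=> Hu; rewrite /full_form mul1r lerDl; exact: (form_ge0 (L2dot_form oOm)). Qed.

End coercive.

End plate_forms.

(** * The closure of the plate form *)

Section plate_domain.
Context {R : realType}.
Local Notation plane := (R * R)%type.
Local Notation leb1 := (@lebesgue_measure R).
Local Notation leb2 := (leb1 \x leb1)%E.
Local Notation E := (plane -> R^o).
Implicit Types (u v w f g h phi psi : plane -> R) (a : nat * nat) (c : R).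
Variables (Om : set plane) (nu : R).
Hypotheses (oOm : open Om) (nu01 : 0 <= nu < 1).

Let mOm := open_plane_measurable oOm.

Lemma L2dot_sqi u : sqint leb2 (u \_ Om) -> sqi leb2 Om u = (L2dot Om u u)%:E.
Proof. by move=> su; rewrite -sqi_restrict dot_sqi// L2dotE. Qed.

Lemma L2dot_ge0 u : 0 <= L2dot Om u u.
Proof. by rewrite L2dotE dot_ge0. Qed.

Lemma L2norm_sqrt u : sqint leb2 (u \_ Om) -> L2norm Om u = (Num.sqrt (L2dot Om u u))%:E.
Proof. by move=> su; rewrite L2normE L2dot_sqi. Qed.

Lemma sqint_patchB u v : sqint leb2 (u \_ Om) -> sqint leb2 (v \_ Om) ->
  sqint leb2 ((fun x => u x - v x) \_ Om).
Proof. by move=> su sv; rewrite patchB; exact: sqintB. Qed.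

Lemma L2_tendsP (u_ : nat -> plane -> R) u : (forall n, sqint leb2 (u_ n \_ Om)) -> sqint leb2 (u \_ Om) ->
  form_tends (L2dot Om : E -> E -> R) (u_ : nat -> E) u <->
  forall e : R, 0 < e -> exists N, forall n, (N <= n)%N -> (sqi leb2 Om (fun x => u_ n x - u x)%R <= e%:E)%E.
Proof.
move=> su_ su; apply: iff_trans (cvg0P _) _; first by move=> n; exact: L2dot_ge0.
split=> H e /H[N HN]; exists N => n /HN; rewrite (L2dot_sqi (sqint_patchB (su_ n) su)); rewrite lee_fin; exact.
Qed.

Lemma dot_cvg (u_ : nat -> plane -> R) u psi : (forall n, sqint leb2 (u_ n \_ Om)) ->
  sqint leb2 (u \_ Om) -> sqint leb2 psi -> form_tends (L2dot Om : E -> E -> R) (u_ : nat -> E) u ->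
  dot leb2 (u_ n \_ Om) psi @[n --> \oo] --> dot leb2 (u \_ Om) psi.
Proof.
move=> su_ su sp tu; apply/subr_cvg0.
apply: (@cvg0_sqr_le _ _ (fun n => L2dot Om (fun x => u_ n x - u x) (fun x => u_ n x - u x) * dot leb2 psi psi)).
  move=> n; have sd := sqint_patchB (su_ n) su.
  by rewrite -dotBl// L2dotE -patchB; exact: dot_CS.
rewrite -[X in _ --> X](mul0r (dot leb2 psi psi)); apply: cvgM; last exact: cvg_cst.
exact: tu.
Qed.

(** Both sides of the defining identity are L^2 pairings with a fixed test function, hence
    continuous under L^2 convergence. *)
Lemma weak_derivative_closed a (u_ g_ : nat -> plane -> R) u g :
  (forall n, weak_derivative Om a (u_ n) (g_ n)) ->
  (forall n, sqint leb2 (u_ n \_ Om)) -> (forall n, sqint leb2 (g_ n \_ Om)) ->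
  sqint leb2 (u \_ Om) -> sqint leb2 (g \_ Om) ->
  form_tends (L2dot Om : E -> E -> R) (u_ : nat -> E) u ->
  form_tends (L2dot Om : E -> E -> R) (g_ : nat -> E) g ->
  weak_derivative Om a u g.
Proof.
move=> W su_ sg_ su sg tu tg; apply/weak_derivativeP; split; first exact: sqint_loc_integrable.
move=> phi tp; have sp := compactly_supported_sqint (test_function_supported tp).
have sdp := compactly_supported_sqint (test_function_supported (test_function_pderiv a tp)).
have c1 := dot_cvg su_ su sdp tu; have c2 := dot_cvg sg_ sg sp tg.
apply: (cvg_unique _ c1) => //.
rewrite (_ : (fun n => _) = fun n => (-1) ^+ (a.1 + a.2) * dot leb2 (g_ n \_ Om) phi); last first.
  by apply/funext => n; have /weak_derivativeP[_] := W n; exact.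
by apply: cvgM c2; exact: cvg_cst.
Qed.

Lemma dotD_sub a u v : hessian_sqint Om u -> hessian_sqint Om v -> (a.1 + a.2 = 2)%N ->
  dotD Om a (fun x => u x - v x) (fun x => u x - v x) =
  L2dot Om (fun x => wD Om a u x - wD Om a v x) (fun x => wD Om a u x - wD Om a v x).
Proof.
move=> Hu Hv a2; have eB : (fun x => u x - v x) = (fun x => u x + (-1) * v x).
  by apply/funext => x; rewrite mulN1r.
have sH : hessian_sqint Om (fun x => u x - v x).
  by rewrite eB; have [_ H] := hessian_sqint_lsubspace oOm; exact: H.
have [_ sW] := sH.2 a a2; rewrite L2dotE /dotD.
have [_ su] := Hu.2 a a2; have [_ sv] := Hv.2 a a2.
have sd := sqint_patchB su sv.
have ae : {ae leb2, forall x, (wD Om a (fun x => u x - v x) \_ Om) x =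
    ((fun x => wD Om a u x - wD Om a v x) \_ Om) x}.
  have := hessian_patch_lin (-1) oOm Hu Hv a2; rewrite -eB; apply: aeS => x ->.
  by rewrite patchB mulN1r.
have [m1 _] := sW; have [m2 _] := sd.
apply: Rintegral_ae; [exact: measurable_funM|exact: measurable_funM|].
by apply: aeS ae => x ->.
Qed.

Lemma dot_sqrD_le f g : sqint leb2 f -> sqint leb2 g ->
  dot leb2 (fun x => f x + g x) (fun x => f x + g x) <= 2 * (dot leb2 f f + dot leb2 g g).
Proof.
move=> sf sg; have [mf _] := sf; have [mg _] := sg; have sfg := sqintD sf sg.
by have := sqiD leb2 measurableT mf mg; rewrite !dot_sqi// -!EFinM -EFinD lee_fin -mulrDr.
Qed.

Lemma plate_form_le_hessian u : hessian_sqint Om u -> plate_form Om nu u u <=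
  2 * (dotD Om (2, 0)%N u u + dotD Om (0, 2)%N u u + dotD Om (1, 1)%N u u).
Proof.
have /andP[nu0 nu1] := nu01; move=> Hu; rewrite plate_formE//.
have [_ s20] := Hu.2 (2, 0)%N erefl; have [_ s02] := Hu.2 (0, 2)%N erefl.
have L : dot leb2 (laplacian Om u) (laplacian Om u) <= 2 * (dotD Om (2, 0)%N u u + dotD Om (0, 2)%N u u).
  exact: (dot_sqrD_le s20 s02).
have A0 : 0 <= dotD Om (2, 0)%N u u by exact: dot_ge0.
have B0 : 0 <= dotD Om (0, 2)%N u u by exact: dot_ge0.
have C0 : 0 <= dotD Om (1, 1)%N u u by exact: dot_ge0.
move: L A0 B0 C0; move: (dotD Om (2, 0)%N u u) (dotD Om (0, 2)%N u u) (dotD Om (1, 1)%N u u) (dot leb2 _ _).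
move=> A B C L LAB A0 B0 C0.
have := ler_wpM2l nu0 LAB; have : 0 <= 1 - nu by rewrite subr_ge0 ltW.
by have := mulr_ge0 nu0 C0; move: nu1; nra.
Qed.

(** Coercivity makes each second derivative Cauchy in L^2, and the limits are the weak derivatives
    of u. This settles closability and completeness at once. *)
Lemma hessian_closed (u_ : nat -> plane -> R) u : (forall n, hessian_sqint Om (u_ n)) ->
  sqint leb2 (u \_ Om) -> form_tends (L2dot Om : E -> E -> R) (u_ : nat -> E) u ->
  form_cauchy (plate_form Om nu : E -> E -> R) (u_ : nat -> E) ->
  hessian_sqint Om u /\ form_tends (full_form Om nu : E -> E -> R) (u_ : nat -> E) u.
Proof.
move=> Hu_ su tu cu; have /andP[nu0 nu1] := nu01; have n1 : 0 < 1 - nu by rewrite subr_gt0.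
have su_ n : sqint leb2 (u_ n \_ Om) by case: (Hu_ n).
have Hsub v w : hessian_sqint Om v -> hessian_sqint Om w -> hessian_sqint Om (fun x => v x - w x).
  exact: (lsubspaceB (hessian_sqint_lsubspace oOm)).
have lim a : (a.1 + a.2 = 2)%N -> exists2 g, weak_derivative Om a u g &
    sqint leb2 (g \_ Om) /\ form_tends (L2dot Om : E -> E -> R) (fun n => wD Om a (u_ n) : E) g.
  move=> a2; have sW n : sqint leb2 (wD Om a (u_ n) \_ Om) by have [] := (Hu_ n).2 a a2.
  have [|g /L2P sg Hg] := L2_complete mOm sW.
    move=> e e0; have [N HN] := cu ((1 - nu) * e) (mulr_gt0 n1 e0); exists N => m n Nm Nn.
    rewrite (L2dot_sqi (sqint_patchB (sW m) (sW n))) lee_fin -dotD_sub//.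
    rewrite -(ler_pM2l n1); apply: le_trans (HN m n Nm Nn).
    by apply: plate_form_coercive => //; exact: Hsub.
  have tg : form_tends (L2dot Om : E -> E -> R) (fun n => wD Om a (u_ n) : E) g.
    exact/(L2_tendsP sW sg).
  exists g => //; apply: (weak_derivative_closed _ su_ sW su sg tu tg).
  by move=> n; have [] := (Hu_ n).2 a a2.
have Hu : hessian_sqint Om u.
  by apply: hessian_sqintI => // a /lim[g Wg [sg _]]; exists g.
split => //.
have tD a : (a.1 + a.2 = 2)%N -> form_tends (dotD Om a : E -> E -> R) (u_ : nat -> E) u.
  move=> a2; have [g Wg [sg tg]] := lim a a2.
  have [Wu sWu] := Hu.2 a a2; have ae := ae_eq_on_patch (weak_derivative_unique oOm Wu Wg).
  rewrite /form_tends (_ : (fun n => _) = (fun n => L2dot Om (fun x => wD Om a (u_ n) x - g x) (fun x => wD Om a (u_ n) x - g x))) //.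
  apply/funext => n; have [_ sW] := (Hu_ n).2 a a2.
  rewrite [LHS](dotD_sub (Hu_ n) Hu a2) !L2dotE !patchB.
  have [m1 _] := sqintB sW sWu; have [m2 _] := sqintB sW sg.
  apply: Rintegral_ae; [exact: measurable_funM|exact: measurable_funM|].
  by apply: aeS ae => x ->.
have t20 := tD (2, 0)%N erefl; have t02 := tD (0, 2)%N erefl; have t11 := tD (1, 1)%N erefl.
apply: (@cvg0_le _ _ (fun n => 2 * (dotD Om (2, 0)%N (fun x => u_ n x - u x) (fun x => u_ n x - u x)
  + dotD Om (0, 2)%N (fun x => u_ n x - u x) (fun x => u_ n x - u x)
  + dotD Om (1, 1)%N (fun x => u_ n x - u x) (fun x => u_ n x - u x))
  + L2dot Om (fun x => u_ n x - u x) (fun x => u_ n x - u x))).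
  move=> n; have Hn := Hsub _ _ (Hu_ n) Hu; apply/andP; split; first exact: (form_ge0 (full_form_form oOm nu01) Hn).
  by rewrite /full_form mul1r; apply: lerD (lexx _); exact: plate_form_le_hessian.
rewrite -[X in _ --> X](_ : 2 * (0 + 0 + 0) + 0 = 0); last by rewrite !addr0 mulr0.
apply: cvgD tu; apply: cvgM; first exact: cvg_cst.
exact: (cvgD (cvgD t20 t02) t11).
Qed.

Lemma full_form_complete : form_complete (hessian_sqint Om) (full_form Om nu : E -> E -> R).
Proof.
move=> u_ Hu_ cu; have su_ n : sqint leb2 (u_ n \_ Om) by case: (Hu_ n).
have Hsub m n : hessian_sqint Om (fun x => u_ m x - u_ n x).
  exact: (lsubspaceB (hessian_sqint_lsubspace oOm)).
have [|v /L2P sv Hv] := L2_complete mOm su_.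
  move=> e /cu[N HN]; exists N => m n Nm Nn.
  rewrite (L2dot_sqi (sqint_patchB (su_ m) (su_ n))) lee_fin.
  apply: le_trans (HN m n Nm Nn); exact: L2dot_le_full.
have tv : form_tends (L2dot Om : E -> E -> R) u_ v by exact/(L2_tendsP su_ sv).
have [|Hvv tvv] := hessian_closed Hu_ sv tv; last by exists v.
move=> e /cu[N HN]; exists N => m n Nm Nn.
exact: le_trans (plate_form_le_full nu oOm (Hsub m n)) (HN m n Nm Nn).
Qed.

Variables (GD GM : set plane).

Lemma plate_space_hessian u : plate_space Om GD GM u -> hessian_sqint Om u.
Proof. by move=> [su _ _]; exact: sobolev_hessian. Qed.

Lemma plate_space_lsubspace : lsubspace (plate_space Om GD GM : E -> Prop).
Proof.
split; first exact: plate_space0.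
by move=> u v c Hu Hv; exact: (plate_space_lin c oOm Hu Hv).
Qed.

(** By [hessian_closed], the Cauchy condition together with L^2 convergence is already convergence
    to u in the form norm. *)
Lemma form_cvgP (u_ : nat -> plane -> R) u : form_cvg Om GD GM nu u_ u <->
  [/\ forall n, plate_space Om GD GM (u_ n), hessian_sqint Om u &
      form_tends (full_form Om nu : E -> E -> R) (u_ : nat -> E) u].
Proof.
have fF := full_form_form oOm nu01; have sH := hessian_sqint_lsubspace oOm.
split=> [[Pu /L2P su /L2norm_cvg0P tu cu]|[Pu Hu tu]].
  have Hu_ n := plate_space_hessian (Pu n); have su_ n : sqint leb2 (u_ n \_ Om) by case: (Hu_ n).
  have [|Hu t] := hessian_closed Hu_ su ((L2_tendsP su_ su).2 tu); last by split.
  by move=> e /cu[N HN]; exists N => m n Nm Nn; exact: ltW (HN m n Nm Nn).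
have Hu_ n := plate_space_hessian (Pu n); have su_ n : sqint leb2 (u_ n \_ Om) by case: (Hu_ n).
have su : sqint leb2 (u \_ Om) by case: Hu.
have Hd n := lsubspaceB sH (Hu_ n) Hu.
split => //; first exact/L2P.
  apply/L2norm_cvg0P/(L2_tendsP su_ su); apply: cvg0_le tu => n.
  by rewrite L2dot_ge0/=; exact: (L2dot_le_full oOm nu01 (Hd n)).
move=> e e0; have e2 : 0 < e / 2 by rewrite divr_gt0.
have [N HN] := form_tends_cauchy sH fF Hu_ Hu tu e2.
exists N => m n Nm Nn /=; apply: le_lt_trans (_ : e / 2 < e); last first.
  by rewrite ltr_pdivrMr// ltr_pMr// ltr1n.
exact: le_trans (plate_form_le_full nu oOm (lsubspaceB sH (Hu_ m) (Hu_ n))) (HN m n Nm Nn).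
Qed.

Definition plate_domain : E -> Prop :=
  form_closure (hessian_sqint Om) (full_form Om nu : E -> E -> R) (plate_space Om GD GM).

Lemma closed_form_domainP u : closed_form_domain Om GD GM nu u <-> plate_domain u.
Proof.
split=> [[u_ /form_cvgP[Pu Hu tu]]|[Hu [u_ Pu tu]]]; first by split => //; exists u_.
by exists u_; apply/form_cvgP.
Qed.

(** The plate form is continuous in the form norm, so every pair of approximating sequences yields
    the same limit; this is the value that [xget] must return. *)
Lemma closed_formE u v : plate_domain u -> plate_domain v ->
  closed_form Om GD GM nu u v = plate_form Om nu u v.
Proof.
have fF := full_form_form oOm nu01; have sH := hessian_sqint_lsubspace oOm.
have fP := plate_form_form oOm nu01.
have lim (u_ v_ : nat -> plane -> R) u' v' : form_cvg Om GD GM nu u_ u' -> form_cvg Om GD GM nu v_ v' ->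
    plate_form Om nu (u_ n) (v_ n) @[n --> \oo] --> plate_form Om nu u' v'.
  move=> /form_cvgP[Pu Hu tu] /form_cvgP[Pv Hv tv].
  have Hu_ n := plate_space_hessian (Pu n); have Hv_ n := plate_space_hessian (Pv n).
  have weak (w_ : nat -> E) w : (forall n, hessian_sqint Om (w_ n)) -> hessian_sqint Om w ->
      form_tends (full_form Om nu : E -> E -> R) w_ w -> form_tends (plate_form Om nu : E -> E -> R) w_ w.
    move=> Hw_ Hw; apply: cvg0_le => n; have Hd := lsubspaceB sH (Hw_ n) Hw.
    by rewrite (form_ge0 fP Hd)/=; exact: (plate_form_le_full nu oOm Hd).
  exact: (form_cvg2 sH fP Hu_ Hv_ Hu Hv (weak _ _ Hu_ Hu tu) (weak _ _ Hv_ Hv tv)).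
move=> /closed_form_domainP[u_ cu] /closed_form_domainP[v_ cv]; rewrite /closed_form.
case: xgetP => [c _ [u' [v' [cu' cv' cc]]]|/(_ (plate_form Om nu u v)) []].
  exact: (cvg_unique _ cc (lim _ _ _ _ cu' cv')).
by exists u_, v_; split => //; exact: lim.
Qed.

End plate_domain.

(** * The spectrum of the plate operator *)

Section plate_spectral_theory.
Context {R : realType}.
Local Notation plane := (R * R)%type.
Local Notation leb1 := (@lebesgue_measure R).
Local Notation leb2 := (leb1 \x leb1)%E.
Local Notation E := (plane -> R^o).
Implicit Types (u v w f g : plane -> R) (lam : R).
Variables (Om GD GM : set plane) (nu : R).
Hypotheses (oOm : open Om) (nu01 : 0 <= nu < 1) (pO : precompact_on Om Om).

Let mOm := open_plane_measurable oOm.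
Let D := plate_domain Om nu GD GM.
Let p := full_form Om nu : E -> E -> R.
Let b := L2dot Om : E -> E -> R.
Let sH := hessian_sqint_lsubspace oOm.
Let fH := full_form_form oOm nu01.

Lemma plate_domain_hessian u : D u -> hessian_sqint Om u.
Proof. by case. Qed.

Lemma plate_domain_sqint u : D u -> sqint leb2 (u \_ Om).
Proof. by move=> /plate_domain_hessian[]. Qed.

Lemma form_on_sub (W W' : E -> Prop) (q : E -> E -> R) : (forall u, W' u -> W u) -> form_on W q -> form_on W' q.
Proof.
move=> WW fq; split=> [u v|u v w c /WW Wu /WW Wv /WW Ww|u /WW Wu].
- exact: (form_sym fq).
- exact: (form_linl fq).
- exact: (form_ge0 fq).
Qed.

Lemma plate_domain_lsubspace : lsubspace D.
Proof.
apply: (form_closure_lsubspace sH fH (plate_space_lsubspace oOm GD GM)).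
by move=> u; exact: plate_space_hessian.
Qed.

Lemma plate_domain_complete : form_complete D p.
Proof.
apply: (form_closure_complete sH fH); first by move=> u; exact: plate_space_hessian.
exact: full_form_complete.
Qed.

Lemma plate_domain_full_form : form_on D p.
Proof. exact: form_on_sub plate_domain_hessian fH. Qed.

Lemma plate_domain_L2dot : form_on D b.
Proof. exact: form_on_sub plate_domain_hessian (L2dot_form oOm). Qed.

Lemma L2dot_le_full_domain u : D u -> b u u <= p u u.
Proof. by move=> Du; exact: (L2dot_le_full oOm nu01 (plate_domain_hessian Du)). Qed.

Lemma plate_domain_compact (u_ : nat -> E) : (forall n, D (u_ n)) ->
  (exists M, forall n, p (u_ n) (u_ n) <= M) ->
  exists2 s : nat -> nat, {homo s : m n / (m < n)%N} & form_cauchy b (u_ \o s).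
Proof.
move=> Du [M HM]; have /andP[nu0 nu1] := nu01; have n1 : 0 < 1 - nu by rewrite subr_gt0.
have Hu n := plate_domain_hessian (Du n); have su n : sqint leb2 (u_ n \_ Om) by case: (Hu n).
have W n : twice_diff Om (u_ n \_ Om) (wD Om (2, 0)%N (u_ n) \_ Om) (wD Om (0, 2)%N (u_ n) \_ Om).
  have [w20 s20] := (Hu n).2 (2, 0)%N erefl; have [w02 s02] := (Hu n).2 (0, 2)%N erefl.
  exact: (twice_diff_patch (su n) s20 s02 w20 w02).
have [|s [sh sc]] := cauchy_subsequence mOm pO W (M := M + M / (1 - nu) + M / (1 - nu)).
  move=> n; have plM : plate_form Om nu (u_ n) (u_ n) <= M.
    exact: le_trans (plate_form_le_full nu oOm (Hu n)) (HM n).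
  have bound a : (a.1 + a.2 = 2)%N -> dotD Om a (u_ n) (u_ n) <= M / (1 - nu).
    move=> a2; rewrite ler_pdivlMr// mulrC.
    exact: le_trans (plate_form_coercive nu01 (Hu n) a2) plM.
  have bM : dot leb2 (u_ n \_ Om) (u_ n \_ Om) <= M.
    by rewrite -L2dotE; exact: le_trans (L2dot_le_full oOm nu01 (Hu n)) (HM n).
  exact: (lerD (lerD bM (bound (2, 0)%N erefl)) (bound (0, 2)%N erefl)).
exists s => // e /sc[N HN]; exists N => m n Nm Nn.
have := HN m n Nm Nn; rewrite sqi_patchB (L2dot_sqi (sqint_patchB (su (s m)) (su (s n)))) lee_fin.
exact.
Qed.

Let sD := plate_domain_lsubspace.
Let fp := plate_domain_full_form.
Let fb := plate_domain_L2dot.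
Let cD := plate_domain_complete.

(** The shift from lam to lam + 1 comes from replacing the plate form by [full_form], the positive
    form to which the abstract theory applies. *)
Lemma plate_opE u f lam : plate_op Om GD GM nu u (fun x => lam * u x + f x) <->
  [/\ D u, L2 Om f & forall v, D v -> p u v - (lam + 1) * b u v = L2dot Om f v].
Proof.
have split_rhs v : D u -> L2 Om f -> D v ->
    L2dot Om (fun x => lam * u x + f x) v = lam * b u v + L2dot Om f v.
  move=> /plate_domain_sqint su /L2P sf /plate_domain_sqint sv; rewrite /b !L2dotE.
  have -> : (fun x => lam * u x + f x) \_ Om = fun x => (f \_ Om) x + lam * (u \_ Om) x.
    by rewrite -patch_lin; congr (_ \_ _); apply/funext => x; rewrite addrC.
  by rewrite dotDl//; [rewrite dotZl// addrC|exact: sqintZ].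
have lin (g : plane -> R) c : D u -> L2 Om g -> L2 Om (fun x => c * u x + g x).
  move=> /plate_domain_sqint su /L2P sg; apply/L2P.
  have -> : (fun x => c * u x + g x) \_ Om = fun x => (g \_ Om) x + c * (u \_ Om) x.
    by rewrite -patch_lin; congr (_ \_ _); apply/funext => x; rewrite addrC.
  by apply: sqintD => //; exact: sqintZ.
split=> [[/(closed_form_domainP oOm nu01) Du Lf H]|[Du Lf H]].
  have Lf' : L2 Om f.
    have := lin _ (- lam) Du Lf; congr (L2 Om _); apply/funext => x.
    by rewrite addrA -mulrDl addNr mul0r add0r.
  split => // v Dv; have := H v ((closed_form_domainP oOm nu01 GD GM v).2 Dv).
  rewrite (closed_formE oOm nu01 Du Dv) split_rhs// => pf.
  rewrite /p /full_form pf -/b; move: (b u v) (L2dot Om f v) => B F; ring.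
split; [exact/(closed_form_domainP oOm nu01)|exact: lin|].
move=> v /(closed_form_domainP oOm nu01) Dv; rewrite (closed_formE oOm nu01 Du Dv) split_rhs//.
rewrite -(H v Dv) /p /full_form -/b; move: (b u v) (plate_form Om nu u v) => B F; ring.
Qed.

Lemma plate_eigenfunctionP lam u : plate_eigenfunction Om GD GM nu lam u <-> eigenvector D p b (lam + 1) u.
Proof.
have E0 : (fun x => lam * u x) = (fun x => lam * u x + (fun=> 0) x).
  by apply/funext => x; rewrite addr0.
rewrite /plate_eigenfunction E0; split=> [/plate_opE[Du _ H]|[Du H]].
  split => // v Dv; apply/eqP; rewrite -subr_eq0 H// /L2dot /Rintegral integral0_eq// => x _.
  by rewrite mul0r.
apply/plate_opE; split => //.
  by apply/L2P; apply: sqint_restrict => //; exact: sqint0.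
move=> v Dv; rewrite H// subrr /L2dot /Rintegral integral0_eq// => x _.
by rewrite mul0r.
Qed.

Lemma L2norm_neq0 u : D u -> (L2norm Om u != 0%E) = (b u u != 0).
Proof.
move=> /plate_domain_sqint su; rewrite L2norm_sqrt// eqe sqrtr_eq0 /b.
by rewrite le_eqVlt [X in _ || X]ltNge L2dot_ge0 orbF.
Qed.

(** If lam + 1 has no genuine eigenvector, [fredholm_bound] is the resolvent estimate and
    [fredholm_solve] is surjectivity, so lam lies in the resolvent set. *)
Lemma plate_spectrum_eigenvalue lam : plate_spectrum Om GD GM nu lam ->
  exists u, eigenvector D p b (lam + 1) u /\ b u u != 0.
Proof.
move=> Hlam; apply: contrapT => nE; apply: Hlam.
have regular u : eigenvector D p b (lam + 1) u -> b u u = 0.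
  by move=> eu; apply/eqP/negPn/negP => bu; apply: nE; exists u.
have CS f v : L2 Om f -> D v -> L2dot Om f v ^+ 2 <= L2dot Om f f * p v v.
  move=> /L2P sf Dv; have sv := plate_domain_sqint Dv.
  apply: le_trans (_ : _ <= L2dot Om f f * L2dot Om v v) _.
    by rewrite !L2dotE; exact: dot_CS.
  by apply: ler_wpM2l; [exact: L2dot_ge0|exact: L2dot_le_full_domain].
split.
  have [C [C0 HC]] := fredholm_bound sD fp fb cD L2dot_le_full_domain plate_domain_compact regular.
  (* The a priori bound concerns squared norms. *)
  exists (Num.sqrt C) => u f /plate_opE[Du Lf H].
  have : p u u <= C * L2dot Om f f.
    apply: HC => //; first exact: L2dot_ge0.
    by move=> v Dv; rewrite H//; exact: CS.
  move=> puC; have su := plate_domain_sqint Du; have /L2P sf := Lf.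
  rewrite !L2norm_sqrt// -EFinM lee_fin -sqrtrM// ler_sqrt ?mulr_ge0 ?L2dot_ge0//.
  exact: le_trans (L2dot_le_full_domain Du) puC.
move=> f Lf.
have [|u Du Hu] := fredholm_solve sD fp fb cD L2dot_le_full_domain plate_domain_compact regular (l := L2dot Om f).
  split=> [v w c Dv Dw|]; last first.
    by exists (L2dot Om f f); split; [exact: L2dot_ge0|move=> v Dv; exact: CS].
  have /L2P sf := Lf; have sv := plate_domain_sqint Dv; have sw := plate_domain_sqint Dw.
  have L2C (g h : plane -> R) : L2dot Om g h = L2dot Om h g by rewrite !L2dotE; exact: dotC.
  rewrite !(L2C f) !L2dotE (patch_lin Om v w c) dotDl//; last exact: sqintZ.
  by rewrite dotZl.
by exists u; apply/plate_opE.
Qed.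

Lemma L2dot_eq0 u : sqint leb2 (u \_ Om) -> L2dot Om u u = 0 -> {ae leb2, forall x, Om x -> u x = 0}.
Proof.
move=> su u0; have := L2dot_sqi su; rewrite u0 -sqi_restrict => I0.
have [mu _] := su.
have := (ae_eq_integral_abs leb2 measurableT (measurable_sqr mu)).1.
rewrite (_ : (\int[leb2]_(x in setT) `|((u \_ Om) x ^+ 2)%:E|)%E = 0%E); last first.
  rewrite -[RHS]I0; apply: eq_integral => x _; rewrite gee0_abs// lee_fin sqr_ge0//.
move=> /(_ erefl); apply: aeS => x /(_ I) /= + Ox.
by rewrite patchE mem_set// => -[] /eqP; rewrite sqrf_eq0 => /eqP.
Qed.

Lemma plate_finite_multiplicity lam : finite_multiplicity Om GD GM nu lam.
Proof.
have [s Hs] := eigenspace_finite sD fp fb plate_domain_compact (lam + 1).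
exists (size s), (fun i => nth 0 s i) => u /plate_eigenfunctionP eu.
have [Du _] := eu; exists (fun i => b u (nth 0 s i)).
have E0 : (u : E) + (-1) *: (\sum_(v <- s) b u v *: v) =
    (fun x => u x - \sum_(i < size s) b u (nth 0 s i) * nth 0 s i x) :> E.
  apply/funext => x; rewrite scaleN1r [LHS]/=; congr (_ - _).
  rewrite (big_nth 0) big_mkord.
  by elim/big_rec2: _ => // i y z _ <-.
have [] := Hs u eu; rewrite /= E0 => /plate_domain_sqint sw /(L2dot_eq0 sw).
by apply: aeS => x + Ox => /(_ Ox) /eqP; rewrite subr_eq0 => /eqP.
Qed.

(** A punctured neighbourhood free of spectrum exists around every real t. For t in the spectrum
    this is isolation, and for all t together it excludes limit points. *)
Lemma precompact_plate_spectrum_discrete : plate_spectrum_discrete Om GD GM nu.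
Proof.
have iso t : exists2 d, 0 < d & forall lam, plate_spectrum Om GD GM nu lam -> lam != t -> d <= `|lam - t|.
  have [d d0 Hd] := eigenvalues_isolated sD fp fb plate_domain_compact (t + 1).
  exists d => // lam /plate_spectrum_eigenvalue[u [eu bu]] lt.
  by have := Hd _ _ eu bu; rewrite (inj_eq (addIr 1)) opprD addrACA subrr addr0; exact.
split=> [lam slam|].
  split; last exact: plate_finite_multiplicity.
    split; first exact/mem_set.
    have [d d0 Hd] := iso lam; exists (ball lam d); first exact: nbhsx_ballx.
    apply/seteqP; split=> [t [bt st]|t ->]; last by split => //; exact: ballxx.
    apply/eqP/negPn/negP => tl; have := Hd t st tl.
    by move: bt; rewrite /ball /= distrC leNgt => ->.
  have [u [eu bu]] := plate_spectrum_eigenvalue slam; exists u; first exact/plate_eigenfunctionP.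
  by rewrite L2norm_neq0//; case: eu.
apply/seteqP; split=> [t Ht|//]; have [d d0 Hd] := iso t.
have [y [yt sy by_]] := Ht (ball t d) (nbhsx_ballx t d d0).
have := Hd y sy yt; by move: by_; rewrite /ball /= distrC leNgt => ->.
Qed.

End plate_spectral_theory.

Theorem theorem8 (R : realType) (y0 : R) (H : R -> R)
    (Om GD GN GM : set (R * R)) (nu : R)
    (y0_ge0 : 0 <= y0)
    (H_gt0 : forall t, 0 <= t -> 0 < H t)
    (H_smooth : smooth_on_ray y0 H)
    (H_decr : forall s t, y0 <= s -> s <= t -> H t <= H s)
    (H'_to0 : derive1 H t @[t --> +oo%R] --> (0 : R))
    (H''_bounded : exists M : R, forall t, y0 < t -> `|derive1n 2 H t| <= M)
    (Om_domain : domain Om)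
    (Om_boundary : smooth_boundary Om)
    (Om_peak : Om `&` [set x | y0 < x.1] = peak H y0)
    (Om_bounded : bounded_set (Om `\` [set x | y0 < x.1]))
    (GD_curves : finite_union_of_curves Om GD)
    (GN_curves : finite_union_of_curves Om GN)
    (GM_curves : finite_union_of_curves Om GM)
    (GDN_disj : GD `&` GN = set0)
    (GDM_disj : GD `&` GM = set0)
    (GNM_disj : GN `&` GM = set0)
    (G_cover : frontier Om = closure GD `|` closure GN `|` closure GM)
    (nu_range : 0 <= nu < 2^-1)
    (H_C2 : C2_on_ray 0 H)
    (H_integrable :
      (\int[lebesgue_measure]_(s in `[0%R, +oo[) (H s)%:E < +oo)%E)
    (H_convex : exists2 T : R, 0 <= T &
      forall t, T < t -> derive1 H t < 0 /\ 0 < derive1n 2 H t)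
    (H_logderiv : derive1 (fun t => ln (H t)) t @[t --> +oo%R] --> -oo%R)
    (Neumann_peak : upper_side H y0 `|` lower_side H y0 `<=` GN) :
  H2_compactly_embedded Om /\ plate_spectrum_discrete Om GD GM nu.
Proof.
have [oOm _ _] := Om_domain.
have Hpos t : y0 <= t -> 0 < H t by move=> yt; apply: H_gt0; exact: le_trans yt.
have pO : precompact_on Om Om.
  exact: (domain_precompact oOm Om_boundary Hpos H_decr (smooth_ray_derivable H_smooth)
    H_logderiv Om_peak Om_bounded).
have nu01 : 0 <= nu < 1.
  by have /andP[-> nu2] := nu_range; apply: lt_le_trans nu2 _; rewrite invf_le1// ler1n.
split; [exact: sobolev_compact|exact: precompact_plate_spectrum_discrete].
Qed.
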